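(* Let $k$ be a perfect field and $K$ an $n$-dimensional topological local field (TLF) over $k$. 1. For any system of liftings $\sigma$, the construction $V\mapsto\sharp_\sigma V$ described in the context gives rise to a functor $$\mathsf{Vect}_f(K)\xrightarrow{\ \sharp_\sigma\ }n\text{-}\mathsf{Tate}^{el}(\mathsf{Vect}_f(k))\xrightarrow{\ \mathrm{eval}\ }\mathsf{Vect}(k)$$ such that the composition agrees with the forgetful functor to $k$-vector spaces. 2. For any $V_1,V_2\in\mathsf{Vect}_f(K)$, the functor $\sharp_\sigma$ induces an isomorphism $$E^{\mathrm{Yek}}(V_1,V_2)\xrightarrow{\ \sim\ }\operatorname{Hom}_{n\text{-}\mathsf{Tate}^{el}}(\sharp_\sigma V_1,\sharp_\sigma V_2).$$ 3. For any two systems of liftings $\sigma,\sigma'$, there exists an $n$-Tate automorphism $e_{\sigma,\sigma'}$ such that $\sharp_{\sigma'}=e_{\sigma,\sigma'}\circ\sharp_\sigma$ (i.e. $n$-Tate isomorphisms $e_{\sigma,\sigma'}:\sharp_\sigma V\to\sharp_{\sigma'}V$, compatible with the functors). 4. For any $V_1,V_2$, the image of $\operatorname{Hom}_{n\text{-}\mathsf{Tate}^{el}}(\sharp_\sigma V_1,\sharp_\sigma V_2)$ under $\mathrm{eval}$ in $\operatorname{Hom}_k(V_1,V_2)$ is independent of the choice of $\sigma$, and agrees with $E^{\mathrm{Yek}}(V_1,V_2)$.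
   Context: **$n$-local fields and TLFs.** A $0$-local field with last residue field $\kappa$ is $\kappa$; for $n\ge1$, an $n$-local field is a complete discrete valuation field $K$ whose residue field is an $(n-1)$-local field. Write $\mathcal O_1\subset K$ for the ring of integers, $\mathfrak m_1$ its maximal ideal, $k_1=\mathcal O_1/\mathfrak m_1$; $\mathcal O_2\subset k_1$ with residue field $k_2$, etc. A semi-topological (ST) ring over $k$ is a $k$-algebra with a $k$-linear topology ($k$ discrete) for which left and right multiplication by each fixed element is continuous. Laurent series $\kappa((t_1))\cdots((t_n))=\varinjlim_{i_n}\varprojlim_{j_n}\cdots\varinjlim_{i_1}\varprojlim_{j_1}\frac1{t_1^{i_1}\cdots t_n^{i_n}}\kappa[t_1,\dots,t_n]/(t_1^{j_1},\dots,t_n^{j_n})$ are an ST ring: inner terms discrete, limits with the limit topology, colimits (localizations) with the fine topology, i.e. the finest linear topology making them ST modules over the ring being localized. A TLF over the perfect field $k$ of dimension $n$ is an $n$-local field $K$ with an ST ring topology and a ring homomorphism $k\to\mathcal O_1\times_{k_1}\cdots\times_{k_{n-1}}\mathcal O_n\subset K$ with $k\to k_n$ finite, such that some field isomorphism of $K$ with a Laurent series field $\kappa((t_1))\cdots((t_n))$, $\kappa/k$ finite, is an isomorphism of ST $k$-algebras. The $\mathcal O_i,k_i$ carry the induced subspace and quotient topologies. A system of liftings $\sigma=(\sigma_1,\dots,\sigma_n)$ consists of continuous $k$-algebra homomorphisms $\sigma_i:k_i\to\mathcal O_i$ that are sections of $\mathcal O_i\twoheadrightarrow k_i$. **Tate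 objects.** For an idempotent complete exact category $\mathcal C$, $\mathsf{Ind}^a(\mathcal C)$ is the exact category of admissible Ind-objects (formal filtered colimits with admissible monics as transition maps), $\mathsf{Pro}^a(\mathcal C)=\mathsf{Ind}^a(\mathcal C^{op})^{op}$. $\mathsf{Tate}^{el}(\mathcal C)\subset\mathsf{Ind}^a\mathsf{Pro}^a(\mathcal C)$ is the full subcategory of $V$ admitting an exact sequence $L\hookrightarrow V\twoheadrightarrow V/L$ with $L\in\mathsf{Pro}^a(\mathcal C)$, $V/L\in\mathsf{Ind}^a(\mathcal C)$. $0\text{-}\mathsf{Tate}(\mathcal C)=\mathcal C$, $n\text{-}\mathsf{Tate}^{el}(\mathcal C)=\mathsf{Tate}^{el}((n-1)\text{-}\mathsf{Tate}(\mathcal C))$, $n\text{-}\mathsf{Tate}(\mathcal C)$ is its idempotent completion. $\mathsf{Vect}_f(F)$ denotes finite-dimensional $F$-vector spaces, and $\mathrm{eval}:n\text{-}\mathsf{Tate}^{el}(\mathsf{Vect}_f(k))\to\mathsf{Vect}(k)$ evaluates all formal colimits and limits. **The functor $\sharp_\sigma$.** If $n=0$, a finite-dimensional $K$-vector space is regarded as an object of $\mathsf{Vect}_f(k)=0\text{-}\mathsf{Tate}$. If $n\ge1$ and $V\in\mathsf{Vect}_f(K)$, for each $K$-basis $b=\{b_1,\dots,b_r\}$ of $V$ let $\mathcal O_1\otimes\{b_1,\dots,b_r\}\subset V$ be its $\mathcal O_1$-span; order bases by inclusion of spans. Each $(\mathcal O_1\otimes\{b_1,\dots,b_r\})/\mathfrak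 m_1^m$ is a finite-dimensional $k_1$-vector space via $\sigma_1$, hence by induction an $(n-1)$-Tate object $(-)^\sharp$ using $(\sigma_2,\dots,\sigma_n)$. Set $$\sharp_\sigma V=\varinjlim_{b_1,\dots,b_r}\varprojlim_m\big((\mathcal O_1\otimes\{b_1,\dots,b_r\})/\mathfrak m_1^m\big)^\sharp.$$ **$E^{\mathrm{Yek}}$.** A Yekutieli lattice in a finite $K$-module $M$ is a finite $\mathcal O_1$-submodule $L$ with $KL=M$. $E_\sigma^{\mathrm{Yek}}(M_1,M_2)\subseteq\operatorname{Hom}_k(M_1,M_2)$ is: everything if $n=0$; for $n\ge1$, those $f$ such that for all Yekutieli lattices $L_1\subset M_1$, $L_2\subset M_2$ there exist Yekutieli lattices $L_1'\subseteq L_1$, $L_2'\supseteq L_2$ with $f(L_1')\subseteq L_2$, $f(L_1)\subseteq L_2'$, and for all such choices the induced $\bar f:L_1/L_1'\to L_2'/L_2$ lies in $E^{\mathrm{Yek}}_{(\sigma_2,\dots,\sigma_n)}(L_1/L_1',L_2'/L_2)$, the quotients being $k_1$-modules via $\sigma_1$. By a theorem of Yekutieli a $\sigma$ exists and $E^{\mathrm{Yek}}:=E^{\mathrm{Yek}}_\sigma$ is independent of $\sigma$. *)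

(* Defs.v *)
From HB Require Import structures.
From mathcomp Require Import all_boot all_order all_algebra.
From mathcomp Require Import boolp classical_sets.

Set Implicit Arguments.
Unset Strict Implicit.
Unset Printing Implicit Defensive.

Import Order.TTheory GRing.Theory Num.Theory.
Local Open Scope classical_set_scope.
Local Open Scope quotient_scope.
Local Open Scope ring_scope.

Definition linmk (k : fieldType) (U V : lmodType k) (f : U -> V)
    (fL : linear f) : {linear U -> V} :=
  HB.pack f (GRing.isLinear.Build k U V *:%R f fL).

Lemma linmkE (k : fieldType) (U V : lmodType k) (f : U -> V)
  (fL : linear f) x : linmk fL x = f x.
Proof. by []. Qed.

Lemma lin_ext (k : fieldType) (U V : lmodType k) (f g : {linear U -> V}) :
  f =1 g -> f = g.
Proof.
case: f => f cf; case: g => g cg /= fg.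
have {}fg : f = g by apply/funext.
subst g; congr GRing.Linear.Pack.
case: cf => [[a1] [a2]]; case: cg => [[b1] [b2]].
by congr GRing.Linear.Class; [congr GRing.isNmodMorphism.Axioms_
  |congr GRing.isScalable.Axioms_]; apply: Prop_irrelevance.
Qed.

Section Modules.
Variable k : fieldType.

Section LinHom.
Variables U V : lmodType k.

Definition linhom := {linear U -> V}.
Implicit Types f g h : linhom.

HB.instance Definition _ := gen_eqMixin linhom.
HB.instance Definition _ := gen_choiceMixin linhom.

Lemma lin0_linear : linear (fun _ : U => 0 : V).
Proof. by move=> a x y; rewrite scaler0 addr0. Qed.
Lemma linD_linear f g : linear (fun x => f x + g x).
Proof. by move=> a x y; rewrite !linearP scalerDr addrACA. Qed.
Lemma linN_linear f : linear (fun x => - f x).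
Proof. by move=> a x y; rewrite linearP opprD scalerN. Qed.
Lemma linZ_linear c f : linear (fun x => c *: f x).
Proof.
by move=> a x y; rewrite linearP scalerDr !scalerA mulrC.
Qed.

Definition lin0 : linhom := linmk lin0_linear.
Definition linD f g : linhom := linmk (linD_linear f g).
Definition linN f : linhom := linmk (linN_linear f).
Definition linZ c f : linhom := linmk (linZ_linear c f).

Fact linDA : associative linD.
Proof. by move=> f g h; apply: lin_ext => x /=; rewrite addrA. Qed.
Fact linDC : commutative linD.
Proof. by move=> f g; apply: lin_ext => x /=; rewrite addrC. Qed.
Fact lin0D : left_id lin0 linD.
Proof. by move=> f; apply: lin_ext => x /=; rewrite add0r. Qed.
Fact linND : left_inverse lin0 linN linD.
Proof. by move=> f; apply: lin_ext => x /=; rewrite addNr. Qed.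
HB.instance Definition _ := GRing.isZmodule.Build linhom linDA linDC lin0D linND.

Fact linZA c d f : linZ c (linZ d f) = linZ (c * d) f.
Proof. by apply: lin_ext => x /=; rewrite scalerA. Qed.
Fact lin1Z : left_id 1 linZ.
Proof. by move=> f; apply: lin_ext => x /=; rewrite scale1r. Qed.
Fact linZDr : right_distributive linZ +%R.
Proof. by move=> c f g; apply: lin_ext => x /=; rewrite scalerDr. Qed.
Fact linZDl f : {morph linZ^~ f : c d / c + d}.
Proof. by move=> c d; apply: lin_ext => x /=; rewrite scalerDl. Qed.
HB.instance Definition _ :=
  GRing.Zmodule_isLmodule.Build k linhom linZA lin1Z linZDr linZDl.

End LinHom.

Record submod (V : lmodType k) := Submod {
  smem :> V -> Prop;
  smem0 : smem 0;
  smemP : forall a x y, smem x -> smem y -> smem (a *: x + y) }.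

Section Submodules.
Variable V : lmodType k.
Implicit Type S : submod V.

Definition spred S : {pred V} := fun x => `[< S x >].

Lemma spredP S x : (x \in spred S) = `[< S x >]. Proof. by []. Qed.

Fact spred_submod S : GRing.submod_closed (spred S).
Proof.
split; first by apply/asboolP; exact: smem0.
by move=> a x y /asboolP Sx /asboolP Sy; apply/asboolP; exact: smemP.
Qed.
HB.instance Definition _ S :=
  GRing.isSubmodClosed.Build k V (spred S) (spred_submod S).

Fact spred_opp S : GRing.oppr_closed (spred S).
Proof.
move=> x Sx; rewrite -scaleN1r -[_ *: _]addr0.
by apply: (spred_submod S).2 => //; exact: (spred_submod S).1.
Qed.
HB.instance Definition _ S := GRing.isOppClosed.Build V (spred S) (@spred_opp S).

Definition sublm S : Type := {x : V | x \in spred S}.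
HB.instance Definition _ S := SubChoice.on (sublm S).
HB.instance Definition _ S := [SubChoice_isSubLmodule of sublm S by <:].

Lemma sublmP S (x : sublm S) : S (val x).
Proof. exact/asboolP/(valP x). Qed.
Definition submk S x (Sx : S x) : sublm S :=
  exist (fun y => is_true (y \in spred S)) x (introT (asboolP _) Sx).

Definition quotlm S : Type := Quotient.quot (spred S).
HB.instance Definition _ S := GRing.Zmodule.on (quotlm S).
End Submodules.


Section Quotients.
Variables (V : lmodType k) (S : submod V).

Definition qpi (x : V) : quotlm S := \pi_(Quotient.quot (spred S)) x.
Definition qrep (q : quotlm S) : V := repr (q : Quotient.quot (spred S)).

Lemma qpiK q : qpi (qrep q) = q.
Proof. exact: reprK. Qed.

Lemma qpi_eq x y : qpi x = qpi y <-> S (x - y).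
Proof.
rewrite /qpi; split.
  by move/eqP; rewrite -Quotient.idealrBE spredP => /asboolP.
by move=> Sxy; apply/eqP; rewrite -Quotient.idealrBE spredP; apply/asboolP.
Qed.

Lemma qpiD x y : qpi (x + y) = qpi x + qpi y.
Proof. exact: (raddfD (\pi_(Quotient.quot (spred S)))). Qed.

Lemma qrepP x : S (qrep (qpi x) - x).
Proof. by apply/qpi_eq; rewrite qpiK. Qed.

Lemma smemZ a x : S x -> S (a *: x).
Proof. by move=> Sx; rewrite -[_ *: _]addr0; apply: smemP => //; exact: smem0. Qed.

Definition qscale a q : quotlm S := qpi (a *: qrep q).

Lemma qscaleE a x : qscale a (qpi x) = qpi (a *: x).
Proof. by apply/qpi_eq; rewrite -scalerBr; apply/smemZ/qrepP. Qed.

Fact qscaleA a b q : qscale a (qscale b q) = qscale (a * b) q.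
Proof. by rewrite -(qpiK q) !qscaleE scalerA. Qed.
Fact qscale1 : left_id 1 qscale.
Proof. by move=> q; rewrite -(qpiK q) !qscaleE scale1r. Qed.
Fact qscaleDr : right_distributive qscale +%R.
Proof.
move=> a p q; rewrite -(qpiK p) -(qpiK q) -qpiD !qscaleE -qpiD.
by rewrite scalerDr.
Qed.
Fact qscaleDl q : {morph qscale^~ q : a b / a + b}.
Proof. by move=> a b; rewrite -(qpiK q) !qscaleE -qpiD scalerDl. Qed.
HB.instance Definition _ := GRing.Zmodule_isLmodule.Build k (quotlm S)
  qscaleA qscale1 qscaleDr qscaleDl.

Fact qpi_linear : linear qpi.
Proof. by move=> a x y; rewrite qpiD -qscaleE. Qed.

End Quotients.

Section Products.
Variables (I : Type) (D : I -> lmodType k).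

Definition prodlm : Type := forall i, D i.
Implicit Types x y z : prodlm.

HB.instance Definition _ := gen_eqMixin prodlm.
HB.instance Definition _ := gen_choiceMixin prodlm.

Definition prod0 : prodlm := fun=> 0.
Definition prodD x y : prodlm := fun i => x i + y i.
Definition prodN x : prodlm := fun i => - x i.
Definition prodZ a x : prodlm := fun i => a *: x i.

Fact prodDA : associative prodD.
Proof. by move=> x y z; apply: functional_extensionality_dep => i; rewrite /prodD addrA. Qed.
Fact prodDC : commutative prodD.
Proof. by move=> x y; apply: functional_extensionality_dep => i; rewrite /prodD addrC. Qed.
Fact prod0D : left_id prod0 prodD.
Proof. by move=> x; apply: functional_extensionality_dep => i; rewrite /prodD add0r. Qed.
Fact prodND : left_inverse prod0 prodN prodD.
Proof. by move=> x; apply: functional_extensionality_dep => i; rewrite /prodD addNr. Qed.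
HB.instance Definition _ := GRing.isZmodule.Build prodlm prodDA prodDC prod0D prodND.

Fact prodZA a b x : prodZ a (prodZ b x) = prodZ (a * b) x.
Proof. by apply: functional_extensionality_dep => i; rewrite /prodZ scalerA. Qed.
Fact prod1Z : left_id 1 prodZ.
Proof. by move=> x; apply: functional_extensionality_dep => i; rewrite /prodZ scale1r. Qed.
Fact prodZDr : right_distributive prodZ +%R.
Proof. by move=> a x y; apply: functional_extensionality_dep => i; rewrite /prodZ scalerDr. Qed.
Fact prodZDl x : {morph prodZ^~ x : a b / a + b}.
Proof. by move=> a b; apply: functional_extensionality_dep => i; rewrite /prodZ scalerDl. Qed.
HB.instance Definition _ := GRing.Zmodule_isLmodule.Build k prodlm
  prodZA prod1Z prodZDr prodZDl.

End Products.

End Modules.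

(* Small filtered categories, the index categories of formal colimits. *)
Record fcat := Fcat {
  iob :> Type;
  ihom : iob -> iob -> Type;
  iid : forall i, ihom i i;
  icomp : forall i j l, ihom j l -> ihom i j -> ihom i l;
  icompA : forall i j l m (w : ihom l m) (v : ihom j l) (u : ihom i j),
    icomp w (icomp v u) = icomp (icomp w v) u;
  icomp1m : forall i j (u : ihom i j), icomp (iid j) u = u;
  icompm1 : forall i j (u : ihom i j), icomp u (iid i) = u;
  inonempty : exists _ : iob, True;
  ijoin : forall i j : iob, exists l (_ : ihom i l) (_ : ihom j l), True;
  icoeq : forall i j (u v : ihom i j),
    exists l (w : ihom j l), icomp w u = icomp w v }.

Arguments icomp {f i j l} _ _ : rename.
Arguments iid {f} i : rename.

Section Colimits.
Variable k : fieldType.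

Record mdiag (I : fcat) := Mdiag {
  mob :> I -> lmodType k;
  mmap : forall i j, ihom i j -> {linear mob i -> mob j};
  mmap1 : forall i x, mmap (iid i) x = x;
  mmapM : forall i j l (v : ihom j l) (u : ihom i j) x,
    mmap (icomp v u) x = mmap v (mmap u x) }.

Section Colim.
Variables (I : fcat) (D : mdiag I).

Definition tot : Type := {i : I & D i}.
HB.instance Definition _ := gen_eqMixin tot.
HB.instance Definition _ := gen_choiceMixin tot.

Definition germeq_prop (p q : tot) : Prop :=
  exists l (u : ihom (projT1 p) l) (v : ihom (projT1 q) l),
    mmap D u (projT2 p) = mmap D v (projT2 q).
Definition germeq (p q : tot) : bool := `[< germeq_prop p q >].

Lemma ijoin2 (i j l m : I) (u : ihom i j) (v : ihom i l) (w : ihom l m) :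
  exists n (a : ihom j n) (b : ihom m n),
    icomp a u = icomp b (icomp w v).
Proof.
have [n [a [b _]]] := ijoin j m.
have [o [c e]] := icoeq (icomp a u) (icomp b (icomp w v)).
by exists o, (icomp c a), (icomp c b); rewrite -!icompA.
Qed.

Fact germeq_refl : reflexive germeq.
Proof. by move=> p; apply/asboolP; exists (projT1 p), (iid _), (iid _). Qed.
Fact germeq_sym : symmetric germeq.
Proof.
by move=> p q; apply/asboolP/asboolP => -[l [u [v e]]]; exists l, v, u.
Qed.
Fact germeq_trans : transitive germeq.
Proof.
move=> q p r /asboolP[l [u [v e]]] /asboolP[m [u' [v' e']]]; apply/asboolP.
have [n [a [b ab]]] := ijoin2 v u' (iid m).
rewrite icomp1m in ab.
exists n, (icomp a u), (icomp b v').
by rewrite !mmapM e -e' -!mmapM ab.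
Qed.

Canonical germ_equiv := EquivRel germeq germeq_refl germeq_sym germeq_trans.
Definition colim : Type := {eq_quot germeq}.
HB.instance Definition _ := Choice.on colim.

Definition cinj i (x : D i) : colim :=
  \pi_({eq_quot germeq}) (existT _ i x : tot).
Definition crep (c : colim) : tot := repr (c : {eq_quot germeq}).

Lemma crepK c : cinj (projT2 (crep c)) = c.
Proof. by rewrite -[RHS]reprK /cinj -/(crep c); case: (crep c). Qed.

Lemma cinj_eq i j (x : D i) (y : D j) : cinj x = cinj y <->
  exists l (u : ihom i l) (v : ihom j l), mmap D u x = mmap D v y.
Proof.
split; first by move/eqP; rewrite eqmodE => /asboolP.
by move=> h; apply/eqP; rewrite eqmodE; apply/asboolP.
Qed.

Lemma cinj_map i j (u : ihom i j) (x : D i) : cinj (mmap D u x) = cinj x.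
Proof. by apply/cinj_eq; exists j, (iid j), u; rewrite mmap1. Qed.

Lemma colim_ind (c : colim) : exists i (x : D i), c = cinj x.
Proof. by exists _, (projT2 (crep c)); rewrite crepK. Qed.

Lemma colim_ind2 (c d : colim) : exists i (x y : D i), c = cinj x /\ d = cinj y.
Proof.
have [i [x ->]] := colim_ind c; have [j [y ->]] := colim_ind d.
have [l [u [v _]]] := ijoin i j.
by exists l, (mmap D u x), (mmap D v y); rewrite !cinj_map.
Qed.

Lemma colim_ind3 (c d e : colim) : exists i (x y z : D i),
  [/\ c = cinj x, d = cinj y & e = cinj z].
Proof.
have [i [x [y [-> ->]]]] := colim_ind2 c d; have [j [z ->]] := colim_ind e.
have [l [u [v _]]] := ijoin i j.
by exists l, (mmap D u x), (mmap D u y), (mmap D v z); rewrite !cinj_map.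
Qed.

Definition coprep (c d : colim) := cid (colim_ind2 c d).
Definition cadd (c d : colim) : colim :=
  let: exist i p := coprep c d in
  cinj (projT1 (cid p) + projT1 (cid (projT2 (cid p)))).
Definition czero : colim := cinj (0 : D (projT1 (cid (inonempty I)))).
Definition copp (c : colim) : colim := cinj (- projT2 (crep c)).
Definition cscale a (c : colim) : colim := cinj (a *: projT2 (crep c)).

Lemma caddE i (x y : D i) : cadd (cinj x) (cinj y) = cinj (x + y).
Proof.
rewrite /cadd; case: (coprep _ _) => j p.
move: (projT1 (cid p)) (projT2 (cid p)) => x' p'.
move: (projT1 (cid p')) (projT2 (cid p')) => y' [/cinj_eq ex /cinj_eq ey] /=.
have [l [u [v e]]] := ex; have [l' [u' [v' e']]] := ey.
have [n [a [b]]] := ijoin2 v v' (iid l'); rewrite icomp1m => ab.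
have [o [c cab]] := icoeq (icomp a u) (icomp b u').
apply/cinj_eq; exists o, (icomp c (icomp b v')), (icomp c (icomp a u)).
rewrite !linearD /=; congr (_ + _).
  by rewrite -ab !mmapM e.
by rewrite cab !mmapM e'.
Qed.

Lemma czeroE i : czero = cinj (0 : D i).
Proof.
have [l [u [v _]]] := ijoin (projT1 (cid (inonempty I))) i.
by apply/cinj_eq; exists l, u, v; rewrite !linear0.
Qed.

Lemma coppE i (x : D i) : copp (cinj x) = cinj (- x).
Proof.
apply/cinj_eq; have /cinj_eq[l [u [v e]]] := crepK (cinj x).
by exists l, u, v; rewrite !linearN /= e.
Qed.

Lemma cscaleE a i (x : D i) : cscale a (cinj x) = cinj (a *: x).
Proof.
apply/cinj_eq; have /cinj_eq[l [u [v e]]] := crepK (cinj x).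
by exists l, u, v; rewrite !linearZ /= e.
Qed.

Fact caddA : associative cadd.
Proof.
by move=> c d e; have [i [x [y [z [-> -> ->]]]]] := colim_ind3 c d e;
  rewrite !caddE addrA.
Qed.
Fact caddC : commutative cadd.
Proof.
by move=> c d; have [i [x [y [-> ->]]]] := colim_ind2 c d;
  rewrite !caddE addrC.
Qed.
Fact cadd0 : left_id czero cadd.
Proof.
by move=> c; have [i [x ->]] := colim_ind c; rewrite (czeroE i) caddE add0r.
Qed.
Fact caddN : left_inverse czero copp cadd.
Proof.
move=> c; have [i [x ->]] := colim_ind c.
by rewrite (czeroE i) coppE caddE addNr.
Qed.
HB.instance Definition _ := GRing.isZmodule.Build colim caddA caddC cadd0 caddN.

Fact cscaleA a b c : cscale a (cscale b c) = cscale (a * b) c.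
Proof. by have [i [x ->]] := colim_ind c; rewrite !cscaleE scalerA. Qed.
Fact cscale1 : left_id 1 cscale.
Proof. by move=> c; have [i [x ->]] := colim_ind c; rewrite !cscaleE scale1r. Qed.
Fact cscaleDr : right_distributive cscale cadd.
Proof.
move=> a c d; have [i [x [y [-> ->]]]] := colim_ind2 c d.
by rewrite caddE !cscaleE caddE scalerDr.
Qed.
Fact cscaleDl c : {morph cscale^~ c : a b / a + b >-> cadd a b}.
Proof.
move=> a b; have [i [x ->]] := colim_ind c.
by rewrite !cscaleE caddE scalerDl.
Qed.
HB.instance Definition _ := GRing.Zmodule_isLmodule.Build k colim
  cscaleA cscale1 cscaleDr cscaleDl.

Lemma cinjP a i (x y : D i) : a *: cinj x + cinj y = cinj (a *: x + y).
Proof. by rewrite -caddE -cscaleE. Qed.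

Fact cinj_linear i : linear (@cinj i).
Proof. by move=> a x y; rewrite cinjP. Qed.

Definition cdesc_fun (W : Type) (h : forall i, D i -> W) (c : colim) : W :=
  h (projT1 (crep c)) (projT2 (crep c)).

Lemma cdesc_funE (W : Type) (h : forall i, D i -> W) :
  (forall i j (u : ihom i j) x, h j (mmap D u x) = h i x) ->
  forall i (x : D i), cdesc_fun h (cinj x) = h i x.
Proof.
move=> hP i x; rewrite /cdesc_fun.
have /cinj_eq[l [u [v e]]] := crepK (cinj x).
by rewrite -(hP _ _ u) e hP.
Qed.

Variables (W : lmodType k) (h : forall i, {linear D i -> W}).
Hypothesis hP : forall i j (u : ihom i j) x, h j (mmap D u x) = h i x.

Fact cdesc_linear : linear (cdesc_fun h).
Proof.
move=> a c d; have [i [x [y [-> ->]]]] := colim_ind2 c d.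
by rewrite cinjP !cdesc_funE // linearP.
Qed.
Definition cdesc : {linear colim -> W} := linmk cdesc_linear.
Lemma cdescE i (x : D i) : cdesc (cinj x) = h i x.
Proof. exact: cdesc_funE. Qed.

End Colim.
End Colimits.

(* k-linear categories with a distinguished class [conf] of short exact
   sequences.  The axioms of an exact category are not part of the structure:
   none of the constructions below uses them, and they are preserved by all of
   these constructions when they hold. *)
Record cat (k : fieldType) := Cat {
  ob :> Type;
  mor : ob -> ob -> lmodType k;
  idm : forall x, mor x x;
  mcomp : forall x y z, mor y z -> mor x y -> mor x z;
  compA : forall x y z t (h : mor z t) (g : mor y z) (f : mor x y),
    mcomp h (mcomp g f) = mcomp (mcomp h g) f;
  comp1m : forall x y (f : mor x y), mcomp (idm y) f = f;
  compm1 : forall x y (f : mor x y), mcomp f (idm x) = f;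
  compPl : forall x y z (f : mor x y) a (g h : mor y z),
    mcomp (a *: g + h) f = a *: mcomp g f + mcomp h f;
  compPr : forall x y z (g : mor y z) a (f h : mor x y),
    mcomp g (a *: f + h) = a *: mcomp g f + mcomp g h;
  conf : forall x y z, mor x y -> mor y z -> Prop }.

Arguments mor {k c} x y : rename.
Arguments idm {k c} x : rename.
Arguments mcomp {k c x y z} _ _ : rename.
Arguments conf {k c x y z} _ _ : rename.

Record functor (k l : fieldType) (C : cat k) (D : cat l) := Functor {
  fob :> C -> D;
  fmap : forall x y, mor x y -> mor (fob x) (fob y);
  fmap1 : forall x, fmap (idm x) = idm (fob x);
  fmapM : forall x y z (g : mor y z) (f : mor x y),
    fmap (mcomp g f) = mcomp (fmap g) (fmap f) }.
Arguments fmap {k l C D} f {x y} _ : rename.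

Definition fid (k : fieldType) (C : cat k) : functor C C :=
  @Functor _ _ C C id (fun x y f => f) (fun=> erefl) (fun _ _ _ _ _ => erefl).

Section FunctorComp.
Variables (k l m : fieldType) (C : cat k) (D : cat l) (E : cat m).
Variables (G : functor D E) (F : functor C D).
Fact fcomp1 x : fmap G (fmap F (idm x)) = idm (G (F x)).
Proof. by rewrite !fmap1. Qed.
Fact fcompM x y z (g : mor y z) (f : mor x y) :
  fmap G (fmap F (mcomp g f)) = mcomp (fmap G (fmap F g)) (fmap G (fmap F f)).
Proof. by rewrite !fmapM. Qed.
Definition fcomp : functor C E :=
  @Functor _ _ C E (fun x => G (F x)) (fun x y f => fmap G (fmap F f))
    fcomp1 fcompM.
End FunctorComp.

Record natiso (k l : fieldType) (C : cat k) (D : cat l) (F G : functor C D) :=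
  NatIso {
  nt : forall x, mor (F x) (G x);
  ntV : forall x, mor (G x) (F x);
  ntK : forall x, mcomp (ntV x) (nt x) = idm (F x);
  ntVK : forall x, mcomp (nt x) (ntV x) = idm (G x);
  nt_nat : forall x y (f : mor x y),
    mcomp (fmap G f) (nt x) = mcomp (nt y) (fmap F f) }.

Section Categories.
Variable k : fieldType.

Definition is_iso (C : cat k) (x y : C) (f : mor x y) : Prop :=
  exists g : mor y x, mcomp g f = idm x /\ mcomp f g = idm y.

(* Admissible monics.  In an exact category the second case includes the
   first one; as the axioms are not part of [cat], it is stated separately. *)
Definition inflation (C : cat k) (x y : C) (f : mor x y) : Prop :=
  is_iso f \/ exists z (g : mor y z), conf f g.

Section Opposite.
Variable C : cat k.
Definition opc : cat k := @Cat k C (fun x y => mor y x) (fun x => idm x)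
  (fun x y z g f => mcomp f g)
  (fun x y z t h g f => esym (compA f g h))
  (fun x y f => compm1 f) (fun x y f => comp1m f)
  (fun x y z f a g h => compPr f a g h)
  (fun x y z g a f h => compPl g a f h)
  (fun x y z f g => conf g f).
End Opposite.

Section FullSub.
Variables (C : cat k) (P : C -> Prop).
Definition fullsub : cat k := @Cat k {x : C | P x}
  (fun x y => mor (sval x) (sval y)) (fun x => idm (sval x))
  (fun x y z g f => mcomp g f)
  (fun x y z t h g f => compA h g f)
  (fun x y f => comp1m f) (fun x y f => compm1 f)
  (fun x y z f a g h => compPl f a g h)
  (fun x y z g a f h => compPr g a f h)
  (fun x y z f g => conf f g).
Definition fullsub_incl : functor fullsub C :=
  @Functor _ _ fullsub C (fun x => sval x) (fun x y f => f)
    (fun=> erefl) (fun _ _ _ _ _ => erefl).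
End FullSub.

Section VectCat.
Fact lin1_linear (U : lmodType k) : linear (id : U -> U). Proof. by []. Qed.
Fact linM_linear (U V W : lmodType k) (g : {linear V -> W})
  (f : {linear U -> V}) : linear (fun x => g (f x)).
Proof. by move=> a x y; rewrite !linearP. Qed.
Definition lin1 (U : lmodType k) : linhom U U := linmk (@lin1_linear U).
Definition linM (U V W : lmodType k) (g : linhom V W) (f : linhom U V) :
  linhom U W := linmk (linM_linear g f).

Definition exact_seq (U V W : lmodType k) (f : linhom U V) (g : linhom V W) :=
  [/\ injective f, forall z, exists y, g y = z &
      forall y, g y = 0 <-> exists x, f x = y].

Fact linMA (U V W X : lmodType k) (h : linhom W X) (g : linhom V W)
  (f : linhom U V) : linM h (linM g f) = linM (linM h g) f.
Proof. exact: lin_ext. Qed.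
Fact lin1M (U V : lmodType k) (f : linhom U V) : linM (lin1 V) f = f.
Proof. exact: lin_ext. Qed.
Fact linM1 (U V : lmodType k) (f : linhom U V) : linM f (lin1 U) = f.
Proof. exact: lin_ext. Qed.
Fact linMPl (U V W : lmodType k) (f : linhom U V) a (g h : linhom V W) :
  linM (a *: g + h) f = a *: linM g f + linM h f.
Proof. exact: lin_ext. Qed.
Fact linMPr (U V W : lmodType k) (g : linhom V W) a (f h : linhom U V) :
  linM g (a *: f + h) = a *: linM g f + linM g h.
Proof. by apply: lin_ext => x; rewrite /= linearP. Qed.

Definition Vect : cat k := @Cat k (lmodType k) (fun U V => linhom U V : lmodType k)
  lin1 linM linMA lin1M linM1 linMPl linMPr exact_seq.

Definition findim (V : lmodType k) : Prop :=
  exists n (s : 'I_n -> V), forall x, exists c : 'I_n -> k,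
    x = \sum_i c i *: s i.

Definition Vectf : cat k := fullsub (C := Vect) findim.
End VectCat.

Lemma comp0m (C : cat k) (x y z : C) (f : mor x y) : mcomp (0 : mor y z) f = 0.
Proof.
have := compPl f (-1) 0 (0 : mor y z).
by rewrite scaler0 addr0 scaleN1r addNr.
Qed.

Lemma compm0 (C : cat k) (x y z : C) (g : mor y z) : mcomp g (0 : mor x y) = 0.
Proof.
have := compPr g (-1) 0 (0 : mor x y).
by rewrite scaler0 addr0 scaleN1r addNr.
Qed.

(* Idempotent completion: the objects are the pairs (x, e) with e an
   idempotent of x; the conflations are the retracts of those of C. *)
Section Idempotent.
Variable C : cat k.

Definition idob : Type := {x : C & {e : mor x x | mcomp e e = e}}.
Definition idp (x : idob) : mor (projT1 x) (projT1 x) := projT1 (projT2 x).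
Lemma idpK x : mcomp (idp x) (idp x) = idp x.
Proof. exact: (projT2 (projT2 x)). Qed.
Definition idob1 (x : C) : idob :=
  existT _ x (exist (fun e => mcomp e e = e) (idm x) (comp1m (idm x))).

Section IdHom.
Variables x y : idob.
Definition idhom_set (f : mor (projT1 x) (projT1 y)) : Prop :=
  mcomp (idp y) (mcomp f (idp x)) = f.
Fact idhom0 : idhom_set 0. Proof. by rewrite /idhom_set comp0m compm0. Qed.
Fact idhomP a f g : idhom_set f -> idhom_set g -> idhom_set (a *: f + g).
Proof. by rewrite /idhom_set => ef eg; rewrite compPl compPr ef eg. Qed.
Definition idhom : lmodType k := sublm (Submod idhom0 idhomP).
Definition idval (f : idhom) : mor (projT1 x) (projT1 y) := val f.
Lemma idvalP (f : idhom) : idhom_set (idval f).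
Proof. exact: (sublmP f). Qed.
Lemma idval_inj (f g : idhom) : idval f = idval g -> f = g.
Proof. exact: val_inj. Qed.
Definition idmk f (fP : idhom_set f) : idhom :=
  submk (S := Submod idhom0 idhomP) fP.
Lemma idvalD a f g : idval (a *: f + g) = a *: idval f + idval g.
Proof. by []. Qed.
Lemma idvall (f : idhom) : mcomp (idp y) (idval f) = idval f.
Proof. by rewrite -{1}(idvalP f) compA idpK (idvalP f). Qed.
Lemma idvalr (f : idhom) : mcomp (idval f) (idp x) = idval f.
Proof. by rewrite -{1}(idvalP f) -!compA idpK (idvalP f). Qed.
End IdHom.

Fact ididP x : idhom_set (x := x) (y := x) (idp x).
Proof. by rewrite /idhom_set !idpK. Qed.
Definition idid x : idhom x x := idmk (ididP x).
Fact idcompP x y z (g : idhom y z) (f : idhom x y) :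
  idhom_set (mcomp (idval g) (idval f)).
Proof. by rewrite /idhom_set !compA idvall -compA idvalr. Qed.
Definition idcomp x y z (g : idhom y z) (f : idhom x y) : idhom x z :=
  idmk (idcompP g f).

Fact idcompA x y z t (h : idhom z t) (g : idhom y z) (f : idhom x y) :
  idcomp h (idcomp g f) = idcomp (idcomp h g) f.
Proof. by apply: idval_inj; exact: compA. Qed.
Fact idcomp1m x y (f : idhom x y) : idcomp (idid y) f = f.
Proof. by apply: idval_inj; exact: idvall. Qed.
Fact idcompm1 x y (f : idhom x y) : idcomp f (idid x) = f.
Proof. by apply: idval_inj; exact: idvalr. Qed.
Fact idcompPl x y z (f : idhom x y) a (g h : idhom y z) :
  idcomp (a *: g + h) f = a *: idcomp g f + idcomp h f.
Proof. by apply: idval_inj; exact: compPl. Qed.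
Fact idcompPr x y z (g : idhom y z) a (f h : idhom x y) :
  idcomp g (a *: f + h) = a *: idcomp g f + idcomp g h.
Proof. by apply: idval_inj; exact: compPr. Qed.

Fact idincP (x y : C) (f : mor x y) : idhom_set (x := idob1 x) (y := idob1 y) f.
Proof. by rewrite /idhom_set comp1m compm1. Qed.
Definition idinc (x y : C) (f : mor x y) : idhom (idob1 x) (idob1 y) :=
  idmk (idincP f).

Definition idconf x y z (f : idhom x y) (g : idhom y z) : Prop :=
  exists (x' y' z' : C) (f' : mor x' y') (g' : mor y' z')
    (sx : idhom x (idob1 x')) (rx : idhom (idob1 x') x)
    (sy : idhom y (idob1 y')) (ry : idhom (idob1 y') y)
    (sz : idhom z (idob1 z')) (rz : idhom (idob1 z') z),
  [/\ conf f' g',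
      [/\ idcomp rx sx = idid x, idcomp ry sy = idid y & idcomp rz sz = idid z],
      idcomp sy f = idcomp (idinc f') sx /\ idcomp sz g = idcomp (idinc g') sy &
      idcomp f rx = idcomp ry (idinc f') /\ idcomp g ry = idcomp rz (idinc g')].

Definition idemc : cat k := @Cat k idob idhom idid idcomp
  idcompA idcomp1m idcompm1 idcompPl idcompPr idconf.

Fact idinc1 (x : C) : idinc (idm x) = idid (idob1 x).
Proof. exact: idval_inj. Qed.
Fact idincM (x y z : C) (g : mor y z) (f : mor x y) :
  idinc (mcomp g f) = idcomp (idinc g) (idinc f).
Proof. exact: idval_inj. Qed.
Definition idem_incl : functor C idemc :=
  @Functor _ _ C idemc idob1 idinc idinc1 idincM.

End Idempotent.

Record diag (I : fcat) (C : cat k) := Diag {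
  dob :> I -> C;
  dmap : forall i j, ihom i j -> mor (dob i) (dob j);
  dmap1 : forall i, dmap (iid i) = idm (dob i);
  dmapM : forall i j l (v : ihom j l) (u : ihom i j),
    dmap (icomp v u) = mcomp (dmap v) (dmap u) }.

Definition admissible (I : fcat) (C : cat k) (D : diag I C) : Prop :=
  forall i j (u : ihom i j), inflation (dmap D u).

(* Ind^a(C): formal filtered colimits of diagrams whose transition maps are
   admissible monics, with Hom(X, Y) = lim_i colim_j Hom(X_i, Y_j). *)
Section Ind.
Variable C : cat k.

Record indob := IndOb {
  ind_idx : fcat;
  ind_dg :> diag ind_idx C;
  ind_adm : admissible ind_dg }.

Section HomFrom.
Variable Y : indob.

Fact postc_linear (a : C) i j (u : ihom i j) :
  linear (fun f : mor a (Y i) => mcomp (dmap Y u) f).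
Proof. by move=> c f g; exact: compPr. Qed.
Fact yhom1 (a : C) i (f : mor a (Y i)) : mcomp (dmap Y (iid i)) f = f.
Proof. by rewrite dmap1 comp1m. Qed.
Fact yhomM (a : C) i j l (v : ihom j l) (u : ihom i j) (f : mor a (Y i)) :
  mcomp (dmap Y (icomp v u)) f = mcomp (dmap Y v) (mcomp (dmap Y u) f).
Proof. by rewrite dmapM compA. Qed.

(* j |-> Hom(a, Y_j) *)
Definition yhom (a : C) : mdiag k (ind_idx Y) :=
  @Mdiag k (ind_idx Y) (fun j => mor a (Y j))
    (fun i j u => linmk (@postc_linear a i j u)) (@yhom1 a) (@yhomM a).

Fact pre_linear (a b : C) (g : mor a b) j :
  linear (fun f : mor b (Y j) => cinj (mcomp f g : yhom a j)).
Proof. by move=> c f h; rewrite cinjP compPl. Qed.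
Fact pre_compat (a b : C) (g : mor a b) i j (u : ihom i j) (f : yhom b i) :
  linmk (pre_linear g (j := j)) (mmap (yhom b) u f) =
  linmk (pre_linear g (j := i)) f.
Proof. by rewrite !linmkE /= -compA -[RHS](cinj_map (D := yhom a) u). Qed.
Definition pre (a b : C) (g : mor a b) :
    {linear colim (yhom b) -> colim (yhom a)} :=
  cdesc (pre_compat g).
Lemma preE (a b : C) (g : mor a b) j (f : mor b (Y j)) :
  pre g (cinj (f : yhom b j)) = cinj (mcomp f g : yhom a j).
Proof. exact: cdescE. Qed.
Lemma preM (a b c : C) (g : mor b c) (f : mor a b) p :
  pre (mcomp g f) p = pre f (pre g p).
Proof. by have [j [h ->]] := colim_ind p; rewrite !preE compA. Qed.
Lemma pre1 (a : C) p : pre (idm a) p = p.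
Proof. by have [j [h ->]] := colim_ind p; rewrite !preE compm1. Qed.
Lemma preP (a b : C) c (f g : mor a b) p :
  pre (c *: f + g) p = c *: pre f p + pre g p.
Proof. by have [j [h ->]] := colim_ind p; rewrite !preE compPr cinjP. Qed.
End HomFrom.

Section IndHom.
Variables X Y : indob.
Definition ihom_set (p : prodlm (fun i => colim (yhom Y (X i)) : lmodType k)) :=
  forall i j (u : ihom i j), pre Y (dmap X u) (p j) = p i.
Fact ihom0 : ihom_set 0.
Proof. by move=> i j u; exact: linear0. Qed.
Fact ihomP a p q : ihom_set p -> ihom_set q -> ihom_set (a *: p + q).
Proof.
by move=> hp hq i j u; rewrite (linearP (pre Y (dmap X u))) hp hq.
Qed.
Definition indhom : lmodType k := sublm (Submod ihom0 ihomP).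
Definition ival (f : indhom) : forall i, colim (yhom Y (X i)) := val f.
Lemma ivalP (f : indhom) i j (u : ihom i j) :
  pre Y (dmap X u) (ival f j) = ival f i.
Proof. exact: (sublmP f). Qed.
Lemma iext (f g : indhom) : (forall i, ival f i = ival g i) -> f = g.
Proof. by move=> h; apply/val_inj/functional_extensionality_dep. Qed.
Definition imk p (pP : ihom_set p) : indhom :=
  submk (S := Submod ihom0 ihomP) pP.
Lemma ivalD a f g i : ival (a *: f + g) i = a *: ival f i + ival g i.
Proof. by []. Qed.
End IndHom.

Section Post.
Variables (Y Z : indob) (g : indhom Y Z).
Fact post_linear (a : C) j :
  linear (fun f : yhom Y a j => pre Z f (ival g j)).
Proof. by move=> c f h; exact: preP. Qed.
Fact post_compat (a : C) i j (u : ihom i j) (f : yhom Y a i) :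
  linmk (post_linear (j := j)) (mmap (yhom Y a) u f) =
  linmk (post_linear (j := i)) f.
Proof. by rewrite !linmkE -[RHS](congr1 (pre Z f) (ivalP g u)) -preM. Qed.
Definition post (a : C) : {linear colim (yhom Y a) -> colim (yhom Z a)} :=
  cdesc (@post_compat a).
Lemma postE (a : C) j (f : mor a (Y j)) :
  post a (cinj (f : yhom Y a j)) = pre Z f (ival g j).
Proof. exact: cdescE. Qed.
Lemma post_pre (a b : C) (f : mor a b) p :
  post a (pre Y f p) = pre Z f (post b p).
Proof.
by have [j [h ->]] := colim_ind p; rewrite preE !postE preM.
Qed.
End Post.

Fact indidP X i j (u : ihom i j) :
  pre X (dmap X u) (cinj (idm (X j) : yhom X (X j) j)) =
  cinj (idm (X i) : yhom X (X i) i).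
Proof. by rewrite preE comp1m -[RHS](cinj_map (D := yhom X (X i)) u) /= compm1. Qed.
Definition indid X : indhom X X := imk (@indidP X).

Fact indcompP X Y Z (g : indhom Y Z) (f : indhom X Y) i j (u : ihom i j) :
  pre Z (dmap X u) (post g (X j) (ival f j)) = post g (X i) (ival f i).
Proof. by rewrite -post_pre ivalP. Qed.
Definition indcomp X Y Z (g : indhom Y Z) (f : indhom X Y) : indhom X Z :=
  imk (@indcompP X Y Z g f).

Lemma ivalM X Y Z (g : indhom Y Z) (f : indhom X Y) i :
  ival (indcomp g f) i = post g (X i) (ival f i).
Proof. by []. Qed.
Lemma ival1 X i : ival (indid X) i = cinj (idm (X i) : yhom X (X i) i).
Proof. by []. Qed.

Fact indcompA X Y Z T (h : indhom Z T) (g : indhom Y Z) (f : indhom X Y) :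
  indcomp h (indcomp g f) = indcomp (indcomp h g) f.
Proof.
apply: iext => i; rewrite !ivalM.
have [j [q ->]] := colim_ind (ival f i).
by rewrite (postE g) (postE (indcomp h g)) ivalM post_pre.
Qed.
Fact indcomp1m X Y (f : indhom X Y) : indcomp (indid Y) f = f.
Proof.
apply: iext => i; rewrite ivalM.
have [j [q ->]] := colim_ind (ival f i).
by rewrite postE ival1 preE comp1m.
Qed.
Fact indcompm1 X Y (f : indhom X Y) : indcomp f (indid X) = f.
Proof. by apply: iext => i; rewrite ivalM ival1 postE pre1. Qed.
Fact indcompPl X Y Z (f : indhom X Y) a (g h : indhom Y Z) :
  indcomp (a *: g + h) f = a *: indcomp g f + indcomp h f.
Proof.
apply: iext => i; rewrite ivalD !ivalM.
have [j [q ->]] := colim_ind (ival f i).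
by rewrite !postE ivalD linearP.
Qed.
Fact indcompPr X Y Z (g : indhom Y Z) a (f h : indhom X Y) :
  indcomp g (a *: f + h) = a *: indcomp g f + indcomp g h.
Proof. by apply: iext => i; rewrite ivalD !ivalM ivalD linearP. Qed.

(* morphism induced by a levelwise map of diagrams on the same index category *)
Section Levelwise.
Variables (I : fcat) (D E : diag I C).
Hypotheses (aD : admissible D) (aE : admissible E).
Variable t : forall i, mor (D i) (E i).
Definition natural : Prop := forall i j (u : ihom i j),
  mcomp (t j) (dmap D u) = mcomp (dmap E u) (t i).
Hypothesis tN : natural.
Let X := IndOb aD.
Let Y := IndOb aE.
Fact indlvlP i j (u : ihom i j) :
  pre Y (dmap X u) (cinj (t j : yhom Y (X j) j)) =
  cinj (t i : yhom Y (X i) i).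
Proof. by rewrite preE [mcomp _ _]tN -[RHS](cinj_map (D := yhom Y (X i)) u). Qed.
Definition indlvl : indhom X Y := imk indlvlP.
Lemma indlvlE i : ival indlvl i = cinj (t i : yhom Y (X i) i).
Proof. by []. Qed.
End Levelwise.

Lemma indlvl1 (I : fcat) (D : diag I C) (aD : admissible D)
    (n : natural (fun i => idm (D i))) :
  indlvl aD aD n = indid (IndOb aD).
Proof. exact: iext. Qed.

Lemma indlvlM (I : fcat) (D E F : diag I C) (aD : admissible D)
    (aE : admissible E) (aF : admissible F)
    (s : forall i, mor (D i) (E i)) (t : forall i, mor (E i) (F i))
    (ns : natural s) (nt : natural t) (n : natural (fun i => mcomp (t i) (s i))) :
  indlvl aD aF n = indcomp (indlvl aE aF nt) (indlvl aD aE ns).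
Proof. by apply: iext => i; rewrite ivalM !indlvlE postE indlvlE preE. Qed.

Definition indiso X Y (f : indhom X Y) (g : indhom Y X) : Prop :=
  indcomp g f = indid X /\ indcomp f g = indid Y.

(* The short exact sequences are the formal filtered colimits of short exact
   sequences of C, up to isomorphism. *)
Definition indconf X Y Z (f : indhom X Y) (g : indhom Y Z) : Prop :=
  exists (I : fcat) (A B D : diag I C)
    (aA : admissible A) (aB : admissible B) (aD : admissible D)
    (s : forall i, mor (A i) (B i)) (t : forall i, mor (B i) (D i))
    (ns : natural s) (nt : natural t),
  (forall i, conf (s i) (t i)) /\
  exists (x : indhom X (IndOb aA)) (x' : indhom (IndOb aA) X)
    (y : indhom Y (IndOb aB)) (y' : indhom (IndOb aB) Y)
    (z : indhom Z (IndOb aD)) (z' : indhom (IndOb aD) Z),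
  [/\ indiso x x', indiso y y' & indiso z z'] /\
  indcomp y f = indcomp (indlvl aA aB ns) x /\
  indcomp z g = indcomp (indlvl aB aD nt) y.

Definition ind : cat k := @Cat k indob indhom indid indcomp
  indcompA indcomp1m indcompm1 indcompPl indcompPr indconf.

End Ind.

(* Pro^a(C) = Ind^a(C^op)^op *)
Definition pro (C : cat k) : cat k := opc (ind (opc C)).

Lemma fmap_iso (C D : cat k) (F : functor C D) (x y : C) (f : mor x y) :
  is_iso f -> is_iso (fmap F f).
Proof. by move=> [g [gf fg]]; exists (fmap F g); rewrite -!fmapM gf fg !fmap1. Qed.

Definition fone : fcat.
Proof.
apply: (@Fcat unit (fun _ _ => unit) (fun=> tt) (fun _ _ _ _ _ => tt)).
- by [].
- by move=> ? ? [].
- by move=> ? ? [].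
- by exists tt.
- by exists tt, tt, tt.
- by move=> ? ? [] []; exists tt, tt.
Defined.

(* The embedding of C in Ind^a(C). *)
Section Constant.
Variable C : cat k.

Definition cdiag (x : C) : diag fone C :=
  @Diag fone C (fun=> x) (fun _ _ _ => idm x) (fun=> erefl)
    (fun _ _ _ _ _ => esym (comp1m (idm x))).
Fact cdiag_adm x : admissible (cdiag x).
Proof. by move=> i j u; left; exists (idm x); rewrite comp1m. Qed.
Fact cdiag_natural (x y : C) (f : mor x y) :
  natural (D := cdiag x) (E := cdiag y) (fun=> f).
Proof. by move=> i j u; rewrite /= comp1m compm1. Qed.
Definition icst (x : C) : ind C := IndOb (@cdiag_adm x).
Definition icstm (x y : C) (f : mor x y) : mor (icst x) (icst y) :=
  indlvl (@cdiag_adm x) (@cdiag_adm y) (cdiag_natural f).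
Fact icst1 x : icstm (idm x) = idm (icst x).
Proof. exact: iext. Qed.
Fact icstM x y z (g : mor y z) (f : mor x y) :
  icstm (mcomp g f) = mcomp (icstm g) (icstm f).
Proof.
exact: (indlvlM (@cdiag_adm x) (@cdiag_adm y) (@cdiag_adm z)
  (cdiag_natural f) (cdiag_natural g) (cdiag_natural (mcomp g f))).
Qed.
Definition ind_cst : functor C (ind C) :=
  @Functor _ _ C (ind C) icst icstm icst1 icstM.

Lemma icst_conf x y z (f : mor x y) (g : mor y z) :
  conf f g -> conf (icstm f) (icstm g).
Proof.
move=> fg; exists fone, (cdiag x), (cdiag y), (cdiag z).
exists (@cdiag_adm x), (@cdiag_adm y), (@cdiag_adm z).
exists (fun=> f), (fun=> g), (cdiag_natural f), (cdiag_natural g).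
split=> //; do 2 exists (indid (icst x)); do 2 exists (indid (icst y)).
do 2 exists (indid (icst z)).
split; first by split; split; exact: indcomp1m.
by split; rewrite ?indcompm1 indcomp1m.
Qed.
End Constant.

Section Tate.
Variable C : cat k.

(* The embedding of C in Pro^a(C). *)
Definition pcst (x : C) : pro C := icst (x : opc C).
Definition pcstm (x y : C) (f : mor x y) : mor (pcst x) (pcst y) :=
  icstm (C := opc C) (x := y) (y := x) f.
Fact pcst1 x : pcstm (idm x) = idm (pcst x).
Proof. exact: (icst1 (C := opc C)). Qed.
Fact pcstM x y z (g : mor y z) (f : mor x y) :
  pcstm (mcomp g f) = mcomp (pcstm g) (pcstm f).
Proof. exact: (icstM (C := opc C) (x := z) (y := y) (z := x)). Qed.
Definition pro_cst : functor C (pro C) :=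
  @Functor _ _ C (pro C) pcst pcstm pcst1 pcstM.

Lemma pcst_inflation x y (f : mor x y) : inflation f -> inflation (pcstm f).
Proof.
case=> [fI|[z [g fg]]]; first by left; exact: (fmap_iso pro_cst).
by right; exists (pcst z), (pcstm g); exact: (icst_conf (C := opc C)).
Qed.

(* The embedding of Ind^a(C) in Ind^a(Pro^a(C)), on objects. *)
Section IndPro.
Variable Y : ind C.
Fact ipdiag1 i : pcstm (dmap Y (iid i)) = idm (pcst (Y i)).
Proof. by rewrite dmap1 pcst1. Qed.
Fact ipdiagM i j l (v : ihom j l) (u : ihom i j) :
  pcstm (dmap Y (icomp v u)) = mcomp (pcstm (dmap Y v)) (pcstm (dmap Y u)).
Proof. by rewrite dmapM pcstM. Qed.
Definition ipdiag : diag (ind_idx Y) (pro C) :=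
  @Diag (ind_idx Y) (pro C) (fun i => pcst (Y i))
    (fun i j u => pcstm (dmap Y u)) ipdiag1 ipdiagM.
Fact ipdiag_adm : admissible ipdiag.
Proof. by move=> i j u; apply: pcst_inflation; exact: (ind_adm (i := Y)). Qed.
Definition ind_pcst : ind (pro C) := IndOb ipdiag_adm.
End IndPro.

(* V has a lattice L in Pro^a(C), with V / L in Ind^a(C). *)
Definition is_tate (V : ind (pro C)) : Prop :=
  exists (L : pro C) (Q : ind C)
    (f : mor (icst L) V) (g : mor V (ind_pcst Q)), conf f g.

Definition tateel : cat k := fullsub is_tate.

End Tate.

(* n-Tate(Vect_f(k)) and n-Tate^el(Vect_f(k)), with 0-Tate^el = 0-Tate *)
Fixpoint ntate (n : nat) : cat k :=
  if n is m.+1 then idemc (tateel (ntate m)) else Vectf.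

Definition ntateel (n : nat) : cat k :=
  if n is m.+1 then tateel (ntate m) else Vectf.

Definition ntate_incl (n : nat) : functor (ntateel n) (ntate n) :=
  if n is m.+1 return functor (ntateel n) (ntate n)
  then idem_incl (tateel (ntate m)) else fid Vectf.

(* Evaluation of formal limits and colimits, given a functor from C to vector
   spaces. *)
Section Eval.
Variables (C : cat k) (F : functor C Vect).
Definition fapp (x y : C) (f : mor x y) : {linear F x -> F y} := fmap F f.
Lemma fapp1 x v : fapp (idm x) v = v.
Proof. by rewrite /fapp fmap1. Qed.
Lemma fappM x y z (g : mor y z) (f : mor x y) v :
  fapp (mcomp g f) v = fapp g (fapp f v).
Proof. by rewrite /fapp fmapM. Qed.

Section IndEval.
Section Ob.
Variable X : ind C.
Fact evdiag1 i v : fapp (dmap X (iid i)) v = v.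
Proof. by rewrite dmap1 fapp1. Qed.
Fact evdiagM i j l (v : ihom j l) (u : ihom i j) x :
  fapp (dmap X (icomp v u)) x = fapp (dmap X v) (fapp (dmap X u) x).
Proof. by rewrite dmapM fappM. Qed.
Definition evdiag : mdiag k (ind_idx X) :=
  @Mdiag k (ind_idx X) (fun i => F (X i)) (fun i j u => fapp (dmap X u))
    evdiag1 evdiagM.
Definition evind_ob : Vect := (colim evdiag : lmodType k).
End Ob.

Section Act.
Variables (Y : ind C) (a : C).
Definition act (c : colim (yhom Y a)) (x : F a) : colim (evdiag Y) :=
  cdesc_fun (fun j (f : yhom Y a j) => cinj (fapp f x : evdiag Y j)) c.
Lemma actE j (f : mor a (Y j)) x :
  act (cinj (f : yhom Y a j)) x = cinj (fapp f x : evdiag Y j).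
Proof.
rewrite /act cdesc_funE // => i l u g.
by rewrite -[RHS](cinj_map (D := evdiag Y) u) /= fappM.
Qed.
Fact act_linear c : linear (act c).
Proof.
by move=> b x y; have [j [f ->]] := colim_ind c; rewrite !actE linearP cinjP.
Qed.
End Act.

Lemma act_pre (Y : ind C) (a b : C) (g : mor a b) c x :
  act (pre Y g c) x = act c (fapp g x).
Proof. by have [j [f ->]] := colim_ind c; rewrite preE !actE fappM. Qed.

Section Mor.
Variables (X Y : ind C) (f : mor X Y).
Fact evind_compat i j (u : ihom i j) x :
  linmk (act_linear (ival f j)) (mmap (evdiag X) u x) =
  linmk (act_linear (ival f i)) x.
Proof. by rewrite !linmkE -(ivalP f u) act_pre. Qed.
Definition evind_mor : mor (evind_ob X) (evind_ob Y) := cdesc evind_compat.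
Lemma evind_morE i (x : F (X i)) :
  cdesc evind_compat (cinj (x : evdiag X i)) = act (ival f i) x.
Proof. by rewrite cdescE. Qed.
End Mor.

Fact evind1 X : evind_mor (idm X) = idm (evind_ob X).
Proof.
apply: lin_ext => c; have [i [x ->]] := colim_ind c.
by rewrite evind_morE ival1 actE fapp1.
Qed.
Fact evindM X Y Z (g : mor Y Z) (f : mor X Y) :
  evind_mor (mcomp g f) = mcomp (evind_mor g) (evind_mor f).
Proof.
apply: lin_ext => c; have [i [x ->]] := colim_ind c.
apply: etrans (evind_morE _ _) _; apply: esym.
apply: etrans (congr1 (evind_mor g : linhom _ _) (evind_morE f x)) _.
rewrite ivalM; have [j [h ->]] := colim_ind (ival f i).
by rewrite postE act_pre actE; exact: evind_morE.
Qed.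
Definition evind : functor (ind C) Vect :=
  @Functor _ _ (ind C) Vect evind_ob evind_mor evind1 evindM.
End IndEval.

Section ProEval.
Section Ob.
Variable X : pro C.
Definition plim_set (p : prodlm (fun i => F (X i))) : Prop :=
  forall i j (u : ihom i j), fapp (dmap X u : mor (X j : C) (X i)) (p j) = p i.
Fact plim0 : plim_set 0.
Proof. by move=> i j u; exact: linear0. Qed.
Fact plimP a p q : plim_set p -> plim_set q -> plim_set (a *: p + q).
Proof. by move=> hp hq i j u; rewrite linearP hp hq. Qed.
Definition plim : lmodType k := sublm (Submod plim0 plimP).
Definition plim_val (p : plim) : forall i, F (X i) := val p.
End Ob.

Section Mor.
Variables (X Y : pro C) (f : mor X Y).
Let f' : indhom Y X := f.
Definition pact j (c : colim (yhom (C := opc C) X (Y j))) (p : plim X) : F (Y j) :=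
  cdesc_fun (fun i (g : yhom (C := opc C) X (Y j) i) =>
    fapp (g : mor (X i : C) (Y j)) (plim_val p i)) c.
Lemma pactE j i (g : mor (X i : C) (Y j)) p :
  pact (cinj (g : yhom (C := opc C) X (Y j) i)) p = fapp g (plim_val p i).
Proof.
rewrite /pact cdesc_funE // => i' l u h /=.
by rewrite fappM (sublmP p).
Qed.
Fact prolimP p : plim_set (X := Y) (fun j => pact (ival f' j) p).
Proof.
move=> i j u; rewrite -(ivalP f' u).
by have [l [g ->]] := colim_ind (ival f' j); rewrite preE !pactE fappM.
Qed.
Definition evpro_fun (p : plim X) : plim Y := 
  submk (S := Submod (@plim0 Y) (@plimP Y)) (prolimP p).
Fact evpro_linear : linear evpro_fun.
Proof.
move=> a p q; apply/val_inj/functional_extensionality_dep => j /=.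
rewrite [in RHS]/GRing.add /= /prodD [in RHS]/GRing.scale /= /prodZ.
have [l [g e]] := colim_ind (ival f' j).
by rewrite e !pactE -linearP.
Qed.
Definition evpro_mor : linhom (plim X) (plim Y) := linmk evpro_linear.
End Mor.

Fact evpro1 X : evpro_mor (idm X) = idm (plim X : Vect).
Proof.
apply: lin_ext => p; apply/val_inj/functional_extensionality_dep => i /=.
by rewrite [ival _ _]ival1 pactE fapp1.
Qed.
Fact evproM X Y Z (g : mor Y Z) (f : mor X Y) :
  evpro_mor (mcomp g f) =
  mcomp (evpro_mor g : @mor _ Vect (plim Y) (plim Z)) (evpro_mor f).
Proof.
apply: lin_ext => p; apply/val_inj/functional_extensionality_dep => l /=.
rewrite [ival _ _]ivalM.
have [j [h ->]] := colim_ind (ival (g : indhom Z Y) l).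
rewrite postE pactE.
have [i [m e]] := colim_ind (ival (f : indhom Y X) j).
rewrite [X in pre _ _ X]e preE !pactE /= fappM; congr (fapp h _).
by rewrite /plim_val /= e pactE.
Qed.
Definition evpro : functor (pro C) Vect :=
  @Functor _ _ (pro C) Vect plim evpro_mor evpro1 evproM.
End ProEval.

Section IdemEval.
Section Ob.
Variable X : idemc C.
Definition idimg_set (x : F (projT1 X)) : Prop := exists y, x = fapp (idp X) y.
Fact idimg0 : idimg_set 0. Proof. by exists 0; rewrite linear0. Qed.
Fact idimgP a x y : idimg_set x -> idimg_set y -> idimg_set (a *: x + y).
Proof. by move=> [x' ->] [y' ->]; exists (a *: x' + y'); rewrite linearP. Qed.
Definition idimg : lmodType k := sublm (Submod idimg0 idimgP).
End Ob.
Section Mor.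
Variables (X Y : idemc C) (f : mor X Y).
Fact evidemP (x : idimg X) : idimg_set (X := Y) (fapp (idval f) (val x)).
Proof. by exists (fapp (idval f) (val x)); rewrite -fappM idvall. Qed.
Definition evidem_fun (x : idimg X) : idimg Y :=
  submk (S := Submod (@idimg0 Y) (@idimgP Y)) (evidemP x).
Fact evidem_linear : linear evidem_fun.
Proof. by move=> a x y; apply: val_inj; rewrite /= linearP. Qed.
Definition evidem_mor : linhom (idimg X) (idimg Y) := linmk evidem_linear.
End Mor.
Fact evidem1 X : evidem_mor (idm X) = idm (idimg X : Vect).
Proof.
apply: lin_ext => x; apply: val_inj => /=.
by have [y ->] := sublmP x; rewrite -fappM idpK.
Qed.
Fact evidemM X Y Z (g : mor Y Z) (f : mor X Y) :
  evidem_mor (mcomp g f) =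
  mcomp (evidem_mor g : @mor _ Vect (idimg Y) (idimg Z)) (evidem_mor f).
Proof. by apply: lin_ext => x; apply: val_inj; exact: fappM. Qed.
Definition evidem : functor (idemc C) Vect :=
  @Functor _ _ (idemc C) Vect idimg evidem_mor evidem1 evidemM.
End IdemEval.

End Eval.

Definition evtate (C : cat k) (F : functor C Vect) :
    functor (tateel C) Vect :=
  fcomp (evind (evpro F)) (fullsub_incl (@is_tate C)).

Fixpoint eval_ntate (n : nat) : functor (ntate n) Vect :=
  if n is m.+1 return functor (ntate n) Vect
  then evidem (evtate (eval_ntate m))
  else fullsub_incl (C := Vect) (@findim).

Definition eval (n : nat) : functor (ntateel n) Vect :=
  if n is m.+1 return functor (ntateel n) Vect
  then evtate (eval_ntate m)
  else fullsub_incl (C := Vect) (@findim).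

End Categories.

(* Restriction of scalars along a ring homomorphism. *)
Definition restr (F K : fieldType) (s : {rmorphism F -> K}) (V : lmodType K) :
  Type := V.

Section Restr.
Variables (F K : fieldType) (s : {rmorphism F -> K}) (V : lmodType K).
Local Notation restr := (restr s V).
HB.instance Definition _ := GRing.Zmodule.copy restr V.
Definition rscale (a : F) (x : restr) : restr := s a *: (x : V).
Fact rscaleA a b x : rscale a (rscale b x) = rscale (a * b) x.
Proof. by rewrite /rscale scalerA rmorphM. Qed.
Fact rscale1 : left_id 1 rscale.
Proof. by move=> x; rewrite /rscale rmorph1 scale1r. Qed.
Fact rscaleDr : right_distributive rscale +%R.
Proof. by move=> a x y; rewrite /rscale; exact: (scalerDr (s a) (x : V)). Qed.
Fact rscaleDl x : {morph rscale^~ x : a b / a + b}.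
Proof. by move=> a b; rewrite /rscale rmorphD; exact: (scalerDl (x : V)). Qed.
HB.instance Definition _ := GRing.Zmodule_isLmodule.Build F restr
  rscaleA rscale1 rscaleDr rscaleDl.
End Restr.

Section RestrMap.
Variables (F K : fieldType) (s : {rmorphism F -> K}).
Fact restr_linear (V W : lmodType K) (f : {linear V -> W}) :
  linear (f : restr s V -> restr s W).
Proof. by move=> a x y; exact: linearP. Qed.
Definition restrm (V W : lmodType K) (f : linhom V W) :
  linhom (restr s V) (restr s W) := linmk (restr_linear f).
Fact restrm1 (V : lmodType K) : restrm (lin1 V) = lin1 (restr s V).
Proof. exact: lin_ext. Qed.
Fact restrmM (U V W : lmodType K) (g : linhom V W) (f : linhom U V) :
  restrm (linM g f) = linM (restrm g) (restrm f).
Proof. exact: lin_ext. Qed.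

Definition forget : functor (Vectf K) (Vect F) :=
  @Functor _ _ (Vectf K) (Vect F) (fun V => restr s (sval V))
    (fun V W f => restrm f) (fun V => restrm1 (sval V))
    (fun U V W g f => restrmM g f).

Definition finite_ext : Prop := findim (restr s K^o).

Lemma findim_restr (V : lmodType K) :
  finite_ext -> findim V -> findim (restr s V).
Proof.
move=> [m [t tP]] [n [b bP]].
pose e (p : 'I_#|{: 'I_m * 'I_n}|) : restr s V :=
  (t (enum_val p).1 : K) *: b (enum_val p).2.
exists _, e => x; have [c ->] := bP x.
have /choice[d dP] : forall j, exists d : 'I_m -> F,
    c j = \sum_i (d i *: t i : restr s K^o) by move=> j; exact: tP.
exists (fun p => d (enum_val p).2 (enum_val p).1).
rewrite (eq_bigr (fun j => \sum_i (s (d j i) * (t i : K)) *: b j)); last first.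
  by move=> j _; rewrite dP -scaler_suml.
rewrite exchange_big pair_big /= (reindex_onto enum_val enum_rank) /=; last first.
  by move=> p _; rewrite enum_rankK.
rewrite (eq_bigl predT) => [|p]; last by rewrite enum_valK eqxx.
by apply: eq_bigr => p _; rewrite -scalerA.
Qed.

Definition forgetf (fin : finite_ext) : functor (Vectf K) (Vectf F) :=
  @Functor _ _ (Vectf K) (Vectf F)
    (fun V => exist _ (restr s (sval V) : lmodType F)
      (findim_restr fin (svalP V)))
    (fun V W f => restrm f) (fun V => restrm1 (sval V))
    (fun U V W g f => restrmM g f).
End RestrMap.

(* Formal power series; their fraction field is the field of Laurent series. *)
Section PowerSeries.
Variable F : fieldType.
Definition pser : Type := nat -> F.
Implicit Types f g h : pser.
HB.instance Definition _ := gen_eqMixin pser.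
HB.instance Definition _ := gen_choiceMixin pser.

Definition pzero : pser := fun=> 0.
Definition padd f g : pser := fun i => f i + g i.
Definition popp f : pser := fun i => - f i.
Definition pconst (a : F) : pser := fun i => if i is 0%N then a else 0.
Definition pmul f g : pser := fun n => \sum_(i < n.+1) f i * g (n - i)%N.

Fact paddA : associative padd.
Proof. by move=> f g h; apply/funext => i; exact: addrA. Qed.
Fact paddC : commutative padd.
Proof. by move=> f g; apply/funext => i; exact: addrC. Qed.
Fact padd0 : left_id pzero padd.
Proof. by move=> f; apply/funext => i; exact: add0r. Qed.
Fact paddN : left_inverse pzero popp padd.
Proof. by move=> f; apply/funext => i; exact: addNr. Qed.
HB.instance Definition _ := GRing.isZmodule.Build pser paddA paddC padd0 paddN.

Definition ptrunc N f : {poly F} := \poly_(i < N) f i.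
Lemma pmulE N f g n : (n < N)%N -> pmul f g n = (ptrunc N f * ptrunc N g)`_n.
Proof.
move=> nN; rewrite coefM; apply: eq_bigr => i _.
rewrite !coef_poly !(leq_ltn_trans _ nN) ?leq_subr //.
by rewrite -ltnS.
Qed.
Lemma pmulC : commutative pmul.
Proof. by move=> f g; apply/funext => n; rewrite !(pmulE _ _ (ltnSn n)) mulrC. Qed.
Lemma pmulA : associative pmul.
Proof.
move=> f g h; apply/funext => n.
pose P := ptrunc n.+1.
transitivity ((P f * (P g * P h))`_n).
  rewrite coefM; apply: eq_bigr => i _.
  rewrite coef_poly ltn_ord; congr (_ * _); apply: pmulE.
  by rewrite ltnS leq_subr.
rewrite mulrA coefM; apply: eq_bigr => i _.
by rewrite -(pmulE f g (ltn_ord i)) coef_poly ltnS leq_subr.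
Qed.
Lemma pmul1 : left_id (pconst 1) pmul.
Proof.
move=> f; apply/funext => n; rewrite /pmul big_ord_recl /= mul1r subn0.
by rewrite big1 ?addr0 // => i _; rewrite /= mul0r.
Qed.
Lemma pmulDl : left_distributive pmul padd.
Proof.
move=> f g h; apply/funext => n; rewrite /padd /pmul -big_split /=.
by apply: eq_bigr => i _; rewrite mulrDl.
Qed.
Lemma p1_neq0 : pconst 1 != 0.
Proof. by apply/eqP => /(congr1 (fun f : pser => f 0%N)) /eqP; rewrite /= oner_eq0. Qed.
HB.instance Definition _ := GRing.Zmodule_isComNzRing.Build pser
  pmulA pmulC pmul1 pmulDl p1_neq0.

Definition punit : pred pser := fun f => `[< exists g : pser, g * f = 1 >].
Definition pinv f : pser :=
  if pselect (exists g : pser, g * f = 1) is left e then projT1 (cid e) else f.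
Fact pmulV : {in punit, left_inverse 1 pinv *%R}.
Proof.
move=> f /asboolP fP; rewrite /pinv; case: pselect => // e.
exact: (projT2 (cid e)).
Qed.
Fact punitP f g : g * f = 1 -> punit f.
Proof. by move=> gf; apply/asboolP; exists g. Qed.
Fact pinv_out : {in [predC punit], pinv =1 id}.
Proof. by move=> f /asboolP fP; rewrite /pinv; case: pselect. Qed.
HB.instance Definition _ := GRing.ComNzRing_hasMulInverse.Build pser
  pmulV punitP pinv_out.

Lemma pord f : f <> 0 -> exists2 a, f a != 0 & forall i, (i < a)%N -> f i = 0.
Proof.
move=> f0; have ex : exists a, f a != 0.
  apply: contrapT => h; apply: f0; apply/funext => i; apply/eqP.
  by apply: contrapT => fi; apply: h; exists i; apply/negP.
exists (ex_minn ex); first by case: ex_minnP.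
move=> i; case: ex_minnP => a _ amin ia; apply/eqP; apply: contraTT ia => fi.
by rewrite -leqNgt amin.
Qed.

Fact pser_integral : GRing.integral_domain_axiom pser.
Proof.
move=> f g fg0; apply: contrapT => /negP.
rewrite negb_or => /andP[/eqP /pord[a fa fP] /eqP /pord[b gb gP]].
have := congr1 (fun f : pser => f (a + b)%N) fg0; apply/eqP.
have aab : (a < (a + b).+1)%N by rewrite ltnS leq_addr.
rewrite [X in X != _](_ : _ = f a * g b) ?mulf_neq0 //.
rewrite /GRing.mul /= /pmul (bigD1 (Ordinal aab)) //= addKn.
rewrite big1 ?addr0 // => i; rewrite -val_eqE /= neq_ltn => /orP[ia|ai].
  by rewrite fP ?mul0r.
rewrite [g _]gP ?mulr0 // ltn_subLR ?ltn_add2r //.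
by rewrite -ltnS.
Qed.
HB.instance Definition _ := GRing.ComUnitRing_isIntegral.Build pser pser_integral.

Fact pconst_zmod : zmod_morphism pconst.
Proof. by move=> a b; apply/funext => -[|i] //=; rewrite [RHS]/GRing.add /= /padd /= subr0. Qed.
Fact pconst_monoid : monoid_morphism pconst.
Proof.
split=> // a b; apply/funext => n.
rewrite [RHS]/GRing.mul /= /pmul big_ord_recl /= subn0 big1 ?addr0.
  by case: n => [|n] //=; rewrite mulr0.
by move=> i _; rewrite /= mul0r.
Qed.
HB.instance Definition _ := GRing.isZmodMorphism.Build F pser pconst pconst_zmod.
HB.instance Definition _ := GRing.isMonoidMorphism.Build F pser pconst pconst_monoid.
End PowerSeries.

Definition perfect (k : fieldType) : Prop :=
  forall p, p \in [pchar k] -> forall x : k, exists y : k, y ^+ p = x.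

(* A field with a ring homomorphism from k *)
Record kfield (k : fieldType) := KField {
  kf :> fieldType;
  kmap : {rmorphism k -> kf} }.
Arguments kmap {k} K : rename.

Section LocalFields.

(* 0 has valuation +oo, whatever the value of v at 0. *)
Definition val_ge (K : fieldType) (v : K -> int) (i : int) (x : K) : Prop :=
  x = 0 \/ i <= v x.

(* Complete discrete valuation on K, with residue field k1.  The map [dres] is
   only meaningful on the ring of integers [val_ge dv 0]; it identifies k1 with
   the quotient of the latter by its maximal ideal [val_ge dv 1]. *)
Record cdvf (K k1 : fieldType) := Cdvf {
  dv : K -> int;
  dvM : forall x y, x != 0 -> y != 0 -> dv (x * y) = dv x + dv y;
  dvD : forall x y, x != 0 -> y != 0 -> x + y != 0 ->
    Num.min (dv x) (dv y) <= dv (x + y);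
  dv1 : exists2 x, x != 0 & dv x = 1;
  dv_complete : forall u : nat -> K,
    (forall i : int, exists N, forall m n, (N <= m)%N -> (N <= n)%N ->
       val_ge dv i (u m - u n)) ->
    exists l : K, forall i : int, exists N, forall n, (N <= n)%N ->
       val_ge dv i (u n - l);
  dres : K -> k1;
  dres1 : dres 1 = 1;
  dresD : forall x y, val_ge dv 0 x -> val_ge dv 0 y ->
    dres (x + y) = dres x + dres y;
  dresM : forall x y, val_ge dv 0 x -> val_ge dv 0 y ->
    dres (x * y) = dres x * dres y;
  dres_surj : forall a, exists2 x, val_ge dv 0 x & dres x = a;
  dres_ker : forall x, val_ge dv 0 x -> (dres x = 0 <-> val_ge dv 1 x) }.

Lemma val_geD (K k1 : fieldType) (D : cdvf K k1) i x y :
  val_ge (dv D) i x -> val_ge (dv D) i y -> val_ge (dv D) i (x + y).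
Proof.
case: (eqVneq x 0) => [->|x0]; first by rewrite add0r.
case: (eqVneq y 0) => [->|y0]; first by rewrite addr0.
case: (eqVneq (x + y) 0) => [->|xy0]; first by left.
move=> [/eqP|ix]; first by rewrite (negbTE x0).
move=> [/eqP|iy]; first by rewrite (negbTE y0).
right; apply: le_trans (dvD D x0 y0 xy0).
by rewrite le_min ix iy.
Qed.

Lemma val_geM (K k1 : fieldType) (D : cdvf K k1) i j x y :
  val_ge (dv D) i x -> val_ge (dv D) j y -> val_ge (dv D) (i + j) (x * y).
Proof.
case: (eqVneq x 0) => [->|x0]; first by left; rewrite mul0r.
case: (eqVneq y 0) => [->|y0]; first by left; rewrite mulr0.
move=> [/eqP|ix]; first by rewrite (negbTE x0).
move=> [/eqP|iy]; first by rewrite (negbTE y0).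
by right; rewrite dvM // lerD.
Qed.

Variable k : fieldType.
Implicit Types K : kfield k.

(* An n-local field K with a ring homomorphism from k to
   O_1 x_{k_1} ... x_{k_(n-1)} O_n such that k_n is finite over k. *)
Inductive tower : nat -> kfield k -> Type :=
| Tower0 (K : kfield k) : finite_ext (kmap K) -> tower 0 K
| TowerS (n : nat) (K k1 : kfield k) (D : cdvf K k1) :
    (forall c, val_ge (dv D) 0 (kmap K c) /\ dres D (kmap K c) = kmap k1 c) ->
    tower n k1 -> tower n.+1 K.

(* k-linear topologies.  A k-linear topology on a k-module is determined by
   its open submodules, which form a filter in the lattice of submodules, and
   a k-linear map is continuous if and only if the preimages of open
   submodules are open; a topology is therefore represented by the set of its
   open submodules. *)
Section Topologies.
Variables (A : nzRingType) (i : k -> A).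

Definition ksub (U : set A) : Prop :=
  U 0 /\ forall c x y, U x -> U y -> U (i c * x + y).

Definition linear_topology (T : set (set A)) : Prop :=
  [/\ forall U, T U -> ksub U, T setT,
      forall U W, T U -> T W -> T (U `&` W) &
      forall U W, T U -> ksub W -> U `<=` W -> T W].

Definition discrete : set (set A) := [set U | ksub U].

Definition ST_ring (T : set (set A)) : Prop :=
  linear_topology T /\
  forall a U, T U -> T [set x | U (a * x)] /\ T [set x | U (x * a)].
End Topologies.

(* The topology induced on the residue field k1: the quotient topology of the
   subspace topology of O_1. *)
Definition residue_topology K (k1 : kfield k) (D : cdvf K k1)
    (T : set (set K)) : set (set k1) :=
  [set U | ksub (kmap k1) U /\
     exists2 W, T W & forall x, val_ge (dv D) 0 x -> W x -> U (dres D x)].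

Record lifting K (k1 : kfield k) (D : cdvf K k1) := Lifting {
  lift :> {rmorphism k1 -> K};
  lift_int : forall a, val_ge (dv D) 0 (lift a);
  lift_res : forall a, dres D (lift a) = a;
  lift_kmap : forall c, lift (kmap k1 c) = kmap K c }.

Fixpoint liftings n K (T : tower n K) : Type :=
  match T with
  | Tower0 _ _ => unit
  | TowerS n K k1 D _ T1 => (lifting D * liftings T1)%type
  end.

Fixpoint liftings_continuous n K (T : tower n K) :
    set (set K) -> liftings T -> Prop :=
  match T as T0 in tower n K return set (set K) -> liftings T0 -> Prop with
  | Tower0 _ _ => fun _ _ => True
  | TowerS n K k1 D _ T1 => fun top s =>
      (forall W, top W -> residue_topology D top [set a | W (lift s.1 a)]) /\
      liftings_continuous (residue_topology D top) s.2
  end.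

(* The Laurent series field F((t)) *)
Definition laurent1 (F : kfield k) : kfield k :=
  @KField k {fraction (pser F)}
    (@tofrac (pser F) \o (@pconst F \o kmap F)).

(* F[[t]] = lim_j F[t]/(t^j), where F[t]/(t^j) is topologized as F^j *)
Definition pser_topology (F : kfield k) (T : set (set F)) : set (set (pser F)) :=
  [set U | ksub (fun c => pconst (kmap F c)) U /\
     exists j (W : nat -> set F), (forall i, (i < j)%N -> T (W i)) /\
       forall f : pser F, (forall i, (i < j)%N -> W i (f i)) -> U f].

(* T makes F((t)) an ST module over F[[t]] *)
Definition laurent1_STmod (F : kfield k) (TF : set (set F))
    (T : set (set (laurent1 F))) : Prop :=
  [/\ linear_topology (kmap (laurent1 F)) T,
      forall (a : pser F) U, T U ->
        T [set x : laurent1 F | U ((tofrac a : laurent1 F) * x)] &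
      forall (x : laurent1 F) U, T U ->
        pser_topology TF [set a : pser F | U ((tofrac a : laurent1 F) * x)]].

(* The finest of these topologies: as they are stable under suprema, a
   subspace is open for the finest one when it is open for one of them. *)
Definition laurent1_topology (F : kfield k) (TF : set (set F)) :
    set (set (laurent1 F)) :=
  [set U | exists2 T, laurent1_STmod TF T & T U].

(* F((t_1))...((t_n)) *)
Fixpoint laurent (F : kfield k) (n : nat) : kfield k :=
  if n is m.+1 then laurent1 (laurent F m) else F.

Fixpoint laurent_topology (F : kfield k) (n : nat) : set (set (laurent F n)) :=
  if n is m.+1 return set (set (laurent F n))
  then laurent1_topology (@laurent_topology F m) else discrete (kmap F).

Record tlf (n : nat) := Tlf {
  tlf_field :> kfield k;
  tlf_tower : tower n tlf_field;
  tlf_top : set (set tlf_field);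
  tlf_ST : ST_ring (kmap tlf_field) tlf_top;
  tlf_param : exists F : kfield k, finite_ext (kmap F) /\
    exists phi : {rmorphism tlf_field -> laurent F n},
      [/\ bijective phi, forall c, phi (kmap tlf_field c) = kmap (laurent F n) c &
          forall U, tlf_top U <-> @laurent_topology F n (phi @` U)] }.

Definition lifting_system n (K : tlf n) : Type :=
  {s : liftings (tlf_tower K) | liftings_continuous (@tlf_top n K) s}.

End LocalFields.

(* Subquotients S / (S' :&: S) *)
Section Subquotients.
Variable F : fieldType.

Section Ob.
Variables (V : lmodType F) (S S' : submod V).
Definition within_set (x : sublm S) : Prop := S' (val x).
Fact within0 : within_set 0. Proof. exact: smem0. Qed.
Fact withinP a x y : within_set x -> within_set y -> within_set (a *: x + y).
Proof. exact: smemP. Qed.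
Definition within : submod (sublm S) := Submod within0 withinP.
Definition subquot : lmodType F := quotlm within.
End Ob.

(* The map induced by f, if f maps S to T and S' to T'; the default value 0 of
   [insubd] is only used outside of this case. *)
Definition subquot_fun (V W : lmodType F) (S S' : submod V) (T T' : submod W)
    (f : V -> W) (q : subquot S S') : subquot T T' :=
  qpi (within T T') (insubd (0 : sublm T) (f (val (qrep q)))).

Section Map.
Variables (V W : lmodType F) (S S' : submod V) (T T' : submod W).
Variable f : {linear V -> W}.
Hypothesis fS : forall x, S x -> T (f x).
Hypothesis fS' : forall x, S x -> S' x -> T' (f x).

Lemma subquot_insubd (x : sublm S) : val (insubd (0 : sublm T) (f (val x))) = f (val x).
Proof. by rewrite insubdK //; apply/asboolP/fS/sublmP. Qed.

Lemma subquot_funE (x : sublm S) :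
  subquot_fun T T' f (qpi (within S S') x) =
  qpi (within T T') (insubd (0 : sublm T) (f (val x))).
Proof.
apply/qpi_eq; rewrite /= /within_set raddfB /= !subquot_insubd -linearB /=.
apply: fS'; last exact: (qrepP (within S S') x).
exact: (sublmP (qrep (qpi (within S S') x) - x)).
Qed.

Fact subquot_linear : linear (@subquot_fun V W S S' T T' f).
Proof.
move=> a p q; rewrite -(qpiK p) -(qpiK q); move: (qrep p) (qrep q) => x y.
rewrite -qpi_linear !subquot_funE -qpi_linear.
apply: (congr1 (qpi (within T T'))); apply: val_inj.
rewrite subquot_insubd. by rewrite /= !subquot_insubd linearP.
Qed.
Definition subquot_map : linhom (subquot S S') (subquot T T') :=
  linmk subquot_linear.
End Map.
End Subquotients.

(* O_1-submodules of K-vector spaces *)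
Section Lattices.
Variables (K k1 : fieldType) (D : cdvf K k1) (V : lmodType K).

Record osub := Osub {
  omem :> V -> Prop;
  omem0 : omem 0;
  omemD : forall x y, omem x -> omem y -> omem (x + y);
  omemZ : forall a x, val_ge (dv D) 0 a -> omem x -> omem (a *: x) }.

(* L is a finite O_1-module with K L = V *)
Definition yek_lattice (L : osub) : Prop :=
  (exists r (s : 'I_r -> V), forall x, L x <->
     exists c : 'I_r -> K, (forall i, val_ge (dv D) 0 (c i)) /\
       x = \sum_i c i *: s i) /\
  (forall x, exists r (c : 'I_r -> K) (y : 'I_r -> V),
     (forall i, L (y i)) /\ x = \sum_i c i *: y i).

Record basis := Basis {
  brank : nat;
  bvec :> 'I_brank -> V;
  basisP : forall x, exists! c : 'I_brank -> K, x = \sum_i c i *: bvec i }.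

(* m_1^i (O_1 (x) {b_1, ..., b_r}) *)
Section Span.
Variables (b : basis) (i : nat).
Definition bspan_set (x : V) : Prop := exists c : 'I_(brank b) -> K,
  (forall j, val_ge (dv D) i%:Z (c j)) /\ x = \sum_j c j *: b j.
Fact bspan0 : bspan_set 0.
Proof.
exists (fun=> 0); split; first by left.
by rewrite big1 // => j _; rewrite scale0r.
Qed.
Fact bspanD x y : bspan_set x -> bspan_set y -> bspan_set (x + y).
Proof.
move=> [c [cP ->]] [d [dP ->]]; exists (fun j => c j + d j).
split; first by move=> j; exact: val_geD.
by rewrite -big_split; apply: eq_bigr => j _; rewrite scalerDl.
Qed.
Fact bspanZ a x : val_ge (dv D) 0 a -> bspan_set x -> bspan_set (a *: x).
Proof.
move=> aP [c [cP ->]]; exists (fun j => a * c j).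
split; first by move=> j; rewrite -[i%:Z]add0r; exact: val_geM.
by rewrite scaler_sumr; apply: eq_bigr => j _; rewrite scalerA.
Qed.
Definition bspan : osub := Osub bspan0 bspanD bspanZ.
End Span.
End Lattices.

Section Sharp.
Variable k : fieldType.

Section OneStep.
Variables (K k1 : kfield k) (D : cdvf K k1) (s : lifting D).

(* O_1-submodules as k_1-submodules, via the lifting *)
Section Osubmod.
Variables (V : lmodType K) (L : osub D V).
Fact osubmodP (a : k1) (x y : restr s V) : L x -> L y -> L (a *: x + y).
Proof. by move=> Lx Ly; apply: omemD => //; exact: (omemZ (lift_int s a) Lx). Qed.
Definition osubmod : submod (restr s V) :=
  Submod (smem := (L : restr s V -> Prop)) (omem0 L) osubmodP.
End Osubmod.

Definition oquot (V : lmodType K) (L L' : osub D V) : lmodType k1 :=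
  subquot (osubmod L) (osubmod L').

Definition oquot_fun (V W : lmodType K) (L L' : osub D V) (M M' : osub D W)
    (f : V -> W) : oquot L L' -> oquot M M' :=
  @subquot_fun _ (restr s V) (restr s W) _ _ (osubmod M) (osubmod M') f.

(* (O_1 (x) {b_1, ..., b_r}) / m_1^i *)
Definition bquot (V : lmodType K) (b : basis V) (i : nat) : lmodType k1 :=
  oquot (bspan D b 0) (bspan D b i).

Definition bmaps (V W : lmodType K) (f : V -> W) (b : basis V) (c : basis W) :=
  forall x, bspan D b 0 x -> bspan D c 0 (f x).

Lemma bmapsP (V W : lmodType K) (f : {linear V -> W}) b c i j x :
  (j <= i)%N -> bmaps f b c -> bspan D b i x -> bspan D c j (f x).
Proof.
move=> ji fbc [u [uP ->]]; rewrite linear_sum /=.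
apply: (big_ind (bspan D c j)); [exact: omem0 | exact: omemD | move=> l _].
rewrite linearZ /=.
have [|w [wP ->]] := fbc (b l).
  exists (fun m => (m == l)%:R); split.
    move=> m; case: eqP => _; last by left.
    right; rewrite -(lerD2r (dv D 1)) -dvM ?oner_neq0 // mulr1 add0r.
    exact: lexx.
  rewrite (bigD1 l) //= eqxx scale1r big1 ?addr0 // => m /negbTE ->.
  by rewrite scale0r.
exists (fun m => u l * w m); split.
  move=> m; have := val_geM (uP l) (wP m); rewrite addr0 => -[->|h].
    by left.
  by right; apply: le_trans h; rewrite lez_nat.
by rewrite scaler_sumr; apply: eq_bigr => m _; rewrite scalerA.
Qed.
End OneStep.

(* E^Yek_sigma(M1, M2); the map f is meant to be k-linear. *)
Fixpoint EYek n (K : kfield k) (T : tower n K) :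
    liftings T -> forall M1 M2 : lmodType K, (M1 -> M2) -> Prop :=
  match T as T0 in tower n K
    return liftings T0 -> forall M1 M2 : lmodType K, (M1 -> M2) -> Prop with
  | Tower0 _ _ => fun _ M1 M2 f => True
  | TowerS n K k1 D _ T1 => fun s M1 M2 f =>
      forall (L1 : osub D M1) (L2 : osub D M2),
        yek_lattice L1 -> yek_lattice L2 ->
        let good (L1' : osub D M1) (L2' : osub D M2) :=
          [/\ yek_lattice L1' /\ yek_lattice L2',
              (forall x, L1' x -> L1 x) /\ (forall x, L2 x -> L2' x),
              forall x, L1' x -> L2 (f x) &
              forall x, L1 x -> L2' (f x)] in
        (exists L1' L2', good L1' L2') /\
        (forall L1' L2', good L1' L2' ->
           EYek s.2 (@oquot_fun K k1 D s.1 M1 M2 L1 L1' L2' L2 f))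
  end.

(* The construction of sharp for K, given that for the residue field. *)
Section Step.
Variables (K k1 : kfield k) (D : cdvf K k1) (s : lifting D) (n : nat).
Variable G : functor (Vectf k1) (ntate k n).

(* Preorder of bases, as a category *)
Definition blt (V : lmodType K) (b c : basis V) : Prop :=
  forall x, bspan D b 0 x -> bspan D c 0 x.
Definition bdirected (V : lmodType K) : Prop :=
  (exists _ : basis V, True) /\
  forall b c : basis V, exists d, blt b d /\ blt c d.

Definition bcat (V : lmodType K) (dir : bdirected V) : fcat.
Proof.
apply: (@Fcat (basis V) (@blt V) (fun b x bx => bx)
  (fun b c d v u x bx => v x (u x bx))).
- by [].
- by [].
- by [].
- exact: dir.1.
- by move=> b c; have [d [bd cd]] := dir.2 b c; exists d, bd, cd.
- by move=> b c u v; exists c, (fun x cx => cx); apply: Prop_irrelevance.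
Defined.

Definition natcat : fcat.
Proof.
apply: (@Fcat nat (fun i j => (i <= j)%N) leqnn
  (fun i j l v u => leq_trans u v)).
- by move=> *; exact: bool_irrelevance.
- by move=> *; exact: bool_irrelevance.
- by move=> *; exact: bool_irrelevance.
- by exists 0%N.
- by move=> i j; exists (maxn i j), (leq_maxl i j), (leq_maxr i j).
- by move=> i j u v; exists j, (leqnn j); exact: bool_irrelevance.
Defined.

Section Quotients.
Hypothesis fin : forall (V : Vectf K) (b : basis (sval V)) i,
  findim (bquot s b i).

Definition qob (V : Vectf K) (b : basis (sval V)) (i : nat) : Vectf k1 :=
  exist _ (bquot s b i) (fin b i).

Definition vmap (V W : Vectf K) (f : mor V W) :
  {linear sval V -> sval W} := f.

Section QMap.
Variables (V W : Vectf K) (f : mor V W).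
Variables (b : basis (sval V)) (c : basis (sval W)).
Hypothesis bc : bmaps D (vmap f) b c.

Definition qmap (i j : nat) (ji : (j <= i)%N) : mor (qob b i) (qob c j) :=
  @subquot_map _ (restr s (sval V)) (restr s (sval W))
    (osubmod s (bspan D b 0)) (osubmod s (bspan D b i))
    (osubmod s (bspan D c 0)) (osubmod s (bspan D c j))
    (restrm s (vmap f)) bc (fun x _ => @bmapsP _ _ D _ _ (vmap f) b c i j x ji bc).
End QMap.

Lemma qmapE (V W : Vectf K) (f : mor V W) b c (bc : bmaps D (vmap f) b c)
    i j (ji : (j <= i)%N) x :
  (qmap bc ji : linhom _ _) (qpi _ x) =
  qpi _ (insubd (0 : sublm (osubmod s (bspan D c 0))) (vmap f (val x))).
Proof.
exact: (@subquot_funE _ (restr s (sval V)) (restr s (sval W))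
  (osubmod s (bspan D b 0)) (osubmod s (bspan D b i))
  (osubmod s (bspan D c 0)) (osubmod s (bspan D c j)) (restrm s (vmap f)) bc
  (fun x _ => @bmapsP _ _ D _ _ (vmap f) b c i j x ji bc)).
Qed.

Lemma qmap1 (V : Vectf K) (b : basis (sval V))
    (bb : bmaps D (vmap (idm V)) b b) i (ii : (i <= i)%N) :
  qmap bb ii = idm (qob b i).
Proof.
apply: lin_ext => q; rewrite -(qpiK q); move: (qrep q) => x.
apply: etrans (qmapE _ _ _) _.
by apply: (congr1 (qpi _)); apply: val_inj; rewrite insubdK //; exact: valP.
Qed.

Section GMap.
Variables (U V W : Vectf K) (f : mor U V) (g : mor V W) (h : mor U W).
Hypothesis hgf : forall x, vmap h x = vmap g (vmap f x).
Variables (a : basis (sval U)) (b : basis (sval V)) (c : basis (sval W)).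
Variables (ab : bmaps D (vmap f) a b) (bc : bmaps D (vmap g) b c).
Variables (ac : bmaps D (vmap h) a c) (i j l : nat).
Variables (ji : (j <= i)%N) (lj : (l <= j)%N) (li : (l <= i)%N).

Lemma qmapM : qmap ac li = mcomp (qmap bc lj) (qmap ab ji).
Proof.
apply: lin_ext => q; rewrite -(qpiK q); move: (qrep q) => x.
apply: etrans (qmapE _ _ _) _; apply: esym.
apply: etrans (congr1 (qmap bc lj : linhom _ _) (qmapE _ _ _)) _.
apply: etrans (qmapE _ _ _) _; apply: (congr1 (qpi _)); apply: val_inj.
rewrite [val (insubd _ (vmap f _))]insubdK ?hgf //.
by apply/asboolP/ab/(sublmP x).
Qed.

Lemma gmapM :
  fmap G (qmap ac li) = mcomp (fmap G (qmap bc lj)) (fmap G (qmap ab ji)).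
Proof. by rewrite qmapM fmapM. Qed.
End GMap.

Definition brefl (V : Vectf K) (b : basis (sval V)) :
  bmaps D (vmap (idm V)) b b := fun x bx => bx.

(* i |-> G((O_1 (x) {b_1, ..., b_r}) / m_1^i) *)
Section ProDiagram.
Variables (V : Vectf K) (b : basis (sval V)).
Fact pdiag1 i : fmap G (qmap (@brefl V b) (leqnn i)) = idm (G (qob b i)).
Proof. by rewrite qmap1 fmap1. Qed.
Fact pdiagM i j l (v : (j <= l)%N) (u : (i <= j)%N) :
  fmap G (qmap (@brefl V b) (leq_trans u v)) =
  mcomp (fmap G (qmap (@brefl V b) u)) (fmap G (qmap (@brefl V b) v)).
Proof. exact: gmapM. Qed.
Definition pdiag : diag natcat (opc (ntate k n)) :=
  @Diag k natcat (opc (ntate k n)) (fun i => G (qob b i))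
    (fun i j u => fmap G (qmap (@brefl V b) u)) pdiag1 pdiagM.
End ProDiagram.

Section ProObjects.
Hypothesis epi : forall (V : Vectf K) (b : basis (sval V)),
  admissible (pdiag b).

(* lim_i G((O_1 (x) {b_1, ..., b_r}) / m_1^i) *)
Definition pob (V : Vectf K) (b : basis (sval V)) : pro (ntate k n) :=
  IndOb (@epi V b).

Section PMap.
Variables (V W : Vectf K) (f : mor V W).
Variables (b : basis (sval V)) (c : basis (sval W)).
Hypothesis bc : bmaps D (vmap f) b c.
Fact pmap_natural : natural (D := pdiag c) (E := pdiag b)
  (fun i => fmap G (qmap bc (leqnn i)) : mor (pdiag c i) (pdiag b i)).
Proof.
move=> i j u; apply: etrans (esym (gmapM _ _ _ bc _ _ _)) _ => //.
by apply: gmapM.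
Qed.
Definition pmap : mor (pob b) (pob c) := indlvl (@epi W c) (@epi V b) pmap_natural.
End PMap.

Lemma pmapM (U V W : Vectf K) (f : mor U V) (g : mor V W) (h : mor U W)
    (hgf : forall x, vmap h x = vmap g (vmap f x)) a b c
    (ab : bmaps D (vmap f) a b) (bc : bmaps D (vmap g) b c)
    (ac : bmaps D (vmap h) a c) :
  pmap ac = mcomp (pmap bc) (pmap ab).
Proof.
apply: iext => i; apply: esym.
apply: etrans (ivalM (C := opc (ntate k n)) _ _ _) _.
rewrite indlvlE (postE (C := opc (ntate k n))) indlvlE preE.
apply: (congr1 (@cinj _ _ (yhom (C := opc (ntate k n)) (pob a) (pob c i)) i)).
exact/esym/gmapM.
Qed.

Lemma pmap1 (V : Vectf K) (b : basis (sval V))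
  (bb : bmaps D (vmap (idm V)) b b) : pmap bb = idm (pob b).
Proof.
apply: iext => i; rewrite indlvlE qmap1 fmap1.
by [].
Qed.

Section IndDiagram.
Variables (V : Vectf K) (dir : bdirected (sval V)).
Definition bltmap (b c : basis (sval V)) (bc : blt b c) :
  bmaps D (vmap (idm V)) b c := bc.
Fact idiag1 b : pmap (bltmap (@iid (bcat dir) b)) = idm (pob b).
Proof. exact: pmap1. Qed.
Fact idiagM (a b c : basis (sval V)) (v : blt b c) (u : blt a b) :
  pmap (bltmap (@icomp (bcat dir) a b c v u)) =
  mcomp (pmap (bltmap v)) (pmap (bltmap u)).
Proof. exact: pmapM. Qed.
Definition idiag : diag (bcat dir) (pro (ntate k n)) :=
  @Diag k (bcat dir) (pro (ntate k n)) (fun b => pob b)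
    (fun b c u => pmap (bltmap u)) idiag1 idiagM.
End IndDiagram.

Section IndObjects.
Hypothesis dir : forall V : Vectf K, bdirected (sval V).
Hypothesis mono : forall V : Vectf K, admissible (idiag (dir V)).

(* colim_b lim_i G((O_1 (x) {b_1, ..., b_r}) / m_1^i) *)
Definition sob (V : Vectf K) : ind (pro (ntate k n)) := IndOb (@mono V).

Hypothesis bound : forall (V W : Vectf K) (f : mor V W) (b : basis (sval V)),
  exists c : basis (sval W), bmaps D (vmap f) b c.

Section SMap.
Variables (V W : Vectf K) (f : mor V W).
Definition scomp (b : basis (sval V)) (c : basis (sval W))
    (bc : bmaps D (vmap f) b c) : colim (yhom (sob W) (pob b)) :=
  cinj (pmap bc : yhom (sob W) (pob b) c).

Lemma scomp_eq b c d (bc : bmaps D (vmap f) b c) (bd : bmaps D (vmap f) b d) :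
  scomp bc = scomp bd.
Proof.
have [e [ce de]] := (dir W).2 c d.
have be : bmaps D (vmap f) b e by move=> x bx; exact/ce/bc.
rewrite /scomp; apply/cinj_eq; exists e, ce, de.
transitivity (pmap be).
  by apply/esym; apply: (pmapM (g := idm W)).
by apply: (pmapM (g := idm W)).
Qed.

Definition smapc (b : basis (sval V)) : colim (yhom (sob W) (pob b)) :=
  scomp (projT2 (cid (bound f b))).

Lemma smapcE b c (bc : bmaps D (vmap f) b c) : smapc b = scomp bc.
Proof. exact: scomp_eq. Qed.

Fact smapP : ihom_set (X := sob V) (Y := sob W) smapc.
Proof.
move=> b c u; have [d cd] := bound f c.
have bd : bmaps D (vmap f) b d by move=> x /u; exact: cd.
rewrite (smapcE cd) (smapcE bd); apply: etrans (preE _ _) _.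
apply: (congr1 (@cinj _ _ (yhom (sob W) (pob b)) d)).
by apply/esym; apply: (pmapM (f := idm V)).
Qed.
Definition smap : mor (sob V) (sob W) := imk smapP.
Lemma smapE b c (bc : bmaps D (vmap f) b c) : ival smap b = scomp bc.
Proof. exact: smapcE. Qed.
End SMap.

Fact smap1 V : smap (idm V) = idm (sob V).
Proof.
apply: iext => b; rewrite (smapE (@brefl V b)) /scomp pmap1.
by [].
Qed.
Fact smapM U V W (g : mor V W) (f : mor U V) :
  smap (mcomp g f) = mcomp (smap g) (smap f).
Proof.
apply: iext => b; apply: esym; apply: etrans (ivalM _ _ _) _.
have [c bc] := bound f b; have [d cd] := bound g c.
have bd : bmaps D (vmap (mcomp g f)) b d by move=> x bx; exact/cd/bc.
rewrite (smapE bd) (smapE bc) /scomp postE (smapE cd) preE.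
apply: (congr1 (@cinj _ _ (yhom (sob W) (pob b)) d)).
by apply/esym; apply: pmapM.
Qed.

Hypothesis tate : forall V, is_tate (sob V).
Definition step : functor (Vectf K) (ntateel k n.+1) :=
  @Functor _ _ (Vectf K) (ntateel k n.+1)
    (fun V => exist _ (sob V) (@tate V)) smap smap1 smapM.
End IndObjects.
End ProObjects.
End Quotients.

Record step_defined : Prop := StepDefined {
  (* the (O_1 (x) b) / m_1^i are finite-dimensional over k_1, *)
  sd_fin : forall (V : Vectf K) (b : basis (sval V)) i,
    findim (bquot s b i);
  (* the transition maps of lim_i are admissible epics, *)
  sd_epi : forall (V : Vectf K) (b : basis (sval V)),
    admissible (pdiag sd_fin b);
  (* the colimit over the bases is filtered, *)
  sd_dir : forall V : Vectf K, bdirected (sval V);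
  (* with admissible monics as transition maps, *)
  sd_mono : forall V : Vectf K, admissible (@idiag sd_fin sd_epi V (sd_dir V));
  (* every K-linear map respects the filtrations, *)
  sd_bound : forall (V W : Vectf K) (f : mor V W) (b : basis (sval V)),
    exists c : basis (sval W), bmaps D (vmap f) b c;
  (* and the objects obtained have lattices *)
  sd_tate : forall V : Vectf K, is_tate (@sob sd_fin sd_epi sd_dir sd_mono V) }.

Definition step_functor (h : step_defined) :
    functor (Vectf K) (ntateel k n.+1) :=
  step (sd_bound h) (sd_tate h).
End Step.

(* [low] states that the construction for the residue field is well-defined,
   and G is the resulting functor. *)
Record sharp_step (K k1 : kfield k) (D : cdvf K k1) (s : lifting D) (n : nat)
    (low : Prop) (G : low -> functor (Vectf k1) (ntateel k n)) : Prop :=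
  SharpStep {
  ss_low : low;
  ss_step : step_defined s (fcomp (ntate_incl k n) (G ss_low)) }.

Fixpoint sharp_rec n (K : kfield k) (T : tower n K) :
    liftings T -> {P : Prop & P -> functor (Vectf K) (ntateel k n)} :=
  match T as T0 in tower n K
    return liftings T0 -> {P : Prop & P -> functor (Vectf K) (ntateel k n)} with
  | Tower0 K fin => fun _ => existT _ True (fun _ => forgetf fin)
  | TowerS n K k1 D _ T1 => fun s =>
      let low := sharp_rec s.2 in
      existT _ (sharp_step s.1 (projT2 low))
        (fun h => step_functor (ss_step h))
  end.

(* [sharp_defined] asserts that the formula for sharp makes sense at each level
   of the tower; [sharp] is the functor given by this formula.  As
   [sharp_defined] is a proposition, this functor does not depend on its proof. *)
Definition sharp_defined n (K : kfield k) (T : tower n K) (s : liftings T) :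
  Prop := projT1 (sharp_rec s).

Definition sharp n (K : kfield k) (T : tower n K) (s : liftings T)
    (h : sharp_defined s) : functor (Vectf K) (ntateel k n) :=
  projT2 (sharp_rec s) h.

End Sharp.

Section Statement.
Variables (k : fieldType) (n : nat) (K : tlf k n).

Definition EYek_hom (tau : lifting_system K) (V1 V2 : Vectf K)
    (f : mor (forget (kmap K) V1) (forget (kmap K) V2)) : Prop :=
  EYek (sval tau) ((f : {linear _ -> _}) : sval V1 -> sval V2).

Definition EYek_type (tau : lifting_system K) (V1 V2 : Vectf K) : Type :=
  {f : mor (forget (kmap K) V1) (forget (kmap K) V2) | EYek_hom tau f}.

(* The map Hom(F V1, F V2) -> Hom_k(V1, V2) given by eval, for F lifting the
   forgetful functor along eval. *)
Definition eval_hom (F : functor (Vectf K) (ntateel k n))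
    (a : natiso (fcomp (eval k n) F) (forget (kmap K))) (V1 V2 : Vectf K)
    (g : mor (F V1) (F V2)) :
    mor (forget (kmap K) V1) (forget (kmap K) V2) :=
  mcomp (nt a V2) (mcomp (fmap (eval k n) g) (ntV a V1)).
End Statement.

(* Main.v *)
(** A k-linear map V -> W is a morphism of Tate objects between the images of V
    and W under sharp, for two possibly different liftings, if and only if it
    maps every lattice L into a lattice M so that for all M' in M there is L' in
    L for which L/L' -> M/M' is defined and is a morphism of (n-1)-Tate objects.
    Indeed lattices are complete, so that sharp V evaluates to V, and eval is
    faithful on these objects, as the transition maps of the limits are
    surjective and those of the colimits are injective.  By induction on n this
    is the condition defining E^Yek, except that the k_1-structures on L/L' and
    M/M' depend on the liftings.

    This dependence is harmless because the identity of L/L', seen as a map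
    between the structures given by two continuous liftings, belongs to E^Yek:
    its matrix coefficients are continuous differential operators of k_1 over k,
    and these are bounded for the valuation of k_1, as are, recursively, the
    operators that they induce on the residue fields.  The boundedness only
    needs that the topology of Laurent series separates unbounded sequences
    from 0, and that the valuation of K agrees with that of the Laurent series
    field: the latter is determined by the field, since 1-units are infinitely
    divisible by any integer prime to the residue characteristic. *)

From HB Require Import structures.
Require Import Defs.
From mathcomp Require Import all_boot all_order all_algebra.
From mathcomp Require Import boolp classical_sets zify ring.

Set Implicit Arguments.
Unset Strict Implicit.
Unset Printing Implicit Defensive.

Import Order.TTheory GRing.Theory Num.Theory.
Local Open Scope ring_scope.

(** * Finite-dimensional spaces and presentations of evaluated objects *)

(** Exactness shapes the proof. A transition map is shown admissible by exhibiting a conflation, and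
    a conflation of pro- or ind-objects is a formal limit of conflations of the level below. The
    induction therefore has to carry that sharp preserves short exact sequences, and the diagram of
    all bases has to be compared, by cofinality, with sequences of lattices adapted to a given exact
    sequence. Squares between such diagrams are never computed. Each object is presented as a
    subquotient of a space over k, a morphism is described by the map of ambient spaces that it
    covers, and faithfulness turns equality of these maps into equality of morphisms. The ambient
    space does not see the lifting, so all liftings are treated at once and the change of liftings
    is the morphism covering the identity. Differential operators arise because the l-th digit of
    s(a) x with respect to another lifting s' is not linear in a: its commutator with a involves
    s(a) - s'(a), which is divisible by the uniformizer, and this lowers l by one. Hence the order
    is at most l. *)

Section FiniteDimension.
Variable k : fieldType.
Implicit Types U V W : lmodType k.

(** An arbitrary predicate becomes a matrix, to which row-space algebra applies: among the matrices
    with row space inside S take one of maximal rank; a further vector of S would raise the rank. *)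
Lemma submod_rowspace n (S : submod 'rV[k]_n) :
  exists A : 'M[k]_n, forall v, S v <-> (v <= A)%MS.
Proof.
pose P r := `[< exists A : 'M[k]_n,
  (forall v : 'rV_n, (v <= A)%MS -> S v) /\ \rank A = r >].
have exP : exists r, P r.
  exists 0%N; apply/asboolP; exists 0; split; last exact: mxrank0.
  by move=> v; rewrite submx0 => /eqP ->; exact: smem0.
have ubP r : P r -> (r <= n)%N.
  by move=> /asboolP[A [_ <-]]; exact: rank_leq_row.
case: (ex_maxnP exP ubP) => r /asboolP[A [AS Ar]] rmax.
exists A => v; split=> [Sv|]; last exact: AS.
apply: contrapT => vA.
have /rank_ltmx : (A < A + v)%MS.
  by rewrite ltmxE addsmxSl /= addsmx_sub submx_refl; apply/negP.
rewrite Ar ltnNge; apply/negP/negPn/rmax/asboolP.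
exists (A + v)%MS; split=> // w /sub_addsmxP[[u1 u2] /= ->].
rewrite addrC -[u1 *m A]scale1r addrC; apply: smemP; first exact/AS/submxMl.
by rewrite [u2]mx11_scalar mul_scalar_mx; exact: smemZ.
Qed.

Lemma linear_inv V W (f : {linear V -> W}) (g : W -> V) :
  cancel f g -> cancel g f -> linear g.
Proof.
by move=> fK gK a x y; rewrite -[LHS]fK -[RHS]fK gK linearP !gK.
Qed.

(** [findim] only supplies generators. The relations between them form a row space A, and a
    complement of A maps isomorphically onto V. *)
Lemma findim_coord V : findim V ->
  exists n (e : {linear V -> 'rV[k]_n}) (e' : {linear 'rV[k]_n -> V}),
    cancel e e' /\ cancel e' e.
Proof.
move=> [n [s sP]].
have pL : linear (fun c : 'rV[k]_n => \sum_i c 0 i *: s i).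
  move=> a x y; rewrite scaler_sumr -big_split; apply: eq_bigr => i _ /=.
  by rewrite !mxE scalerDl scalerA.
pose p := linmk pL.
have K0 : p 0 = 0 by exact: linear0.
have KP a x y : p x = 0 -> p y = 0 -> p (a *: x + y) = 0.
  by move=> px py; rewrite linearP px py scaler0 addr0.
have [A AP] := submod_rowspace (Submod K0 KP).
pose B := row_base (A^C)%MS.
have eL : linear (fun c : 'rV[k]_(\rank (A^C)%MS) => p (c *m B)).
  by move=> a x y; rewrite mulmxDl -scalemxAl linearP.
pose e' := linmk eL.
have e'I c : e' c = 0 -> c = 0.
  move=> /AP cA; have : (c *m B <= A :&: A^C)%MS.
    by rewrite sub_capmx cA /= (submx_trans (submxMl _ _)) ?eq_row_base.
  rewrite capmx_compl submx0 => /eqP cB0.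
  by apply: (row_free_inj (row_base_free _)); rewrite cB0 mul0mx.
have e'S x : exists c, e' c = x.
  have [c ->] := sP x; pose v := \row_i c i.
  have -> : \sum_i c i *: s i = p v.
    by apply: eq_bigr => i _; rewrite mxE.
  have /sub_addsmxP[[u1 u2] vE] : (v <= A + A^C)%MS.
    by rewrite submx_full // addsmx_compl_full.
  have /submxP[w wP] : (u2 *m A^C <= B)%MS by rewrite eq_row_base submxMl.
  exists w; rewrite [v]vE -[u1]/(u1, u2).1 (linearD p) [p (_ *m A)](_ : _ = 0).
    by rewrite add0r wP.
  exact/AP/submxMl.
have [e eP] := choice e'S.
have eK : cancel e' e.
  move=> c; apply/eqP; rewrite -subr_eq0; apply/eqP/e'I.
  by rewrite linearB eP subrr.
by exists _, (linmk (linear_inv eK eP)), e'.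
Qed.

Lemma findim_rV n : findim 'rV[k]_n.
Proof.
exists n, (delta_mx 0) => x; exists (fun i => x 0 i).
by rewrite [LHS]row_sum_delta.
Qed.

Lemma findim_surj V W (f : {linear V -> W}) :
  findim V -> (forall y, exists x, f x = y) -> findim W.
Proof.
move=> [n [s sP]] fS; exists n, (f \o s) => y; have [x <-] := fS y.
have [c ->] := sP x; exists c; rewrite linear_sum.
by apply: eq_bigr => i _; rewrite linearZ.
Qed.

Lemma linear_retraction V W (f : {linear V -> W}) : findim V -> findim W ->
  injective f -> exists r : {linear W -> V}, cancel f r.
Proof.
move=> /findim_coord[m [e [e' [eK e'K]]]] /findim_coord[n [d [d' [dK d'K]]]] fI.
have gL : linear (fun c => d (f (e' c))) by move=> a x y; rewrite !linearP.
pose A := lin1_mx (linmk gL).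
have gA c : c *m A = d (f (e' c)) by rewrite mul_rV_lin1.
have AF : row_free A.
  apply/inj_row_free => c; rewrite gA => /(congr1 d'); rewrite dK linear0 => h.
  have /(congr1 e) : e' c = 0 by apply: fI; rewrite h linear0.
  by rewrite e'K linear0.
have rL : linear (fun y => e' (d y *m pinvmx A)).
  by move=> a x y; rewrite linearP mulmxDl -scalemxAl linearP.
exists (linmk rL) => x; rewrite linmkE -[x in f x]eK -gA.
by rewrite (mulmxKp AF) eK.
Qed.

Lemma linear_section V W (f : {linear V -> W}) : findim V -> findim W ->
  (forall y, exists x, f x = y) -> exists s : {linear W -> V}, cancel s f.
Proof.
move=> /findim_coord[m [e [e' [eK e'K]]]] /findim_coord[n [d [d' [dK d'K]]]] fS.
have gL : linear (fun c => d (f (e' c))) by move=> a x y; rewrite !linearP.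
pose A := lin1_mx (linmk gL).
have gA c : c *m A = d (f (e' c)) by rewrite mul_rV_lin1.
have AF : row_full A.
  rewrite -sub1mx; apply/row_subP => i; have [x xP] := fS (d' (row i 1%:M)).
  by apply/submxP; exists (e x); rewrite gA eK xP d'K.
have sL : linear (fun y => e' (d y *m pinvmx A)).
  by move=> a x y; rewrite linearP mulmxDl -scalemxAl linearP.
exists (linmk sL) => y; rewrite linmkE -[LHS]dK -gA -mulmxA.
by rewrite (mulVpmx AF) mulmx1 dK.
Qed.

(** In coordinates the image of f is the row space of some A; every c *m A has a unique preimage in
    V, and these preimages make V a quotient of the space of rows c. *)
Lemma findim_inj V W (f : {linear V -> W}) :
  findim W -> injective f -> findim V.
Proof.
move=> /findim_coord[n [d [d' [dK d'K]]]] fI.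
pose S c := exists x, d (f x) = c.
have S0 : S 0 by exists 0; rewrite !linear0.
have SP a x y : S x -> S y -> S (a *: x + y).
  by move=> [u <-] [v <-]; exists (a *: u + v); rewrite !linearP.
have [A AP] := submod_rowspace (Submod S0 SP).
have gP c : exists x, d (f x) = c *m A by apply/AP/submxMl.
have [g gE] := choice gP.
have dfI : injective (fun x => d (f x)) by move=> x y /(can_inj dK)/fI.
have gL : linear g.
  by move=> a x y; apply: dfI; rewrite !linearP /= !gE mulmxDl -scalemxAl.
apply: (findim_surj (f := linmk gL) (findim_rV n)) => x.
have /AP/submxP[c cP] : S (d (f x)) by exists x.
by exists c; apply: dfI; rewrite linmkE gE.
Qed.

End FiniteDimension.

Lemma basis_exists (K : fieldType) (V : lmodType K) :
  findim V -> exists _ : basis V, True.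
Proof.
move=> /findim_coord[n [e [e' [eK e'K]]]].
have eE (c : 'I_n -> K) :
    e' (\row_i c i) = \sum_i c i *: e' (delta_mx 0 i).
  rewrite [X in e' X]row_sum_delta linear_sum; apply: eq_bigr => i _.
  by rewrite linearZ mxE.
suff bP x : exists! c : 'I_n -> K, x = \sum_i c i *: e' (delta_mx 0 i).
  by exists (Basis bP).
exists (fun i => e x 0 i); split.
  rewrite -eE; rewrite -[LHS]eK; congr (e' _).
  by apply/rowP => i; rewrite mxE.
by move=> c; rewrite -eE => ->; apply/funext => i; rewrite e'K mxE.
Qed.

(** * Presentations of evaluated objects and the morphisms between them *)

Section Presentations.
Variable k : fieldType.

Section Pres.
Variables (C : Defs.cat k) (F : functor C (Vect k)).

(* The vector space F x is identified, through pr, with the subquotient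
   S / N of the ambient space V; maps between such objects can then be compared
   with maps between the ambient spaces. *)
Record pres (x : C) (V : lmodType k) (S N : V -> Prop) := Pres {
  pr :> V -> F x;
  pr_S0 : S 0;
  pr_SP : forall a y z, S y -> S z -> S (a *: y + z);
  pr_lin : forall a y z, S y -> S z -> pr (a *: y + z) = a *: pr y + pr z;
  pr_surj : forall v, exists2 y, S y & pr y = v;
  pr_ker : forall y, S y -> (pr y = 0 <-> N y) }.

Lemma pr_sub (x : C) (V : lmodType k) (S N : V -> Prop) (P : pres x S N) y z :
  S y -> S z -> S (y - z) /\ P (y - z) = P y - P z.
Proof.
move=> Sy Sz; rewrite -[y - z]addrC -scaleN1r; split; first exact: (pr_SP P).
by rewrite pr_lin // scaleN1r addrC.
Qed.

Lemma pr_eq (x : C) (V : lmodType k) (S N : V -> Prop) (P : pres x S N) y z :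
  S y -> S z -> (P y = P z <-> N (y - z)).
Proof.
move=> Sy Sz; have [Syz e] := pr_sub P Sy Sz.
rewrite -(pr_ker P Syz) e; split=> [->|/eqP]; first by rewrite subrr.
by rewrite subr_eq0 => /eqP.
Qed.

Section Realize.
Variables (x y : C) (V W : lmodType k) (S N : V -> Prop) (S' N' : W -> Prop).
Variables (P : pres x S N) (Q : pres y S' N').

(** In the comments below, f is said to cover phi. The map phi is an arbitrary function, so that the
    same phi can be confronted with morphisms between objects built from different liftings. *)
Definition rz (f : mor x y) (phi : V -> W) : Prop :=
  forall v, S v -> S' (phi v) /\ fapp F f (P v) = Q (phi v).

(** Faithfulness on a single Hom set: it is established only for the objects that occur. *)
Definition faithful : Prop := forall f g : mor x y,
  (forall v, fapp F f v = fapp F g v) -> f = g.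

Lemma rz_inj f g phi : faithful -> rz f phi -> rz g phi -> f = g.
Proof.
move=> Fxy fP gP; apply: Fxy => v; have [w Sw <-] := pr_surj P v.
by rewrite (fP _ Sw).2 (gP _ Sw).2.
Qed.
End Realize.

Lemma rz1 (x : C) (V : lmodType k) (S N : V -> Prop) (P : pres x S N) :
  rz P P (idm x) id.
Proof. by move=> v Sv; rewrite fapp1. Qed.

Lemma rzM (x y z : C) (U V W : lmodType k) (S N : U -> Prop)
    (S' N' : V -> Prop) (S'' N'' : W -> Prop) (P : pres x S N)
    (Q : pres y S' N') (R : pres z S'' N'') (f : mor x y) (g : mor y z) phi psi :
  rz P Q f phi -> rz Q R g psi -> rz P R (mcomp g f) (fun v => psi (phi v)).
Proof.
move=> fP gP v Sv; have [Sfv efv] := fP v Sv; have [Sgv egv] := gP _ Sfv.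
by split=> //; rewrite fappM efv egv.
Qed.

(** The source of the isomorphisms of pro- and ind-objects below: once both directions cover the
    identity of V, nothing is left to compute. *)
Lemma rz_iso (x y : C) (V : lmodType k) (S N S' N' : V -> Prop)
    (P : pres x S N) (Q : pres y S' N') (f : mor x y) (g : mor y x) :
  faithful x x -> faithful y y -> rz P Q f id -> rz Q P g id ->
  mcomp g f = idm x /\ mcomp f g = idm y.
Proof.
move=> Fx Fy fP gP; split.
  by apply: (rz_inj Fx (rzM fP gP)); exact: rz1.
by apply: (rz_inj Fy (rzM gP fP)); exact: rz1.
Qed.
End Pres.

Section Pro.
Variables (C : Defs.cat k) (F : functor C (Vect k)).

Definition psurj (X : pro C) : Prop :=
  forall (i : ind_idx X) (v : F (X i)), exists p : plim F X, plim_val p i = v.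

(** The components of f and g at j are represented over a common stage i, where they can be compared
    because the limit maps onto F (X i). *)
Lemma pro_faithful (X Y : pro C) : psurj X ->
  (forall i j, faithful F (X i : C) (Y j : C)) -> faithful (evpro F) X Y.
Proof.
move=> sX FXY f g fg; apply: iext => j.
have [i [a [b [ea eb]]]] :=
  colim_ind2 (ival (f : indhom Y X) j) (ival (g : indhom Y X) j).
rewrite ea eb; congr cinj; apply: (FXY i j) => v.
have [p <-] := sX i v.
have := congr1 (fun q => plim_val q j) (fg p).
by rewrite /plim_val /fapp /= ea eb !pactE.
Qed.

Section Ob.
Variables (X : pro C) (V : lmodType k) (S : V -> Prop).
Variable N : ind_idx X -> V -> Prop.
Variable P : forall i, pres F (X i : C) S (N i).
Hypothesis natP : forall i j (u : ihom i j),
  rz (P j) (P i) (dmap X u : mor (X j : C) (X i : C)) id.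
Hypothesis complete : forall p : ind_idx X -> V, (forall i, S (p i)) ->
  (forall i j, ihom i j -> N i (p j - p i)) ->
  exists2 x, S x & forall i, N i (x - p i).

Fact pro_prP x : S x -> plim_set (X := X) (fun i => P i x).
Proof. by move=> Sx i j u; rewrite (natP u Sx).2. Qed.

Definition pro_pr (x : V) : plim F X :=
  if pselect (S x) is left Sx
  then submk (S := Submod (@plim0 _ _ F X) (@plimP _ _ F X)) (pro_prP Sx) else 0.

Lemma pro_prE x i : S x -> plim_val (pro_pr x) i = P i x.
Proof. by rewrite /pro_pr; case: pselect. Qed.

Lemma plim_ext (p q : plim F X) :
  (forall i, plim_val p i = plim_val q i) -> p = q.
Proof. by move=> h; apply/val_inj/functional_extensionality_dep. Qed.

Fact pro_i0 : exists _ : ind_idx X, True.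
Proof. exact: inonempty. Qed.
Fact pro_S0 : S 0.
Proof. by have [i _] := pro_i0; exact: (pr_S0 (P i)). Qed.
Fact pro_SP a y z : S y -> S z -> S (a *: y + z).
Proof. by have [i _] := pro_i0; exact: (pr_SP (P i)). Qed.
Fact pro_lin a y z : S y -> S z ->
  pro_pr (a *: y + z) = a *: pro_pr y + pro_pr z.
Proof.
move=> Sy Sz; apply: plim_ext => i.
rewrite pro_prE; last exact: pro_SP.
by rewrite (pr_lin (P i)) // -!(pro_prE i).
Qed.
Fact pro_surj v : exists2 y, S y & pro_pr y = v.
Proof.
have h i : exists y, S y /\ P i y = plim_val v i.
  by have [y Sy yv] := pr_surj (P i) (plim_val v i); exists y.
have [p pP] := choice h.
have [||x Sx xP] := complete (p := p).
- by move=> i; have [] := pP i.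
- move=> i j u; have [Si ei] := pP i; have [Sj ej] := pP j.
  apply/(pr_eq (P i)) => //; rewrite ei.
  by have := sublmP v i j u; rewrite /= -/(plim_val v j) -ej (natP u Sj).2.
exists x => //; apply: plim_ext => i; rewrite pro_prE //.
by have [Si <-] := pP i; apply/(pr_eq (P i)).
Qed.
Fact pro_ker y : S y -> (pro_pr y = 0 <-> (forall i, N i y)).
Proof.
move=> Sy; split=> [y0 i|Ny].
  by apply/(pr_ker (P i)) => //; rewrite -(pro_prE i Sy) y0.
by apply: plim_ext => i; rewrite pro_prE //; apply/(pr_ker (P i)).
Qed.
Definition pro_pres : pres (evpro F) X S (fun x => forall i, N i x) :=
  Pres (F := evpro F) (x := X) pro_S0 pro_SP pro_lin pro_surj pro_ker.

Lemma pro_psurj : psurj X.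
Proof.
move=> i v; have [y Sy <-] := pr_surj (P i) v.
by exists (pro_pr y); rewrite pro_prE.
Qed.
End Ob.

Section Mor.
Variables (X Y : pro C) (V W : lmodType k) (S : V -> Prop) (S' : W -> Prop).
Variables (N : ind_idx X -> V -> Prop) (N' : ind_idx Y -> W -> Prop).
Variable P : forall i, pres F (X i : C) S (N i).
Variable Q : forall j, pres F (Y j : C) S' (N' j).
Hypothesis natP : forall i j (u : ihom i j),
  rz (P j) (P i) (dmap X u : mor (X j : C) (X i : C)) id.
Hypothesis natQ : forall i j (u : ihom i j),
  rz (Q j) (Q i) (dmap Y u : mor (Y j : C) (Y i : C)) id.
Hypothesis cP : forall p : ind_idx X -> V, (forall i, S (p i)) ->
  (forall i j, ihom i j -> N i (p j - p i)) ->
  exists2 x, S x & forall i, N i (x - p i).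
Hypothesis cQ : forall p : ind_idx Y -> W, (forall i, S' (p i)) ->
  (forall i j, ihom i j -> N' i (p j - p i)) ->
  exists2 x, S' x & forall i, N' i (x - p i).

Variable phi : V -> W.

Lemma rz_pro (f : mor X Y) :
  (forall j, exists i (g : mor (X i : C) (Y j : C)),
    ival (f : indhom Y X) j = cinj (g : yhom (C := opc C) X (Y j) i) /\
    rz (P i) (Q j) g phi) ->
  rz (pro_pres natP cP) (pro_pres natQ cQ) f phi.
Proof.
move=> h v Sv.
have Sphi : S' (phi v).
  have [j _] := inonempty (ind_idx Y); have [i [g [_ gP]]] := h j.
  by have [] := gP v Sv.
split=> //; apply: plim_ext => j; rewrite /= pro_prE //.
have [i [g [e gP]]] := h j.
by rewrite /plim_val /fapp /= e pactE pro_prE // (gP v Sv).2.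
Qed.

Lemma rz_proP (f : mor X Y) :
  rz (pro_pres natP cP) (pro_pres natQ cQ) f phi ->
  forall j, exists i (g : mor (X i : C) (Y j : C)), rz (P i) (Q j) g phi.
Proof.
move=> fP j; have [i [g e]] := colim_ind (ival (f : indhom Y X) j).
exists i, g => v Sv; have [Sphi ephi] := fP v Sv; split=> //.
have /= := congr1 (fun q => plim_val q j) ephi.
by rewrite pro_prE // /plim_val /fapp /= e pactE pro_prE.
Qed.

(** The choices of i and g need not be coherent: morphisms covering the same phi agree by
    faithfulness, and this supplies the compatibility. *)
Lemma rz_pro_ex : (forall i j, faithful F (X i : C) (Y j : C)) ->
  (forall j, exists i (g : mor (X i : C) (Y j : C)), rz (P i) (Q j) g phi) ->
  exists f : mor X Y, rz (pro_pres natP cP) (pro_pres natQ cQ) f phi.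
Proof.
move=> FXY h.
have hfi j : exists c : colim (yhom (C := opc C) X (Y j)),
    exists i (g : mor (X i : C) (Y j : C)),
      c = cinj (g : yhom (C := opc C) X (Y j) i) /\ rz (P i) (Q j) g phi.
  by have [i [g gP]] := h j; exists (cinj (g : yhom (C := opc C) X (Y j) i)), i, g.
pose fi j := projT1 (cid (hfi j)).
have fiP j : exists i (g : mor (X i : C) (Y j : C)),
    fi j = cinj (g : yhom (C := opc C) X (Y j) i) /\ rz (P i) (Q j) g phi.
  exact: (projT2 (cid (hfi j))).
have fP : ihom_set (X := (Y : indob (opc C))) (Y := (X : indob (opc C))) fi.
  move=> j j' u; have [i [g [-> gP]]] := fiP j; have [i' [g' [-> gP']]] := fiP j'.
  rewrite preE; apply/cinj_eq; have [l [a [b _]]] := ijoin i' i.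
  exists l, a, b; apply: (rz_inj (P := P l) (Q := Q j) (phi := phi)) => //=.
    have := rzM (natP a) (rzM gP' (natQ u)).
    by congr (rz _ _ _); exact: compA.
  exact: rzM (natP b) gP.
by exists (imk fP); apply: rz_pro => j; exact: fiP.
Qed.
End Mor.
End Pro.

Section Ind.
Variables (D : Defs.cat k) (E : functor D (Vect k)).

Lemma fapp_evind (X Y : ind D) (f : mor X Y) i (v : E (X i)) :
  fapp (evind E) f (cinj (v : evdiag E X i)) = act (ival f i) v.
Proof. exact: evind_morE. Qed.

Definition iinj (Y : ind D) : Prop :=
  forall j (v : E (Y j)), cinj (v : evdiag E Y j) = 0 -> v = 0.

Lemma ind_faithful (X Y : ind D) : iinj Y ->
  (forall i j, faithful E (X i) (Y j)) -> faithful (evind E) X Y.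
Proof.
move=> sY FXY f g fg; apply: iext => i.
have [j [a [b [ea eb]]]] := colim_ind2 (ival f i) (ival g i).
rewrite ea eb; congr cinj; apply: (FXY i j) => v.
have := fg (cinj (v : evdiag E X i)).
rewrite !fapp_evind ea eb !actE => h.
have /sY : cinj (-1 *: fapp E b v + fapp E a v : evdiag E Y j) = 0.
  by rewrite -cinjP h scaleN1r addNr.
by rewrite scaleN1r addrC => /eqP; rewrite subr_eq0 => /eqP.
Qed.

Section Ob.
Variables (X : ind D) (V : lmodType k) (S : ind_idx X -> V -> Prop).
Variable N : V -> Prop.
Variable P : forall i, pres E (X i) (S i) N.
Hypothesis natP : forall i j (u : ihom i j), rz (P i) (P j) (dmap X u) id.

Definition ind_S (x : V) : Prop := exists i, S i x.

Definition ind_pr (x : V) : colim (evdiag E X) :=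
  if pselect (ind_S x) is left Sx
  then cinj (P (projT1 (cid Sx)) x : evdiag E X _) else 0.

Lemma ind_prE i x : S i x -> ind_pr x = cinj (P i x : evdiag E X i).
Proof.
move=> Sx; rewrite /ind_pr; case: pselect => [e|]; last by case; exists i.
move: (projT1 _) (projT2 (cid e)) => j Sj.
apply/cinj_eq; have [l [u [v _]]] := ijoin j i; exists l, u, v.
by rewrite /= (natP u Sj).2 (natP v Sx).2.
Qed.

Lemma ind_S2 x y : ind_S x -> ind_S y -> exists2 i, S i x & S i y.
Proof.
move=> [i Sx] [j Sy]; have [l [u [v _]]] := ijoin i j.
by exists l; [exact: (natP u Sx).1 | exact: (natP v Sy).1].
Qed.

Fact ind_S0 : ind_S 0.
Proof. by have [i _] := inonempty (ind_idx X); exists i; exact: (pr_S0 (P i)). Qed.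
Fact ind_SP a y z : ind_S y -> ind_S z -> ind_S (a *: y + z).
Proof.
by move=> Sy Sz; have [i ? ?] := ind_S2 Sy Sz; exists i; exact: (pr_SP (P i)).
Qed.
Fact ind_lin a y z : ind_S y -> ind_S z ->
  ind_pr (a *: y + z) = a *: ind_pr y + ind_pr z.
Proof.
move=> Sy Sz; have [i yi zi] := ind_S2 Sy Sz.
rewrite (ind_prE yi) (ind_prE zi) (ind_prE (pr_SP (P i) a yi zi)).
by rewrite cinjP pr_lin.
Qed.
Fact ind_surj v : exists2 y, ind_S y & ind_pr y = v.
Proof.
have [i [w ->]] := colim_ind v; have [y Sy <-] := pr_surj (P i) w.
by exists y; [exists i | rewrite (ind_prE Sy)].
Qed.
Fact ind_ker y : ind_S y -> (ind_pr y = 0 <-> N y).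
Proof.
move=> [i Sy]; rewrite (ind_prE Sy) -[0]/(czero (evdiag E X)) (czeroE (evdiag E X) i); split.
  move=> /cinj_eq[l [u [v]]]; rewrite linear0 /= (natP u Sy).2.
  by move/(pr_ker (P l)); apply; exact: (natP u Sy).1.
by move=> Ny; congr cinj; apply/(pr_ker (P i)).
Qed.
Definition ind_pres : pres (evind E) X ind_S N :=
  Pres (F := evind E) (x := X) ind_S0 ind_SP ind_lin ind_surj ind_ker.

Lemma ind_presE i x : S i x -> ind_pres x = cinj (P i x : evdiag E X i).
Proof. exact: ind_prE. Qed.

Lemma ind_iinj : iinj X.
Proof.
move=> i v; have [y Sy <-] := pr_surj (P i) v.
by rewrite -(ind_prE Sy) ind_ker; [move=> Ny; apply/(pr_ker (P i))|exists i].
Qed.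
End Ob.

Section Mor.
Variables (X Y : ind D) (V W : lmodType k).
Variables (S : ind_idx X -> V -> Prop) (S' : ind_idx Y -> W -> Prop).
Variables (N : V -> Prop) (N' : W -> Prop).
Variable P : forall i, pres E (X i) (S i) N.
Variable Q : forall j, pres E (Y j) (S' j) N'.
Hypothesis natP : forall i j (u : ihom i j), rz (P i) (P j) (dmap X u) id.
Hypothesis natQ : forall i j (u : ihom i j), rz (Q i) (Q j) (dmap Y u) id.

Variable phi : V -> W.

Lemma rz_ind (f : mor X Y) :
  (forall i, exists j (g : mor (X i) (Y j)),
    ival f i = cinj (g : yhom Y (X i) j) /\ rz (P i) (Q j) g phi) ->
  rz (ind_pres natP) (ind_pres natQ) f phi.
Proof.
move=> h v [i Sv]; have [j [g [e gP]]] := h i.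
have [Sphi egv] := gP v Sv; split; first by exists j.
rewrite (ind_presE natP Sv) (ind_presE natQ Sphi) -egv.
by rewrite fapp_evind e actE.
Qed.

(** A priori the stage containing phi v depends on v. As N' is trivial, phi v is the only element
    with its class, and that class comes from the fixed stage j; hence phi maps all of S i into S'
    j. *)
Lemma rz_indP (f : mor X Y) : (forall x, N' x -> x = 0) ->
  rz (ind_pres natP) (ind_pres natQ) f phi ->
  forall i, exists j (g : mor (X i) (Y j)), rz (P i) (Q j) g phi.
Proof.
move=> N0 fP i; have [j [g e]] := colim_ind (ival f i).
exists j, g => v Sv.
have [Sphi] := fP v (ex_intro _ i Sv).
rewrite (ind_presE natP Sv) fapp_evind e actE => ephi.
have [w Sw ew] := pr_surj (Q j) (fapp E g (P i v)).
suff -> : phi v = w by split.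
apply/eqP; rewrite -subr_eq0; apply/eqP/N0.
have Iw : ind_S S' w by exists j.
apply/(pr_eq (ind_pres natQ) Sphi Iw).
by rewrite (ind_presE natQ Sw) ew.
Qed.

Lemma rz_ind_ex : (forall i j, faithful E (X i) (Y j)) ->
  (forall i, exists j (g : mor (X i) (Y j)), rz (P i) (Q j) g phi) ->
  exists f : mor X Y, rz (ind_pres natP) (ind_pres natQ) f phi.
Proof.
move=> FXY h.
have hfi i : exists c : colim (yhom Y (X i)), exists j (g : mor (X i) (Y j)),
    c = cinj (g : yhom Y (X i) j) /\ rz (P i) (Q j) g phi.
  by have [j [g gP]] := h i; exists (cinj (g : yhom Y (X i) j)), j, g.
pose fi i := projT1 (cid (hfi i)).
have fiP i : exists j (g : mor (X i) (Y j)),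
    fi i = cinj (g : yhom Y (X i) j) /\ rz (P i) (Q j) g phi.
  exact: (projT2 (cid (hfi i))).
have fP : ihom_set (X := X) (Y := Y) fi.
  move=> i i' u; have [j [g [-> gP]]] := fiP i; have [j' [g' [-> gP']]] := fiP i'.
  rewrite preE; apply/cinj_eq; have [l [a [b _]]] := ijoin j' j.
  exists l, a, b; apply: (rz_inj (P := P i) (Q := Q l) (phi := phi)) => //=.
    exact: rzM (rzM (natP u) gP') (natQ a).
  exact: rzM gP (natQ b).
by exists (imk fP); apply: rz_ind => i; exact: fiP.
Qed.
End Mor.
End Ind.
End Presentations.

(** * Valuations and lattices *)

Section Valuation.
Variables (K k1 : fieldType) (D : cdvf K k1).
Local Notation O := (val_ge (dv D)).

Lemma val_ge_0 i : O i 0. Proof. by left. Qed.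

Lemma val_ge_le i j x : j <= i -> O i x -> O j x.
Proof. by move=> ji [->|ix]; [left|right; exact: le_trans ji ix]. Qed.

Lemma dv_one : dv D 1 = 0.
Proof.
have := dvM D (oner_neq0 K) (oner_neq0 K); rewrite mulr1 => /eqP.
by rewrite -{1}[dv D 1]addr0 => /eqP /addrI.
Qed.

Lemma dvV x : x != 0 -> dv D x^-1 = - dv D x.
Proof.
move=> x0; apply/eqP; rewrite -addr_eq0 -dvM ?invr_eq0 // mulVf //.
by rewrite dv_one.
Qed.

Lemma dvN1 : dv D (-1) = 0.
Proof.
have n0 : (-1 : K) != 0 by rewrite oppr_eq0 oner_neq0.
have := dvM D n0 n0; rewrite mulrNN mulr1 dv_one; lia.
Qed.

Lemma val_geN i x : O i x -> O i (- x).
Proof.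
move=> ix; rewrite -mulN1r -[i]add0r; apply: val_geM ix.
by right; rewrite dvN1.
Qed.

Lemma val_geB i x y : O i x -> O i y -> O i (x - y).
Proof. by move=> ix iy; apply: val_geD ix (val_geN iy). Qed.

Lemma val_ge1 : O 0 1. Proof. by right; rewrite dv_one. Qed.

Lemma val_ge_sum i n (F : 'I_n -> K) : (forall j, O i (F j)) -> O i (\sum_j F j).
Proof.
move=> h; apply: (big_ind (O i)) => [|x y|j _]; first exact: val_ge_0.
  exact: val_geD.
exact: h.
Qed.

Lemma val_ge_sep x : (forall i, O i x) -> x = 0.
Proof. by move=> h; have [//|] := h (dv D x + 1); lia. Qed.

Lemma val_ge_ex x : exists N : nat, O (- N%:Z) x.
Proof. by exists `|dv D x|%N; right; lia. Qed.

Definition unif : K := sval (cid2 (dv1 D)).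
Lemma unif_neq0 : unif != 0. Proof. by rewrite /unif; case: cid2. Qed.
Lemma dv_unif : dv D unif = 1. Proof. by rewrite /unif; case: cid2. Qed.

Lemma unifX_neq0 (z : int) : unif ^ z != 0.
Proof. exact: expfz_neq0 unif_neq0. Qed.
Lemma dv_unifX (z : int) : dv D (unif ^ z) = z.
Proof.
have h (n : nat) : dv D (unif ^+ n) = n%:Z.
  elim: n => [|n IH]; first exact: dv_one.
  rewrite exprS dvM ?unif_neq0 ?expf_neq0 ?unif_neq0 // IH dv_unif; lia.
case: z => n; first exact: h.
by rewrite NegzE -exprnN dvV ?expf_neq0 ?unif_neq0 // h.
Qed.

Lemma val_ge_unifX (z i : int) x : O i (unif ^ z * x) <-> O (i - z) x.
Proof.
split=> h.
  rewrite -[x](mulKf (unifX_neq0 z)) [i - z]addrC; apply: val_geM h.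
  by right; rewrite dvV ?unifX_neq0 // dv_unifX.
rewrite -[i](subrK z) addrC; apply: val_geM h.
by right; rewrite dv_unifX.
Qed.

Lemma unifXK (z : int) x : unif ^ z * (unif ^ (- z) * x) = x.
Proof. by rewrite mulrA -expfzDr ?unif_neq0 // subrr expr0z mul1r. Qed.

End Valuation.

Section Lattices.
Variables (K k1 : fieldType) (D : cdvf K k1).
Local Notation O := (val_ge (dv D)).

Section OneModule.
Variable V : lmodType K.
Implicit Types (b : basis V) (L M : osub D V).

Lemma osubN L x : L x -> L (- x).
Proof. by move=> Lx; rewrite -scaleN1r; apply: omemZ => //; exact/val_geN/val_ge1. Qed.
Lemma osubB L x y : L x -> L y -> L (x - y).
Proof. by move=> Lx Ly; apply: omemD => //; exact: osubN. Qed.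
Lemma osub_sum L n (F : 'I_n -> V) : (forall j, L (F j)) -> L (\sum_j F j).
Proof.
move=> h; apply: (big_ind L) => [|x y|j _]; [exact: omem0|exact: omemD|exact: h].
Qed.

Definition bco b x : 'I_(brank b) -> K := sval (cid (basisP b x)).
Arguments bco : clear implicits.
Lemma bcoE b x : x = \sum_j bco b x j *: b j.
Proof. by rewrite /bco; case: cid => c [] /=. Qed.
Lemma bco_uniq b x c : x = \sum_j c j *: b j -> bco b x = c.
Proof. by rewrite /bco; case: cid => d [] /= _ h /h. Qed.
Lemma bcoP b a x y j : bco b (a *: x + y) j = a * bco b x j + bco b y j.
Proof.
rewrite (@bco_uniq b _ (fun j => a * bco b x j + bco b y j)) //.
rewrite {1}(bcoE b x) {1}(bcoE b y) scaler_sumr -big_split; apply: eq_bigr => i _.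
by rewrite scalerDl scalerA.
Qed.
Lemma bco0 b j : bco b 0 j = 0.
Proof.
rewrite (@bco_uniq b _ (fun=> 0)) // big1 // => i _; exact: scale0r.
Qed.
Lemma bcoD b x y j : bco b (x + y) j = bco b x j + bco b y j.
Proof. by rewrite -[x]scale1r bcoP mul1r scale1r. Qed.
Lemma bcoZ b a x j : bco b (a *: x) j = a * bco b x j.
Proof. by rewrite -[a *: x]addr0 bcoP bco0 addr0. Qed.

Definition blv_set b (z : int) (x : V) : Prop := forall j, O z (bco b x j).
Fact blv0 b z : blv_set b z 0.
Proof. by move=> j; rewrite bco0; exact: val_ge_0. Qed.
Fact blvD b z x y : blv_set b z x -> blv_set b z y -> blv_set b z (x + y).
Proof. by move=> hx hy j; rewrite bcoD; exact: val_geD. Qed.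
Fact blvZ b z a x : O 0 a -> blv_set b z x -> blv_set b z (a *: x).
Proof. by move=> ha hx j; rewrite bcoZ -[z]add0r; exact: val_geM. Qed.
(* m_1^z (O_1 (x) b), also for negative z *)
Definition blv b z : osub D V := Osub (@blv0 b z) (@blvD b z) (@blvZ b z).

Lemma bspan_blv b i x : bspan D b i x <-> blv b i%:Z x.
Proof.
split=> [[c [cP e]]|h]; first by move=> j; rewrite (bco_uniq e); exact: cP.
by exists (bco b x); split => //; exact: bcoE.
Qed.

Lemma blv_le b z z' x : z' <= z -> blv b z x -> blv b z' x.
Proof. by move=> h hx j; apply: val_ge_le h (hx j). Qed.

Lemma blvZ' b z z' a x : O z a -> blv b z' x -> blv b (z + z') (a *: x).
Proof. by move=> ha hx j; rewrite bcoZ; exact: val_geM. Qed.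

Lemma blv_unifX b z z' x : blv b z (unif D ^ z' *: x) <-> blv b (z - z') x.
Proof. by split=> h j; have := h j; rewrite bcoZ => /val_ge_unifX. Qed.

Lemma blv_ex b x : exists N : nat, blv b (- N%:Z) x.
Proof.
have [N NP] := choice (fun j => val_ge_ex D (bco b x j)).
(* Here and below a sum serves as a common bound of finitely many natural numbers. *)
exists (\sum_j N j)%N => j; apply: val_ge_le (NP j).
by rewrite lerN2 lez_nat (bigD1 j) //= leq_addr.
Qed.

Lemma blv_sep b x : (forall z, blv b z x) -> x = 0.
Proof.
move=> h; rewrite (bcoE b x) big1 // => j _.
by rewrite (val_ge_sep (fun i => h i j)) scale0r.
Qed.

Lemma scale_basisP b z x : exists! c : 'I_(brank b) -> K,
  x = \sum_j c j *: (unif D ^ z *: b j).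
Proof.
exists (fun j => unif D ^ (- z) * bco b x j); split.
  rewrite {1}(bcoE b x); apply: eq_bigr => j _; rewrite scalerA.
  by rewrite mulrC unifXK.
move=> c e; apply/funext => j.
rewrite (@bco_uniq b x (fun j => unif D ^ z * c j)) ?mulrA.
  by rewrite -expfzDr ?unif_neq0 // addNr expr0z mul1r.
by rewrite {1}e; apply: eq_bigr => i _; rewrite scalerA mulrC.
Qed.
(** Rescaling turns the z-th power of m_1 times a span, also for negative z, into the span of a
    basis, the only kind of lattice that indexes the colimit in sharp. *)
Definition scale_basis b z : basis V := Basis (scale_basisP b z).
Lemma scale_blv b z i x : blv (scale_basis b z) i x <-> blv b (z + i) x.
Proof.
have e : bco b x = fun j => unif D ^ z * bco (scale_basis b z) x j.
  apply: bco_uniq; rewrite {1}(bcoE (scale_basis b z) x).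
  by apply: eq_bigr => j _; rewrite /= scalerA mulrC.
split=> h j.
  by move: (h j); rewrite e => hj; apply/val_ge_unifX; rewrite addrC addKr.
by have := h j; rewrite e => /val_ge_unifX; rewrite addrC addKr.
Qed.

(* Lattices, without the requirement of finite generation *)
Definition lat L : Prop := exists b (N : nat),
  (forall x, blv b N%:Z x -> L x) /\ (forall x, L x -> blv b (- N%:Z) x).

Lemma blv_lat b z : lat (blv b z).
Proof.
by exists b, `|z|%N; split=> x; apply: blv_le; lia.
Qed.

Lemma bspan_lat b i : lat (bspan D b i).
Proof.
exists b, i; split=> x; first by move/bspan_blv.
by move/bspan_blv; apply: blv_le; lia.
Qed.
End OneModule.
Arguments bco {V} b x _.

Lemma lin_blv (V W : lmodType K) (f : {linear V -> W}) (b : basis V) (c : basis W) :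
  exists N : nat, forall z x, blv b z x -> blv c (z - N%:Z) (f x).
Proof.
have [N NP] := choice (fun j => blv_ex c (f (b j))).
exists (\sum_j N j)%N => z x xP.
rewrite (bcoE b x) linear_sum; apply: osub_sum => j; rewrite linearZ /=.
apply: blvZ'; first exact: xP.
apply: blv_le (NP j).
by rewrite lerN2 lez_nat (bigD1 j) //= leq_addr.
Qed.

Section Bounds.
Variable V : lmodType K.
Implicit Types (b : basis V) (L M : osub D V).

Lemma lat_ub L b : lat L -> exists N : nat, forall x, L x -> blv b (- N%:Z) x.
Proof.
move=> [c [N [_ NP]]]; have [M MP] := lin_blv (idfun : {linear V -> V}) c b.
exists (N + M)%N => x /NP/MP; apply: blv_le; lia.
Qed.

Lemma lat_lb L b : lat L -> exists N : nat, forall x, blv b N%:Z x -> L x.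
Proof.
move=> [c [N [NP _]]]; have [M MP] := lin_blv (idfun : {linear V -> V}) b c.
exists (N + M)%N => x /MP h; apply: NP; apply: blv_le h; lia.
Qed.

Lemma lat_between L b (N M : nat) : (forall x, blv b N%:Z x -> L x) ->
  (forall x, L x -> blv b (- M%:Z) x) -> lat L.
Proof.
move=> h1 h2; exists b, (N + M)%N; split=> x.
  by move=> h; apply: h1; apply: blv_le h; lia.
by move=> /h2; apply: blv_le; lia.
Qed.

Lemma blv_yek b z L : (forall x, L x <-> blv b z x) -> yek_lattice L.
Proof.
move=> LP; split.
  exists (brank b), (fun j => unif D ^ z *: b j) => x; rewrite LP; split=> [h|].
    exists (fun j => unif D ^ (- z) * bco b x j); split.
      by move=> j; apply/val_ge_unifX; rewrite opprK add0r.
    rewrite {1}(bcoE b x); apply: eq_bigr => j _; rewrite scalerA.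
    by rewrite mulrC unifXK.
  move=> [c [cP e]] j; rewrite (@bco_uniq V b x (fun j => unif D ^ z * c j)).
    by apply/val_ge_unifX; rewrite subrr.
  by rewrite {1}e; apply: eq_bigr => i _; rewrite scalerA mulrC.
move=> x; have [N xN] := blv_ex b x.
exists 1%N, (fun=> unif D ^ (- N%:Z - z)), (fun=> unif D ^ (z + N%:Z) *: x).
split; first by move=> _; apply/LP/blv_unifX; apply: blv_le xN; lia.
rewrite big_ord1 scalerA -expfzDr ?unif_neq0 //.
by rewrite [_ + _](_ : _ = 0) ?expr0z ?scale1r //; lia.
Qed.

Lemma bspan_yek b i : yek_lattice (bspan D b i).
Proof. by apply: (@blv_yek b i%:Z) => x; exact: bspan_blv. Qed.

(** Finitely many generators bound L from above; K L = V puts a multiple of each basis vector into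
    L, which bounds it from below. *)
Lemma yek_lat L : findim V -> yek_lattice L -> lat L.
Proof.
move=> /basis_exists[b _] [[r [s sP]] gen].
have [N NP] := choice (fun j => blv_ex b (s j)).
have lowj j : exists M : nat, L (unif D ^ M%:Z *: b j).
  have [m [c [y [yL ->]]]] := gen (b j).
  have [M MP] := choice (fun i => val_ge_ex D (c i)).
  exists (\sum_i M i)%N; rewrite scaler_sumr; apply: osub_sum => i.
  rewrite scalerA; apply: omemZ => //; apply/val_ge_unifX.
  apply: val_ge_le (MP i).
  by rewrite sub0r lerN2 lez_nat (bigD1 i) //= leq_addr.
have [M MP] := choice lowj.
apply: (@lat_between L b (\sum_j M j) (\sum_j N j)) => x.
  move=> h; rewrite (bcoE b x); apply: osub_sum => j.
  rewrite -[bco b x j](unifXK D (M j)%:Z) mulrC -scalerA; apply: omemZ (MP j).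
  apply/val_ge_unifX; rewrite opprK add0r; apply: val_ge_le (h j).
  by rewrite lez_nat (bigD1 j) //= leq_addr.
move=> /sP[c [cP ->]]; apply: osub_sum => j; apply: omemZ => //.
apply: blv_le (NP j); by rewrite lerN2 lez_nat (bigD1 j) //= leq_addr.
Qed.
End Bounds.
End Lattices.
Arguments bco {K V} b x _.

Lemma withinB (k : fieldType) (V : lmodType k) (S S' : submod V) (x y : sublm S) :
  within S S' (x - y) <-> S' (val x - val y).
Proof. by rewrite /= /within_set raddfB. Qed.

(** * Quotients of lattices as vector spaces over the residue field *)

Section Quotients.
Variables (k : fieldType) (K k1 : kfield k) (D : cdvf K k1) (s : lifting D).
Local Notation O := (val_ge (dv D)).

Section One.
Variables (V : lmodType K) (L L' : osub D V).

(** Total on V, so that elements of V can be used without membership proofs; outside L the value is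
    the class of 0. *)
Definition cls (x : V) : oquot s L L' :=
  qpi (within (osubmod s L) (osubmod s L'))
    (insubd (0 : sublm (osubmod s L)) (x : restr s V)).

Lemma val_insubd_osub x : L x -> val (insubd (0 : sublm (osubmod s L)) (x : restr s V)) = x.
Proof. by move=> Lx; rewrite insubdK //; apply/asboolP. Qed.

Lemma cls_eq x y : L x -> L y -> (cls x = cls y <-> L' (x - y)).
Proof.
move=> Lx Ly; rewrite /cls.
apply: (iff_trans (qpi_eq _ _ _)); apply: (iff_trans (withinB _ _ _)).
by rewrite !val_insubd_osub.
Qed.

Lemma cls_lin a x y : L x -> L y -> cls (s a *: x + y) = a *: cls x + cls y.
Proof.
move=> Lx Ly; rewrite /cls -qpi_linear; congr (qpi _ _); apply: val_inj.
rewrite /= !val_insubd_osub //.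
by apply: omemD => //; apply: omemZ => //; exact: lift_int.
Qed.

Lemma clsZ a x : L x -> cls (s a *: x) = a *: cls x.
Proof.
move=> Lx; have cls0 : cls 0 = 0.
  have := cls_lin (-1) (omem0 L) (omem0 L).
  by rewrite scaler0 addr0 scaleN1r addNr.
by rewrite -[s a *: x]addr0 cls_lin ?cls0 ?addr0 //; exact: omem0.
Qed.

Lemma clsD x y : L x -> L y -> cls (x + y) = cls x + cls y.
Proof. by move=> Lx Ly; have := cls_lin 1 Lx Ly; rewrite rmorph1 !scale1r. Qed.

Lemma cls0 : cls 0 = 0.
Proof. by have := clsZ 0 (omem0 L); rewrite scaler0 scale0r. Qed.

Lemma cls_ker x : L x -> (cls x = 0 <-> L' x).
Proof. by move=> Lx; rewrite -cls0 (cls_eq Lx (omem0 L)) subr0. Qed.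

Lemma cls_qrep (q : oquot s L L') : L (val (qrep q)) /\ cls (val (qrep q)) = q.
Proof.
have Lq : L (val (qrep q)) := sublmP (qrep q).
split=> //; rewrite -[RHS]qpiK /cls; congr (qpi _ _); apply: val_inj.
by rewrite val_insubd_osub.
Qed.

Lemma cls_surj (q : oquot s L L') : exists2 x, L x & cls x = q.
Proof. by have [Lq e] := cls_qrep q; exists (val (qrep q)). Qed.

Lemma cls_sum n (F : 'I_n -> V) : (forall j, L (F j)) ->
  cls (\sum_j F j) = \sum_j cls (F j).
Proof.
move=> FL; have [] : L (\sum_j F j) /\ cls (\sum_j F j) = \sum_j cls (F j).
  apply: (big_ind2 (fun x q => L x /\ cls x = q)) => [|x p y q [Lx <-] [Ly <-]|j _].
  - by split; [exact: omem0|exact: cls0].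
  - by split; [exact: omemD|exact: clsD].
  - by split.
by [].
Qed.

Lemma cls_lift (A : lmodType k1) (p : V -> A) :
  (forall a x y, L x -> L y -> p (s a *: x + y) = a *: p x + p y) ->
  (forall x, L x -> L' x -> p x = 0) ->
  exists h : {linear oquot s L L' -> A}, forall x, L x -> h (cls x) = p x.
Proof.
move=> pL p0; pose h (q : oquot s L L') : A := p (val (qrep q)).
have hE x : L x -> h (cls x) = p x.
  move=> Lx; have [Ly /(cls_eq Ly Lx) xy] := cls_qrep (cls x); rewrite /h.
  move: (val _) Ly xy => y Ly xy; apply/eqP; rewrite -subr_eq0; apply/eqP.
  have Lxy := osubB Ly Lx.
  have := p0 _ Lxy xy; have := pL (-1) x y Lx Ly.
  by rewrite rmorphN1 !scaleN1r [_ + y]addrC [_ + p y]addrC => <-.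
have hL : linear h.
  move=> a q r; have [x Lx <-] := cls_surj q; have [y Ly <-] := cls_surj r.
  rewrite -cls_lin // !hE ?pL //; apply: omemD => //; apply: omemZ => //.
  exact: lift_int.
by exists (linmk hL).
Qed.
End One.

Section Two.
Variables (V W : lmodType K) (L L' : osub D V) (M M' : osub D W).

Lemma cls_map (f : V -> W) :
  (forall a x y, L x -> L y -> f (s a *: x + y) = s a *: f x + f y) ->
  (forall x, L x -> M (f x)) -> (forall x, L x -> L' x -> M' (f x)) ->
  exists h : {linear oquot s L L' -> oquot s M M'},
    forall x, L x -> h (cls L L' x) = cls M M' (f x).
Proof.
move=> fL fM fM'; apply: (cls_lift (p := fun x => cls M M' (f x))) => [a x y Lx Ly|x Lx L'x].
  by rewrite fL // cls_lin //; exact: fM.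
by apply/cls_ker; [exact: fM|exact: fM'].
Qed.

End Two.

Section Funs.
Variables (V W : lmodType K) (L L' : osub D V) (M M' : osub D W).

Lemma oquot_funE (f : V -> W) x :
  (forall x y, f (x - y) = f x - f y) ->
  (forall x, L x -> M (f x)) -> (forall x, L x -> L' x -> M' (f x)) ->
  L x -> @oquot_fun k K k1 D s V W L L' M M' f (cls L L' x) = cls M M' (f x).
Proof.
move=> fB fM fM' Lx; have [Ly e] := cls_qrep (cls L L' x).
apply/cls_eq; [exact: fM|exact: fM|rewrite -fB; apply: fM'].
  exact: osubB.
exact/(cls_eq L' Ly Lx).
Qed.
End Funs.

Section Findim.
Variable V : lmodType K.

(** The expansion in powers of the uniformizer with lifted residues as digits. The next digit is the
    residue of the remainder divided by the N-th power. *)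
Lemma val_ge_expand (N : nat) (x : K) : O 0 x -> exists c : 'I_N -> k1,
  O N%:Z (x - \sum_i s (c i) * unif D ^+ i).
Proof.
elim: N x => [|N IH] x x0; first by exists (fun=> 0); rewrite big_ord0 subr0.
have [c cP] := IH x x0.
set y := x - _ in cP.
have yO : O 0 (unif D ^ (- N%:Z) * y) by apply/val_ge_unifX; rewrite opprK add0r.
pose a := dres D (unif D ^ (- N%:Z) * y).
exists (fun i => if unlift ord_max i is Some j then c j else a).
rewrite big_ord_recr /= unlift_none.
rewrite (eq_bigr (fun i : 'I_N => s (c i) * unif D ^+ i)); last first.
  move=> i _; rewrite (_ : widen_ord _ i = lift ord_max i) ?liftK //.
  by apply: val_inj; rewrite /= /bump leqNgt ltn_ord.
rewrite opprD addrA -/y.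
have -> : y - s a * unif D ^+ N = unif D ^ N%:Z * (unif D ^ (- N%:Z) * y - s a).
  by rewrite mulrBr unifXK [_ * s a]mulrC.
apply/val_ge_unifX; rewrite [_ - _](_ : _ = 1); last by lia.
have sO := lift_int s a.
apply/dres_ker; first exact: val_geB.
have := dresD yO (val_geN sO); rewrite -/a => ->.
have := dresD sO (val_geN sO); rewrite subrr lift_res => e.
have d0 : dres D 0 = 0 by apply/dres_ker; [exact: val_ge_0|exact: val_ge_0].
by rewrite -e d0.
Qed.

Lemma oquot_mono (L L' M M' : osub D V) :
  (forall x, L x -> M x) -> (forall x, L x -> (L' x <-> M' x)) ->
  exists2 h : {linear oquot s L L' -> oquot s M M'}, injective h &
    forall x, L x -> h (cls L L' x) = cls M M' x.
Proof.
move=> LM LM'; have [||h hE] := @cls_map V V L L' M M' id _ LM.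
- by [].
- by move=> x Lx /LM'; exact.
exists h => // p q; have [x Lx <-] := cls_surj p; have [y Ly <-] := cls_surj q.
rewrite !hE // => /(cls_eq _ (LM _ Lx) (LM _ Ly)) xy; apply/cls_eq => //.
by apply/LM' => //; exact: osubB.
Qed.

Lemma oquot_epi (L L' M' : osub D V) : (forall x, L x -> L' x -> M' x) ->
  exists2 h : {linear oquot s L L' -> oquot s L M'},
    (forall q, exists p, h p = q) &
    forall x, L x -> h (cls L L' x) = cls L M' x.
Proof.
move=> LM'; have [//|//|//|h hE] := @cls_map V V L L' L M' id.
exists h => // q; have [x Lx <-] := cls_surj q.
by exists (cls L L' x); rewrite hE.
Qed.

Lemma findim_blv (b : basis V) (z : int) (N : nat) :
  findim (oquot s (blv D b z) (blv D b (z + N%:Z))).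
Proof.
pose J := ('I_(brank b) * 'I_N)%type.
pose t (p : J) : V := (unif D ^ z * unif D ^+ p.2) *: b p.1.
have tL p : blv D b z (t p).
  move=> j; rewrite /t bcoZ -mulrA; apply/val_ge_unifX; rewrite subrr.
  rewrite -[0]add0r; apply: val_geM.
    by apply: (@val_ge_le _ _ _ p.2%:Z) => //; right; rewrite (dv_unifX D p.2).
  rewrite (@bco_uniq _ _ b (b p.1) (fun i => (i == p.1)%:R)); last first.
    rewrite (bigD1 p.1) //= eqxx scale1r big1 ?addr0 // => i /negbTE ->.
    by rewrite scale0r.
  by case: eqP => _; [exact: val_ge1|exact: val_ge_0].
exists #|{: J}|, (fun i => cls (blv D b z) (blv D b (z + N%:Z)) (t (enum_val i))) => q.
have [x Lx <-] := cls_surj q.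
have xO j : O 0 (unif D ^ (- z) * bco b x j).
  by apply/val_ge_unifX; rewrite opprK add0r; exact: Lx.
have [c cP] := choice (fun j => val_ge_expand N (xO j)).
exists (fun i => c (enum_val i).1 (enum_val i).2).
transitivity (cls (blv D b z) (blv D b (z + N%:Z))
    (\sum_(i < #|{: J}|) s (c (enum_val i).1 (enum_val i).2) *: t (enum_val i))).
  apply/cls_eq => //.
    by apply: osub_sum => i; apply: omemZ (tL _); exact: lift_int.
  rewrite -(big_enum_val (fun p : J => s (c p.1 p.2) *: t p)) /=.
  rewrite -(pair_bigA_idem _ (fun j i => s (c j i) *: t (j, i))) /=; last by rewrite addr0.
  rewrite {1}(bcoE b x) -sumrB -[blv_set D b (z + N%:Z)]/(omem (blv D b (z + N%:Z))); apply: osub_sum => j.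
  rewrite [_ - _](_ : _ = (unif D ^ z * (unif D ^ (- z) * bco b x j
      - \sum_i s (c j i) * unif D ^+ i)) *: b j); last first.
    rewrite mulrBr unifXK scalerBl; congr (_ - _).
    rewrite mulr_sumr scaler_suml; apply: eq_bigr => i _.
    by rewrite /t /= scalerA mulrCA.
  rewrite -[_ + N%:Z]addr0; apply: blvZ'.
    by apply/val_ge_unifX; rewrite addrC addKr; exact: cP.
  move=> i; rewrite (@bco_uniq _ _ b (b j) (fun i => (i == j)%:R)); last first.
    rewrite (bigD1 j) //= eqxx scale1r big1 ?addr0 // => l /negbTE ->.
    by rewrite scale0r.
  by case: eqP => _; [exact: val_ge1|exact: val_ge_0].
rewrite cls_sum => [|i]; last by apply: omemZ (tL _); exact: lift_int.
by apply: eq_bigr => i _; exact: clsZ.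
Qed.

(** L/L' is a quotient of L/B, which embeds into a quotient of two multiples of one span, where the
    digit expansion gives explicit generators. *)
Lemma findim_oquot (L L' : osub D V) : lat L -> lat L' -> findim (oquot s L L').
Proof.
move=> [b [N [_ LN]]] /(lat_lb b)[M ML'].
pose B := blv D b (- N%:Z + (N + M)%:Z).
have [|h h_inj _] := @oquot_mono L B (blv D b (- N%:Z)) B LN; first by [].
have [|h' h'S _] := @oquot_epi L B L'.
  by move=> x Lx xB; apply: ML'; apply: blv_le xB; lia.
exact: (findim_surj (f := h') (findim_inj (findim_blv _ _ _) h_inj) h'S).
Qed.
End Findim.
End Quotients.

Local Notation ofun s L L' M M' f := (@oquot_fun _ _ _ _ s _ _ L L' M M' f).

(** * Composition in E^Yek *)

Section KLinear.
Variable k : fieldType.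

Definition klin (K : kfield k) (V W : lmodType K) (f : V -> W) : Prop :=
  forall a x y, f (kmap K a *: x + y) = kmap K a *: f x + f y.

Section Basics.
Variables (K : kfield k) (U V W : lmodType K).

Lemma klin_linear (f : {linear V -> W}) : klin f.
Proof. by move=> a x y; rewrite linearP. Qed.

Lemma klin_comp (g : V -> W) (f : U -> V) : klin g -> klin f -> klin (g \o f).
Proof. by move=> gL fL a x y; rewrite /= fL gL. Qed.

Lemma klinB (f : V -> W) x y : klin f -> f (x - y) = f x - f y.
Proof.
move=> fL; rewrite -scaleN1r -(rmorphN1 (kmap K)) addrC fL.
by rewrite rmorphN1 scaleN1r addrC.
Qed.

Lemma klinD (f : V -> W) x y : klin f -> f (x + y) = f x + f y.
Proof. by move=> fL; have := fL 1 x y; rewrite rmorph1 !scale1r. Qed.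

Lemma klin0 (f : V -> W) : klin f -> f 0 = 0.
Proof. by move=> fL; rewrite -(subrr 0) klinB // subrr. Qed.

Lemma klin_sum (f : V -> W) n (F : 'I_n -> V) : klin f ->
  f (\sum_i F i) = \sum_i f (F i).
Proof.
move=> fL; apply: (big_morph f (fun x y => klinD x y fL)); exact: klin0.
Qed.
End Basics.

Section OneStep.
Variables (K k1 : kfield k) (D : cdvf K k1).

Section Induced.
Variables (s : lifting D) (V W : lmodType K).
Variables (L L' : osub D V) (M M' : osub D W) (f : V -> W).
Hypothesis fL : klin f.
Hypothesis fM : forall x, L x -> M (f x).
Hypothesis fM' : forall x, L x -> L' x -> M' (f x).

Lemma oquot_fun_cls x : L x ->
  @oquot_fun k K k1 D s V W L L' M M' f (cls s L L' x) = cls s M M' (f x).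
Proof. by move=> Lx; apply: oquot_funE => // y z; exact: klinB. Qed.

Lemma cls_kmap (X : lmodType K) (A A' : osub D X) a x y : A x -> A y ->
  cls s A A' (kmap K a *: x + y) = kmap k1 a *: cls s A A' x + cls s A A' y.
Proof. by move=> Ax Ay; rewrite -(lift_kmap s) cls_lin. Qed.

Lemma osub_kmap (X : lmodType K) (A : osub D X) a x : A x -> A (kmap K a *: x).
Proof. by move=> Ax; apply: omemZ => //; rewrite -(lift_kmap s); exact: lift_int. Qed.

Lemma oquot_fun_klin : klin (@oquot_fun k K k1 D s V W L L' M M' f).
Proof.
move=> a p q; have [x Lx <-] := cls_surj p; have [y Ly <-] := cls_surj q.
rewrite -cls_kmap // !oquot_fun_cls ?fL ?cls_kmap //; try exact: fM.
by apply: omemD => //; exact: osub_kmap.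
Qed.
End Induced.

Section Sandwich.
Variable s : lifting D.
Variable E : forall V W : lmodType k1, (V -> W) -> Prop.
Hypothesis Elin : forall (V W : lmodType k1) (f : {linear V -> W}),
  findim V -> findim W -> E f.
Hypothesis Ecomp : forall (U V W : lmodType k1) (f : U -> V) (g : V -> W),
  findim U -> findim V -> findim W -> klin f -> klin g ->
  E f -> E g -> E (g \o f).

(** The map L/L' → M/M' is the map A/A' → B/B' composed with k_1-linear maps: a section of L/A' →
    L/L', maps induced by inclusions, and a retraction of the embedding M/M' → B/M'. So a condition
    over all admissible pairs of lattices can be checked on one pair that is large enough. *)
Lemma sandwich (V W : lmodType K) (f : V -> W) (A A' L L' : osub D V)
    (B B' M M' : osub D W) : klin f ->
  [/\ lat A, lat A', lat L & lat L'] -> [/\ lat B, lat B', lat M & lat M'] ->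
  (forall x, A x -> B (f x)) -> (forall x, A x -> A' x -> B' (f x)) ->
  (forall x, L x -> M (f x)) -> (forall x, L x -> L' x -> M' (f x)) ->
  (forall x, L x -> A x) -> (forall x, L x -> A' x -> L' x) ->
  (forall x, M x -> B x) -> (forall x, B x -> B' x -> M' x) ->
  E (@oquot_fun k K k1 D s V W A A' B B' f) ->
  E (@oquot_fun k K k1 D s V W L L' M M' f).
Proof.
move=> fL [lA lA' lL lL'] [lB lB' lM lM'] fAB fAB' fLM fLM' LA A'L' MB B'M' EF.
have fd := findim_oquot s.
have [//|h1 _ h1E] := @oquot_mono k K k1 D s V L A' A A' LA.
have [h2 h2S h2E] := @oquot_epi k K k1 D s V L A' L' A'L'.
have [s2 s2K] := linear_section (fd _ _ _ lL lA') (fd _ _ _ lL lL') h2S.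
have [h3 _ h3E] := @oquot_epi k K k1 D s W B B' M' B'M'.
have [//|h4 h4I h4E] := @oquot_mono k K k1 D s W M M' B M' MB.
have [r rK] := linear_retraction (fd _ _ _ lM lM') (fd _ _ _ lB lM') h4I.
set F := ofun s A A' B B' f in EF.
have FL : klin F by exact: oquot_fun_klin.
rewrite (_ : ofun s L L' M M' f = r \o (h3 \o (F \o (h1 \o s2)))); last first.
  apply/funext => q; have [x Lx <-] := cls_surj q.
  rewrite oquot_fun_cls //=.
  have [y Ly ye] := cls_surj (s2 (cls s L L' x)).
  rewrite -ye h1E // /F oquot_fun_cls //; last exact: LA.
  rewrite h3E; last exact/fAB/LA.
  have : h2 (s2 (cls s L L' x)) = cls s L L' x by exact: s2K.
  rewrite -ye h2E // => /(cls_eq _ _ Ly Lx) yx.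
  rewrite -h4E; last exact: fLM.
  rewrite rK; apply/cls_eq; [exact: fLM|exact: fLM|].
  rewrite -opprB; apply: osubN; rewrite -klinB //; apply: fLM' => //.
  exact: osubB.
have k2 : klin s2 by exact: klin_linear.
have k12 : klin (h1 \o s2) by apply: klin_comp => //; exact: klin_linear.
have kF : klin (F \o (h1 \o s2)) by exact: klin_comp.
have k3 : klin (h3 \o (F \o (h1 \o s2))).
  by apply: klin_comp => //; exact: klin_linear.
have fLL := fd _ _ _ lL lL'; have fLA := fd _ _ _ lL lA'.
have fAA := fd _ _ _ lA lA'; have fBB := fd _ _ _ lB lB'.
have fBM := fd _ _ _ lB lM'; have fMM := fd _ _ _ lM lM'.
have E1 : E (h1 \o s2).
  exact: (Ecomp fLL fLA fAA k2 (klin_linear h1) (Elin s2 fLL fLA) (Elin h1 fLA fAA)).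
have E2 : E (F \o (h1 \o s2)) by exact: (Ecomp fLL fAA fBB k12 FL E1 EF).
have E3 : E (h3 \o (F \o (h1 \o s2))).
  exact: (Ecomp fLL fBB fBM kF (klin_linear h3) E2 (Elin h3 fBB fBM)).
exact: (Ecomp fLL fBM fMM k3 (klin_linear r) E3 (Elin r fBM fMM)).
Qed.
End Sandwich.
End OneStep.

Lemma small_bspan (K k1 : fieldType) (D : cdvf K k1) (V : lmodType K)
  (L : osub D V) (b : basis V) : lat L ->
  exists N, forall i, (N <= i)%N -> forall x, bspan D b i x -> L x.
Proof.
move=> /(lat_lb b)[N NP]; exists N => i Ni x /bspan_blv h; apply: NP.
by apply: blv_le h; lia.
Qed.

Lemma big_blv (K k1 : fieldType) (D : cdvf K k1) (V : lmodType K)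
  (L : osub D V) (b : basis V) : lat L ->
  exists N : nat, forall i : nat, (N <= i)%N -> forall x, L x -> blv D b (- i%:Z) x.
Proof.
move=> /(lat_ub b)[N NP]; exists N => i Ni x /NP; apply: blv_le; lia.
Qed.

(** Both claims are proved in one induction because [sandwich], used for compositions, needs both of
    them over the residue field. *)
Lemma EYek_lin_comp n (K : kfield k) (T : tower n K) (s : liftings T) :
  (forall (V W : lmodType K) (f : {linear V -> W}),
     findim V -> findim W -> EYek s f) /\
  (forall (U V W : lmodType K) (f : U -> V) (g : V -> W),
     findim U -> findim V -> findim W -> klin f -> klin g ->
     EYek s f -> EYek s g -> EYek s (g \o f)).
Proof.
elim: T s => {n K} [K fin|n K k1 D e T1 IH] s; first by split.
have [Elin Ecomp] := IH s.2; split.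
  move=> V W f fV fW L1 L2 yL1 yL2 good.
  have [lL1 lL2] := (yek_lat fV yL1, yek_lat fW yL2).
  have [b _] := basis_exists fV; have [c _] := basis_exists fW.
  have [N NP] := lin_blv D f b c.
  split.
    have [i1 i1P] := small_bspan b lL1; have [N1 N1P] := lat_ub b lL1.
    have [N2 N2P] := lat_lb c lL2; have [N3 N3P] := lat_ub c lL2.
    exists (bspan D b (i1 + N + N2)), (blv D c (- (N1 + N3 + N)%:Z)); split.
    - by split; [exact: bspan_yek|apply: (@blv_yek _ _ D W c (- (N1 + N3 + N)%:Z))].
    - split; first by apply: i1P; lia.
      by move=> x /N3P; apply: blv_le; lia.
    - by move=> x /bspan_blv /NP h; apply: N2P; apply: blv_le h; lia.
    - by move=> x /N1P /NP; apply: blv_le; lia.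
  move=> L1' L2' [[yL1' yL2'] [L1'L1 L2L2'] fL1' fL1].
  have [lL1' lL2'] := (yek_lat fV yL1', yek_lat fW yL2').
  have [a x y Lx Ly|||h hE] := @cls_map k K k1 D s.1 V W L1 L1' L2' L2 f.
  - exact: linearP.
  - exact: fL1.
  - by move=> x _; exact: fL1'.
  rewrite (_ : ofun s.1 L1 L1' L2' L2 f = h); first by apply: Elin; exact: findim_oquot.
  apply/funext => q; have [x Lx <-] := cls_surj q; rewrite hE //.
  apply: oquot_fun_cls => //; first exact: klin_linear.
  by move=> y _; exact: fL1'.
move=> U V W f g fU fV fW fL gL Ef Eg L1 L3 yL1 yL3 good.
have [lL1 lL3] := (yek_lat fU yL1, yek_lat fW yL3).
have [a _] := basis_exists fU; have [b _] := basis_exists fV.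
have [c _] := basis_exists fW.
(* The target [bspan D b 0] is an arbitrary choice: only some A2 containing f(L1) is wanted. *)
have [[_ [A2 [[_ yA2] _ _ fA2]]] _] := Ef L1 (bspan D b 0) yL1 (bspan_yek _ _ _).
have [[A2' [A3 [[yA2' yA3] [A2'A2 L3A3] gA2' gA2]]] Eg'] := Eg A2 L3 yA2 yL3.
have [[L1a [_ [[yL1a _] [L1aL1 _] fL1a _]]] Ef'] := Ef L1 A2' yL1 yA2'.
split.
  exists L1a, A3; split => //; first by move=> x /fL1a/gA2'.
  by move=> x /fA2/gA2.
move=> L1' L3' [[yL1' yL3'] [L1'L1 L3L3'] fL1' fL1].
have [lL1' lL3'] := (yek_lat fU yL1', yek_lat fW yL3').
have [i1 i1P] := small_bspan a (yek_lat fU yL1a).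
have [i2 i2P] := small_bspan a lL1'.
(* A1 lies in L1a and in the given L1', and B3 contains A3 and the given L3'. The map L1/A1 → B3/L3
   then factors through A2/A2', and [sandwich] returns from it to L1/L1' → L3'/L3. *)
pose A1 := bspan D a (i1 + i2).
have [j1 j1P] := big_blv c (yek_lat fW yA3).
have [j2 j2P] := big_blv c lL3'.
pose B3 := blv D c (- (j1 + j2)%:Z).
have yB3 : yek_lattice B3 by apply: (@blv_yek _ _ D W c (- (j1 + j2)%:Z)).
have A1L1a x : A1 x -> L1a x by apply: i1P; lia.
have A1L1' x : A1 x -> L1' x by apply: i2P; lia.
have A3B3 x : A3 x -> B3 x by apply: j1P; lia.
have L3'B3 x : L3' x -> B3 x by apply: j2P; lia.
have lA1 : lat A1 by exact: bspan_lat.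
have lB3 : lat B3 by exact: blv_lat.
have lA2 := yek_lat fV yA2; have lA2' := yek_lat fV yA2'.
have A1L1 x : A1 x -> L1 x by move/A1L1a/L1aL1.
have L3B3 x : L3 x -> B3 x by move/L3A3/A3B3.
have fA1 x : A1 x -> A2' (f x) by move/A1L1a/fL1a.
have gB3 x : A2 x -> B3 (g x) by move/gA2/A3B3.
apply: (sandwich Elin Ecomp (A := L1) (A' := A1) (B := B3) (B' := L3)) => //.
- exact: klin_comp.
- by move=> x /fA2/gB3.
- by move=> x _ /fA1/gA2'.
- by move=> x _; exact: fL1'.
- by move=> x _ /A1L1'.
have EF : EYek s.2 (ofun s.1 L1 A1 A2 A2' f).
  by apply: Ef'; split=> //; split=> //; exact: bspan_yek.
have EG : EYek s.2 (ofun s.1 A2 A2' B3 L3 g) by exact: Eg'.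
rewrite (_ : ofun s.1 L1 A1 B3 L3 (g \o f) =
  ofun s.1 A2 A2' B3 L3 g \o ofun s.1 L1 A1 A2 A2' f); last first.
  apply/funext => q; have [x Lx <-] := cls_surj q.
  rewrite oquot_fun_cls //=; first last.
  - by move=> y _ /fA1/gA2'.
  - by move=> y /fA2/gB3.
  - exact: klin_comp.
  by rewrite !oquot_fun_cls //; [move=> y _; exact: gA2'|exact: fA2|move=> y _; exact: fA1].
apply: Ecomp => //; try exact: findim_oquot; apply: oquot_fun_klin => //.
  by move=> y _; exact: fA1.
by move=> y _; exact: gA2'.
Qed.
End KLinear.

(** * Continuous differential operators *)

Section Continuous.
Variable k : fieldType.
Implicit Types K : kfield k.

Definition fklin K1 K2 (p : K1 -> K2) : Prop :=
  forall a x y, p (kmap K1 a * x + y) = kmap K2 a * p x + p y.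

Lemma fklin0 K1 K2 (p : K1 -> K2) : fklin p -> p 0 = 0.
Proof.
move=> pL; have := pL (-1) 0 0; rewrite (_ : _ * 0 + 0 = 0); last by ring.
by rewrite rmorphN1 mulN1r addNr.
Qed.

Section Maps.
Variables (K1 K2 : kfield k) (T1 : set (set K1)) (T2 : set (set K2)).

Definition ccl (p : K1 -> K2) : Prop :=
  fklin p /\ forall U, T2 U -> T1 (fun x => U (p x)).

Hypothesis ST1 : ST_ring (kmap K1) T1.
Hypothesis ST2 : ST_ring (kmap K2) T2.

Lemma ksub_pre (p : K1 -> K2) U : fklin p -> ksub (kmap K2) U ->
  ksub (kmap K1) (fun x => U (p x)).
Proof.
move=> pL [U0 UP]; split; first by rewrite fklin0.
by move=> c x y Ux Uy; rewrite pL; exact: UP.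
Qed.

Lemma ccl_add p q : ccl p -> ccl q -> ccl (fun x => p x + q x).
Proof.
move=> [pL pC] [qL qC].
have pqL : fklin (fun x => p x + q x).
  by move=> a x y; rewrite pL qL; ring.
split=> // U TU; have [lin1 top1 cap1 sup1] := ST1.1.
have [U0 UP] : ksub (kmap K2) U by have [h _ _ _] := ST2.1; exact: h.
apply: (sup1 _ _ (cap1 _ _ (pC U TU) (qC U TU))); first exact: ksub_pre.
by move=> x [/= Up Uq]; have := UP 1 _ _ Up Uq; rewrite rmorph1 mul1r.
Qed.

Lemma ccl_mul c p : ccl p -> ccl (fun x => c * p x).
Proof.
move=> [pL pC]; split; first by move=> a x y; rewrite pL; ring.
by move=> U TU; apply: (pC (fun x => U (c * x))); have [] := ST2.2 c U TU.
Qed.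

Lemma ccl_premul c p : ccl p -> ccl (fun x => p (c * x)).
Proof.
move=> [pL pC]; split; first by move=> a x y; rewrite -pL; congr p; ring.
move=> U TU; have [h _] := ST1.2 c _ (pC U TU); exact: h.
Qed.

Lemma ccl0 : ccl (fun=> 0).
Proof.
have [lin1 top1 _ sup1] := ST1.1; split; first by move=> a x y; rewrite mulr0 addr0.
move=> U TU; have [U0 _] : ksub (kmap K2) U by have [h _ _ _] := ST2.1; exact: h.
apply: (sup1 _ _ top1); last by move=> x _.
by split.
Qed.

Lemma ccl_sum n (p : 'I_n -> K1 -> K2) : (forall i, ccl (p i)) ->
  ccl (fun x => \sum_i p i x).
Proof.
elim: n p => [|n IH] p pC.
  rewrite (_ : (fun x => _) = fun=> 0); first exact: ccl0.
  by apply/funext => x; rewrite big_ord0.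
rewrite (_ : (fun x => _) =
    fun x => \sum_(i < n) p (widen_ord (leqnSn n) i) x + p ord_max x).
  by apply: ccl_add => //; apply: IH.
by apply/funext => x; rewrite big_ord_recr.
Qed.
End Maps.

Lemma ccl_comp K1 K2 K3 (T1 : set (set K1)) (T2 : set (set K2)) (T3 : set (set K3)) p q :
  ccl T1 T2 p -> ccl T2 T3 q -> ccl T1 T3 (fun x => q (p x)).
Proof.
move=> [pL pC] [qL qC]; split; first by move=> a x y; rewrite pL qL.
by move=> U /qC/pC.
Qed.

Lemma ccl_id K (T : set (set K)) : ccl T T (fun x => x).
Proof. by []. Qed.

(* Differential operators of order less than m, in the sense of Grothendieck *)
Fixpoint DO (K : fieldType) (m : nat) (g : K -> K) : Prop :=
  if m is m'.+1 then forall a, DO m' (fun x => g (a * x) - a * g x)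
  else forall x, g x = 0.

Lemma DO_eq (K : fieldType) m (f g : K -> K) : f =1 g -> DO m f -> DO m g.
Proof. by move=> /funext ->. Qed.

Lemma DO0 (K : fieldType) m (g : K -> K) : (forall x, g x = 0) -> DO m g.
Proof.
elim: m g => [//|m IH] g g0 a /=; apply: IH => x.
by rewrite !g0 mulr0 subrr.
Qed.

Lemma DO_add (K : fieldType) m (f g : K -> K) :
  DO m f -> DO m g -> DO m (fun x => f x + g x).
Proof.
elim: m f g => [|m IH] f g fD gD /=; first by move=> x; rewrite fD gD addr0.
move=> a; apply: DO_eq (IH _ _ (fD a) (gD a)) => x /=; ring.
Qed.

Lemma DO_mul (K : fieldType) m c (g : K -> K) : DO m g -> DO m (fun x => c * g x).
Proof.
elim: m g => [|m IH] g gD /=; first by move=> x; rewrite gD mulr0.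
move=> a; apply: DO_eq (IH _ (gD a)) => x /=; ring.
Qed.

Lemma DO_premul (K : fieldType) m c (g : K -> K) : DO m g -> DO m (fun x => g (c * x)).
Proof.
elim: m g => [|m IH] g gD /=; first by move=> x; rewrite gD.
move=> a; apply: DO_eq (IH _ (gD a)) => x /=.
by rewrite mulrCA.
Qed.

Lemma DO_leq (K : fieldType) m m' (g : K -> K) : (m <= m')%N -> DO m g -> DO m' g.
Proof.
elim: m m' g => [|m IH] [|m'] g //= mm' gD; first exact: (@DO0 K m'.+1).
by move=> a; exact: IH.
Qed.

Lemma DO_sum (K : fieldType) m n (p : 'I_n -> K -> K) : (forall i, DO m (p i)) ->
  DO m (fun x => \sum_i p i x).
Proof.
elim: n p => [|n IH] p pC; first by apply: DO0 => x; rewrite big_ord0.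
apply: (@DO_eq _ _ (fun x =>
    \sum_(i < n) p (widen_ord (leqnSn n) i) x + p ord_max x)).
  by move=> x; rewrite big_ord_recr.
by apply: DO_add => //; apply: IH.
Qed.

Definition cdo K (T : set (set K)) (g : K -> K) : Prop :=
  ccl T T g /\ exists m, DO m g.

Lemma cdo_sum K (T : set (set K)) n (p : 'I_n -> K -> K) : ST_ring (kmap K) T ->
  (forall i, cdo T (p i)) -> cdo T (fun x => \sum_i p i x).
Proof.
move=> ST pC; split; first by apply: ccl_sum => // i; have [] := pC i.
have [m mP] := choice (fun i => (pC i).2).
exists (\sum_i m i)%N; apply: DO_sum => i; apply: DO_leq (mP i).
by rewrite (bigD1 i) //= leq_addr.
Qed.

Lemma cdo_mul K (T : set (set K)) c (p : K -> K) : ST_ring (kmap K) T ->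
  cdo T p -> cdo T (fun x => c * p x).
Proof.
by move=> ST [pC [m pD]]; split; [exact: ccl_mul|exists m; exact: DO_mul].
Qed.

Lemma cdo_mulr K (T : set (set K)) c : ST_ring (kmap K) T -> cdo T (fun x => x * c).
Proof.
move=> ST; split.
  rewrite (_ : (fun x => _) = fun x => c * x); last by apply/funext => x; ring.
  by apply: ccl_mul => //; exact: ccl_id.
by exists 1%N => a x /=; ring.
Qed.

Section Step.
Variables (K k1 : kfield k) (D : cdvf K k1).
Hypothesis compat : forall c,
  val_ge (dv D) 0 (kmap K c) /\ dres D (kmap K c) = kmap k1 c.
Variable T : set (set K).
Hypothesis ST : ST_ring (kmap K) T.
Local Notation O := (val_ge (dv D)).
Local Notation T' := (residue_topology D T).

Lemma dres0 : dres D 0 = 0.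
Proof. by apply/dres_ker; exact: val_ge_0. Qed.

Lemma dresN x : O 0 x -> dres D (- x) = - dres D x.
Proof.
move=> Ox; have := dresD Ox (val_geN Ox); rewrite subrr dres0 => /esym/eqP.
by rewrite addrC addr_eq0 => /eqP.
Qed.

Lemma dresB x y : O 0 x -> O 0 y -> dres D (x - y) = dres D x - dres D y.
Proof. by move=> Ox Oy; rewrite dresD ?dresN //; exact: val_geN. Qed.

Lemma residue_ST : ST_ring (kmap k1) T'.
Proof.
have [lin top cap sup] := ST.1; split; first split.
- by move=> U [].
- by split=> //; exists setT.
- move=> U W [kU [A TA AU]] [kW [B TB BW]]; split.
    have [U0 UP] := kU; have [W0 WP] := kW; split=> // c x y [Ux Wx] [Uy Wy].
    by split; [exact: UP|exact: WP].
  exists (A `&` B)%classic; first exact: cap.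
  by move=> x Ox [Ax Bx]; split; [exact: AU|exact: BW].
- move=> U W [kU [A TA AU]] kW UW; split=> //; exists A => // x Ox Ax.
  exact/UW/AU.
move=> a U [[U0 UP] [A TA AU]].
have [b Ob <-] := dres_surj D a.
have kb : ksub (kmap k1) (fun x => U (dres D b * x)).
  split; first by rewrite mulr0.
  by move=> c x y Ux Uy; rewrite mulrDr mulrCA; exact: UP.
have Tb : T' [set x | U (dres D b * x)]%classic.
  split=> //; exists (fun x => A (b * x)); first by have [] := ST.2 b A TA.
  move=> x Ox Abx; rewrite /= -dresM //; apply: AU => //.
  by rewrite -[0]addr0; exact: val_geM.
by split=> //; rewrite (_ : mkset _ = [set x | U (dres D b * x)]%classic) //;
  apply/funext => x; rewrite /mkset mulrC.
Qed.

Section Coefficients.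
Variable s : lifting D.
Hypothesis sC : forall W, T W -> T' (fun a => W (s a)).

Lemma lift_ccl : ccl T' T s.
Proof. by split=> // a x y; rewrite rmorphD rmorphM lift_kmap. Qed.

(** [dl] removes the leading digit and divides by the uniformizer, so that [cf l] reads the l-th
    digit of an integral element. On the ring of integers [cf l] is linear for the k_1-structure
    given by s. *)
Definition dl (x : K) : K := unif D ^ (-1) * (x - s (dres D x)).
Definition cf l x : k1 := dres D (iter l dl x).

Lemma dlE x : x = s (dres D x) + unif D * dl x.
Proof. by rewrite /dl -[X in X * _]expr1z unifXK addrC subrK. Qed.

Lemma dl_int x : O 0 x -> O 0 (dl x).
Proof.
move=> Ox; apply/val_ge_unifX; rewrite [_ - _](_ : _ = 1) //.
have Os := lift_int s (dres D x).
apply/dres_ker; first exact: val_geB.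
by rewrite dresB // lift_res subrr.
Qed.

Lemma iter_dl_int l x : O 0 x -> O 0 (iter l dl x).
Proof. by move=> Ox; elim: l => //= l; exact: dl_int. Qed.

Lemma dlD x y : O 0 x -> O 0 y -> dl (x + y) = dl x + dl y.
Proof. by move=> Ox Oy; rewrite /dl dresD // rmorphD /=; ring. Qed.

Lemma dlM a x : O 0 x -> dl (s a * x) = s a * dl x.
Proof.
move=> Ox; rewrite /dl dresM //; last exact: lift_int.
by rewrite lift_res rmorphM /=; ring.
Qed.

Lemma dl_unif x : O 0 x -> dl (unif D * x) = x.
Proof.
move=> Ox; rewrite /dl [dres D _](_ : _ = 0) ?rmorph0 ?subr0.
  by rewrite mulrA exprN1 mulVf ?mul1r // unif_neq0.
have Ou : O 1 (unif D * x) by rewrite -[unif D]expr1z; apply/val_ge_unifX; rewrite subrr.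
apply/dres_ker => //; exact: val_ge_le Ou.
Qed.

Lemma cfD l x y : O 0 x -> O 0 y -> cf l (x + y) = cf l x + cf l y.
Proof.
rewrite /cf; elim: l x y => [|l IH] x y Ox Oy; first exact: dresD.
by rewrite !iterSr dlD // IH //; exact: dl_int.
Qed.
Lemma cfM l a x : O 0 x -> cf l (s a * x) = a * cf l x.
Proof.
rewrite /cf; elim: l x => [|l IH] x Ox.
  by rewrite /= dresM ?lift_res //; exact: lift_int.
by rewrite !iterSr dlM // IH //; exact: dl_int.
Qed.
Lemma cf_unif l x : O 0 x -> cf l.+1 (unif D * x) = cf l x.
Proof. by move=> Ox; rewrite /cf iterSr dl_unif. Qed.
Lemma cf0_unif x : O 0 x -> cf 0 (unif D * x) = 0.
Proof.
move=> Ox; have Ou : O 1 (unif D * x).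
  by rewrite -[unif D]expr1z; apply/val_ge_unifX; rewrite subrr.
by apply/dres_ker => //; exact: val_ge_le Ou.
Qed.
Lemma cfN1 l x : O 0 x -> cf l (- x) = - cf l x.
Proof. by move=> Ox; rewrite -mulN1r -(rmorphN1 s) cfM // mulN1r. Qed.

Lemma cf_expand N x : O 0 x ->
  O N%:Z (x - \sum_(i < N) s (cf i x) * unif D ^+ i).
Proof.
move=> Ox; rewrite (_ : _ - _ = unif D ^ N%:Z * iter N dl x).
  by apply/val_ge_unifX; rewrite subrr; exact: iter_dl_int.
elim: N => [|N IH]; first by rewrite big_ord0 subr0 mul1r.
rewrite big_ord_recr /= opprD addrA IH /cf {1}[iter N dl x]dlE.
by rewrite -!exprnP exprSr; ring.
Qed.

Lemma ccl_dres (K0 : kfield k) (T0 : set (set K0)) (p : K0 -> K) :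
  (forall x, O 0 (p x)) -> ST_ring (kmap K0) T0 -> ccl T0 T p ->
  ccl T0 T' (fun x => dres D (p x)).
Proof.
move=> pO ST0 [pL pC].
have dL : fklin (fun x => dres D (p x)).
  move=> a x y; have [Oa ea] := compat a.
  rewrite pL dresD ?dresM ?ea //.
  by rewrite -[0]addr0; exact: val_geM.
split=> // U [kU [W TW WU]]; have [_ _ _ sup] := ST0.1.
apply: (sup _ _ (pC W TW)); first exact: ksub_pre.
by move=> x /=; exact: WU.
Qed.

Lemma ccl_cf (K0 : kfield k) (T0 : set (set K0)) (p : K0 -> K) l :
  (forall x, O 0 (p x)) -> ST_ring (kmap K0) T0 -> ccl T0 T p ->
  ccl T0 T' (fun x => cf l (p x)).
Proof.
move=> pO ST0; elim: l p pO => [|l IH] p pO pC; first exact: ccl_dres.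
rewrite (_ : (fun x => _) = fun x => cf l (dl (p x))); last first.
  by apply/funext => x; rewrite /cf iterSr.
apply: IH; first by move=> x; exact: dl_int.
apply: ccl_mul => //; apply: ccl_add => //.
rewrite (_ : (fun x => _) = fun x => (-1) * s (dres D (p x))); last first.
  by apply/funext => x; rewrite mulN1r.
apply: ccl_mul => //; apply: ccl_comp lift_ccl; exact: ccl_dres.
Qed.
End Coefficients.

(** The commutator with a is a sum of two terms. In the first, g is replaced by its own commutator
    with s a, so m drops. The second carries the factor s a - s' a, which is [unif D] times an
    integral d, so l drops and w absorbs d. Hence the induction on m + l: passing from s to s'
    raises the order by at most l. *)
Lemma DO_cf (s s' : lifting D) N : forall m l (w : K) (g : K -> K),
  (m + l <= N)%N -> DO m g -> (forall b, O 0 (w * g (s b))) ->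
  DO N (fun b => cf s' l (w * g (s b))).
Proof.
elim: N => [|N IH] m l w g.
  rewrite leqn0 addn_eq0 => /andP[/eqP-> /eqP->] /= g0 _ b.
  by rewrite g0 mulr0 /cf /= dres0.
case: m => [|m] mlN gD gO.
  apply: DO0 => b; rewrite gD mulr0 -(mulr0 (s' 0)) cfM ?mul0r //.
  exact: val_ge_0.
move=> a; pose d := unif D ^ (-1) * (s a - s' a).
have dO : O 0 d.
  apply/val_ge_unifX; rewrite [_ - _](_ : _ = 1) //.
  have Os := lift_int s a; have Os' := lift_int s' a.
  apply/dres_ker; first exact: val_geB.
  by rewrite dresB // !lift_res subrr.
have Oa b : O 0 (w * (g (s a * s b) - s a * g (s b))).
  rewrite mulrBr; apply: val_geB; first by rewrite -rmorphM.
  by rewrite mulrCA -[0]addr0; apply: val_geM => //; exact: lift_int.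
have Ob b : O 0 (w * d * g (s b)).
  by rewrite mulrAC -[0]addr0 [w * _ * _]mulrC; apply: val_geM => //.
apply: (@DO_eq _ _ (fun b => cf s' l (w * (g (s a * s b) - s a * g (s b)))
    + cf s' l (unif D * (w * d * g (s b))))).
  move=> b.
  have Ou : O 0 (unif D * (w * d * g (s b))).
    rewrite -[0]addr0; apply: val_geM => //; right; rewrite dv_unif //.
  rewrite -cfD // rmorphM /=.
  have -> : w * (g (s a * s b) - s a * g (s b)) + unif D * (w * d * g (s b)) =
      w * g (s a * s b) + - (s' a * (w * g (s b))).
    have du : unif D * d = s a - s' a by rewrite /d -[X in X * _]expr1z unifXK.
    have -> : unif D * (w * d * g (s b)) = w * (s a - s' a) * g (s b).
      by rewrite -du; ring.
    by ring.
  have Oab : O 0 (w * g (s a * s b)) by rewrite -rmorphM.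
  have Osa : O 0 (s' a * (w * g (s b))).
    by rewrite -[0]addr0; apply: val_geM => //; exact: lift_int.
  by rewrite cfD ?cfN1 ?cfM //; exact: val_geN.
apply: DO_add; first exact: (IH m l w (fun x => g (s a * x) - s a * g x)).
(* Digit 0 of a multiple of the uniformizer vanishes; digit l + 1 is digit l of the cofactor. *)
case: l mlN => [|l] mlN; first by apply: DO0 => b; rewrite cf0_unif.
apply: (@DO_eq _ _ (fun b => cf s' l (w * d * g (s b)))).
  by move=> b; rewrite cf_unif.
by apply: (IH m.+1 l (w * d) g) => //; rewrite addnS in mlN.
Qed.

End Step.
End Continuous.

(** * Boundedness of continuous differential operators *)

Section Bounded.
Variable k : fieldType.

(* The two properties of the topology of a TLF on which the boundedness of
   continuous differential operators rests *)
Definition separating (K k1 : fieldType) (D : cdvf K k1) (T : set (set K)) : Prop :=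
  (forall y : nat -> K, (forall j : nat, ~ val_ge (dv D) (- j%:Z) (y j)) ->
     exists2 U, T U & forall j, ~ U (y j)) /\
  (forall U, T U -> exists N : nat, forall x, val_ge (dv D) N%:Z x -> U x).

Section Step.
Variables (K k1 : kfield k) (D : cdvf K k1).
Hypothesis compat : forall c,
  val_ge (dv D) 0 (kmap K c) /\ dres D (kmap K c) = kmap k1 c.
Variable T : set (set K).
Hypothesis ST : ST_ring (kmap K) T.
Hypothesis sep : separating D T.
Local Notation O := (val_ge (dv D)).
Local Notation T' := (residue_topology D T).

(** A power of the uniformizer is moved past g one factor at a time. Each move leaves a value of the
    commutator h, whose order is lower, so that an induction on the order controls the sum. *)
Lemma DO_unifX (g h : K -> K) : (forall x, h x = g (unif D * x) - unif D * g x) ->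
  forall j x, g (unif D ^+ j * x) =
    unif D ^+ j * g x + \sum_(i < j) unif D ^+ (j - i.+1) * h (unif D ^+ i * x).
Proof.
move=> hE; elim=> [|j IH] x; first by rewrite !mul1r big_ord0 addr0.
rewrite exprS -mulrA -[LHS](subrK (unif D * g (unif D ^+ j * x))) -hE IH.
rewrite big_ord_recr /= subnn mul1r mulrDr mulrA [h _ + _]addrC addrA.
congr (_ + _ + _); rewrite mulr_sumr; apply: eq_bigr => i _.
by rewrite mulrA -exprS subSn // ltnW.
Qed.

Lemma val_ge_unifXn i (j : nat) x : O (i - j%:Z) x -> O i (unif D ^+ j * x).
Proof. by move=> h; rewrite exprnP; apply/val_ge_unifX. Qed.

(* If g were unbounded on the ring of integers, there would be x_j with g(x_j)
   of valuation < -2j, up to a constant; as g(t^j x) = t^j g(x) up to bounded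
   terms, t^j x_j would tend to 0 while the valuations of g(t^j x_j) tend
   to -oo, contradicting continuity. *)
Lemma cdo_bounded m (g : K -> K) : ccl T T g -> DO m g ->
  (forall N : int, exists M : int, forall x, O N x -> O M (g x)) /\
  (forall M : int, exists N : int, forall x, O N x -> O M (g x)).
Proof.
elim: m g => [|m IH] g gC gD.
  by split=> z; exists 0 => x _; rewrite gD; exact: val_ge_0.
have hC (f : K -> K) : ccl T T f -> ccl T T (fun x => f (unif D * x) - unif D * f x).
  move=> fC; rewrite (_ : (fun x => _) =
      fun x => f (unif D * x) + (-1) * (unif D * f x)); last first.
    by apply/funext => x; rewrite mulN1r.
  apply: ccl_add => //; first exact: ccl_premul.
  exact: (ccl_mul ST _ (ccl_mul ST _ fC)).
have bnd (f : K -> K) : ccl T T f -> DO m.+1 f ->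
    exists M : int, forall x, O 0 x -> O M (f x).
  move=> fC fD; have [/(_ 0)[B BP] _] := IH _ (hC f fC) (fD (unif D)).
  apply: contrapT => nb.
  have /choice[x xP] (j : nat) : exists x,
      O 0 x /\ ~ O (- (2 * j%:Z) - `|B|%:Z) (f x).
    apply: contrapT => nx; apply: nb; exists (- (2 * j%:Z) - `|B|%:Z) => x Ox.
    by apply: contrapT => nfx; apply: nx; exists x.
  have [|U TU Uy] := sep.1 (fun j => f (unif D ^+ j * x j)).
    move=> j; have [Ox nf] := xP j.
    rewrite (DO_unifX (h := fun x => f (unif D * x) - unif D * f x)) // => fj.
    apply: nf; set S := \sum_(i < j) _ in fj.
    have BS : O B S.
      apply: val_ge_sum => i; apply: val_ge_unifXn; apply: (@val_ge_le _ _ _ B).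
        lia.
      by apply: BP; apply: val_ge_unifXn; apply: val_ge_le Ox; lia.
    have : O (- j%:Z - `|B|%:Z) (unif D ^+ j * f (x j)).
      rewrite -[_ * _](addrK S); apply: val_geB; first by apply: val_ge_le fj; lia.
      by apply: val_ge_le BS; lia.
    by rewrite exprnP => /val_ge_unifX; apply: val_ge_le; lia.
  have [N NP] := sep.2 _ (fC.2 U TU).
  apply: (Uy N); apply: NP; apply: val_ge_unifXn; rewrite subrr.
  by have [] := xP N.
split=> [N|M].
  have [M MP] := bnd _ (ccl_premul ST (unif D ^ N) gC) (DO_premul (unif D ^ N) gD).
  exists M => x Ox; rewrite -[x](unifXK D N); apply: MP.
  by apply/val_ge_unifX; rewrite opprK add0r.
have [M0 M0P] := bnd _ gC gD.
have [/(_ 0)[B BP] /(_ M)[I IP]] := IH _ (hC g gC) (gD (unif D)).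
pose j := (`|M0| + `|M| + `|B| + `|I|)%N.
exists j%:Z => y Oy; rewrite -[y](unifXK D j%:Z).
set x := _ ^ (- j%:Z) * y.
have Ox : O 0 x by apply/val_ge_unifX; rewrite opprK add0r.
rewrite -exprnP (DO_unifX (h := fun x => g (unif D * x) - unif D * g x)) //.
apply: val_geD.
  by apply: val_ge_unifXn; apply: val_ge_le (M0P _ Ox); lia.
apply: val_ge_sum => i; have ij := ltn_ord i; apply: val_ge_unifXn.
(* For large i the commutator term is small by induction. For the finitely many other i it is
   bounded, and the power of the uniformizer in front of it, of exponent j - i - 1, makes it
   small. *)
have [iI|iI] := leqP `|I|%N i.
  apply: (@val_ge_le _ _ _ M); first by lia.
  by apply: IP; apply: val_ge_unifXn; apply: val_ge_le Ox; lia.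
apply: (@val_ge_le _ _ _ B); first by lia.
by apply: BP; apply: val_ge_unifXn; apply: val_ge_le Ox; lia.
Qed.

Section Quotient.
Variables s s' : lifting D.
Hypothesis sC : forall W, T W -> T' (fun a => W (s a)).
Hypothesis sC' : forall W, T W -> T' (fun a => W (s' a)).
Variables (V W : lmodType K) (f : V -> W).
Hypothesis fW : findim W.

(** For a map that is only k-linear a matrix entry is an operator on X rather than a scalar.
    Quantifying over all u and v avoids fixing bases of the quotients. *)
Definition cdo_entries (X : kfield k) (TX : set (set X)) (A B : lmodType X)
    (h : A -> B) : Prop :=
  forall (u : A) (v : {linear B -> X^o}), cdo TX (fun a => v (h (a *: u))).

Hypothesis fD : cdo_entries T f.
Variables (L L' : osub D V) (M M' : osub D W).
Hypotheses (lM : lat M) (lM' : lat M').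
Hypothesis fM : forall x, L x -> M (f x).

Lemma bco_linear (c : basis W) i : linear (fun x => bco c x i : K^o).
Proof. by move=> a x y; rewrite bcoP. Qed.

(** In a quotient of two multiples of a span the digits of the coordinates write an entry of F as a
    finite sum of constants times digits, taken with respect to s', of entries of f along s.
    [ccl_cf] and [DO_cf] apply to each summand. *)
Lemma oquot_cdo (F : oquot s L L' -> oquot s' M M') :
  (forall x, L x -> F (cls s L L' x) = cls s' M M' (f x)) -> cdo_entries T' F.
Proof.
move=> FE q v; have [x Lx <-] := cls_surj q.
rewrite (_ : (fun a => _) = fun a => v (cls s' M M' (f (s a *: x)))); last first.
  apply/funext => a; rewrite -clsZ // FE //; apply: omemZ => //; exact: lift_int.
have ST' : ST_ring (kmap k1) T' by exact: residue_ST.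
have [c _] := basis_exists fW.
have [N NP] := lat_ub c lM; have [N' NP'] := lat_lb c lM'.
pose B := blv D c (- N%:Z); pose B' := blv D c N'%:Z.
have lB : lat B by exact: blv_lat.
have lB' : lat B' by exact: blv_lat.
have [|h h_inj hE] := @oquot_mono k K k1 D s' W M B' B B' NP; first by [].
have [|h' _ hE'] := @oquot_epi k K k1 D s' W M B' M'; first by move=> ? _; exact: NP'.
(* The form v lives on M/M'. The retraction extends its pullback from M/B' to B/B', so that it can
   be evaluated on the elements e j i, which need not lie in M. *)
have [r rK] := linear_retraction (findim_oquot s' lM lB') (findim_oquot s' lB lB') h_inj.
have vE y : M y -> v (cls s' M M' y) = v (h' (r (cls s' B B' y))).
  by move=> My; rewrite -hE // rK hE'.
have uN y : unif D ^ (- N%:Z) * (unif D ^ N%:Z * y) = y.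
  by rewrite -{2}[N%:Z]opprK unifXK.
pose e j i : W := (unif D ^ (- N%:Z) * unif D ^+ i) *: c j.
have eB j i : B (e j i).
  move=> l; rewrite bcoZ -mulrA; apply/val_ge_unifX; rewrite subrr.
  apply: val_ge_unifXn.
  rewrite (@bco_uniq _ _ c (c j) (fun i => (i == j)%:R)).
    by case: eqP => _; [apply: val_ge_le (val_ge1 D); lia|exact: val_ge_0].
  rewrite (bigD1 j) //= eqxx scale1r big1 ?addr0 // => i0 /negbTE ->.
  by rewrite scale0r.
have fO a j : O 0 (unif D ^ N%:Z * bco c (f (s a *: x)) j).
  apply/val_ge_unifX; rewrite sub0r; apply: NP; apply: fM.
  by apply: omemZ => //; exact: lift_int.
rewrite (_ : (fun a => _) = fun a => \sum_(j < brank c) \sum_(i < N + N')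
    v (h' (r (cls s' B B' (e j i)))) *
    cf s' i (unif D ^ N%:Z * bco c (f (s a *: x)) j)); last first.
  apply/funext => a; have Mf : M (f (s a *: x)).
    by apply: fM; apply: omemZ => //; exact: lift_int.
  rewrite vE // (_ : cls s' B B' (f (s a *: x)) = cls s' B B' (\sum_j \sum_(i < N + N')
      s' (cf s' i (unif D ^ N%:Z * bco c (f (s a *: x)) j)) *: e j i)).
    rewrite cls_sum => [|j]; last first.
      by apply: osub_sum => i; apply: omemZ (eB _ _); exact: lift_int.
    rewrite !linear_sum; apply: eq_bigr => j _.
    rewrite cls_sum => [|i]; last by apply: omemZ (eB _ _); exact: lift_int.
    rewrite !linear_sum; apply: eq_bigr => i _.
    by rewrite clsZ // !linearZ [RHS]mulrC.
  apply/cls_eq; first exact: NP.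
    do 2 apply: osub_sum => ?; apply: omemZ (eB _ _); exact: lift_int.
  move: (fO a) => {}fO; set y := f _ in fO Mf *.
  rewrite {1}(bcoE c y) -sumrB; apply: (@osub_sum _ _ _ _ B') => j.
  rewrite (_ : _ - _ = (unif D ^ (- N%:Z) * (unif D ^ N%:Z * bco c y j -
      \sum_(i < N + N') s' (cf s' i (unif D ^ N%:Z * bco c y j)) * unif D ^+ i)) *: c j).
    move=> i; rewrite bcoZ -mulrA; apply/val_ge_unifX.
    rewrite -[_ - _]addr0; apply: val_geM.
      by rewrite opprK -PoszD addnC; exact: cf_expand.
    rewrite (@bco_uniq _ _ c (c j) (fun i => (i == j)%:R)).
      by case: eqP => _; [exact: val_ge1|exact: val_ge_0].
    rewrite (bigD1 j) //= eqxx scale1r big1 ?addr0 // => i0 /negbTE ->.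
    by rewrite scale0r.
  rewrite mulrBr uN scalerBl; congr (_ - _).
  rewrite mulr_sumr scaler_suml; apply: eq_bigr => i _.
  by rewrite /e scalerA mulrCA.
apply: cdo_sum => // j; apply: cdo_sum => // i; apply: cdo_mul => //.
have [gC [m gD]] := fD x (linmk (@bco_linear c j)).
split; last by exists (m + i)%N; apply: (@DO_cf k K k1 D s s' (m + i) m i (unif D ^ N%:Z)
  (fun a => bco c (f (a *: x)) j) (leqnn _) gD) => b; exact: fO.
apply: (@ccl_cf k K k1 D compat T ST s' sC' k1 T'
  (fun a => unif D ^ N%:Z * bco c (f (s a *: x)) j) i (fun a => fO a j) ST').
exact: (ccl_mul ST _ (ccl_comp (lift_ccl sC) gC)).
Qed.
End Quotient.
End Step.

Fixpoint nice n (K : kfield k) (T : tower n K) : set (set K) -> Prop :=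
  match T as T0 in tower n K return set (set K) -> Prop with
  | Tower0 _ _ => fun _ => True
  | TowerS n K k1 D _ T1 => fun top =>
      separating D top /\ nice T1 (residue_topology D top)
  end.

(** [cdo_bounded], applied to the entries, provides the lattices asked for; [oquot_cdo] hands the
    hypothesis down to the induced maps of quotients. *)
Lemma EYek_cdo n (K : kfield k) (T : tower n K) (top : set (set K)) (s : liftings T) :
  ST_ring (kmap K) top -> nice T top -> liftings_continuous top s ->
  forall (V W : lmodType K) (f : V -> W), findim V -> findim W -> klin f ->
  cdo_entries top f -> EYek s f.
Proof.
elim: T top s => {n K} [K fin|n K k1 D e T1 IH] top s ST ni sC V W f fV fW fL fD.
  by [].
have [sep ni1] := ni; have [sC1 sC2] := sC.
move=> L1 L2 yL1 yL2 good.
have [lL1 lL2] := (yek_lat fV yL1, yek_lat fW yL2).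
have [b _] := basis_exists fV; have [c _] := basis_exists fW.
have cE i : linear (fun x => bco c x i : K^o) by move=> a x y; rewrite bcoP.
have fbd j i : (forall N : int, exists M : int, forall x, val_ge (dv D) N x ->
      val_ge (dv D) M (bco c (f (x *: b j)) i)) /\
    (forall M : int, exists N : int, forall x, val_ge (dv D) N x ->
      val_ge (dv D) M (bco c (f (x *: b j)) i)).
  have [gC [m gD]] := fD (b j) (linmk (cE i)).
  exact: (cdo_bounded ST sep gC gD).
have fsum x i : bco c (f x) i = \sum_j bco c (f (bco b x j *: b j)) i.
  rewrite {1}(bcoE b x) (klin_sum _ fL).
  exact: (linear_sum (linmk (cE i))).
have up (z : int) : exists z' : nat, forall x, blv D b z x -> blv D c (- z'%:Z) (f x).
  have /choice[M MP] (p : 'I_(brank b) * 'I_(brank c)) : exists M : int,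
      forall x, val_ge (dv D) z x -> val_ge (dv D) M (bco c (f (x *: b p.1)) p.2).
    by have [h _] := fbd p.1 p.2; exact: h.
  exists (\sum_p `|M p|)%N => x xP i; rewrite fsum; apply: val_ge_sum => j.
  apply: val_ge_le (MP (j, i) _ (xP j)).
  have : (`|M (j, i)| <= \sum_p `|M p|)%N by rewrite (bigD1 (j, i)) //= leq_addr.
  lia.
have down (z' : int) : exists z : nat, forall x, blv D b z%:Z x -> blv D c z' (f x).
  have /choice[M MP] (p : 'I_(brank b) * 'I_(brank c)) : exists M : int,
      forall x, val_ge (dv D) M x -> val_ge (dv D) z' (bco c (f (x *: b p.1)) p.2).
    by have [_ h] := fbd p.1 p.2; exact: h.
  exists (\sum_p `|M p|)%N => x xP i; rewrite fsum; apply: val_ge_sum => j.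
  apply: (MP (j, i)); apply: val_ge_le (xP j).
  have : (`|M (j, i)| <= \sum_p `|M p|)%N by rewrite (bigD1 (j, i)) //= leq_addr.
  lia.
split.
  have [i1 i1P] := small_bspan b lL1; have [N1 N1P] := lat_ub b lL1.
  have [N2 N2P] := lat_lb c lL2; have [N3 N3P] := lat_ub c lL2.
  have [z zP] := down N2%:Z; have [z' zP'] := up (- N1%:Z).
  exists (bspan D b (i1 + z)), (blv D c (- (N3 + z')%:Z)); split.
  - by split; [exact: bspan_yek|apply: (@blv_yek _ _ D W c (- (N3 + z')%:Z))].
  - split; first by apply: i1P; lia.
    by move=> x /N3P; apply: blv_le; lia.
  - move=> x /bspan_blv h; apply: N2P; apply: zP; apply: blv_le h; lia.
  - by move=> x /N1P /zP'; apply: blv_le; lia.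
move=> L1' L2' [[yL1' yL2'] [L1'L1 L2L2'] fL1' fL1].
have [lL1' lL2'] := (yek_lat fV yL1', yek_lat fW yL2').
apply: (IH (residue_topology D top)) => //.
- exact: residue_ST.
- exact: findim_oquot.
- exact: findim_oquot.
- by apply: oquot_fun_klin => // y _; exact: fL1'.
- apply: (oquot_cdo e ST sC1 sC1 fW fD lL2' lL2 fL1) => x Lx.
  by apply: oquot_fun_cls => // y _; exact: fL1'.
Qed.
End Bounded.

(** * Change of liftings *)

Section Mixed.
Variable k : fieldType.

Section Fun.
Variables (K k1 : kfield k) (D : cdvf K k1) (s s' : lifting D).
Variables (V W : lmodType K) (L L' : osub D V) (M M' : osub D W) (f : V -> W).

(* The map L/L' -> M/M' induced by f, between quotients seen as k_1-modules
   via two different liftings. *)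
Definition mfun (q : oquot s L L') : oquot s' M M' :=
  cls s' M M' (f (val (qrep q))).

Hypothesis fL : klin f.
Hypothesis fM : forall x, L x -> M (f x).
Hypothesis fM' : forall x, L x -> L' x -> M' (f x).

Lemma mfun_cls x : L x -> mfun (cls s L L' x) = cls s' M M' (f x).
Proof.
move=> Lx; have [Ly e] := cls_qrep (cls s L L' x).
apply/cls_eq; [exact: fM|exact: fM|rewrite -klinB //; apply: fM'].
  exact: osubB.
exact/(cls_eq s L' Ly Lx).
Qed.

Lemma mfun_klin : klin mfun.
Proof.
move=> a p q; have [x Lx <-] := cls_surj p; have [y Ly <-] := cls_surj q.
rewrite -cls_kmap // !mfun_cls ?fL ?cls_kmap //; try exact: fM.
by apply: omemD => //; exact: osub_kmap.
Qed.
End Fun.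
Arguments mfun {K k1 D} s s' {V W} L L' M M' f q.

Section Swap.
Variables (n : nat) (K k1 : kfield k) (D : cdvf K k1) (T1 : tower n k1).
Hypothesis compat : forall c,
  val_ge (dv D) 0 (kmap K c) /\ dres D (kmap K c) = kmap k1 c.
Variable top : set (set K).
Hypothesis ST : ST_ring (kmap K) top.
Hypothesis ni1 : nice T1 (residue_topology D top).
Variable tau : liftings T1.
Hypothesis tauC : liftings_continuous (residue_topology D top) tau.
Definition continuous_lift (s : lifting D) : Prop :=
  forall W, top W -> residue_topology D top (fun a => W (s a)).

(** Over K the identity has multiplications as entries, operators of order 0. By [oquot_cdo] the map
    it induces between the two k_1-structures has continuous differential operators as entries. *)
Lemma EYek_change (s s' : lifting D) (V : lmodType K) (L L' : osub D V) :
  continuous_lift s -> continuous_lift s' -> findim V -> lat L -> lat L' ->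
  EYek tau (mfun s s' L L' L L' id).
Proof.
move=> sC sC' fV lL lL'.
have ST' : ST_ring (kmap k1) (residue_topology D top) by exact: residue_ST.
have fLL := findim_oquot s lL lL'; have fLL' := findim_oquot s' lL lL'.
have kl : klin (mfun s s' L L' L L' id) by exact: mfun_klin.
apply: (EYek_cdo ST' ni1 tauC fLL fLL' kl).
apply: (oquot_cdo compat ST sC sC' fV _ lL lL' (fun x Lx => Lx)).
  move=> u v; rewrite (_ : (fun a => _) = fun a => a * v u); first exact: cdo_mulr.
  by apply/funext => a; rewrite linearZ.
by move=> x Lx; rewrite mfun_cls.
Qed.

(** The map for t, t' is the one for s, s' composed on both sides with the identity maps of
    [EYek_change]. *)
Lemma EYek_mfun (s s' t t' : lifting D) (V W : lmodType K)
    (L L' : osub D V) (M M' : osub D W) (f : V -> W) :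
  [/\ continuous_lift s, continuous_lift s', continuous_lift t & continuous_lift t'] ->
  findim V -> findim W -> [/\ lat L, lat L', lat M & lat M'] -> klin f ->
  (forall x, L x -> M (f x)) -> (forall x, L x -> L' x -> M' (f x)) ->
  EYek tau (mfun s s' L L' M M' f) -> EYek tau (mfun t t' L L' M M' f).
Proof.
move=> [sC sC' tC tC'] fV fW [lL lL' lM lM'] fL fM fM' Ef.
have [_ Ecomp] := EYek_lin_comp tau.
rewrite (_ : mfun t t' _ _ _ _ f =
  mfun s' t' M M' M M' id \o (mfun s s' L L' M M' f \o mfun t s L L' L L' id)).
  apply: (Ecomp); try exact: findim_oquot; try exact: EYek_change.
  - by apply: klin_comp; exact: mfun_klin.
  - exact: mfun_klin.
  apply: (Ecomp); try exact: findim_oquot; try exact: EYek_change => //.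
  - exact: mfun_klin.
  - exact: mfun_klin.
  - exact: Ef.
apply/funext => q; have [x Lx <-] := cls_surj q.
by rewrite /= !mfun_cls //; exact: fM.
Qed.

End Swap.

(** The right-hand side has the quantifiers of a morphism from colim_b lim_i to colim_c lim_j. It
    asks for one good quotient where E^Yek asks for all of them; [sandwich] bridges the gap. *)
Lemma EYek_basesP n (K k1 : kfield k) (D : cdvf K k1) e (T1 : tower n k1)
    (s : liftings (TowerS (K := K) (D := D) e T1)) (V W : lmodType K) (f : V -> W) :
  findim V -> findim W -> klin f ->
  EYek s f <->
  forall b : basis V, exists c : basis W,
    (forall x, bspan D b 0 x -> bspan D c 0 (f x)) /\
    forall j, exists i, (forall x, bspan D b 0 x -> bspan D b i x -> bspan D c j (f x)) /\
      EYek s.2 (ofun s.1 (bspan D b 0) (bspan D b i) (bspan D c 0) (bspan D c j) f).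
Proof.
move=> fV fW fL; split=> [Ef b|Ef].
  have [c0 _] := basis_exists fW.
  have [[_ [L2' [[_ yL2'] [_ L2L2'] _ fL2']]] _] :=
    Ef _ _ (bspan_yek D b 0) (bspan_yek D c0 0).
  have [N NP] := lat_ub c0 (yek_lat fW yL2').
  pose c := scale_basis D c0 (- N%:Z).
  have cP x : bspan D b 0 x -> bspan D c 0 (f x).
    by move=> /fL2' /NP h; apply/bspan_blv/scale_blv; rewrite addr0.
  exists c; split=> // j.
  have [[L1' [_ [[yL1' _] _ fL1' _]]] Ef'] :=
    Ef _ _ (bspan_yek D b 0) (bspan_yek D c j).
  have [i iP] := small_bspan b (yek_lat fV yL1').
  have fi x : bspan D b i x -> bspan D c j (f x) by move=> h; apply/fL1'/(iP i).
  exists i; split; first by move=> x _; exact: fi.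
  apply: Ef'; split=> //; first by split; exact: bspan_yek.
  by split=> x /bspan_blv h; apply/bspan_blv; apply: blv_le h.
move=> L1 L2 yL1 yL2 good.
have [lL1 lL2] := (yek_lat fV yL1, yek_lat fW yL2).
have [b0 _] := basis_exists fV.
have [N NP] := lat_ub b0 lL1; pose b := scale_basis D b0 (- N%:Z).
have L1b x : L1 x -> bspan D b 0 x.
  by move=> /NP h; apply/bspan_blv/scale_blv; rewrite addr0.
have [c [bc cE]] := Ef b.
have [M MP] := lat_ub c lL2.
have [j jP] := small_bspan c lL2.
split.
  have [i [iP _]] := cE j.
  have [i' iP'] := small_bspan b lL1.
  exists (bspan D b (i + i')), (blv D c (- M%:Z)); split.
  - by split; [exact: bspan_yek|apply: (@blv_yek _ _ D W c (- M%:Z))].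
  - by split => //; apply: iP'; lia.
  - move=> x h; apply: (jP j) => //; apply: iP.
      by apply/L1b/(iP' (i + i')%N) => //; lia.
    by move/bspan_blv: h => h; apply/bspan_blv; apply: blv_le h; lia.
  - move=> x /L1b/bc/bspan_blv; apply: blv_le; lia.
move=> L1' L2' [[yL1' yL2'] [L1'L1 L2L2'] fL1' fL1].
have [lL1' lL2'] := (yek_lat fV yL1', yek_lat fW yL2').
have [Elin Ecomp] := EYek_lin_comp s.2.
have [i [iP Ei]] := cE j.
have [i' iP'] := small_bspan b lL1'.
have [M' MP'] := lat_ub c lL2'.
(* B contains L2' and the span of c, while level i + i' of b lies in level i and in L1'. The map
   known to be in E^Yek, composed with the two linear maps between these quotients, has the form
   that [sandwich] expects. *)
pose B := blv D c (- M'%:Z).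
have cB x : bspan D c 0 x -> B x by move/bspan_blv; apply: blv_le; lia.
have bi x : bspan D b (i + i') x -> bspan D b i x.
  by move/bspan_blv => h; apply/bspan_blv; apply: blv_le h; lia.
have lB : lat B by exact: blv_lat.
have [//|h1 _ h1E] := @oquot_mono k K k1 D s.1 W (bspan D c 0) (bspan D c j) B (bspan D c j) cB.
have [|h2 _ h2E] := @oquot_epi k K k1 D s.1 V (bspan D b 0) (bspan D b (i + i')) (bspan D b i).
  by move=> x _; exact: bi.
have lb m : lat (bspan D b m) by exact: bspan_lat.
have lc m : lat (bspan D c m) by exact: bspan_lat.
have fB x : bspan D b 0 x -> B (f x) by move=> /bc/cB.
have fB' x : bspan D b 0 x -> bspan D b (i + i') x -> bspan D c j (f x).
  by move=> b0x /bi; exact: iP.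
have biL x : L1 x -> bspan D b (i + i') x -> L1' x.
  by move=> _; apply: iP'; lia.
have fL1'2 x : L1 x -> L1' x -> L2 (f x) by move=> _; exact: fL1'.
have jL x : B x -> bspan D c j x -> L2 x by move=> _; exact: jP.
refine (sandwich Elin Ecomp fL (And4 (lb 0%N) (lb (i + i')%N) lL1 lL1')
  (And4 lB (lc j) lL2' lL2) fB fB' fL1 fL1'2 L1b biL MP' jL _).
set F := ofun s.1 _ _ _ _ f in Ei.
have kF : klin F by apply: oquot_fun_klin.
have fd := findim_oquot s.1.
have E2 : EYek s.2 (F \o h2).
  exact: (Ecomp _ _ _ _ _ (fd _ _ _ (lb 0%N) (lb (i + i')%N)) (fd _ _ _ (lb 0%N) (lb i))
   (fd _ _ _ (lc 0%N) (lc j)) (klin_linear h2) kF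
   (Elin _ _ _ (fd _ _ _ (lb 0%N) (lb (i + i')%N)) (fd _ _ _ (lb 0%N) (lb i))) Ei).
rewrite (_ : ofun s.1 _ _ _ _ f = h1 \o (F \o h2)).
  exact: (Ecomp _ _ _ _ _ (fd _ _ _ (lb 0%N) (lb (i + i')%N))
   (fd _ _ _ (lc 0%N) (lc j)) (fd _ _ _ lB (lc j))
   (klin_comp kF (klin_linear h2)) (klin_linear h1) E2
   (Elin _ _ _ (fd _ _ _ (lc 0%N) (lc j)) (fd _ _ _ lB (lc j)))).
apply/funext => q; have [x Lx <-] := cls_surj q.
rewrite /= h2E // /F !oquot_fun_cls //; first by rewrite h1E //; exact: bc.
Qed.
End Mixed.

Lemma fraction_ex (R : idomainType) (x : {fraction R}) :
  exists n d : R, d != 0 /\ x * tofrac d = tofrac n.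
Proof.
elim/quotW: x => x; exists (frac x).1, (frac x).2; split; first exact: denom_ratioP.
rewrite -[_ * _]/(FracField.mul _ _) !piE; apply/eqP.
rewrite piE FracField.equivfE /FracField.mulf !numden_Ratio ?mulr1 ?oner_eq0 ?denom_ratioP //.
by rewrite mulrC.
Qed.

Lemma mulr_swap (R : comPzRingType) (a b x : R) : a * (x * b) = b * (x * a).
Proof. by rewrite mulrCA [RHS]mulrCA [a * b]mulrC. Qed.

(** * Laurent series and their topology *)

Section PowerSeriesFacts.
Variable X : fieldType.
Implicit Types f g u : pser X.

Definition pt : pser X := fun i => (i == 1)%:R.

Lemma paddE f g i : (f + g) i = f i + g i. Proof. by []. Qed.
Lemma pserM f g i : (f * g) i = \sum_(j < i.+1) f j * g (i - j)%N.
Proof. by []. Qed.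

Lemma psum n (F : 'I_n -> pser X) i : (\sum_j F j) i = \sum_j F j i.
Proof.
elim: n F => [|n IH] F; first by rewrite !big_ord0.
by rewrite !big_ord_recr /= paddE IH.
Qed.

Lemma ptM f i : (pt * f) i = if i is i'.+1 then f i' else 0.
Proof.
rewrite pserM; case: i => [|i]; first by rewrite big_ord1 /pt /= mul0r.
rewrite (bigD1 (Ordinal (isT : 1 < i.+2)%N)) //= /pt /= mul1r subSS subn0.
rewrite big1 ?addr0 // => j j1.
by rewrite (_ : (j == 1 :> nat) = false) ?mul0r //; apply/negbTE.
Qed.

Lemma ptXM n f i : (pt ^+ n * f) i = if (n <= i)%N then f (i - n)%N else 0.
Proof.
elim: n i => [|n IH] i; first by rewrite mul1r subn0.
by rewrite exprS -mulrA ptM; case: i => [|i] //; rewrite IH subSS.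
Qed.

(** A geometric series in w, where u / u(0) = 1 - w. As w^m has no coefficient below degree m,
    coefficient n of the sum only involves the first n + 1 powers. *)
Lemma pser_unit u : u 0%N != 0 -> exists v, u * v = 1.
Proof.
move=> u0; pose w : pser X := 1 - pconst (u 0%N)^-1 * u.
have w0 : w 0%N = 0.
  rewrite /w; transitivity (1 - (pconst (u 0%N)^-1 * u) 0%N) => //.
  by rewrite pserM big_ord1 /= mulVf // subrr.
have wX n i : (i < n)%N -> (w ^+ n) i = 0.
  elim: n i => // n IH i; rewrite ltnS => le_in.
  rewrite exprS pserM big1 // => -[[|j] /= ji] _; first by rewrite w0 mul0r.
  by rewrite IH ?mulr0 //; move: ji le_in; lia.
pose v : pser X := fun n => (\sum_(m < n.+1) w ^+ m) n.
have vE n i : (i <= n)%N -> v i = (\sum_(m < n.+1) w ^+ m) i.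
  move=> le_in; rewrite /v !psum -(subnKC le_in) -addSn big_split_ord /=.
  by rewrite [X in _ + X]big1 ?addr0 // => j _; rewrite wX //; lia.
exists (v * pconst (u 0%N)^-1); rewrite mulrCA mulrC [u * _]mulrC.
have -> : pconst (u 0%N)^-1 * u = 1 - w by rewrite /w opprB addrCA subrr addr0.
apply/funext => n; rewrite pserM.
rewrite (eq_bigr (fun i : 'I_n.+1 => (1 - w) i * (\sum_(m < n.+1) w ^+ m) (n - i)%N)).
  rewrite -pserM -[1 - w]opprB mulNr -subrX1 opprB.
  by transitivity ((1 : pser X) n - (w ^+ n.+1) n); rewrite // wX // subr0.
by move=> i _; rewrite (vE n) // leq_subr.
Qed.

Lemma pser_decomp f : f != 0 -> exists a u, u 0%N != 0 /\ f = pt ^+ a * u.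
Proof.
move=> /eqP/pord[a fa f0]; exists a, (fun i => f (i + a)%N); split=> //.
apply/funext => i; rewrite ptXM; case: leqP => ai; first by rewrite subnK.
exact: f0.
Qed.
End PowerSeriesFacts.

Section Laurent.
Variable X : fieldType.
Implicit Types (f g u : pser X) (x y : {fraction (pser X)}).
Local Notation "f %:F" := (tofrac f).
Definition tL : {fraction (pser X)} := (pt X)%:F.

Lemma tofrac_inj : injective (@tofrac (pser X)).
Proof.
move=> f g /eqP; rewrite -subr_eq0 -rmorphB tofrac_eq0 subr_eq0.
by move/eqP.
Qed.

Lemma tL_neq0 : tL != 0.
Proof.
rewrite tofrac_eq0; apply/eqP => /(congr1 (fun f : pser X => f 1%N)) /eqP.
by rewrite /pt /= oner_eq0.
Qed.
Lemma tLX_neq0 (z : int) : tL ^ z != 0. Proof. exact: expfz_neq0 tL_neq0. Qed.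

Lemma laurent_rep x : exists N f, x * tL ^+ N = f%:F.
Proof.
have [n [d [d0 e]]] := fraction_ex x.
have [a [u [u0 du]]] := pser_decomp d0; have [v uv] := pser_unit u0.
exists a, (n * v); rewrite rmorphM /= -e du rmorphM rmorphXn -!mulrA.
by rewrite -rmorphM uv rmorph1 mulr1.
Qed.

Definition lrep x := cid (laurent_rep x).
Definition lN x : nat := projT1 (lrep x).
Definition lf x : pser X := projT1 (cid (projT2 (lrep x))).
Lemma lfE x : x * tL ^+ lN x = (lf x)%:F.
Proof. exact: (projT2 (cid (projT2 (lrep x)))). Qed.

(* the coefficient of t^i *)
Definition coe x (i : int) : X :=
  if 0 <= i + (lN x)%:Z then lf x (absz (i + (lN x)%:Z)) else 0.

(** [coe] relies on a chosen denominator t^N; this frees it from that choice and is the way in which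
    all coefficients are computed. *)
Lemma coeE x N f i : x * tL ^+ N = f%:F ->
  coe x i = if 0 <= i + N%:Z then f (absz (i + N%:Z)) else 0.
Proof.
move=> e; have : pt X ^+ lN x * f = pt X ^+ N * lf x.
  apply: tofrac_inj; rewrite !rmorphM !rmorphXn /= -/tL -e -lfE; exact: mulr_swap.
move=> h; rewrite /coe.
have hz (z : nat) : (if (lN x <= z)%N then f (z - lN x)%N else 0) =
    (if (N <= z)%N then lf x (z - N)%N else 0).
  by rewrite -!ptXM h.
have [i1|i1] := leP 0 (i + (lN x)%:Z); have [i2|i2] := leP 0 (i + N%:Z) => //.
- have := hz (absz (i + (lN x)%:Z + N%:Z)).
  rewrite !ifT; [|lia|lia] => e2; transitivity (lf x (absz (i + (lN x)%:Z + N%:Z)%R - N)%N); first by congr (lf x _); lia.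
  by rewrite -e2; congr (f _); lia.
- have := hz (absz (i + (lN x)%:Z + N%:Z)); rewrite ifF; last lia.
  rewrite ifT; last lia.
  by move=> ->; congr (lf x _); lia.
- have := hz (absz (i + (lN x)%:Z + N%:Z)); rewrite ifT; last lia.
  rewrite ifF; last lia.
  by move=> <-; congr (f _); lia.
Qed.

Lemma coe_tofrac f (i : nat) : coe f%:F i%:Z = f i.
Proof. by rewrite (@coeE _ 0 f) ?mulr1 // addr0. Qed.

Lemma coe_shift x (z i : int) : coe (tL ^ z * x) i = coe x (i - z).
Proof.
pose a := absz (z + (absz z)%:Z).
have e : tL ^ z * x * tL ^+ (lN x + absz z) = (pt X ^+ a * lf x)%:F.
  rewrite rmorphM rmorphXn /= -/tL -lfE exprD !exprnP.
  rewrite (_ : a%:Z = z + (absz z)%:Z) ?expfzDr ?tL_neq0 //; last lia.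
  by rewrite -!mulrA; congr (_ * _); rewrite mulrA mulrC.
rewrite (coeE i e) /coe ptXM.
have [i1|i1] := leP 0 (i - z + (lN x)%:Z).
  by rewrite !ifT; [congr (lf x _)| |]; lia.
by case: ifP => // i2; rewrite ifF //; lia.
Qed.

Lemma coeD x y i : coe (x + y) i = coe x i + coe y i.
Proof.
have ex : x * tL ^+ (lN x + lN y) = (pt X ^+ lN y * lf x)%:F.
  by rewrite rmorphM rmorphXn /= -/tL -lfE exprD mulrA mulrC.
have ey : y * tL ^+ (lN x + lN y) = (pt X ^+ lN x * lf y)%:F.
  by rewrite rmorphM rmorphXn /= -/tL -lfE exprD mulrCA.
have exy : (x + y) * tL ^+ (lN x + lN y) = (pt X ^+ lN y * lf x + pt X ^+ lN x * lf y)%:F.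
  by rewrite mulrDl ex ey rmorphD.
rewrite (coeE i ex) (coeE i ey) (coeE i exy).
by case: ifP => // _; rewrite addr0.
Qed.

Lemma coe0 i : coe 0 i = 0.
Proof.
rewrite (@coeE 0 0 0); first by case: ifP.
by rewrite mul0r rmorph0.
Qed.

Lemma coe_sum n (F : 'I_n -> {fraction (pser X)}) i :
  coe (\sum_j F j) i = \sum_j coe (F j) i.
Proof.
elim: n F => [|n IH] F; first by rewrite !big_ord0 coe0.
by rewrite !big_ord_recr /= coeD IH.
Qed.

Lemma coe_monomial (z i : int) : coe (tL ^ z) i = (i == z)%:R.
Proof.
rewrite -[tL ^ z]mulr1 coe_shift (@coeE _ 0 1); last by rewrite mulr1 rmorph1.
case: eqP => [->|iz]; first by rewrite subrr.
case: ifP => // h; rewrite (_ : absz _ = (absz (i - z)).-1.+1) //; lia.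
Qed.

Lemma coe_low x : exists m : int, forall i, i < m -> coe x i = 0.
Proof. by exists (- (lN x)%:Z) => i im; rewrite /coe ifF //; lia. Qed.

Lemma coe_int x (i : int) : (forall j, j < i -> coe x j = 0) <->
  exists f, x = tL ^ i * f%:F.
Proof.
split=> [h|[f ->] j ji]; last first.
  by rewrite coe_shift (@coeE _ 0 f) ?mulr1 // ifF //; lia.
pose y := tL ^ (- i) * x.
have yE : x = tL ^ i * y.
  by rewrite /y mulrA -expfzDr ?tL_neq0 // subrr expr0z mul1r.
have y0 j : j < 0 -> coe y j = 0 by move=> j0; rewrite coe_shift h //; lia.
exists (fun n => lf y (n + lN y)%N); rewrite {1}yE; congr (_ * _).
apply: (mulIf (tLX_neq0 (lN y))); rewrite -!exprnP lfE mulrC.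
rewrite -rmorphXn -rmorphM; congr tofrac; apply/funext => n.
rewrite ptXM; case: leqP => [nN|nN]; first by rewrite subnK.
have := y0 (n%:Z - (lN y)%:Z); rewrite /coe subrK /= => -> //; lia.
Qed.

Lemma coe_const c x i : coe ((pconst c)%:F * x) i = c * coe x i.
Proof.
have e : (pconst c)%:F * x * tL ^+ lN x = (pconst c * lf x)%:F.
  by rewrite -mulrA lfE rmorphM.
rewrite (coeE i e) /coe; case: ifP => _; last by rewrite mulr0.
rewrite pserM big_ord_recl subn0 big1 ?addr0 // => j _.
by rewrite /= mul0r.
Qed.

Lemma coeN x i : coe (- x) i = - coe x i.
Proof. by apply/eqP; rewrite -addr_eq0 -coeD addNr coe0. Qed.

Lemma coe_mulf f x (i : int) (n : nat) : (forall l : nat, (n <= l)%N -> coe x (i - l%:Z) = 0) ->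
  coe (f%:F * x) i = \sum_(l < n) f l * coe x (i - l%:Z).
Proof.
move=> h; have e : f%:F * x * tL ^+ lN x = (f * lf x)%:F.
  by rewrite -mulrA lfE rmorphM.
rewrite (coeE i e); case: ifP => iN; last first.
  by rewrite big1 // => l _; rewrite /coe ifF ?mulr0 //; lia.
have E (m : nat) : (\sum_(l < n) f l * coe x (i - l%:Z) =
    \sum_(l < n + m) f l * coe x (i - l%:Z)).
  rewrite big_split_ord /= [X in _ + X]big1 ?addr0 // => j _.
  by rewrite h ?mulr0 //; rewrite leq_addr.
rewrite (E (absz (i + (lN x)%:Z)).+1) pserM addnC big_split_ord /=.
rewrite [X in _ = _ + X]big1 ?addr0 => [|j _]; last first.
  by rewrite /coe ifF ?mulr0 //; lia.
apply: eq_bigr => l _; have := ltn_ord l => ln.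
by rewrite /coe ifT; [congr (_ * lf x _)|]; lia.
Qed.

Definition lead (z : int) x : Prop := coe x z != 0 /\ forall j, j < z -> coe x j = 0.

Lemma lead_ex x : x != 0 -> exists z, lead z x.
Proof.
move=> x0; have lx0 : lf x != 0.
  apply: contraNneq x0 => l0; have := lfE x; rewrite l0 rmorph0 => /eqP.
  by rewrite mulf_eq0 expf_eq0 (negbTE tL_neq0) andbF orbF.
have /eqP/pord[a fa f0] := lx0.
exists (a%:Z - (lN x)%:Z); split; first by rewrite /coe subrK.
move=> j ja; rewrite /coe; case: ifP => // jN; apply: f0; lia.
Qed.

Lemma lead_uniq z z' x : lead z x -> lead z' x -> z = z'.
Proof.
move=> [h1 h2] [h1' h2']; have [zz'|zz'|//] := ltgtP z z'.
  by rewrite h2' ?eqxx in h1.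
by rewrite h2 ?eqxx in h1'.
Qed.

Lemma leadM z z' x y : lead z x -> lead z' y -> lead (z + z') (x * y).
Proof.
move=> [x1 /coe_int[f xf]] [y1 /coe_int[g yg]].
have e : x * y = tL ^ (z + z') * (f * g)%:F.
  by rewrite xf yg expfzDr ?tL_neq0 // rmorphM mulrACA.
have fE : coe x z = f 0%N by rewrite xf coe_shift subrr (coe_tofrac f 0).
have gE : coe y z' = g 0%N by rewrite yg coe_shift subrr (coe_tofrac g 0).
rewrite e; split; last by apply/coe_int; exists (f * g).
rewrite coe_shift subrr (coe_tofrac (f * g) 0) pserM big_ord1 subn0.
by rewrite -fE -gE mulf_neq0.
Qed.

Definition lord x : int := if pselect (exists z, lead z x) is left e then projT1 (cid e) else 0.

Lemma lordP x : x != 0 -> lead (lord x) x.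
Proof.
move=> /lead_ex h; rewrite /lord; case: pselect => // e.
exact: (projT2 (cid e)).
Qed.

Lemma lordM x y : x != 0 -> y != 0 -> lord (x * y) = lord x + lord y.
Proof.
move=> x0 y0; apply: (@lead_uniq _ _ (x * y)); first exact/lordP/mulf_neq0.
by apply: leadM; exact: lordP.
Qed.

Lemma lordD x y i : x + y != 0 -> (x = 0 \/ i <= lord x) -> (y = 0 \/ i <= lord y) ->
  i <= lord (x + y).
Proof.
move=> /lordP[h _].
have low z : (z = 0 \/ i <= lord z) -> forall j, j < i -> coe z j = 0.
  move=> hz j ji; have [->|z0] := eqVneq z 0; first exact: coe0.
  case: hz => [/eqP|iz]; first by rewrite (negbTE z0).
  by have [_ ->] := lordP z0 => //; apply: lt_le_trans iz.
move=> /low hx /low hy; rewrite leNgt; apply/negP => li.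
by rewrite coeD hx // hy // addr0 eqxx in h.
Qed.

Lemma lord_tL : lord tL = 1.
Proof.
apply: (@lead_uniq _ _ tL); first exact: lordP tL_neq0.
split; first by rewrite (coe_tofrac (pt X) 1) /pt /= oner_eq0.
by apply/coe_int; exists 1; rewrite rmorph1 mulr1.
Qed.

Lemma lord_ge x i : x != 0 -> (i <= lord x <-> forall j, j < i -> coe x j = 0).
Proof.
move=> x0; have [h1 h2] := lordP x0; split=> [il j ji|h].
  by apply: h2; exact: lt_le_trans il.
by rewrite leNgt; apply/negP => /h h3; rewrite h3 eqxx in h1.
Qed.
End Laurent.

Section BoxTopology.
Variables (k : fieldType) (X : kfield k) (TX : set (set X)).
Local Notation L := (laurent1 X).
Local Notation cf x i := (@coe (kf X) x i).

(* This is the fine topology of F((t)), in terms of the coefficients of the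
   series: see laurent1_box. *)
Definition box : set (set L) :=
  [set U | ksub (kmap L) U /\ exists (W : int -> set X) (j : int),
     (forall i, TX (W i)) /\ forall x : L, (forall i : int, i < j -> W i (cf x i)) -> U x]%classic.

Hypothesis ST : ST_ring (kmap X) TX.

Lemma coe_kmap c (x y : L) i :
  cf (kmap L c * x + y) i = kmap X c * cf x i + cf y i.
Proof. by rewrite coeD /= coe_const. Qed.

Lemma ksub_of (U : set X) : TX U -> ksub (kmap X) U.
Proof. by have [h _ _ _] := ST.1; exact: h. Qed.

Lemma TX_mul c U : TX U -> TX (fun x => U (c * x)).
Proof. by move=> TU; have [] := ST.2 c U TU. Qed.

Lemma TX_cap n (W : 'I_n -> set X) : (forall l, TX (W l)) ->
  TX (fun x => forall l, W l x).
Proof.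
have [_ topT capT sup] := ST.1.
elim: n W => [|n IH] W WP.
  by rewrite (_ : (fun x => _) = setT) //; apply/seteqP; split => // x _ [].
rewrite (_ : (fun x => _) = (W ord_max `&` (fun x => forall l : 'I_n, W (widen_ord (leqnSn n) l) x))%classic).
  by apply: capT => //; exact: IH.
apply/seteqP; split => [x h|x [h1 h2] l]; first by split => [|l]; exact: h.
case: (unliftP ord_max l) => [j ->|-> //].
by have := h2 j; congr (W _ x); apply: val_inj; rewrite /= /bump leqNgt ltn_ord.
Qed.

Lemma ksub_sum (U : set X) n (F : 'I_n -> X) : ksub (kmap X) U ->
  (forall i, U (F i)) -> U (\sum_i F i).
Proof.
move=> [U0 UP] FU; apply: (big_ind U) => // x y Ux Uy.
by have := UP 1 _ _ Ux Uy; rewrite rmorph1 mul1r.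
Qed.

Lemma ksubL_sum (U : set L) n (F : 'I_n -> L) : ksub (kmap L) U ->
  (forall i, U (F i)) -> U (\sum_i F i).
Proof.
move=> [U0 UP] FU; apply: (big_ind U) => // x y Ux Uy.
by have := UP 1 _ _ Ux Uy; rewrite rmorph1 mul1r.
Qed.

Lemma ksub_box (W : int -> set X) (j : int) : (forall i, TX (W i)) ->
  ksub (kmap L) (fun x => forall i : int, i < j -> W i (cf x i)).
Proof.
move=> TW; have kW i := ksub_of (TW i); split.
  by move=> i _; rewrite coe0; have [] := kW i.
move=> c x y Ux Uy i ij; rewrite coe_kmap; have [_ h] := kW i.
by apply: h; [exact: Ux|exact: Uy].
Qed.

Lemma box_box (W : int -> set X) (j : int) : (forall i, TX (W i)) ->
  box (fun x => forall i : int, i < j -> W i (cf x i)).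
Proof. by move=> TW; split; [exact: ksub_box|exists W, j]. Qed.

Lemma box_mul (y : L) U : box U -> box (fun x => U (y * x)).
Proof.
move=> [[U0 UP] [W [j [TW WU]]]]; split.
  split; first by rewrite mulr0.
  by move=> c x z Ux Uz; rewrite mulrDr mulrCA; exact: UP.
set N := lN y; set f := lf y.
have yE : y = tL X ^ (- N%:Z) * tofrac f.
  by rewrite -lfE mulrCA exprnP -expfzDr ?tL_neq0 // addNr expr0z mulr1.
(* Coefficient i of y x is the sum over l of f l times coefficient m = i + N - l of x. Thus i = m -
   N + l, and i < j bounds l by j + N - m: each coefficient of x meets finitely many conditions. *)
exists (fun m => (fun c => forall l : 'I_(absz (j + N%:Z - m)%R), W (m - N%:Z + l%:Z) (f l * c))), (j + N%:Z).
split=> [m|x xW]; first by apply: (@TX_cap _ (fun l c => W (m - N%:Z + l%:Z) (f l * c))) => l; exact: TX_mul.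
apply: WU => i ij.
have [m0 m0P] := coe_low x.
rewrite yE -mulrA coe_shift opprK.
rewrite (@coe_mulf _ _ _ _ (absz (i + N%:Z - m0)%R).+1); last first.
  by move=> l ln; apply: m0P; lia.
apply: ksub_sum => [|l]; first exact: ksub_of.
have lt_l : (l < absz (j + N%:Z - (i + N%:Z - l%:Z))%R)%N by lia.
have := xW (i + N%:Z - l%:Z) _ (Ordinal lt_l) => /=.
by rewrite (_ : _ - _ - _ + _ = i); [apply; lia|lia].
Qed.

Lemma box_linear : linear_topology (kmap L) box.
Proof.
have [_ topT capT sup] := ST.1.
split.
- by move=> U [].
- by split=> //; exists (fun=> setT), 0.
- move=> U V [[U0 UP] [W [j [TW WU]]]] [[V0 VP] [W' [j' [TW' WV]]]]; split.
    by split=> // c x y [Ux Vx] [Uy Vy]; split; [exact: UP|exact: VP].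
  exists (fun i => W i `&` W' i)%classic, (Num.max j j').
  split=> [i|x h]; first exact: capT.
  split; [apply: WU => i ij|apply: WV => i ij].
    by have [|] := h i; first by rewrite lt_max ij.
  by have [|] := h i; first by rewrite lt_max ij orbT.
- move=> U V [_ [W [j [TW WU]]]] kV UV; split=> //; exists W, j; split=> // x /WU.
  exact: UV.
Qed.

Lemma box_ST : ST_ring (kmap L) box.
Proof.
split; first exact: box_linear.
move=> a U bU; split; first exact: box_mul.
rewrite (_ : mkset _ = (fun x : L => U (a * x))); first exact: box_mul.
by apply/funext => x; rewrite /mkset mulrC.
Qed.

Lemma box_STmod : laurent1_STmod TX box.
Proof.
split; [exact: box_linear|by move=> a U; exact: box_mul|].
move=> x U [[U0 UP] [W [j [TW WU]]]]; split.
  split; first by rewrite /= rmorph0 mul0r.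
  move=> c f g Uf Ug; rewrite /= rmorphD rmorphM mulrDl -mulrA.
  exact: UP.
have [m0 m0P] := coe_low x.
(* Coefficient l of f meets coefficient m0 + r of x in degree m0 + l + r. Only degrees below j
   matter, which leaves l, r < j - m0. *)
exists (absz (j - m0)%R), (fun l => (fun c => forall r : 'I_(absz (j - m0)%R), W (m0 + l%:Z + r%:Z) (cf x (m0 + r%:Z) * c))).
split=> [l _|f fW].
  by apply: (@TX_cap _ (fun r c => W (m0 + l%:Z + r%:Z) (cf x (m0 + r%:Z) * c))) => r; exact: TX_mul.
apply: WU => i ij.
rewrite (@coe_mulf _ _ _ _ (absz (i - m0)%R).+1); last first.
  by move=> l ln; apply: m0P; lia.
apply: ksub_sum => [|l]; first exact: ksub_of.
have [lo|hi] := ltP (i - l%:Z) m0.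
  by rewrite m0P // mulr0; have [] := ksub_of (TW i).
have l1 : (l < absz (j - m0))%N by lia.
have r1 : (absz (i - l%:Z - m0)%R < absz (j - m0))%N by lia.
have := fW l l1 (Ordinal r1) => /=; rewrite mulrC.
rewrite (_ : m0 + _ + _ = i); last lia.
by rewrite (_ : m0 + _ = i - l%:Z); last lia.
Qed.

(** Let U be open for some ST-module topology. Continuity of f ↦ f on power series puts t^N F[[t]]
    into U for some N, and continuity of c ↦ c t^i gives an open condition on coefficient i. A
    series is a finite sum of monomials of degree below N plus an element of t^N F[[t]]. *)
Lemma laurent1_box : laurent1_topology TX = box.
Proof.
apply/seteqP; split=> U; last by move=> bU; exists box => //; exact: box_STmod.
move=> [T [lin mul mod] TU].
have kU : ksub (kmap L) U by have [h _ _ _] := lin; exact: h.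
split=> //.
have [N NP] : exists N : nat, forall f : pser X,
    (forall i, (i < N)%N -> f i = 0) -> U (tofrac f).
  have [_ [N [W [TW WU]]]] := mod 1 U TU.
  exists N => f f0; rewrite -[tofrac f]mulr1; apply: WU => i iN; rewrite f0 //.
  by have [] := ksub_of (TW i iN).
have coefU (x : L) : TX (fun c => U (tofrac (pconst c) * x)).
  have [_ [[|M] [W [TW WU]]]] := mod x U TU.
    rewrite (_ : (fun c => _) = setT); first by have [[]] := ST.
    by apply/seteqP; split=> // c _; exact: WU.
  have [_ _ _ sup] := ST.1; apply: (sup _ _ (TW 0%N isT)).
    split; first by rewrite (rmorph0 (@pconst X)) rmorph0 mul0r; have [] := kU.
    move=> c a b Ua Ub; rewrite rmorphD rmorphM /= rmorphD rmorphM mulrDl -mulrA.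
    by have [_ h] := kU; exact: h.
  by move=> c Wc; apply: WU => -[|i] iM //=; have [] := ksub_of (TW i.+1 iM).
exists (fun i => (fun c => U (tofrac (pconst c) * tL X ^ i))), N%:Z.
split=> [i|x xW]; first exact: coefU.
have [m0' m0P'] := coe_low x.
(* The bound m0 <= N keeps r = N - m0 correct also when x starts beyond t^N. *)
have [m0 [m0N m0P]] : exists m0, m0 <= N%:Z /\ forall i : int, i < m0 -> cf x i = 0.
  exists (Num.min m0' N%:Z); split; first by rewrite ge_min lexx orbT.
  by move=> i; rewrite lt_min => /andP[/m0P'].
pose r := absz (N%:Z - m0).
pose S : L := \sum_(l < r) tofrac (pconst (cf x (m0 + l%:Z))) * tL X ^ (m0 + l%:Z).
have SU : U S.
  by apply: ksubL_sum => // l; apply: xW; have := ltn_ord l; rewrite /r; lia.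
have SE (i : int) : i < N%:Z -> cf S i = cf x i.
  move=> iN; rewrite coe_sum.
  rewrite (eq_bigr (fun l : 'I_r => if i == m0 + l%:Z then cf x i else 0)); last first.
    move=> l _; rewrite coe_const coe_monomial; case: eqP => [->|_]; rewrite ?mulr1 ?mulr0 //.
  have [im|im] := ltP i m0.
    by rewrite m0P // big1 // => l _; case: ifP.
  have lt_r : (absz (i - m0)%R < r)%N by rewrite /r; lia.
  rewrite (bigD1 (Ordinal lt_r)) //= ifT; last by apply/eqP; lia.
  rewrite big1 ?addr0 // => l /eqP lne; rewrite ifF //; apply/eqP => e.
  by apply: lne; apply: val_inj => /=; lia.
have RE (i : int) : i < N%:Z -> cf (x - S) i = 0.
  by move=> iN; rewrite coeD coeN SE // subrr.
have [f fE] : exists f, x - S = tL X ^ 0 * tofrac f.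
  by apply/coe_int => i i0; apply: RE; lia.
rewrite expr0z mul1r in fE.
have RU : U (x - S).
  by rewrite fE; apply: NP => i iN; rewrite -coe_tofrac -fE RE //; lia.
by have [_ h] := kU; have := h 1 _ _ RU SU; rewrite rmorph1 mul1r subrK.
Qed.

Definition hausdorff (Y : kfield k) (T : set (set Y)) : Prop :=
  forall c : Y, c != 0 -> exists2 U, T U & ~ U c.

Lemma box_hausdorff : hausdorff TX -> hausdorff box.
Proof.
move=> HX x x0; have [z [xz _]] := lead_ex x0; have [U TU Ux] := HX _ xz.
exists (fun y => forall i : int, i < z + 1 -> (fun i => if i == z then U else setT) i (cf y i)).
  by apply: (@box_box (fun i => if i == z then U else setT)) => i; case: eqP => // _; have [[]] := ST.
by move=> /(_ z); rewrite eqxx => h; apply: Ux; apply: h; lia.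
Qed.

Lemma box_low (U : set L) : box U ->
  exists N : nat, forall x, (forall i : int, i < N%:Z -> cf x i = 0) -> U x.
Proof.
move=> [_ [W [j [TW WU]]]]; exists (absz j) => x x0; apply: WU => i ij.
by rewrite x0; [have [] := ksub_of (TW i)|lia].
Qed.

(** In terms of coefficients, the topology induced on the residue field is the original one: one
    direction imposes a condition on coefficient 0 alone, the other tests on constants. *)
Lemma box_residue (U : set X) : ksub (kmap X) U ->
  (TX U <-> exists2 A, box A &
     forall x, (forall i : int, i < 0 -> cf x i = 0) -> A x -> U (cf x 0)).
Proof.
move=> kU; have [_ topT _ sup] := ST.1; split=> [TU|].
  exists (fun x => forall i : int, i < 1 -> (fun i => if i == 0 then U else setT) i (cf x i)).
    by apply: (@box_box (fun i => if i == 0 then U else setT)) => i; case: eqP.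
  by move=> x _ /(_ 0); rewrite eqxx; apply.
move=> [A [_ [W [j [TW WA]]]] AU]; apply: (sup _ _ (TW 0)) => // c Wc.
pose x : L := tofrac (pconst c).
have xE i : cf x i = if i == 0 then c else 0.
  rewrite -[x]mulr1 -(expr0z (tL X)) coe_const coe_monomial.
  by case: eqP => _; rewrite ?mulr1 ?mulr0.
have := AU x; rewrite xE eqxx; apply.
  by move=> i i0; rewrite xE ifF //; apply/eqP; lia.
by apply: WA => i _; rewrite xE; case: eqP => [->//|_]; have [] := ksub_of (TW i).
Qed.
End BoxTopology.

(** * Uniqueness of the valuation *)

Section Uniqueness.
Variables (K k1 : fieldType) (D : cdvf K k1).
Local Notation O := (val_ge (dv D)).

Lemma O0M x y : O 0 x -> O 0 y -> O 0 (x * y).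
Proof. by move=> Ox Oy; rewrite -[0]addr0; exact: val_geM. Qed.

Lemma O0X x n : O 0 x -> O 0 (x ^+ n).
Proof.
move=> Ox; elim: n => [|n IH]; first exact: val_ge1.
by rewrite exprS; exact: O0M.
Qed.

Lemma O0_nat n : O 0 n%:R.
Proof.
elim: n => [|n IH]; first exact: val_ge_0.
by rewrite -natr1; apply: val_geD IH (val_ge1 D).
Qed.

Lemma exprD_taylor q a d : O 0 a -> O 0 d -> exists2 c, O 0 c &
  (a + d) ^+ q.+1 = a ^+ q.+1 + q.+1%:R * a ^+ q * d + d ^+ 2 * c.
Proof.
move=> Oa Od; elim: q => [|q [c Oc IH]].
  by exists 0; [exact: val_ge_0|rewrite !expr1 expr0; ring].
exists (a * c + q.+1%:R * a ^+ q + d * c).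
  by do 2 ?apply: val_geD; apply: O0M => //; [exact: O0_nat|exact: O0X].
by rewrite exprS IH -[q.+2%:R]natr1 !exprS; ring.
Qed.

Lemma one_unitX y n : O 1 y -> O 1 ((1 + y) ^+ n - 1).
Proof.
move=> Oy; have O0y : O 0 y by exact: val_ge_le Oy.
elim: n => [|n IH]; first by rewrite subrr; exact: val_ge_0.
rewrite exprS mulrDl mul1r addrAC; apply: val_geD => //.
rewrite -(addr0 (1 : int)); apply: val_geM => //; apply: O0X.
by apply: val_geD => //; exact: val_ge1.
Qed.

Section Root.
Variables (q : nat) (x : K).
Hypothesis Oq : O 0 (q.+1%:R)^-1.
Hypothesis q0 : q.+1%:R != 0 :> K.
Hypothesis Ox : O 1 x.

(** A Newton iteration for (1 + y)^(q+1) = 1 + x with the derivative frozen at q + 1, its value at y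
    = 0. As (1 + y)^q is 1 modulo m_1, each step gains one power of m_1. *)
Fixpoint newton (m : nat) : K :=
  if m is m'.+1 then
    newton m' + (1 + x - (1 + newton m') ^+ q.+1) / q.+1%:R
  else 0.
Local Notation err m := (1 + x - (1 + newton m) ^+ q.+1).

Lemma newtonP m : O 1 (newton m) /\ O m.+1%:Z (err m).
Proof.
elim: m => [|m [Oy Oe]].
  split; first exact: val_ge_0.
  by rewrite /= addr0 expr1n addrC addKr.
have Od : O m.+1%:Z (err m / q.+1%:R).
  by rewrite -[m.+1%:Z]addr0; exact: val_geM.
split; first by apply: val_geD => //; apply: val_ge_le Od; lia.
have O0d : O 0 (err m / q.+1%:R) by apply: val_ge_le Od; lia.
have O1y : O 0 (1 + newton m).
  by apply: val_geD; [exact: val_ge1|exact: val_ge_le Oy].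
have [c Oc /=] := exprD_taylor q O1y O0d; rewrite addrA => ->.
set e := err m in Oe Od O0d *.
(* Both terms of the new error are deeper than e: in the first, (1 + y)^q - 1 lies in m_1; the
   second is quadratic in e. *)
have -> : 1 + x - ((1 + newton m) ^+ q.+1 + q.+1%:R * (1 + newton m) ^+ q * (e / q.+1%:R)
   + (e / q.+1%:R) ^+ 2 * c) =
   - (((1 + newton m) ^+ q - 1) * e) - (e / q.+1%:R) * ((e / q.+1%:R) * c).
  transitivity (e - q.+1%:R * (1 + newton m) ^+ q * (e / q.+1%:R)
   - (e / q.+1%:R) ^+ 2 * c); first by rewrite /e; ring.
  rewrite (_ : _ * (e / _) = (1 + newton m) ^+ q * e); first by ring.
  by rewrite mulrAC [_ * (e / _)]mulrC divfK // mulrC.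
apply: val_geB; first apply: val_geN.
  rewrite (_ : m.+2%:Z = 1 + m.+1%:Z) //; apply: val_geM => //; exact: one_unitX.
apply: (@val_ge_le _ _ _ (m.+1%:Z + m.+1%:Z)); first lia.
by apply: val_geM => //; rewrite -[m.+1%:Z]addr0; exact: val_geM.
Qed.

Lemma newton_cauchy m n : (m <= n)%N -> O m.+1%:Z (newton n - newton m).
Proof.
move=> /subnKC <-; elim: (n - m)%N => [|j IH].
  by rewrite addn0 subrr; exact: val_ge_0.
rewrite addnS /= addrAC; apply: val_geD => //.
have [_ Oe] := newtonP (m + j).
rewrite -[m.+1%:Z]addr0; apply: val_geM => //; apply: val_ge_le Oe; lia.
Qed.

Lemma one_unit_root : exists2 y, O 1 y & (1 + y) ^+ q.+1 = 1 + x.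
Proof.
have [|l lP] := dv_complete (c := D) (u := newton).
  move=> i; exists (absz i) => m n im inn.
  have h a b : (absz i <= a)%N -> (a <= b)%N -> O i (newton a - newton b).
    move=> ia ab; rewrite -opprB; apply: val_geN.
    by apply: val_ge_le (newton_cauchy ab); lia.
  have [mn|/ltnW nm] := leqP m n; first exact: h.
  by rewrite -opprB; apply: val_geN; exact: h.
have Ol : O 1 l.
  have [N /(_ N (leqnn N)) NP] := lP 1; have [Oy _] := newtonP N.
  by rewrite -[l](subKr (newton N)); exact: val_geB.
exists l => //; apply/eqP; rewrite -subr_eq0; apply/eqP.
apply: (@val_ge_sep _ _ D) => i.
pose j := Num.max i 0; have [N NP] := lP j.
pose n := (N + absz i)%N; have [Oy Oe] := newtonP n.
have Od : O j (l - newton n).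
  by rewrite -opprB; apply: val_geN; exact: NP n (leq_addr _ _).
have O1y : O 0 (1 + newton n).
  by apply: val_geD; [exact: val_ge1|exact: val_ge_le Oy].
have O0d : O 0 (l - newton n) by apply: val_ge_le Od; lia.
have [c Oc] := exprD_taylor q O1y O0d; rewrite -addrA [newton n + _]addrC subrK => ->.
rewrite (_ : _ - (1 + x) = - err n + (l - newton n) *
   (q.+1%:R * (1 + newton n) ^+ q + (l - newton n) * c)); last by ring.
apply: val_geD; first by apply: val_geN; apply: val_ge_le Oe; lia.
apply: (@val_ge_le _ _ _ (j + 0)); first lia.
apply: val_geM => //; apply: val_geD; last exact: O0M.
by apply: O0M; [exact: O0_nat|exact: O0X].
Qed.
End Root.

Variable v : K -> int.
Hypothesis vM : forall x y, x != 0 -> y != 0 -> v (x * y) = v x + v y.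
Hypothesis vB : forall x, x != 0 -> 1 + x != 0 -> v (1 + x) = 0 -> 0 <= v x.
Hypothesis v1 : exists2 x, x != 0 & v x = 1.
Variable q : nat.
Hypothesis q1 : (0 < q)%N.
Hypothesis q0 : q.+1%:R != 0 :> K.
Hypothesis Oq : O 0 (q.+1%:R)^-1.

Lemma v_one : v 1 = 0.
Proof.
have := vM (oner_neq0 K) (oner_neq0 K); rewrite mulr1 => /eqP.
by rewrite -{1}[v 1]addr0 => /eqP /addrI.
Qed.

Lemma vX x n : x != 0 -> v (x ^+ n) = n%:Z * v x.
Proof.
move=> x0; elim: n => [|n IH]; first by rewrite mul0r v_one.
by rewrite exprS vM ?expf_neq0 // IH; lia.
Qed.

Lemma vV x : x != 0 -> v x^-1 = - v x.
Proof.
move=> x0; have := vM x0 (invr_neq0 x0); rewrite divff // v_one; lia.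
Qed.

Lemma one_unit_neq0 x : O 1 x -> 1 + x != 0.
Proof.
move=> Ox; apply/eqP => e; have xE : x = -1.
  by apply/eqP; rewrite -addr_eq0 addrC e.
case: Ox => [/eqP|]; first by rewrite xE oppr_eq0 oner_eq0.
by rewrite xE dvN1.
Qed.

(* 1-units are (q+1)^j-th powers for all j, so their image under v is
   infinitely divisible. *)
Lemma v_one_unit x : O 1 x -> v (1 + x) = 0.
Proof.
move=> Ox.
have h j : exists2 y, O 1 y & (1 + y) ^+ (q.+1 ^ j) = 1 + x.
  elim: j => [|j [y Oy <-]]; first by exists x.
  have [z Oz <-] := one_unit_root Oq q0 Oy.
  by exists z => //; rewrite expnS exprM.
have [y Oy e] := h (absz (v (1 + x))).
have := ltn_expl (absz (v (1 + x))) (q1 : (1 < q.+1)%N).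
move: e => /(congr1 v); rewrite vX ?one_unit_neq0 //.
set a := (q.+1 ^ _)%N; move: (v (1 + y)) (v (1 + x)) => b c.
have [->|b0] := eqVneq b 0; first by rewrite mulr0.
nia.
Qed.

(** As v vanishes on 1-units, it is nonnegative on m_1. For a unit z this applies to p z^N, with p
    the uniformizer and N > |v p|, so v z >= 0; the same for the inverse gives v z = 0. Hence v is
    v(p) times the valuation, and v(p) = 1 since v(p) is nonnegative and v takes the value 1. *)
Lemma dv_unique x : x != 0 -> v x = dv D x.
Proof.
have m0 y : y != 0 -> O 1 y -> 0 <= v y.
  by move=> y0 Oy; apply: vB => //; [exact: one_unit_neq0|exact: v_one_unit].
have u0 y : y != 0 -> dv D y = 0 -> v y = 0.
  move=> y0 dy; pose p := unif D; have p0 : p != 0 := unif_neq0 D.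
  have dX z : z != 0 -> dv D z = 0 -> 0 <= v p + (absz (v p)).+1%:Z * v z.
    move=> z0 dz; rewrite -vX // -vM ?expf_neq0 //; apply: m0.
      by rewrite mulf_neq0 ?expf_neq0.
    have Oz : O 0 z by right; rewrite dz.
    rewrite -(addr0 (1 : int)); apply: val_geM; last exact: O0X.
    by right; rewrite dv_unif.
  have h1 := dX y y0 dy; have := dX y^-1; rewrite invr_eq0 y0 vV // dvV // dy.
  move=> /(_ isT erefl); nia.
have vp (z : int) : v (unif D ^ z) = z * v (unif D).
  case: z => n; first by rewrite -exprnP vX ?unif_neq0.
  rewrite NegzE -exprnN vV ?expf_neq0 ?unif_neq0 // vX ?unif_neq0 //.
  by rewrite mulNr.
have vE y : y != 0 -> v y = dv D y * v (unif D).
  move=> y0; have z0 : unif D ^ (- dv D y) * y != 0.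
    by rewrite mulf_neq0 ?unifX_neq0.
  have e : v (unif D ^ (- dv D y) * y) = 0.
    by apply: u0 => //; rewrite dvM ?unifX_neq0 // dv_unifX addNr.
  rewrite -{1}[y](unifXK D (dv D y)) vM ?unifX_neq0 // e addr0.
  exact: vp.
have vu : v (unif D) = 1.
  have := m0 _ (unif_neq0 D); have [y y0] := v1; rewrite vE // => e.
  have Ou : O 1 (unif D) by right; rewrite dv_unif.
  move=> /(_ Ou); move: (dv D y) (v (unif D)) e => a b ab b0.
  have := congr1 absz ab; rewrite abszM => /eqP.
  rewrite muln_eq1 => /andP[_ /eqP]; lia.
by move=> /vE ->; rewrite vu mulr1.
Qed.
End Uniqueness.

Definition mk_rmorph (A B : fieldType) (p : A -> B) (pZ : zmod_morphism p)
    (pM : monoid_morphism p) : {rmorphism A -> B} :=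
  HB.pack p (GRing.isZmodMorphism.Build A B p pZ) (GRing.isMonoidMorphism.Build A B p pM).

Section LaurentTopology.
Variables (k : fieldType) (F : kfield k).

Lemma discrete_ST : ST_ring (kmap F) (discrete (kmap F)).
Proof.
split; first split.
- by move=> U.
- by [].
- move=> U W [U0 UP] [W0 WP]; split=> // c x y [Ux Wx] [Uy Wy].
  by split; [exact: UP|exact: WP].
- by move=> U W _ kW _.
move=> a U [U0 UP]; split; split; rewrite /= ?mulr0 ?mul0r // => c x y Ux Uy.
  by rewrite mulrDr mulrCA; exact: UP.
by rewrite mulrDl -mulrA; exact: UP.
Qed.

Lemma laurent_ST n : ST_ring (kmap (laurent F n)) (@laurent_topology k F n) /\
  hausdorff (@laurent_topology k F n).
Proof.
elim: n => [|n [IH1 IH2]].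
  split; first exact: discrete_ST.
  move=> c c0; exists [set 0]%classic; last by move=> /eqP; rewrite (negbTE c0).
  by split=> // a x y -> ->; rewrite /= mulr0 addr0.
rewrite /= (laurent1_box IH1); split; first exact: box_ST.
exact: box_hausdorff.
Qed.
End LaurentTopology.

(** * Passing the parametrization by Laurent series to the residue field *)

Section Step.
Variables (k : fieldType) (K k1 : kfield k) (D : cdvf K k1).
Hypothesis compat : forall c,
  val_ge (dv D) 0 (kmap K c) /\ dres D (kmap K c) = kmap k1 c.
Variable top : set (set K).
Variables (X : kfield k) (TX : set (set X)).
Hypothesis ST : ST_ring (kmap X) TX.
Hypothesis HX : hausdorff TX.
Variable phi : {rmorphism K -> laurent1 X}.
Hypothesis phi_bij : bijective phi.
Hypothesis phi_kmap : forall c, phi (kmap K c) = kmap (laurent1 X) c.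
Hypothesis phi_top : forall U, top U <-> box TX (phi @` U)%classic.
Local Notation O := (val_ge (dv D)).
Local Notation cf x i := (@coe (kf X) x i).

Lemma phi_neq0 x : x != 0 -> phi x != 0. Proof. by rewrite fmorph_eq0. Qed.

Lemma lord1 : lord (1 : laurent1 X) = 0.
Proof.
have := @lordM X 1 1; rewrite oner_eq0 mulr1 => /(_ isT isT) /eqP.
by rewrite -{1}[lord 1]addr0 => /eqP /addrI.
Qed.

Lemma lordN1 : lord (-1 : laurent1 X) = 0.
Proof.
have := @lordM X (-1) (-1); rewrite oppr_eq0 oner_eq0 mulrNN mulr1 => /(_ isT isT).
by rewrite lord1 => /esym/eqP; rewrite -mulr2n mulrn_eq0 => /eqP.
Qed.

Lemma dv_lord x : x != 0 -> lord (phi x) = dv D x.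
Proof.
(* Either 2 is invertible in k, or 2 = 0 and 3 = 1 is. Since k maps into O_1, q + 1 is then a unit
   of O_1. *)
have [q q1 q0] : exists2 q, (0 < q)%N & q.+1%:R != 0 :> k.
  have [e|ne] := eqVneq (2%:R : k) 0; last by exists 1%N.
  exists 2%N => //; rewrite (_ : 3%:R = 2%:R + 1 :> k); last by ring.
  by rewrite e add0r oner_eq0.
have qE : q.+1%:R = kmap K q.+1%:R by rewrite rmorph_nat.
apply: (@dv_unique K k1 D (fun x => lord (phi x)) _ _ _ q) => //.
- by move=> y z y0 z0; rewrite rmorphM lordM //; exact: phi_neq0.
- move=> y y0 y1 l0; have e : phi y = phi (1 + y) + -1.
    by rewrite rmorphD rmorph1 addrC addKr.
  rewrite e; apply: lordD; first by rewrite -e; exact: phi_neq0.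
    by right; rewrite l0.
  by right; rewrite lordN1.
- have [psi _ psiK] := phi_bij; exists (psi (tL X)).
    by rewrite -(fmorph_eq0 phi) psiK tL_neq0.
  by rewrite psiK lord_tL.
- by rewrite qE fmorph_eq0.
- by rewrite qE -fmorphV; have [] := compat (q.+1%:R)^-1.
Qed.

Lemma val_ge_coe i x : O i x <-> forall j : int, j < i -> cf (phi x) j = 0.
Proof.
have [->|x0] := eqVneq x 0.
  by split=> [_ j _|_]; [rewrite rmorph0 coe0|exact: val_ge_0].
apply: (iff_trans _ (lord_ge i (phi_neq0 x0))); rewrite dv_lord //.
by split=> [[/eqP|//]|]; [rewrite (negbTE x0)|right].
Qed.

Lemma phi_pre A : box TX A -> top (fun x => A (phi x)).
Proof.
move=> bA; apply/phi_top; rewrite (_ : (phi @` _)%classic = A) //.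
have [psi _ psiK] := phi_bij.
apply/seteqP; split=> [_ [x Ax <-] //|y Ay].
by exists (psi y); rewrite ?psiK.
Qed.

(** On coefficient i impose the conditions that exclude those y j which have order i and j < |i|.
    These are finitely many for each i, and every y j is excluded because its order is less than
    -j. *)
Lemma param_separating : separating D top.
Proof.
have [_ topT _ _] := ST.1.
split=> [y yO|U /phi_top /(box_low ST)[N NP]]; last first.
  exists N => x /val_ge_coe xN; have [z Uz] := NP _ xN.
  by move/(bij_inj phi_bij) => <-.
have y0 j : phi (y j) != 0.
  by apply: phi_neq0; apply: contra_notN (yO j) => /eqP ->; exact: val_ge_0.
have lo j : lord (phi (y j)) < - j%:Z.
  rewrite ltNge; apply/negP => /(lord_ge _ (y0 j)) h; apply: (yO j).
  exact/val_ge_coe.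
have /choice[W WP] j : exists W, TX W /\ ~ W (cf (phi (y j)) (lord (phi (y j)))).
  by have [W TW nW] := HX (lordP (y0 j)).1; exists W.
pose B (i : int) : set X := fun c => forall j : 'I_(absz i),
  (if lord (phi (y j)) == i then W j else setT) c.
have TB i : TX (B i).
  apply: (TX_cap ST (W := fun j : 'I_(absz i) => if lord (phi (y j)) == i then W j else setT)).
  by move=> j; case: eqP => // _; have [] := WP j.
exists (fun x => forall i : int, i < 0 -> B i (cf (phi x) i)).
  by apply: (phi_pre (A := fun z => forall i : int, i < 0 -> B i (cf z i))); exact: box_box.
move=> j h; have [_ nW] := WP j; have lj := lo j.
have lj0 : lord (phi (y j)) < 0 by lia.
have lt_j : (j < absz (lord (phi (y j))))%N by lia.
by have := h _ lj0 (Ordinal lt_j); rewrite eqxx.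
Qed.

(** phi1 sends the residue of x to coefficient 0 of phi x. It is well defined and injective because
    phi respects the valuations, and [box_residue] matches the topologies. *)
Lemma param_residue : exists phi1 : {rmorphism k1 -> X},
  [/\ bijective phi1, forall c, phi1 (kmap k1 c) = kmap X c &
      forall U, residue_topology D top U <-> TX (phi1 @` U)%classic].
Proof.
have [psi phiK psiK] := phi_bij.
pose lft a := s2val (cid2 (dres_surj D a)).
have lftO a : O 0 (lft a) by rewrite /lft; case: cid2.
have lftE a : dres D (lft a) = a by rewrite /lft; case: cid2.
pose p a := cf (phi (lft a)) 0.
have pE x : O 0 x -> p (dres D x) = cf (phi x) 0.
  move=> Ox; have Ol := lftO (dres D x).
  have : O 1 (lft (dres D x) - x).
    apply/dres_ker; first exact: val_geB.
    have := dresD (val_geB Ol Ox) Ox; rewrite subrK lftE => /eqP.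
    by rewrite -{1}[dres D x]add0r => /eqP/addIr.
  move=> /val_ge_coe /(_ 0 isT); rewrite rmorphB coeD coeN => /eqP.
  by rewrite subr_eq0 => /eqP.
have cM (f g : laurent1 X) : (forall j : int, j < 0 -> cf f j = 0) ->
    (forall j : int, j < 0 -> cf g j = 0) -> cf (f * g) 0 = cf f 0 * cf g 0.
  move=> /coe_int[a ->] g0; rewrite expr0z mul1r (@coe_mulf _ _ _ _ 1).
    by rewrite big_ord1 subr0 (coe_tofrac a 0).
  by move=> l l1; apply: g0; lia.
have pZ : zmod_morphism p.
  move=> a b; rewrite -{1}[a]lftE -{1}[b]lftE.
  have e : dres D (lft a) - dres D (lft b) = dres D (lft a - lft b).
    apply/eqP; rewrite subr_eq -dresD ?subrK //; exact: val_geB.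
  by rewrite e pE ?rmorphB ?coeD ?coeN //; exact: val_geB.
have pM : monoid_morphism p.
  split.
    rewrite -(dres1 D) pE; last exact: val_ge1.
    by rewrite rmorph1 -(expr0z (tL X)) coe_monomial eqxx.
  move=> a b; rewrite -{1}[a]lftE -{1}[b]lftE -dresM // pE; last exact: O0M.
  by rewrite rmorphM cM //; exact/val_ge_coe.
exists (mk_rmorph pZ pM); rewrite /=.
have pK c : p (kmap k1 c) = kmap X c.
  have [Oc <-] := compat c; rewrite pE // phi_kmap /=.
  exact: (coe_tofrac (pconst (kmap X c)) 0).
have pB : bijective p.
  have p_surj c : exists a, p a = c.
    exists (dres D (psi (tofrac (pconst c)))).
    rewrite pE; first by rewrite psiK; exact: (coe_tofrac (pconst c) 0).
    apply/val_ge_coe; rewrite psiK; apply/coe_int; exists (pconst c).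
    by rewrite expr0z mul1r.
  have p_inj : injective p.
    move=> a b ab; apply/eqP; rewrite -subr_eq0; apply/eqP.
    have := fmorph_eq0 (mk_rmorph pZ pM) (a - b).
    by rewrite /= pZ ab subrr eqxx => /esym/eqP.
  have [r rE] := choice p_surj.
  by exists r => // a; apply: p_inj; rewrite rE.
split=> // U.
have [r pKr rK] := pB.
have kU : ksub (kmap k1) U <-> ksub (kmap X) (p @` U)%classic.
  have pU a : (p @` U)%classic (p a) <-> U a.
    by split=> [[b Ub /(bij_inj pB) <-]|Ua] //; exists a.
  have pL c a b : p (kmap k1 c * a + b) = kmap X c * p a + p b.
    by have := rmorphD (mk_rmorph pZ pM) (kmap k1 c * a) b; rewrite rmorphM /= pK.
  have p0 : p 0 = 0 by exact: (rmorph0 (mk_rmorph pZ pM)).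
  split=> [[U0 UP]|[U0 UP]]; split.
  - by rewrite -p0; apply/pU.
  - by move=> c _ _ [a Ua <-] [b Ub <-]; rewrite -pL; apply/pU/UP.
  - by apply/pU; rewrite p0.
  - by move=> c a b /pU Ua /pU Ub; apply/pU; rewrite pL; exact: UP.
split=> [[/kU kpU [W TW WU]]|TU].
  apply/(box_residue ST kpU); exists (phi @` W)%classic; first exact/phi_top.
  move=> y x0 [x Wx e]; rewrite -e in x0 *.
  have Ox : O 0 x by apply/val_ge_coe.
  by rewrite -pE //; exists (dres D x) => //; exact: WU.
have kpU := ksub_of ST TU; split; first exact/kU.
have [A bA AU] := (box_residue ST kpU).1 TU.
exists (fun x => A (phi x)); first exact: phi_pre.
move=> x Ox Ax; have [|a Ua] := AU (phi x) _ Ax; first exact/val_ge_coe.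
by rewrite -pE // => /(bij_inj pB) <-.
Qed.
End Step.

(** Only K itself comes with a parametrization; [param_residue] transports it down the tower. *)
Lemma tower_nice (k : fieldType) (F : kfield k) n (K : kfield k) (T : tower n K)
    (top : set (set K)) (phi : {rmorphism K -> laurent F n}) :
  bijective phi -> (forall c, phi (kmap K c) = kmap (laurent F n) c) ->
  (forall U, top U <-> @laurent_topology k F n (phi @` U)%classic) -> nice T top.
Proof.
elim: T top phi => {n K} [//|n K k1 D e T1 IH] top phi phiB phiK phiT.
have [ST HX] := laurent_ST F n.
have phiT' U : top U <-> box (@laurent_topology k F n) (phi @` U)%classic.
  by rewrite -(laurent1_box ST); exact: phiT.
split; first exact: (param_separating e ST HX phiB phiT').
have [phi1 [phi1B phi1K phi1T]] := param_residue e ST phiB phiK phiT'.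
exact: (IH _ phi1).
Qed.

Lemma tlf_nice (k : fieldType) n (K : tlf k n) : nice (tlf_tower K) (@tlf_top k n K).
Proof. by have [F [_ [phi [phiB phiK phiT]]]] := tlf_param K; exact: (tower_nice _ phiB). Qed.

(** * Exact sequences of pro- and ind-objects *)

Section Systems.
Variables (k : fieldType) (C : Defs.cat k) (F : functor C (Vect k)).
Variable tame : C -> Prop.
Hypothesis tameF : forall x y, tame x -> tame y -> faithful F x y.

Definition ptame (X : pro C) : Prop :=
  (forall i : ind_idx X, tame (X i : C)) /\ psurj F X.

Lemma ptameF (X Y : pro C) : ptame X -> ptame Y -> faithful (evpro F) X Y.
Proof. by move=> [tX sX] [tY _]; apply: pro_faithful => // i j; exact: tameF. Qed.

Definition pcomplete (V : lmodType k) (S : V -> Prop) (N : nat -> V -> Prop) : Prop :=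
  forall p : nat -> V, (forall i, S (p i)) ->
    (forall i j, (i <= j)%N -> N i (p j - p i)) ->
    exists2 x, S x & forall i, N i (x - p i).

(* A tower of objects presenting the quotients S / N_i of V, to be made into a
   pro-object *)
Record psys (V : lmodType k) (S : V -> Prop) := Psys {
  ps_ob : nat -> C;
  ps_N : nat -> V -> Prop;
  ps_pres : forall i, pres F (ps_ob i) S (ps_N i);
  ps_tame : forall i, tame (ps_ob i);
  ps_tr : forall i j, (i <= j)%N -> exists g : mor (ps_ob j) (ps_ob i),
    rz (ps_pres j) (ps_pres i) g id /\
    inflation (C := opc C) (x := ps_ob i) (y := ps_ob j) g;
  ps_complete : pcomplete S ps_N }.

Section PO.
Variables (V : lmodType k) (S : V -> Prop) (A : psys S).

(** [psys] only asserts that transition maps exist. They are chosen one by one, and faithfulness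
    makes the choices functorial. *)
Definition po_map i j (u : (i <= j)%N) : mor (ps_ob A j) (ps_ob A i) :=
  projT1 (cid (ps_tr A u)).
Lemma po_mapP i j (u : (i <= j)%N) :
  rz (ps_pres A j) (ps_pres A i) (po_map u) id /\
  inflation (C := opc C) (x := ps_ob A i) (y := ps_ob A j) (po_map u).
Proof. exact: (projT2 (cid (ps_tr A u))). Qed.
Fact po_map1 i : po_map (leqnn i) = idm (ps_ob A i).
Proof.
apply: (rz_inj _ (po_mapP (leqnn i)).1 (rz1 _)).
by apply: tameF; exact: ps_tame.
Qed.
Fact po_mapM i j l (v : (j <= l)%N) (u : (i <= j)%N) :
  po_map (leq_trans u v) = mcomp (po_map u) (po_map v).
Proof.
apply: (rz_inj _ (po_mapP _).1 (rzM (po_mapP v).1 (po_mapP u).1)).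
by apply: tameF; exact: ps_tame.
Qed.
Definition po_diag : diag natcat (opc C) :=
  @Diag k natcat (opc C) (ps_ob A) (fun i j u => po_map u) po_map1 po_mapM.
Fact po_adm : admissible po_diag.
Proof. by move=> i j u; exact: (po_mapP u).2. Qed.
Definition po : pro C := IndOb po_adm.
Definition po_pres : pres (evpro F) po S (fun x => forall i, ps_N A i x) :=
  pro_pres (X := po) (P := ps_pres A) (fun i j u => (po_mapP u).1) (@ps_complete _ _ A).
Lemma po_ptame : ptame po.
Proof.
split; first exact: ps_tame.
apply: (pro_psurj (X := po) (P := ps_pres A)) => // i j u; exact: (po_mapP u).1.
Qed.
End PO.

Lemma rz_po (V W : lmodType k) (S : V -> Prop) (S' : W -> Prop)
    (A : psys S) (B : psys S') (phi : V -> W) :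
  (forall j, exists i (g : mor (ps_ob A i) (ps_ob B j)),
     rz (ps_pres A i) (ps_pres B j) g phi) ->
  exists f : mor (po A) (po B), rz (po_pres A) (po_pres B) f phi.
Proof.
move=> h; apply: rz_pro_ex => // i j; apply: tameF; exact: ps_tame.
Qed.

Section ConfPro.
Variables (U V W : lmodType k) (SA : U -> Prop) (SB : V -> Prop) (SD : W -> Prop).
Variables (A : psys SA) (B : psys SB) (D : psys SD).
Variables (phi : U -> V) (psi : V -> W).
Hypothesis lev : forall i, exists (s : mor (ps_ob A i) (ps_ob B i))
  (t : mor (ps_ob B i) (ps_ob D i)),
  [/\ rz (ps_pres A i) (ps_pres B i) s phi, rz (ps_pres B i) (ps_pres D i) t psi &
      conf s t].
Variables (X Y Z : pro C) (NX : U -> Prop) (NY : V -> Prop) (NZ : W -> Prop).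
Variables (PX : pres (evpro F) X SA NX) (PY : pres (evpro F) Y SB NY).
Variables (PZ : pres (evpro F) Z SD NZ).
Hypotheses (tX : ptame X) (tY : ptame Y) (tZ : ptame Z).
Definition pisom (X Y : pro C) (V : lmodType k) (S N N' : V -> Prop)
  (P : pres (evpro F) X S N) (Q : pres (evpro F) Y S N') : Prop :=
  (exists a : mor X Y, rz P Q a id) /\ (exists b : mor Y X, rz Q P b id).
Hypotheses (iX : pisom PX (po_pres A)) (iY : pisom PY (po_pres B)).
Hypothesis iZ : pisom PZ (po_pres D).

(** All squares required of a conflation commute because both paths cover the same map of ambient
    spaces. Pro-objects being opposite to ind-objects, the levelwise sequence is supplied in the
    order D, B, A. *)
Lemma conf_pro (f : mor X Y) (g : mor Y Z) :
  rz PX PY f phi -> rz PY PZ g psi -> conf f g.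
Proof.
move=> fP gP.
pose s i := projT1 (cid (lev i)).
have sP i : exists t : mor (ps_ob B i) (ps_ob D i),
    [/\ rz (ps_pres A i) (ps_pres B i) (s i) phi, rz (ps_pres B i) (ps_pres D i) t psi &
        conf (s i) t] by exact: (projT2 (cid (lev i))).
pose t i := projT1 (cid (sP i)).
have stP i : [/\ rz (ps_pres A i) (ps_pres B i) (s i) phi,
    rz (ps_pres B i) (ps_pres D i) (t i) psi & conf (s i) (t i)].
  exact: (projT2 (cid (sP i))).
have ns : natural (D := po_diag D) (E := po_diag B) (fun i => t i : mor (po_diag D i) (po_diag B i)).
  move=> i j u; have [_ tj _] := stP j; have [_ ti _] := stP i.
  apply: (rz_inj _ (rzM tj (po_mapP D u).1) (rzM (po_mapP B u).1 ti)).
  by apply: tameF; exact: ps_tame.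
have nt : natural (D := po_diag B) (E := po_diag A) (fun i => s i : mor (po_diag B i) (po_diag A i)).
  move=> i j u; have [sj _ _] := stP j; have [si _ _] := stP i.
  apply: (rz_inj _ (rzM sj (po_mapP B u).1) (rzM (po_mapP A u).1 si)).
  by apply: tameF; exact: ps_tame.
have [[x' x'P] [x xP]] := iX; have [[y' y'P] [y yP]] := iY.
have [[z' z'P] [z zP]] := iZ.
have [tA tB tD] := And3 (po_ptame A) (po_ptame B) (po_ptame D).
exists natcat, (po_diag D), (po_diag B), (po_diag A).
exists (@po_adm _ _ D), (@po_adm _ _ B), (@po_adm _ _ A).
exists t, s, ns, nt; split; first by move=> i; have [] := stP i.
exists z, z', y, y', x, x'; split; first split.
- exact: (rz_iso (C := pro C) (ptameF tZ tZ) (ptameF tD tD) z'P zP).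
- exact: (rz_iso (C := pro C) (ptameF tY tY) (ptameF tB tB) y'P yP).
- exact: (rz_iso (C := pro C) (ptameF tX tX) (ptameF tA tA) x'P xP).
have tR : rz (po_pres B) (po_pres D) (indlvl (@po_adm _ _ D) (@po_adm _ _ B) ns : mor (po B) (po D)) psi.
  apply: rz_pro => i; exists i, (t i); split=> //; by have [] := stP i.
have sR : rz (po_pres A) (po_pres B) (indlvl (@po_adm _ _ B) (@po_adm _ _ A) nt : mor (po A) (po B)) phi.
  apply: rz_pro => i; exists i, (s i); split=> //; by have [] := stP i.
split.
  apply: (rz_inj (C := pro C) (ptameF tB tZ) (rzM yP gP)).
  exact: (rzM tR zP).
apply: (rz_inj (C := pro C) (ptameF tA tY) (rzM xP fP)).
exact: (rzM sR yP).
Qed.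
End ConfPro.

Definition itame (X : ind (pro C)) : Prop :=
  (forall i, ptame (X i)) /\ iinj (evpro F) X.

Lemma itameF (X Y : ind (pro C)) : itame X -> itame Y ->
  faithful (evind (evpro F)) X Y.
Proof. by move=> [tX _] [tY iY]; apply: ind_faithful => // i j; exact: ptameF. Qed.

Record isys (V : lmodType k) (N : V -> Prop) := Isys {
  is_ob : nat -> pro C;
  is_S : nat -> V -> Prop;
  is_pres : forall i, pres (evpro F) (is_ob i) (is_S i) N;
  is_ptame : forall i, ptame (is_ob i);
  is_tr : forall i j, (i <= j)%N -> exists g : mor (is_ob i) (is_ob j),
    rz (is_pres i) (is_pres j) g id /\ inflation g }.

Section IO.
Variables (V : lmodType k) (N : V -> Prop) (A : isys N).

Definition io_map i j (u : (i <= j)%N) : mor (is_ob A i) (is_ob A j) :=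
  projT1 (cid (is_tr A u)).
Lemma io_mapP i j (u : (i <= j)%N) :
  rz (is_pres A i) (is_pres A j) (io_map u) id /\ inflation (io_map u).
Proof. exact: (projT2 (cid (is_tr A u))). Qed.
Fact io_map1 i : io_map (leqnn i) = idm (is_ob A i).
Proof.
apply: (rz_inj _ (io_mapP (leqnn i)).1 (rz1 _)).
by apply: ptameF; exact: is_ptame.
Qed.
Fact io_mapM i j l (v : (j <= l)%N) (u : (i <= j)%N) :
  io_map (leq_trans u v) = mcomp (io_map v) (io_map u).
Proof.
apply: (rz_inj _ (io_mapP _).1 (rzM (io_mapP u).1 (io_mapP v).1)).
by apply: ptameF; exact: is_ptame.
Qed.
Definition io_diag : diag natcat (pro C) :=
  @Diag k natcat (pro C) (is_ob A) (fun i j u => io_map u) io_map1 io_mapM.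
Fact io_adm : admissible io_diag.
Proof. by move=> i j u; exact: (io_mapP u).2. Qed.
Definition io : ind (pro C) := IndOb io_adm.
Definition io_pres : pres (evind (evpro F)) io (ind_S (X := io) (is_S A)) N :=
  ind_pres (X := io) (P := is_pres A) (fun i j u => (io_mapP u).1).
Lemma io_itame : itame io.
Proof.
split; first exact: is_ptame.
apply: (ind_iinj (X := io) (P := is_pres A)) => i j u; exact: (io_mapP u).1.
Qed.
End IO.

Section ConfInd.
Variables (U V W : lmodType k) (NA : U -> Prop) (NB : V -> Prop) (ND : W -> Prop).
Variables (A : isys NA) (B : isys NB) (D : isys ND).
Variables (phi : U -> V) (psi : V -> W).
Hypothesis lev : forall i, exists (s : mor (is_ob A i) (is_ob B i))
  (t : mor (is_ob B i) (is_ob D i)),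
  [/\ rz (is_pres A i) (is_pres B i) s phi, rz (is_pres B i) (is_pres D i) t psi &
      conf s t].
Variables (X Y Z : ind (pro C)) (SX : U -> Prop) (SY : V -> Prop) (SZ : W -> Prop).
Variables (PX : pres (evind (evpro F)) X SX NA) (PY : pres (evind (evpro F)) Y SY NB).
Variables (PZ : pres (evind (evpro F)) Z SZ ND).
Hypotheses (tX : itame X) (tY : itame Y) (tZ : itame Z).
Definition iisom (X Y : ind (pro C)) (V : lmodType k) (S S' N : V -> Prop)
  (P : pres (evind (evpro F)) X S N) (Q : pres (evind (evpro F)) Y S' N) : Prop :=
  (exists a : mor X Y, rz P Q a id) /\ (exists b : mor Y X, rz Q P b id).
Hypotheses (iX : iisom PX (io_pres A)) (iY : iisom PY (io_pres B)).
Hypothesis iZ : iisom PZ (io_pres D).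

Lemma conf_ind (f : mor X Y) (g : mor Y Z) :
  rz PX PY f phi -> rz PY PZ g psi -> conf f g.
Proof.
move=> fP gP.
pose s i := projT1 (cid (lev i)).
have sP i : exists t : mor (is_ob B i) (is_ob D i),
    [/\ rz (is_pres A i) (is_pres B i) (s i) phi, rz (is_pres B i) (is_pres D i) t psi &
        conf (s i) t] by exact: (projT2 (cid (lev i))).
pose t i := projT1 (cid (sP i)).
have stP i : [/\ rz (is_pres A i) (is_pres B i) (s i) phi,
    rz (is_pres B i) (is_pres D i) (t i) psi & conf (s i) (t i)].
  exact: (projT2 (cid (sP i))).
have ns : natural (D := io_diag A) (E := io_diag B) s.
  move=> i j u; have [sj _ _] := stP j; have [si _ _] := stP i.
  apply: (rz_inj _ (rzM (io_mapP A u).1 sj) (rzM si (io_mapP B u).1)).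
  by apply: ptameF; exact: is_ptame.
have nt : natural (D := io_diag B) (E := io_diag D) t.
  move=> i j u; have [_ tj _] := stP j; have [_ ti _] := stP i.
  apply: (rz_inj _ (rzM (io_mapP B u).1 tj) (rzM ti (io_mapP D u).1)).
  by apply: ptameF; exact: is_ptame.
have [[x xP] [x' x'P]] := iX; have [[y yP] [y' y'P]] := iY.
have [[z zP] [z' z'P]] := iZ.
have [tA tB tD] := And3 (io_itame A) (io_itame B) (io_itame D).
exists natcat, (io_diag A), (io_diag B), (io_diag D).
exists (@io_adm _ _ A), (@io_adm _ _ B), (@io_adm _ _ D).
exists s, t, ns, nt; split; first by move=> i; have [] := stP i.
exists x, x', y, y', z, z'; split; first split.
- exact: (rz_iso (itameF tX tX) (itameF tA tA) xP x'P).
- exact: (rz_iso (itameF tY tY) (itameF tB tB) yP y'P).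
- exact: (rz_iso (itameF tZ tZ) (itameF tD tD) zP z'P).
have sR : rz (io_pres A) (io_pres B) (indlvl (@io_adm _ _ A) (@io_adm _ _ B) ns) phi.
  apply: rz_ind => i; exists i, (s i); split=> //; by have [] := stP i.
have tR : rz (io_pres B) (io_pres D) (indlvl (@io_adm _ _ B) (@io_adm _ _ D) nt) psi.
  apply: rz_ind => i; exists i, (t i); split=> //; by have [] := stP i.
split.
  apply: (rz_inj (itameF tX tB) (rzM fP yP)).
  exact: (rzM xP sR).
apply: (rz_inj (itameF tY tD) (rzM gP zP)).
exact: (rzM yP tR).
Qed.
End ConfInd.
End Systems.

(* G lifts the forgetful functor along F.  The class of tame objects, which
   contains the values of G, is one on which F is faithful. *)
Record lifts_forget (k : fieldType) (C : Defs.cat k) (F : functor C (Vect k))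
    (tame : C -> Prop) (K : kfield k) (G : functor (Vectf K) C) := LiftsForget {
  lf_pres : forall A : Vectf K,
    pres F (G A) (V := restr (kmap K) (sval A)) (fun=> True) (fun x => x = 0);
  lf_tame : forall A, tame (G A);
  lf_nat : forall (A B : Vectf K) (f : mor A B),
    rz (lf_pres A) (lf_pres B) (fmap G f) (f : linhom _ _);
  lf_conf : forall (A B D : Vectf K) (f : mor A B) (g : mor B D),
    conf f g -> conf (fmap G f) (fmap G g) }.

(** * The inductive step of sharp *)

Section Lattices.
Variables (k : fieldType) (C : Defs.cat k) (F : functor C (Vect k)).
Variable tame : C -> Prop.
Hypothesis tameF : forall x y, tame x -> tame y -> faithful F x y.
Variables (K k1 : kfield k) (D : cdvf K k1) (s : lifting D).
Variable G : functor (Vectf k1) C.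
Variable LG : lifts_forget F tame G.
Local Notation R V := (restr (kmap K) V).

Section Quotient.
Variables (V : lmodType K) (L L' : osub D V) (h : findim (oquot s L L')).

Definition Q : Vectf k1 := exist _ (oquot s L L' : lmodType k1) h.

(** The ambient space is V over k, where the lifting has disappeared: quotients formed with
    different liftings are presented in the same space. *)
Definition q_pr (x : R V) : F (G Q) := lf_pres LG Q (cls s L L' x).

Fact q_S0 : L (0 : V). Proof. exact: omem0. Qed.
Fact q_SP a (y z : R V) : L y -> L z -> L (a *: y + z).
Proof. by move=> Ly Lz; apply: (omemD (o := L)) => //; exact: osub_kmap s _ _ _ _ _. Qed.
Fact q_lin a (y z : R V) : L y -> L z -> q_pr (a *: y + z) = a *: q_pr y + q_pr z.
Proof.
move=> Ly Lz; rewrite /q_pr -(pr_lin (lf_pres LG Q)) //; congr (lf_pres LG Q _).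
exact: (cls_kmap s L' a Ly Lz).
Qed.
Fact q_surj v : exists2 y : R V, L y & q_pr y = v.
Proof.
have [q _ <-] := pr_surj (lf_pres LG Q) v.
by have [x Lx <-] := cls_surj (q : oquot s L L'); exists x.
Qed.
Fact q_ker (y : R V) : L y -> (q_pr y = 0 <-> L' y).
Proof.
move=> Ly; apply: iff_trans (pr_ker (lf_pres LG Q) (y := cls s L L' y) I) _.
exact: cls_ker.
Qed.
Definition qpres : pres F (G Q) (V := R V) L L' :=
  Pres (F := F) (x := G Q) (V := R V) q_S0 q_SP q_lin q_surj q_ker.
End Quotient.

Lemma rz_q (V W : lmodType K) (f : V -> W) (L L' : osub D V) (M M' : osub D W)
    (h : findim (oquot s L L')) (h' : findim (oquot s M M')) (u : mor (Q h) (Q h')) :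
  (forall x, L x -> M (f x)) ->
  (forall x, L x -> (u : linhom _ _) (cls s L L' x) = cls s M M' (f x)) ->
  rz (qpres h) (qpres h') (fmap G u) f.
Proof.
move=> fM uE x Lx; split; first exact: fM.
have [_] := lf_nat LG u (v := cls s L L' x) I.
by rewrite /= /q_pr => ->; congr (lf_pres LG (Q h') _); exact: uE.
Qed.

Lemma q_ex (V W : lmodType K) (f : {linear V -> W}) (L L' : osub D V) (M M' : osub D W)
    (h : findim (oquot s L L')) (h' : findim (oquot s M M')) :
  (forall x, L x -> M (f x)) -> (forall x, L x -> L' x -> M' (f x)) ->
  exists g : mor (G (Q h)) (G (Q h')), rz (qpres h) (qpres h') g f.
Proof.
move=> fM fM'.
have [|u uE] := @cls_map k K k1 D s V W L L' M M' f _ fM fM'.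
  by move=> a x y _ _; rewrite linearP.
by exists (fmap G (u : mor (Q h) (Q h'))); exact: rz_q.
Qed.

(** The hypotheses spell out, on representatives, that A/A' → B/B' → E/E' is short exact over k_1; G
    preserves conflations. *)
Lemma q_conf (U V W : lmodType K) (f : {linear U -> V}) (g : {linear V -> W})
    (A A' : osub D U) (B B' : osub D V) (E E' : osub D W)
    (hA : findim (oquot s A A')) (hB : findim (oquot s B B'))
    (hE : findim (oquot s E E')) :
  (forall x, A x -> B (f x)) -> (forall x, A x -> (A' x <-> B' (f x))) ->
  (forall y, B y -> E (g y)) -> (forall y, B y -> B' y -> E' (g y)) ->
  (forall z, E z -> exists2 y, B y & E' (g y - z)) ->
  (forall x, A x -> E' (g (f x))) ->
  (forall y, B y -> E' (g y) -> exists2 x, A x & B' (f x - y)) ->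
  exists (u : mor (G (Q hA)) (G (Q hB))) (w : mor (G (Q hB)) (G (Q hE))),
    [/\ rz (qpres hA) (qpres hB) u f, rz (qpres hB) (qpres hE) w g & conf u w].
Proof.
move=> fB fB' gE gE' gS gf gK.
have [||u uE] := @cls_map k K k1 D s U V A A' B B' f _ fB.
- by move=> a x y _ _; rewrite linearP.
- by move=> x Ax /fB'; exact.
have [|w wE] := @cls_map k K k1 D s V W B B' E E' g _ gE gE'.
  by move=> a x y _ _; rewrite linearP.
exists (fmap G (u : mor (Q hA) (Q hB))), (fmap G (w : mor (Q hB) (Q hE))).
split; [exact: rz_q|exact: rz_q|apply: (lf_conf LG)].
split=> [p q|z|y].
- have [x Ax <-] := cls_surj p; have [y Ay <-] := cls_surj q.
  rewrite !uE // => /(cls_eq _ _ (fB _ Ax) (fB _ Ay)) xy.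
  apply/cls_eq => //; apply/fB'; first exact: osubB.
  by rewrite linearB.
- have [x Ex <-] := cls_surj z; have [y By yx] := gS x Ex.
  by exists (cls s B B' y); rewrite wE //; apply/cls_eq => //; exact: gE.
- have [x Bx <-] := cls_surj y; rewrite wE //; split.
    move/(cls_ker _ _ (gE _ Bx)) => /gK-/(_ Bx)[z Az zx].
    by exists (cls s A A' z); rewrite uE //; apply/cls_eq => //; exact: fB.
  move=> [p]; have [z Az <-] := cls_surj p.
  rewrite uE // => /(cls_eq _ _ (fB _ Az) Bx) zx; apply/cls_ker; first exact: gE.
  rewrite -[x](subKr (f z)) linearB; apply: (osubB (L := E')); first exact: gf.
  by apply: gE' => //; apply: (osubB (L := B)) => //; exact: fB.
Qed.

(** A sequence cofinal among the lattices in L. The limit of the L/L_j does not depend on it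
    ([filt_interleave]), so each exactness claim may use the sequence that suits it. *)
Definition filt (V : lmodType K) (L : osub D V) (Lj : nat -> osub D V) : Prop :=
  [/\ lat L, forall j, lat (Lj j),
      forall i j, (i <= j)%N -> forall x, Lj j x -> Lj i x,
      forall j x, Lj j x -> L x &
      forall M : osub D V, lat M -> exists j, forall x, Lj j x -> M x].

Lemma bspan_le (V : lmodType K) (b : basis V) i j : (i <= j)%N ->
  forall x, bspan D b j x -> bspan D b i x.
Proof. by move=> ij x /bspan_blv h; apply/bspan_blv; apply: blv_le h; lia. Qed.

Lemma bspan_filt (V : lmodType K) (L : osub D V) (b : basis V) N : lat L ->
  (forall x, bspan D b N x -> L x) -> filt L (fun j => bspan D b (j + N)).
Proof.
move=> lL NL; split=> // [j|i j ij x|j x h|M lM].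
- exact: bspan_lat.
- by apply: bspan_le; lia.
- by apply/NL/(bspan_le _ h); lia.
have [j jP] := small_bspan b lM; exists j => x; apply: jP; lia.
Qed.

Lemma filt_sep (V : lmodType K) (L : osub D V) Lj : findim V -> filt L Lj ->
  forall x, (forall j, Lj j x) <-> x = 0.
Proof.
move=> /basis_exists[b _] [_ _ _ _ cof] x; split=> [h|-> j]; last exact: omem0.
apply: (blv_sep (D := D) (b := b)) => z.
by have [j jP] := cof _ (blv_lat D b z); exact: jP.
Qed.

(** The coordinates of p in a basis are Cauchy in K. Lattices are open, hence closed, so the limit
    stays in L and differs from p i by an element of L_i. *)
Lemma filt_complete (V : lmodType K) (L : osub D V) Lj : findim V -> filt L Lj ->
  pcomplete (V := R V) L (fun j => Lj j).
Proof.
move=> /basis_exists[b _] [lL lLj dec sub cof] p pL pC.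
have [l lP] : exists l : 'I_(brank b) -> K, forall c (i : int), exists N,
    forall n, (N <= n)%N -> val_ge (dv D) i (bco b (p n) c - l c).
  suff /choice[l lP] : forall c, exists l, forall i : int, exists N,
    forall n, (N <= n)%N -> val_ge (dv D) i (bco b (p n) c - l) by exists l.
  move=> c; apply: (dv_complete (c := D) (u := fun n => bco b (p n) c)) => i.
  have [j jP] := cof _ (blv_lat D b i).
  have jC n : (j <= n)%N -> blv D b i (p n - p j) by move=> jn; apply/jP/pC.
  exists j => m n jm jn.
  have -> : bco b (p m) c - bco b (p n) c = bco b ((p m - p j) - (p n - p j)) c.
    rewrite [(_ - _) - _](_ : _ = (-1 : K) *: (p n : V) + (p m : V)).
      by rewrite bcoP mulN1r addrC.
    by rewrite scaleN1r opprB addrA subrK addrC.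
  exact: (osubB (jC m jm) (jC n jn)).
pose x : V := \sum_c l c *: b c.
have xE : bco b x = l by apply: bco_uniq.
have xP z : exists N, forall n, (N <= n)%N -> blv D b z ((p n : V) - x).
  have [N NP] := choice (fun c => lP c z).
  exists (\sum_c N c)%N => n Nn c.
  have -> : bco b ((p n : V) - x) c = bco b (p n) c - l c.
    by rewrite -scaleN1r addrC bcoP xE mulN1r addrC.
  by apply: NP; apply: leq_trans Nn; rewrite (bigD1 c) //= leq_addr.
have xL (M : osub D V) : lat M -> exists N, forall n, (N <= n)%N -> M ((p n : V) - x).
  move=> /(lat_lb b)[z zP]; have [N NP] := xP z%:Z; exists N => n Nn.
  exact/zP/NP.
exists x.
  have [N NP] := xL L lL; rewrite -[x](subKr (p N : V)).
  by apply: osubB; [exact: pL|exact: NP].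
move=> i; have [N NP] := xL _ (lLj i); pose n := (N + i)%N.
have -> : x - (p i : V) = ((p n : V) - p i) - ((p n : V) - x).
  by rewrite opprB [RHS]addrC addrA subrK.
by apply: osubB; [apply: pC; exact: leq_addl|apply: NP; exact: leq_addr].
Qed.

Lemma const_complete (V : lmodType K) (L L' : osub D V) :
  pcomplete (V := R V) L (fun _ : nat => L').
Proof.
move=> p pL pC; exists (p 0%N) => // i.
by rewrite -opprB; apply: (osubN (L := L')); exact: pC.
Qed.

Variable V : lmodType K.
Hypothesis fV : findim V.

(** The map L/L' → L/L'' is the cokernel of L''/L' → L/L', hence an admissible epic. *)
Lemma q_deflation (L L' L'' : osub D V) (h : findim (oquot s L L'))
    (h' : findim (oquot s L L'')) : lat L -> lat L' -> lat L'' ->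
  (forall x, L'' x -> L x) -> (forall x, L' x -> L'' x) ->
  exists g : mor (G (Q h)) (G (Q h')), rz (qpres h) (qpres h') g id /\
    inflation (C := opc C) (x := G (Q h')) (y := G (Q h)) g.
Proof.
move=> lL lL' lL'' L''L L'L''.
have [||||||| u [w [uP wP uw]]] := @q_conf V V V idfun idfun L'' L' L L' L L''
  (findim_oquot s lL'' lL') h h' => //.
- by move=> y _; exact: L'L''.
- by move=> z Lz; exists z => //; rewrite subrr; exact: omem0.
- by move=> y Ly L''y; exists y => //; rewrite subrr; exact: omem0.
by exists w; split=> //; right; exists (G (Q (findim_oquot s lL'' lL'))), u.
Qed.

Section FiltSystem.
Variables (L : osub D V) (Lj : nat -> osub D V) (fL : filt L Lj).

Fact filt_findim j : findim (oquot s L (Lj j)).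
Proof. by have [lL lLj _ _ _] := fL; exact: findim_oquot. Qed.

Fact filt_tr i j : (i <= j)%N -> exists g : mor (G (Q (filt_findim j))) (G (Q (filt_findim i))),
  rz (qpres (filt_findim j)) (qpres (filt_findim i)) g id /\
  inflation (C := opc C) (x := G (Q (filt_findim i))) (y := G (Q (filt_findim j))) g.
Proof.
move=> ij; have [lL lLj dec sub _] := fL; apply: q_deflation => //; first exact: sub.
exact: dec.
Qed.

Definition filt_sys : psys F tame (V := R V) L :=
  Psys (ps_ob := fun i => G (Q (filt_findim i))) (fun i => lf_tame LG _) filt_tr
    (filt_complete fV fL).
End FiltSystem.

Section ConstSystem.
Variables (M L : osub D V) (h : findim (oquot s M L)).

Fact const_tr (i j : nat) : (i <= j)%N -> exists g : mor (G (Q h)) (G (Q h)),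
  rz (qpres h) (qpres h) g id /\ inflation (C := opc C) (x := G (Q h)) (y := G (Q h)) g.
Proof.
move=> _; exists (idm _); split; first exact: rz1.
by left; exists (idm _); split; exact: comp1m.
Qed.

Definition const_sys : psys F tame (V := R V) M :=
  Psys (ps_ob := fun i => G (Q h)) (fun i => lf_tame LG _) const_tr
    (@const_complete V M L).

Fact pcst_nat : forall i j (u : ihom i j), rz (qpres h) (qpres h)
  (dmap (pcst (G (Q h)) : indob (opc C)) u : mor (pcst (G (Q h)) j : C) (pcst (G (Q h)) i : C)) id.
Proof. by move=> i j u; exact: rz1. Qed.

Fact pcst_complete (p : unit -> R V) : (forall i, M (p i)) ->
  (forall i j : unit, unit -> L (p j - p i)) ->
  exists2 x, M x & forall i, L (x - p i).
Proof.
move=> pM _; exists (p tt) => // -[]; rewrite subrr; exact: omem0.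
Qed.

Definition pcst_pres : pres (evpro F) (pcst (G (Q h))) (V := R V) M
    (fun x => forall i : unit, L x) :=
  pro_pres (X := pcst (G (Q h))) (P := fun _ => qpres h) pcst_nat pcst_complete.

Lemma pcst_ptame : ptame F tame (pcst (G (Q h))).
Proof.
split; first by move=> i; exact: (lf_tame LG).
exact: (pro_psurj (X := pcst (G (Q h))) (P := fun _ => qpres h) pcst_nat).
Qed.

Lemma pcst_pisom : pisom pcst_pres (po_pres tameF const_sys).
Proof.
split; apply: rz_pro_ex.
- by move=> i j; apply: tameF; exact: (lf_tame LG).
- by move=> j; exists tt, (idm _); exact: rz1.
- by move=> i j; apply: tameF; exact: (lf_tame LG).
- by move=> j; exists 0%N, (idm _); exact: rz1.
Qed.
End ConstSystem.

(* X is the pro-object lim_j G(L / L_j), for L_j ranging over the lattices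
   in L *)
Definition latobj (L : osub D V) (X : pro C)
    (P : pres (evpro F) X (V := R V) L (fun x => x = 0)) : Prop :=
  ptame F tame X /\
  forall Lj (fL : filt L Lj), pisom P (po_pres tameF (filt_sys fL)).

Lemma filt_interleave (L : osub D V) Lj Mj (fL : filt L Lj) (fM : filt L Mj) :
  exists f : mor (po tameF (filt_sys fL)) (po tameF (filt_sys fM)),
    rz (po_pres tameF (filt_sys fL)) (po_pres tameF (filt_sys fM)) f id.
Proof.
apply: rz_po => j; have [lL lLj _ _ cof] := fL; have [_ lMj _ _ _] := fM.
have [i iP] := cof _ (lMj j); exists i.
have [//|x _ /iP //|g gP] := @q_ex V V idfun L (Lj i) L (Mj j) (filt_findim fL i) (filt_findim fM j).
by exists g.
Qed.

Lemma rz_comp_id (X Y Z : pro C) (SX NX SY NY SZ NZ : R V -> Prop)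
    (PX : pres (evpro F) X SX NX) (PY : pres (evpro F) Y SY NY)
    (PZ : pres (evpro F) Z SZ NZ) (f : mor X Y) (g : mor Y Z) :
  rz PX PY f id -> rz PY PZ g id -> exists f : mor X Z, rz PX PZ f id.
Proof. by move=> fP gP; exists (mcomp g f); exact: rzM fP gP. Qed.

(** Filter L and M by one and the same sequence of lattices L_j in L. The inclusion is then the
    limit of the short exact sequences L/L_j → M/L_j → M/L, whose third term is constant. *)
Lemma incl_conf (L M : osub D V) (X Y : pro C) (PX : pres (evpro F) X (V := R V) L _)
    (PY : pres (evpro F) Y (V := R V) M _) (h : findim (oquot s M L)) (f : mor X Y) :
  latobj PX -> latobj PY -> lat L -> lat M -> (forall x, L x -> M x) ->
  rz PX PY f id ->
  exists g : mor Y (pcst (G (Q h))), rz PY (pcst_pres h) g id /\ conf f g.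
Proof.
move=> [tX iX] [tY iY] lL lM LM fP.
have [b _] := basis_exists fV; have [N NP] := small_bspan b lL.
have fL : filt L (fun j => bspan D b (j + N)).
  by apply: bspan_filt => // x; exact: NP.
have fM : filt M (fun j => bspan D b (j + N)).
  by apply: bspan_filt => // x /(NP N (leqnn N))/LM.
have [_ lMj _ _ _] := fM.
have [g gP] : exists g : mor Y (pcst (G (Q h))), rz PY (pcst_pres h) g id.
  have [[a aP] _] := iY _ fM.
  have [||c cP] := @rz_pro_ex k C F (po tameF (filt_sys fM)) (pcst (G (Q h))) _ _ _ _ _ _
    (ps_pres (filt_sys fM)) (fun=> qpres h)
    (fun i j u => (po_mapP (filt_sys fM) u).1) (@pcst_nat M L h)
    (@ps_complete _ _ _ _ _ _ (filt_sys fM)) (@pcst_complete M L) id.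
  - by move=> i j; apply: tameF; exact: (lf_tame LG).
  - move=> j; exists 0%N.
    have [//|x _ /(NP N (leqnn N))//|c cP] := @q_ex V V idfun M (bspan D b (0 + N)) M L (filt_findim fM 0) h.
    by exists c.
  exact: rz_comp_id aP cP.
exists g; split=> //.
apply: (conf_pro (A := filt_sys fL) (B := filt_sys fM) (D := const_sys h) _ tX tY
  (pcst_ptame h) (iX _ fL) (iY _ fM) (pcst_pisom h) fP gP) => i.
apply: (@q_conf V V V idfun idfun) => //.
- by move=> y _; apply: NP; lia.
- by move=> z Mz; exists z => //; rewrite subrr; exact: omem0.
- by move=> y My Ly; exists y => //; rewrite subrr; exact: omem0.
Qed.

End Lattices.

Section Replace.
Variables (k : fieldType) (C : Defs.cat k) (F : functor C (Vect k)) (x : C).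
Variables (V : lmodType k) (S N S' N' : V -> Prop) (P : pres F x S N).
Hypotheses (SS' : forall y, S y <-> S' y) (NN' : forall y, N y <-> N' y).

Fact repl_S0 : S' 0. Proof. exact/SS'/(pr_S0 P). Qed.
Fact repl_SP a y z : S' y -> S' z -> S' (a *: y + z).
Proof. by move=> /SS' Sy /SS' Sz; apply/SS'/(pr_SP P). Qed.
Fact repl_lin a y z : S' y -> S' z -> P (a *: y + z) = a *: P y + P z.
Proof. by move=> /SS' Sy /SS' Sz; exact: (pr_lin P). Qed.
Fact repl_surj v : exists2 y, S' y & P y = v.
Proof. by have [y Sy <-] := pr_surj P v; exists y => //; exact/SS'. Qed.
Fact repl_ker y : S' y -> (P y = 0 <-> N' y).
Proof. by move=> /SS' Sy; apply: iff_trans (NN' y); exact: (pr_ker P). Qed.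
Definition pres_repl : pres F x S' N' :=
  Pres repl_S0 repl_SP repl_lin repl_surj repl_ker.
End Replace.

Section Step.
Variables (k : fieldType) (n : nat) (tame : ntate k n -> Prop).
Local Notation C := (ntate k n).
Local Notation F := (eval_ntate k n).
Hypothesis tameF : forall x y, tame x -> tame y -> faithful F x y.
Variables (K k1 : kfield k) (D : cdvf K k1).
Local Notation R V := (restr (kmap K) V).

Section OneLifting.
Variables (s : lifting D) (G : functor (Vectf k1) C) (LG : lifts_forget F tame G).

Lemma step_fin (V : Vectf K) (b : basis (sval V)) i : findim (bquot s b i).
Proof. by apply: findim_oquot; exact: bspan_lat. Qed.

Section Fin.
Hypothesis fin : forall (V : Vectf K) (b : basis (sval V)) i, findim (bquot s b i).

(** The objects depend on the proofs of the fields of [step_defined]. Hence everything here is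
    stated for an arbitrary [fin], and later for arbitrary [epi], [dir] and [mono], so as to apply
    to the proofs packed in any [sharp_defined]. *)
Definition bpres (V : Vectf K) (b : basis (sval V)) i :
  pres F (G (qob fin b i)) (V := R (sval V)) (bspan D b 0) (bspan D b i) :=
  qpres LG (fin b i).

Lemma rz_qmap (V W : Vectf K) (f : mor V W) (b : basis (sval V)) (c : basis (sval W))
    (bc : bmaps D (vmap f) b c) i j (ji : (j <= i)%N) :
  rz (bpres b i) (bpres c j) (fmap G (qmap fin bc ji)) (vmap f).
Proof.
apply: (@rz_q k C F tame K k1 D s G LG _ _ (vmap f) _ _ _ _ (fin b i) (fin c j)) => // x Lx.
apply: etrans (qmapE fin bc ji _) _.
by rewrite val_insubd_osub.
Qed.

Lemma step_epi (V : Vectf K) (b : basis (sval V)) : admissible (pdiag G fin b).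
Proof.
move=> i j u.
have [g [gP gI]] := q_deflation LG (fin b j) (fin b i) (bspan_lat D b 0)
  (bspan_lat D b j) (bspan_lat D b i) (bspan_le (leq0n i)) (bspan_le u).
rewrite [dmap _ _](_ : _ = g) //.
apply: (rz_inj (tameF (lf_tame LG _) (lf_tame LG _)) _ gP).
exact: (rz_qmap (@brefl _ _ _ D V b) u).
Qed.

Section Epi.
Hypothesis epi : forall (V : Vectf K) (b : basis (sval V)), admissible (pdiag G fin b).

Lemma bspan_filt0 (V : lmodType K) (b : basis V) : filt (bspan D b 0) (bspan D b).
Proof.
have := @bspan_filt k K k1 D V (bspan D b 0) b 0 (bspan_lat D b 0) (fun x h => h).
by rewrite (_ : (fun j => _) = bspan D b) //; apply/funext => j; rewrite addn0.
Qed.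

Fact pob_nat (V : Vectf K) (b : basis (sval V)) : forall (i j : natcat) (u : ihom i j),
  rz (bpres b j) (bpres b i) (dmap (pob epi b : indob (opc C)) u : mor (pob epi b j : C) (pob epi b i : C)) id.
Proof. by move=> i j u; exact: (rz_qmap (@brefl _ _ _ D V b) u). Qed.

Fact pob_sep (V : Vectf K) (b : basis (sval V)) (x : R (sval V)) :
  (forall i, bspan D b i x) <-> x = 0.
Proof. exact: (filt_sep (svalP V) (bspan_filt0 b)). Qed.

Definition pob_pres (V : Vectf K) (b : basis (sval V)) :
    pres (evpro F) (pob epi b) (V := R (sval V)) (bspan D b 0) (fun x => x = 0) :=
  pres_repl (pro_pres (X := pob epi b) (P := bpres b) (@pob_nat V b)
    (filt_complete (svalP V) (bspan_filt0 b))) (fun y => iff_refl _) (pob_sep b).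

Lemma pob_ptame (V : Vectf K) (b : basis (sval V)) : ptame F tame (pob epi b).
Proof.
split; first by move=> i; exact: (lf_tame LG).
exact: (pro_psurj (X := pob epi b) (P := bpres b) (@pob_nat V b)).
Qed.

Lemma rz_pmap (V W : Vectf K) (f : mor V W) (b : basis (sval V)) (c : basis (sval W))
    (bc : bmaps D (vmap f) b c) :
  rz (pob_pres b) (pob_pres c) (Defs.pmap epi bc) (vmap f).
Proof.
apply: (rz_pro (X := pob epi b) (Y := pob epi c) (P := bpres b) (Q := bpres c)) => j.
exists j, (fmap G (qmap fin bc (leqnn j))); split=> //; exact: rz_qmap.
Qed.

Lemma pob_latobj (V : Vectf K) (b : basis (sval V)) :
  latobj tameF s LG (svalP V) (L := bspan D b 0) (pob_pres b).
Proof.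
split=> [|Lj fL]; first exact: pob_ptame.
have [lL lLj _ _ cof] := fL; have [_ lb _ _ cofb] := bspan_filt0 b.
split.
  apply: (@rz_pro_ex k C F (pob epi b) (po tameF (filt_sys s LG (svalP V) fL)) _ _ _ _ _ _
    (bpres b) (ps_pres (filt_sys s LG (svalP V) fL)) (@pob_nat V b)
    (fun i j u => (po_mapP (filt_sys s LG (svalP V) fL) u).1)
    (filt_complete (svalP V) (bspan_filt0 b))
    (@ps_complete _ _ _ _ _ _ (filt_sys s LG (svalP V) fL)) id).
    by move=> i j; apply: tameF; exact: (lf_tame LG).
  move=> j; have [i iP] := cofb _ (lLj j); exists i.
  have [//|x _ /iP //|g gP] := @q_ex k C F tame K k1 D s G LG _ _ idfun (bspan D b 0) (bspan D b i)
    (bspan D b 0) (Lj j) (fin b i) (filt_findim s fL j).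
  by exists g.
apply: (@rz_pro_ex k C F (po tameF (filt_sys s LG (svalP V) fL)) (pob epi b) _ _ _ _ _ _
    (ps_pres (filt_sys s LG (svalP V) fL)) (bpres b)
    (fun i j u => (po_mapP (filt_sys s LG (svalP V) fL) u).1) (@pob_nat V b)
    (@ps_complete _ _ _ _ _ _ (filt_sys s LG (svalP V) fL))
    (filt_complete (svalP V) (bspan_filt0 b)) id).
  by move=> i j; apply: tameF; exact: (lf_tame LG).
move=> j; have [i iP] := cof _ (lb j); exists i.
have [//|x _ /iP //|g gP] := @q_ex k C F tame K k1 D s G LG _ _ idfun (bspan D b 0) (Lj i)
    (bspan D b 0) (bspan D b j) (filt_findim s fL i) (fin b j).
by exists g.
Qed.

Lemma step_dir (V : Vectf K) : bdirected D (sval V).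
Proof.
split; first exact: (basis_exists (svalP V)).
move=> b c; have [N NP] := lat_ub b (bspan_lat D c 0).
exists (scale_basis D b (- N%:Z)); split=> x; last first.
  by move=> /NP h; apply/bspan_blv/scale_blv; rewrite addr0.
by move=> /bspan_blv h; apply/bspan_blv/scale_blv; apply: blv_le h; lia.
Qed.

Lemma step_bound (V W : Vectf K) (f : mor V W) (b : basis (sval V)) :
  exists c : basis (sval W), bmaps D (vmap f) b c.
Proof.
have [c _] := basis_exists (svalP W); have [N NP] := lin_blv D (vmap f) b c.
exists (scale_basis D c (- N%:Z)) => x /bspan_blv/NP h.
by apply/bspan_blv/scale_blv; rewrite addr0; rewrite sub0r in h.
Qed.

Section Dir.
Hypothesis dir : forall V : Vectf K, bdirected D (sval V).

Lemma step_mono (V : Vectf K) : admissible (idiag epi (dir V)).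
Proof.
move=> b c u.
have h : findim (oquot s (bspan D c 0) (bspan D b 0)).
  by apply: findim_oquot; exact: bspan_lat.
have [g [_ gc]] := incl_conf h (pob_latobj b) (pob_latobj c) (bspan_lat D b 0)
  (bspan_lat D c 0) u (rz_pmap (bltmap u)).
by right; exists (pcst (G (Q h))), g.
Qed.

Section Mono.
Hypothesis mono : forall V : Vectf K, admissible (idiag epi (dir V)).
Local Notation sob V := (sob mono V).

Fact sob_nat (V : Vectf K) : forall (i j : bcat (dir V)) (u : ihom i j),
  rz (pob_pres i) (pob_pres j) (dmap (sob V) u) id.
Proof. by move=> b c u; exact: (rz_pmap (bltmap u)). Qed.

Fact sob_S (V : Vectf K) (x : R (sval V)) :
  ind_S (X := sob V) (V := R (sval V)) (fun b => omem (bspan D b 0)) x <-> True.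
Proof.
split=> // _; have [b _] := (dir V).1; have [N NP] := blv_ex D b x.
by exists (scale_basis D b (- N%:Z)); apply/bspan_blv/scale_blv; rewrite addr0.
Qed.

Definition sob_pres (V : Vectf K) :
    pres (evind (evpro F)) (sob V) (V := R (sval V)) (fun=> True) (fun x => x = 0) :=
  pres_repl (ind_pres (X := sob V) (P := @pob_pres V) (@sob_nat V))
    (@sob_S V) (fun y => iff_refl _).

Lemma sob_itame (V : Vectf K) : itame F tame (sob V).
Proof.
split; first by move=> b; exact: pob_ptame.
exact: (ind_iinj (X := sob V) (P := @pob_pres V) (@sob_nat V)).
Qed.

Lemma rz_of_ind (X Y : ind (pro C)) (V W : lmodType k) (SX NX SX' NX' : V -> Prop)
  (SY NY SY' NY' : W -> Prop) (PX : pres (evind (evpro F)) X SX NX)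
  (PY : pres (evind (evpro F)) Y SY NY) SX1 NX1 SY1 NY1 f phi :
  rz PX PY f phi ->
  rz (pres_repl PX SX1 NX1 : pres _ X SX' NX') (pres_repl PY SY1 NY1 : pres _ Y SY' NY') f phi.
Proof. by move=> fP v /SX1 Sv; have [h e] := fP v Sv; split=> //; exact/SY1. Qed.

Lemma rz_to_ind (X Y : ind (pro C)) (V W : lmodType k) (SX NX SX' NX' : V -> Prop)
  (SY NY SY' NY' : W -> Prop) (PX : pres (evind (evpro F)) X SX NX)
  (PY : pres (evind (evpro F)) Y SY NY) SX1 NX1 SY1 NY1 f phi :
  rz (pres_repl PX SX1 NX1 : pres _ X SX' NX') (pres_repl PY SY1 NY1 : pres _ Y SY' NY') f phi ->
  rz PX PY f phi.
Proof. by move=> fP v Sv; have [|h e] := fP v; [exact/SX1|split=> //; exact/SY1]. Qed.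

Section Bound.
Hypothesis bound : forall (V W : Vectf K) (f : mor V W) (b : basis (sval V)),
  exists c : basis (sval W), bmaps D (vmap f) b c.

Lemma rz_smap (V W : Vectf K) (f : mor V W) :
  rz (sob_pres V) (sob_pres W) (smap mono bound f) (vmap f).
Proof.
apply: rz_of_ind; apply: rz_ind => b; have [c bc] := bound f b.
exists c, (Defs.pmap epi bc); split; first exact: smapE.
exact: rz_pmap.
Qed.
End Bound.

Section Lines.
Variables (V : Vectf K) (b : basis (sval V)).
(** A sequence cofinal among all bases, along which the colimit can be computed. *)
Definition bneg (i : nat) : basis (sval V) := scale_basis D b (- i%:Z).
Lemma bneg_blv i x : bspan D (bneg i) 0 x <-> blv D b (- i%:Z) x.
Proof. by rewrite bspan_blv scale_blv addr0. Qed.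
Lemma bneg_le i j : (i <= j)%N -> blt D (bneg i) (bneg j).
Proof. by move=> ij x /bneg_blv h; apply/bneg_blv; apply: blv_le h; lia. Qed.

Definition bneg_sys : isys F tame (V := R (sval V)) (fun x => x = 0).
Proof.
apply: (@Isys k C F tame (R (sval V)) _ (fun i => pob epi (bneg i))
  (fun i => bspan D (bneg i) 0) (fun i => pob_pres (bneg i)) (fun i => pob_ptame (bneg i))).
move=> i j ij; exists (Defs.pmap epi (bltmap (bneg_le ij))); split.
  exact: (rz_pmap (bltmap (bneg_le ij))).
exact: (@mono V (bneg i) (bneg j) (bneg_le ij)).
Defined.
End Lines.
End Mono.
End Dir.
End Epi.
End Fin.
End OneLifting.
End Step.

(** * Lattices as pro-objects and exact sequences filtered by lattices *)

Section LatticeObjects.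
Variables (k : fieldType) (C : Defs.cat k) (F : functor C (Vect k)).
Variable tame : C -> Prop.
Hypothesis tameF : forall x y, tame x -> tame y -> faithful F x y.
Variables (K k1 : kfield k) (D : cdvf K k1) (s : lifting D).
Variable G : functor (Vectf k1) C.
Variable LG : lifts_forget F tame G.
Local Notation R V := (restr (kmap K) V).

Section OneSpace.
Variable V : lmodType K.
Hypothesis fV : findim V.

Section FiltObject.
Variables (L : osub D V) (Lj : nat -> osub D V) (fL : filt L Lj).
Definition fo : pro C := po tameF (filt_sys s LG fV fL).
Definition fo_pres : pres (evpro F) fo (V := R V) L (fun x => x = 0) :=
  pres_repl (po_pres tameF (filt_sys s LG fV fL)) (fun y => iff_refl _) (filt_sep fV fL).
Lemma fo_latobj : latobj tameF s LG fV fo_pres.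
Proof.
split=> [|Mj fM]; first exact: po_ptame.
split; [have [f fP] := filt_interleave tameF s LG fV fL fM|
        have [f fP] := filt_interleave tameF s LG fV fM fL]; exists f; exact: fP.
Qed.
End FiltObject.

Lemma lat_map (L M : osub D V) (X Y : pro C)
    (PX : pres (evpro F) X (V := R V) L (fun x => x = 0))
    (PY : pres (evpro F) Y (V := R V) M (fun x => x = 0)) :
  latobj tameF s LG fV PX -> latobj tameF s LG fV PY -> lat L -> lat M ->
  (forall x, L x -> M x) -> exists f : mor X Y, rz PX PY f id.
Proof.
move=> [_ iX] [_ iY] lL lM LM.
have [b _] := basis_exists fV; have [N NP] := small_bspan b lL.
have fL : filt L (fun j => bspan D b (j + N)).
  by apply: bspan_filt => // x; exact: NP.
have fM : filt M (fun j => bspan D b (j + N)).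
  by apply: bspan_filt => // x /(NP N (leqnn N))/LM.
have [[a aP] _] := iX _ fL; have [_ [c cP]] := iY _ fM.
have [|m mP] := @rz_po k C F tame tameF _ _ _ _ (filt_sys s LG fV fL) (filt_sys s LG fV fM) id.
  move=> j; exists j.
  have [//|//|g gP] := @q_ex k C F tame K k1 D s G LG V V idfun L (bspan D b (j + N)) M
    (bspan D b (j + N)) (filt_findim s fL j) (filt_findim s fM j).
  by exists g.
by have [d dP] := rz_comp_id aP mP; exact: rz_comp_id dP cP.
Qed.

Lemma lat_inflation (L M : osub D V) (X Y : pro C)
    (PX : pres (evpro F) X (V := R V) L (fun x => x = 0))
    (PY : pres (evpro F) Y (V := R V) M (fun x => x = 0)) :
  latobj tameF s LG fV PX -> latobj tameF s LG fV PY -> lat L -> lat M ->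
  (forall x, L x -> M x) -> exists f : mor X Y, rz PX PY f id /\ inflation f.
Proof.
move=> aX aY lL lM LM; have [f fP] := lat_map aX aY lL lM LM; exists f; split=> //.
have [g [_ gc]] := incl_conf (findim_oquot s lM lL) aX aY lL lM LM fP.
by right; exists (pcst (G (Q (findim_oquot s lM lL)))), g.
Qed.

Section LatSystem.
Variables (L : nat -> osub D V) (Lj : nat -> nat -> osub D V).
Hypothesis fL : forall i, filt (L i) (Lj i).
Hypothesis Lup : forall i j, (i <= j)%N -> forall x, L i x -> L j x.

Fact lat_sys_tr i j : (i <= j)%N -> exists g : mor (fo (fL i)) (fo (fL j)),
  rz (fo_pres (fL i)) (fo_pres (fL j)) g id /\ inflation g.
Proof.
move=> ij; have [lLi _ _ _ _] := fL i; have [lLj _ _ _ _] := fL j.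
by apply: lat_inflation; try exact: fo_latobj; try exact: Lup.
Qed.
Definition lat_sys : isys F tame (V := R V) (fun x => x = 0) :=
  Isys (is_pres := fun i => fo_pres (fL i)) (fun i => (fo_latobj (fL i)).1) lat_sys_tr.
End LatSystem.
End OneSpace.

Section ExactSequence.
Variables (U V W : lmodType K) (f : {linear U -> V}) (g : {linear V -> W}).
Hypotheses (fU : findim U) (fV : findim V) (fW : findim W).
Hypothesis f_inj : injective f.
Hypothesis g_surj : forall z, exists y, g y = z.
Hypothesis fg : forall y, g y = 0 <-> exists x, f x = y.
Variable b : basis V.

Section Preimage.
Variable z : int.
Fact pre0 : blv D b z (f 0). Proof. by rewrite linear0; exact: omem0. Qed.
Fact preD x y : blv D b z (f x) -> blv D b z (f y) -> blv D b z (f (x + y)).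
Proof. by move=> hx hy; rewrite linearD; exact: omemD. Qed.
Fact preZ a x : val_ge (dv D) 0 a -> blv D b z (f x) -> blv D b z (f (a *: x)).
Proof. by move=> ha hx; rewrite linearZ; exact: omemZ. Qed.
(** U and W receive the filtrations induced from one basis of V. All levels and all their quotients
    are then exact, and no adapted bases of U and W have to be found. *)
Definition blv_pre : osub D U := Osub (omem := fun x => blv D b z (f x)) pre0 preD preZ.
End Preimage.

Section Image.
Variable z : int.
Definition img_set (w : W) : Prop := exists2 y, blv D b z y & g y = w.
Fact img0 : img_set 0. Proof. by exists 0; [exact: omem0|exact: linear0]. Qed.
Fact imgD x y : img_set x -> img_set y -> img_set (x + y).
Proof.
by move=> [u hu <-] [v hv <-]; exists (u + v); [exact: omemD|exact: linearD].
Qed.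
Fact imgZ a x : val_ge (dv D) 0 a -> img_set x -> img_set (a *: x).
Proof. by move=> ha [u hu <-]; exists (a *: u); [exact: omemZ|exact: linearZ]. Qed.
Definition blv_img : osub D W := Osub img0 imgD imgZ.
End Image.

(** One bound comes from f, the other from a linear retraction of f; both are bounded maps. Hence
    the induced filtration consists of lattices. *)
Lemma blv_pre_bounds (a : basis U) : exists N : nat, forall z x,
  (blv D a (z + N%:Z) x -> blv_pre z x) /\ (blv_pre z x -> blv D a (z - N%:Z) x).
Proof.
have [r rK] := linear_retraction fU fV f_inj.
have [N NP] := lin_blv D f a b; have [M MP] := lin_blv D r b a.
exists (N + M)%N => z x; split=> [/NP|/MP]; last by rewrite rK; apply: blv_le; lia.
by apply: blv_le; lia.
Qed.

Lemma blv_img_bounds (c : basis W) : exists N : nat, forall z x,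
  (blv D c (z + N%:Z) x -> blv_img z x) /\ (blv_img z x -> blv D c (z - N%:Z) x).
Proof.
have [r rK] := linear_section fV fW g_surj.
have [N NP] := lin_blv D g b c; have [M MP] := lin_blv D r c b.
exists (N + M)%N => z x; split=> [/MP h|[y /NP h <-]].
  by exists (r x); rewrite ?rK //; apply: blv_le h; lia.
by apply: blv_le h; lia.
Qed.

Lemma filt_bounds (X : lmodType K) (a : basis X) (L : int -> osub D X) (N : nat) (z : int) :
  (forall z x, (blv D a (z + N%:Z) x -> L z x) /\ (L z x -> blv D a (z - N%:Z) x)) ->
  (forall z z' x, z' <= z -> L z x -> L z' x) ->
  filt (L z) (fun j => L (z + j%:Z)).
Proof.
move=> LP Lle.
have lL z' : lat (L z').
  exists a, (absz z' + N)%N; split=> x h.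
    by apply: (LP z' x).1; apply: blv_le h; lia.
  by have h' := (LP z' x).2 h; apply: blv_le h'; lia.
split=> // [i j ij x|j x|M lM]; [apply: Lle; lia|apply: Lle; lia|].
have [m mP] := lat_lb a lM; exists (absz (m%:Z + N%:Z - z)%R) => x h.
by apply: mP; have h' := (LP _ x).2 h; apply: blv_le h'; lia.
Qed.

Lemma pre_filt z : filt (blv_pre z) (fun j => blv_pre (z + j%:Z)).
Proof.
have [a _] := basis_exists fU; have [N NP] := blv_pre_bounds a.
by apply: filt_bounds NP _ => z1 z2 x z12; apply: blv_le.
Qed.

Lemma img_filt z : filt (blv_img z) (fun j => blv_img (z + j%:Z)).
Proof.
have [c _] := basis_exists fW; have [N NP] := blv_img_bounds c.
apply: filt_bounds NP _ => z1 z2 x z12 [y h <-]; exists y => //.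
exact: blv_le h.
Qed.

Lemma blv_filt z : filt (blv D b z) (fun j => blv D b (z + j%:Z)).
Proof.
apply: (@filt_bounds V b (blv D b) 0) => [z1 x|z1 z2 x]; last exact: blv_le.
by split; apply: blv_le; lia.
Qed.

Fact pre_up i j : (i <= j)%N -> forall x, blv_pre (- i%:Z) x -> blv_pre (- j%:Z) x.
Proof. by move=> ij x; apply: blv_le; lia. Qed.
Definition pre_sys := lat_sys fU (fun i => pre_filt (- i%:Z)) pre_up.
Fact mid_up i j : (i <= j)%N -> forall x, blv D b (- i%:Z) x -> blv D b (- j%:Z) x.
Proof. by move=> ij x; apply: blv_le; lia. Qed.
Definition mid_sys := lat_sys fV (fun i => blv_filt (- i%:Z)) mid_up.
Fact img_up i j : (i <= j)%N -> forall x, blv_img (- i%:Z) x -> blv_img (- j%:Z) x.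
Proof. by move=> ij x [y h <-]; exists y => //; apply: blv_le h; lia. Qed.
Definition img_sys := lat_sys fW (fun i => img_filt (- i%:Z)) img_up.

Lemma exact_level i : exists (u : mor (is_ob pre_sys i) (is_ob mid_sys i))
    (w : mor (is_ob mid_sys i) (is_ob img_sys i)),
  [/\ rz (is_pres pre_sys i) (is_pres mid_sys i) u f,
      rz (is_pres mid_sys i) (is_pres img_sys i) w g & conf u w].
Proof.
pose A := filt_sys s LG fU (pre_filt (- i%:Z)).
pose B := filt_sys s LG fV (blv_filt (- i%:Z)).
pose E := filt_sys s LG fW (img_filt (- i%:Z)).
have lev j : exists (u : mor (ps_ob A j) (ps_ob B j)) (w : mor (ps_ob B j) (ps_ob E j)),
    [/\ rz (ps_pres A j) (ps_pres B j) u f, rz (ps_pres B j) (ps_pres E j) w g & conf u w].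
  apply: q_conf => //.
  - by move=> y hy; exists y.
  - by move=> y _ hy; exists y.
  - by move=> _ [y hy <-]; exists y => //; rewrite subrr; exact: omem0.
  - move=> x _; have -> : g (f x) = 0 by apply/fg; exists x.
    exact: omem0.
  - move=> y hy [y' hy' e]; have [x xE] : exists x, f x = y - y'.
      by apply/fg; rewrite linearB e subrr.
    exists x; last by rewrite xE addrAC subrr sub0r; exact: osubN.
    rewrite /= xE; apply: (osubB (L := blv D b _)) => //.
    by apply: blv_le hy'; lia.
have [u uP] : exists u : mor (po tameF A) (po tameF B), rz (po_pres tameF A) (po_pres tameF B) u f.
  by apply: rz_po => j; have [u [_ [uP _ _]]] := lev j; exists j, u.
have [w wP] : exists w : mor (po tameF B) (po tameF E), rz (po_pres tameF B) (po_pres tameF E) w g.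
  by apply: rz_po => j; have [_ [w [_ wP _]]] := lev j; exists j, w.
have refl (X : pro C) (Y : lmodType k) (S N : Y -> Prop) (P : pres (evpro F) X S N) : pisom P P.
  by split; exists (idm X); exact: rz1.
exists u, w; split; [exact: uP|exact: wP|].
exact: (conf_pro lev (po_ptame tameF A) (po_ptame tameF B) (po_ptame tameF E)
  (refl _ _ _ _ _) (refl _ _ _ _ _) (refl _ _ _ _ _) uP wP).
Qed.
End ExactSequence.
End LatticeObjects.

Section Step.
Variables (k : fieldType) (n : nat) (tame : ntate k n -> Prop).
Local Notation C := (ntate k n).
Local Notation F := (eval_ntate k n).
Hypothesis tameF : forall x y, tame x -> tame y -> faithful F x y.
Variables (K k1 : kfield k) (D : cdvf K k1).
Local Notation R V := (restr (kmap K) V).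

Section OneLifting.
Variables (s : lifting D) (G : functor (Vectf k1) C) (LG : lifts_forget F tame G).
Hypothesis fin : forall (V : Vectf K) (b : basis (sval V)) i, findim (bquot s b i).
Hypothesis epi : forall (V : Vectf K) (b : basis (sval V)), admissible (pdiag G fin b).
Hypothesis dir : forall V : Vectf K, bdirected D (sval V).
Hypothesis mono : forall V : Vectf K, admissible (idiag epi (dir V)).
Local Notation sob V := (sob mono V).

Lemma itame_sym (X Y : ind (pro C)) : itame F tame X -> itame F tame Y ->
  forall i j, faithful (evpro F) (X i) (Y j).
Proof. by move=> [tX _] [tY _] i j; exact: (ptameF tameF). Qed.

Section Conf.
(** Each span of a basis lies in some L i by hypothesis, and each L i lies in the span of a rescaled
    basis: the two ind-systems are cofinal in each other. *)
Lemma sob_iisom (X : Vectf K) (L : nat -> osub D (sval X)) (Lj : nat -> nat -> osub D (sval X))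
    (fL : forall i, filt (L i) (Lj i))
    (Lup : forall i j, (i <= j)%N -> forall x, L i x -> L j x) :
  (forall M : osub D (sval X), lat M -> exists i, forall x, M x -> L i x) ->
  iisom (sob_pres LG mono X) (io_pres tameF (lat_sys tameF s LG (svalP X) fL Lup)).
Proof.
move=> cof; pose A := lat_sys tameF s LG (svalP X) fL Lup.
pose P := ind_pres (X := sob X) (P := @pob_pres k n tame K k1 D s G LG fin epi X) (@sob_nat k n tame K k1 D s G LG fin epi dir mono X).
have lL i : lat (L i) by have [] := fL i.
have aL i := fo_latobj tameF s LG (svalP X) (fL i).
have ab (b : basis (sval X)) := pob_latobj tameF LG epi b.
suff [[a aP] [c cP]] : iisom P (io_pres tameF A).
  split; [exists a|exists c].
    by move=> v _; apply: aP; exact/(sob_S mono).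
  by move=> v Sv; have [h e] := cP v Sv; split.
have tS := sob_itame LG mono X; have tA := io_itame tameF A.
split.
  apply: (@rz_ind_ex k _ _ (sob X) (io tameF A) _ _ _ _ _ _
    (@pob_pres k n tame K k1 D s G LG fin epi X) (is_pres A)).
    exact: itame_sym.
  move=> b; have [i iP] := cof _ (bspan_lat D b 0); exists i.
  have [h hP] := lat_map (ab b) (aL i) (bspan_lat D b 0) (lL i) iP.
  by exists h.
apply: (@rz_ind_ex k _ _ (io tameF A) (sob X) _ _ _ _ _ _
  (is_pres A) (@pob_pres k n tame K k1 D s G LG fin epi X)).
  exact: itame_sym.
move=> i; have [b _] := basis_exists (svalP X); have [N NP] := lat_ub b (lL i).
have Nb x : L i x -> bspan D (bneg D b N) 0 x by move/NP => h; apply/bneg_blv.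
exists (bneg D b N).
have [h hP] := lat_map (aL i) (ab (bneg D b N)) (lL i) (bspan_lat D _ 0) Nb.
by exists h.
Qed.

Lemma exact_systems (U V W : Vectf K) (f : {linear sval U -> sval V})
    (g : {linear sval V -> sval W}) : injective f -> (forall z, exists y, g y = z) ->
  (forall y, g y = 0 <-> exists x, f x = y) ->
  exists (A : isys F tame (V := R (sval U)) (fun x => x = 0))
    (B : isys F tame (V := R (sval V)) (fun x => x = 0))
    (E : isys F tame (V := R (sval W)) (fun x => x = 0)),
  [/\ iisom (sob_pres LG mono U) (io_pres tameF A), iisom (sob_pres LG mono V) (io_pres tameF B),
      iisom (sob_pres LG mono W) (io_pres tameF E) &
      forall i, exists (u : mor (is_ob A i) (is_ob B i)) (w : mor (is_ob B i) (is_ob E i)),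
        [/\ rz (is_pres A i) (is_pres B i) u f, rz (is_pres B i) (is_pres E i) w g & conf u w]].
Proof.
move=> f_inj g_surj fgE; have [b _] := basis_exists (svalP V).
pose fU := svalP U; pose fV := svalP V; pose fW := svalP W.
exists (lat_sys tameF s LG fU (fun i => pre_filt D fU fV f_inj b (- i%:Z)) (@pre_up _ _ _ D _ _ f b)).
exists (lat_sys tameF s LG fV (fun i => blv_filt D b (- i%:Z)) (@mid_up _ _ _ D _ b)).
exists (lat_sys tameF s LG fW (fun i => img_filt D fV fW g_surj b (- i%:Z)) (@img_up _ _ _ D _ _ g b)).
split.
- refine (@sob_iisom U _ _ (fun i => pre_filt D fU fV f_inj b (- i%:Z)) (@pre_up _ _ _ D _ _ f b) _).
  move=> M lM; have [a _] := basis_exists fU.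
  have [N NP] := lat_ub a lM; have [N' NP'] := lin_blv D f a b.
  by exists (N + N')%N => x /NP/NP'; apply: blv_le; lia.
- refine (@sob_iisom V _ _ (fun i => blv_filt D b (- i%:Z)) (@mid_up _ _ _ D _ b) _).
  by move=> M lM; have [N NP] := lat_ub b lM; exists N => x /NP.
- refine (@sob_iisom W _ _ (fun i => img_filt D fV fW g_surj b (- i%:Z)) (@img_up _ _ _ D _ _ g b) _).
  move=> M lM; have [c _] := basis_exists fW.
  have [N NP] := lat_ub c lM; have [r rK] := linear_section fV fW g_surj.
  have [N' NP'] := lin_blv D r c b.
  exists (N + N')%N => x /NP/NP' h; exists (r x); rewrite ?rK //.
  by apply: blv_le h; lia.
exact: (exact_level tameF s LG fU fV fW f_inj g_surj fgE b).
Qed.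

(** In the next dimension this becomes [lf_conf], from which the admissibility of the transition
    maps is deduced. *)
Lemma step_conf (U V W : Vectf K) (f : mor U V) (g : mor V W) : conf f g ->
  forall bound, conf (smap mono bound f) (smap mono bound g).
Proof.
move=> [f_inj g_surj fgE] bound.
have [A [B [E [iU iV iW lev]]]] := @exact_systems U V W (vmap f) (vmap g) f_inj g_surj fgE.
exact: (@conf_ind k C F tame tameF (R (sval U)) (R (sval V)) (R (sval W)) _ _ _ A B E (vmap f) (vmap g) lev
  _ _ _ _ _ _ _ _ _ (sob_itame LG mono U) (sob_itame LG mono V)
  (sob_itame LG mono W) iU iV iW _ _ (rz_smap LG mono bound f) (rz_smap LG mono bound g)).
Qed.
End Conf.

Section Tate.
Variable V : Vectf K.
Variable b : basis (sval V).
Local Notation B i := (bneg D b i).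
Local Notation L0 := (bspan D b 0).

Lemma L0B i x : L0 x -> bspan D (B i) 0 x.
Proof. by move/bspan_blv => h; apply/bneg_blv; apply: blv_le h; lia. Qed.

Lemma quot_fin i : findim (oquot s (bspan D (B i) 0) L0).
Proof. by apply: findim_oquot; exact: bspan_lat. Qed.

Local Notation qob i := (G (Q (quot_fin i))).
Local Notation qpr i := (qpres LG (quot_fin i)).

Lemma quot_tr i j : (i <= j)%N -> exists g : mor (qob i) (qob j),
  rz (qpr i) (qpr j) g id /\ inflation g.
Proof.
move=> ij; have hE : findim (oquot s (bspan D (B j) 0) (bspan D (B i) 0)).
  by apply: findim_oquot; exact: bspan_lat.
have [||||||| u [w [uP wP uw]]] := @q_conf k C F tame K k1 D s G LG _ _ _ idfun idfun
  (bspan D (B i) 0) L0 (bspan D (B j) 0) L0 (bspan D (B j) 0) (bspan D (B i) 0)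
  (quot_fin i) (quot_fin j) hE => //.
- exact: bneg_le.
- by move=> y _; exact: L0B.
- by move=> z hz; exists z => //; rewrite subrr; exact: omem0.
- by move=> y _ hy; exists y => //; rewrite subrr; exact: omem0.
by exists u; split=> //; right; exists (G (Q hE)), w.
Qed.

Definition quot_map i j (u : (i <= j)%N) : mor (qob i) (qob j) := projT1 (cid (quot_tr u)).
Lemma quot_mapP i j (u : (i <= j)%N) :
  rz (qpr i) (qpr j) (quot_map u) id /\ inflation (quot_map u).
Proof. exact: (projT2 (cid (quot_tr u))). Qed.
Fact quot_map1 i : quot_map (leqnn i) = idm (qob i).
Proof.
apply: (rz_inj _ (quot_mapP (leqnn i)).1 (rz1 _)).
by apply: tameF; exact: (lf_tame LG).
Qed.
Fact quot_mapM i j l (v : (j <= l)%N) (u : (i <= j)%N) :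
  quot_map (leq_trans u v) = mcomp (quot_map v) (quot_map u).
Proof.
apply: (rz_inj _ (quot_mapP _).1 (rzM (quot_mapP u).1 (quot_mapP v).1)).
by apply: tameF; exact: (lf_tame LG).
Qed.
Definition quot_diag : diag natcat C :=
  @Diag k natcat C (fun i => qob i) (fun i j u => quot_map u) quot_map1 quot_mapM.
Fact quot_adm : admissible quot_diag.
Proof. by move=> i j u; exact: (quot_mapP u).2. Qed.
Definition quot_ind : ind C := IndOb quot_adm.

Local Notation ppr i := (pcst_pres LG (quot_fin i)).

Lemma pcst_repl (i : nat) (x : R (sval V)) : (unit -> L0 x) <-> L0 x.
Proof. by split=> [|h _] //; exact. Qed.

Definition pqr i := pres_repl (ppr i) (fun y => iff_refl _) (pcst_repl i).

Lemma rz_pcstm i j (u : (i <= j)%N) : rz (pqr i) (pqr j) (pcstm (quot_map u)) id.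
Proof.
apply: (rz_pro (X := pcst (qob i)) (Y := pcst (qob j)) (P := fun _ => qpr i) (Q := fun _ => qpr j)) => -[].
exists tt, (quot_map u); split=> //; exact: (quot_mapP u).1.
Qed.

Fact quot_itr i j : (i <= j)%N -> exists g : mor (pcst (qob i)) (pcst (qob j)),
  rz (pqr i) (pqr j) g id /\ inflation g.
Proof.
move=> u; exists (pcstm (quot_map u)); split; first exact: rz_pcstm.
by apply: pcst_inflation; exact: (quot_mapP u).2.
Qed.
Definition quot_sys : isys F tame (V := R (sval V)) L0 :=
  Isys (fun i => pcst_ptame LG (quot_fin i)) quot_itr.

Fact lat_itr (i j : nat) : (i <= j)%N -> exists g : mor (pob epi b) (pob epi b),
  rz (pob_pres LG epi b) (pob_pres LG epi b) g id /\ inflation g.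
Proof.
move=> _; exists (idm (pob epi b)); split; first exact: rz1.
left; exists (idm (pob epi b)); split; exact: comp1m.
Qed.
Definition lattice_sys : isys F tame (V := R (sval V)) (fun x => x = 0) :=
  Isys (fun i : nat => pob_ptame LG epi b) lat_itr.

Fact icst_nat : forall (i j : fone) (u : ihom i j), rz (pob_pres LG epi b) (pob_pres LG epi b)
  (dmap (icst (pob epi b)) u) id.
Proof. by move=> i j u; exact: rz1. Qed.

Fact quot_ind_nat : forall (i j : natcat) (u : ihom i j),
  rz (pqr i) (pqr j) (dmap (ind_pcst quot_ind) u) id.
Proof. by move=> i j u; exact: rz_pcstm. Qed.

Definition icst_pres := ind_pres (X := icst (pob epi b)) (P := fun _ => pob_pres LG epi b) icst_nat.
Definition ind_pcst_pres := ind_pres (X := ind_pcst quot_ind) (P := pqr) quot_ind_nat.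
Definition sob_raw := ind_pres (X := sob V) (P := @pob_pres k n tame K k1 D s G LG fin epi V)
  (@sob_nat k n tame K k1 D s G LG fin epi dir mono V).

Lemma bneg_cof (M : osub D (sval V)) : lat M -> exists i, forall x, M x -> bspan D (B i) 0 x.
Proof. by move=> /(lat_ub b)[N NP]; exists N => x /NP h; apply/bneg_blv. Qed.

Lemma pob_map (c d : basis (sval V)) : blt D c d -> exists h : mor (pob epi c) (pob epi d),
  rz (pob_pres LG epi c) (pob_pres LG epi d) h id.
Proof. by move=> cd; exists (Defs.pmap epi (bltmap cd)); exact: (rz_pmap LG epi (bltmap cd)). Qed.

(** The lattice is the span of b. The quotient is the colimit over i of the quotients of the span of
    [bneg i] by that of b, an Ind-object of C since these quotients are constant pro-objects. At
    each i the conflation is that of [incl_conf]. *)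
Lemma sob_tate : is_tate (sob V).
Proof.
have ab (c : basis (sval V)) := pob_latobj tameF LG epi c.
have lb (c : basis (sval V)) : lat (bspan D c 0) := bspan_lat D c 0.
have tX : itame F tame (icst (pob epi b)).
  split; first by move=> i; exact: pob_ptame.
  exact: (ind_iinj (X := icst (pob epi b)) (P := fun _ => pob_pres LG epi b) icst_nat).
have tZ : itame F tame (ind_pcst quot_ind).
  split; first by move=> i; exact: (pcst_ptame LG (quot_fin i)).
  exact: (ind_iinj (X := ind_pcst quot_ind) (P := pqr) quot_ind_nat).
have tS := sob_itame LG mono V.
have lev i : exists (u : mor (is_ob lattice_sys i) (is_ob (bneg_sys LG mono b) i))
    (w : mor (is_ob (bneg_sys LG mono b) i) (is_ob quot_sys i)),
    [/\ rz (is_pres lattice_sys i) (is_pres (bneg_sys LG mono b) i) u id,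
        rz (is_pres (bneg_sys LG mono b) i) (is_pres quot_sys i) w id & conf u w].
  have [u uP] := pob_map (@L0B i).
  have [w [wP uw]] := incl_conf (quot_fin i) (ab b) (ab (B i)) (lb b) (lb (B i)) (@L0B i) uP.
  by exists u, w.
have iX : iisom icst_pres (io_pres tameF lattice_sys).
  split.
    apply: (@rz_ind_ex k _ _ (icst (pob epi b)) (io tameF lattice_sys) _ _ _ _ _ _
      (fun _ => pob_pres LG epi b) (is_pres lattice_sys)).
      by apply: itame_sym => //; exact: io_itame.
    by move=> i; exists 0%N, (idm (pob epi b)); exact: rz1.
  apply: (@rz_ind_ex k _ _ (io tameF lattice_sys) (icst (pob epi b)) _ _ _ _ _ _
    (is_pres lattice_sys) (fun _ => pob_pres LG epi b)).
    by apply: itame_sym => //; exact: io_itame.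
  by move=> i; exists tt, (idm (pob epi b)); exact: rz1.
have iY : iisom sob_raw (io_pres tameF (bneg_sys LG mono b)).
  split.
    apply: (@rz_ind_ex k _ _ (sob V) (io tameF (bneg_sys LG mono b)) _ _ _ _ _ _
      (@pob_pres k n tame K k1 D s G LG fin epi V) (is_pres (bneg_sys LG mono b))).
      by apply: itame_sym => //; exact: io_itame.
    by move=> c; have [i iP] := bneg_cof (lb c); exists i; exact: pob_map.
  apply: (@rz_ind_ex k _ _ (io tameF (bneg_sys LG mono b)) (sob V) _ _ _ _ _ _
    (is_pres (bneg_sys LG mono b)) (@pob_pres k n tame K k1 D s G LG fin epi V)).
    by apply: itame_sym => //; exact: io_itame.
  by move=> i; exists (B i), (idm (pob epi (B i))); exact: rz1.
have iZ : iisom ind_pcst_pres (io_pres tameF quot_sys).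
  split.
    apply: (@rz_ind_ex k _ _ (ind_pcst quot_ind) (io tameF quot_sys) _ _ _ _ _ _
      pqr (is_pres quot_sys)).
      by apply: itame_sym => //; exact: io_itame.
    by move=> i; exists i, (idm (pcst (qob i))); exact: rz1.
  apply: (@rz_ind_ex k _ _ (io tameF quot_sys) (ind_pcst quot_ind) _ _ _ _ _ _
    (is_pres quot_sys) pqr).
    by apply: itame_sym => //; exact: io_itame.
  by move=> i; exists i, (idm (pcst (qob i))); exact: rz1.
have [f fP] : exists f : mor (icst (pob epi b)) (sob V), rz icst_pres sob_raw f id.
  apply: rz_ind_ex; first exact: itame_sym.
  by move=> i; exists b, (idm (pob epi b)); exact: rz1.
have [g gP] : exists g : mor (sob V) (ind_pcst quot_ind), rz sob_raw ind_pcst_pres g id.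
  apply: rz_ind_ex; first exact: itame_sym.
  move=> c; have [i iP] := bneg_cof (lb c); exists i.
  have [u uP] := pob_map iP.
  have [_ [w [_ wP _]]] := lev i.
  by exists (mcomp w u); exact: rzM uP wP.
exists (pob epi b), quot_ind, f, g.
exact: (conf_ind lev tX tS tZ iX iY iZ fP gP).
Qed.
End Tate.

Lemma step_tate (V : Vectf K) : is_tate (sob V).
Proof. by have [b _] := basis_exists (svalP V); exact: sob_tate. Qed.
End OneLifting.

Section TwoLiftings.
Variables (s s' : lifting D) (G G' : functor (Vectf k1) C).
Variables (LG : lifts_forget F tame G) (LG' : lifts_forget F tame G').
Hypothesis fin : forall (V : Vectf K) (b : basis (sval V)) i, findim (bquot s b i).
Hypothesis epi : forall (V : Vectf K) (b : basis (sval V)), admissible (pdiag G fin b).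
Hypothesis fin' : forall (V : Vectf K) (b : basis (sval V)) i, findim (bquot s' b i).
Hypothesis epi' : forall (V : Vectf K) (b : basis (sval V)), admissible (pdiag G' fin' b).
Hypothesis dir dir' : forall V : Vectf K, bdirected D (sval V).
Hypothesis mono : forall V : Vectf K, admissible (idiag epi (dir V)).
Hypothesis mono' : forall V : Vectf K, admissible (idiag epi' (dir' V)).
Variables (V W : Vectf K) (phi : R (sval V) -> R (sval W)).

Lemma pob_rzP (b : basis (sval V)) (c : basis (sval W)) :
  (exists g, rz (pob_pres LG epi b) (pob_pres LG' epi' c) g phi) <->
  forall j, exists i, exists g, rz (qpres LG (fin b i)) (qpres LG' (fin' c j)) g phi.
Proof.
split=> [[g gP] j|H].
  have [i [u uP]] := @rz_proP k C F (pob epi b) (pob epi' c) _ _ _ _ _ _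
    (bpres LG fin b) (bpres LG' fin' c) (@pob_nat k n tame K k1 D s G LG fin epi V b)
    (@pob_nat k n tame K k1 D s' G' LG' fin' epi' W c)
    (filt_complete (svalP V) (bspan_filt0 D b)) (filt_complete (svalP W) (bspan_filt0 D c)) phi g gP j.
  by exists i, u.
have [|g gP] := @rz_pro_ex k C F (pob epi b) (pob epi' c) _ _ _ _ _ _
  (bpres LG fin b) (bpres LG' fin' c) (@pob_nat k n tame K k1 D s G LG fin epi V b)
  (@pob_nat k n tame K k1 D s' G' LG' fin' epi' W c)
  (filt_complete (svalP V) (bspan_filt0 D b)) (filt_complete (svalP W) (bspan_filt0 D c)) phi _ H.
  by move=> i j; apply: tameF; [exact: (lf_tame LG)|exact: (lf_tame LG')].
by exists g.
Qed.

(** The quantifiers are those of [EYek_basesP]; it remains to match the conditions on a single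
    quotient. *)
Lemma sob_rzP :
  (exists g, rz (sob_pres LG mono V) (sob_pres LG' mono' W) g phi) <->
  forall b : basis (sval V), exists c : basis (sval W), forall j, exists i,
    exists g, rz (qpres LG (fin b i)) (qpres LG' (fin' c j)) g phi.
Proof.
split=> [[g /rz_to_ind gP] b|H].
  have [//|c [u uP]] := rz_indP (X := sob mono V) (Y := sob mono' W) _ gP b.
  by exists c; apply/pob_rzP; exists u.
have [||g gP] := @rz_ind_ex k _ _ (sob mono V) (sob mono' W) _ _ _ _ _ _
    (@pob_pres k n tame K k1 D s G LG fin epi V) (@pob_pres k n tame K k1 D s' G' LG' fin' epi' W)
    (@sob_nat k n tame K k1 D s G LG fin epi dir mono V)
    (@sob_nat k n tame K k1 D s' G' LG' fin' epi' dir' mono' W) phi.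
- move=> i j; apply: itame_sym; exact: sob_itame.
- by move=> b; have [c /pob_rzP] := H b; exists c.
- by exists g; exact: rz_of_ind.
Qed.
End TwoLiftings.
End Step.

(** * Induction on the dimension *)

Section Subcategory.
Variables (k : fieldType) (C : Defs.cat k) (Q : C -> Prop) (F : functor C (Vect k)).
Local Notation F' := (fcomp F (fullsub_incl Q)).

Definition fullsub_pres (x : fullsub Q) (V : lmodType k) (S N : V -> Prop)
    (P : pres F (sval x) S N) : pres F' x S N :=
  Pres (F := F') (x := x) (pr := P) (pr_S0 P) (pr_SP P) (pr_lin P) (pr_surj P) (pr_ker P).
End Subcategory.

Section Idempotents.
Variables (k : fieldType) (C : Defs.cat k) (F : functor C (Vect k)).
Local Notation F' := (evidem F).

Section Ob.
Variables (x : C) (V : lmodType k) (S N : V -> Prop) (P : pres F x S N).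
Local Notation X := (idob1 x : idemc C).

Fact idem_prP v : idimg_set (F := F) (X := X) (P v).
Proof. by exists (P v); rewrite fapp1. Qed.
Definition idem_pr (v : V) : F' X :=
  submk (S := Submod (@idimg0 k C F X) (@idimgP k C F X)) (idem_prP v).
Fact idem_lin a y z : S y -> S z -> idem_pr (a *: y + z) = a *: idem_pr y + idem_pr z.
Proof. by move=> Sy Sz; apply: val_inj; exact: (pr_lin P). Qed.
Fact idem_surj v : exists2 y, S y & idem_pr y = v.
Proof.
have [y Sy yv] := pr_surj P (val (v : idimg F X)); exists y => //; exact: val_inj.
Qed.
Fact idem_ker y : S y -> (idem_pr y = 0 <-> N y).
Proof.
move=> Sy; apply: iff_trans (pr_ker P Sy); split=> [h|h].
  exact: (congr1 (fun u : idimg F X => val u) h).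
exact: val_inj.
Qed.
Definition idem_pres : pres F' X S N :=
  Pres (F := F') (x := X) (pr_S0 P) (pr_SP P) idem_lin idem_surj idem_ker.
End Ob.

Lemma idem_rzP (x y : C) (V W : lmodType k) (S N : V -> Prop) (S' N' : W -> Prop)
    (P : pres F x S N) (Q : pres F y S' N') (phi : V -> W) (f : mor (idob1 x : idemc C) (idob1 y)) :
  rz (idem_pres P) (idem_pres Q) f phi <-> rz P Q (idval f) phi.
Proof.
split=> h v Sv; have [Sphi e] := h v Sv; split=> //; last exact: val_inj.
exact: (congr1 (fun u : idimg F (idob1 y) => val u) e).
Qed.

Lemma idem_faithful (x y : C) : faithful F x y ->
  faithful F' (idob1 x : idemc C) (idob1 y).
Proof.
move=> Fxy f g fg; apply: idval_inj; apply: Fxy => v.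
have e := fg (submk (S := Submod (@idimg0 k C F (idob1 x)) (@idimgP k C F (idob1 x)))
  (ex_intro _ v (esym (fapp1 v)))).
exact: (congr1 (fun u : idimg F (idob1 y) => val u) e).
Qed.

Lemma idem_conf (x y z : C) (f : mor x y) (g : mor y z) :
  conf f g -> conf (fmap (idem_incl C) f) (fmap (idem_incl C) g).
Proof.
move=> fg; exists x, y, z, f, g.
do 2 exists (idid (idob1 x)); do 2 exists (idid (idob1 y)); do 2 exists (idid (idob1 z)).
by split=> //; rewrite ?idcomp1m ?idcompm1.
Qed.
End Idempotents.

Section Inclusion.
Variable k : fieldType.

Lemma incl_presP n (x : ntateel k n) (V : lmodType k) (S N : V -> Prop) :
  pres (eval k n) x S N -> pres (eval_ntate k n) (ntate_incl k n x) S N.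
Proof. by case: n x => [|n] x P; [exact: P|exact: (idem_pres P)]. Defined.

Lemma incl_rzP n (x y : ntateel k n) (V W : lmodType k) (S N : V -> Prop)
    (S' N' : W -> Prop) (P : pres (eval k n) x S N) (Q : pres (eval k n) y S' N') phi :
  (exists g, rz (incl_presP P) (incl_presP Q) g phi) <-> exists g, rz P Q g phi.
Proof.
case: n x y P Q => [|n] x y P Q /=; first by [].
split=> [[g /idem_rzP gP]|[g gP]]; first by exists (idval (g : idhom (idob1 x) (idob1 y))).
by exists (idinc (g : @mor k (ntateel k n.+1) x y)); exact/idem_rzP.
Qed.

Lemma incl_rz n (x y : ntateel k n) (V W : lmodType k) (S N : V -> Prop)
    (S' N' : W -> Prop) (P : pres (eval k n) x S N) (Q : pres (eval k n) y S' N') g phi :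
  rz P Q g phi -> rz (incl_presP P) (incl_presP Q) (fmap (ntate_incl k n) g) phi.
Proof.
case: n x y P Q g => [|n] x y P Q g /=; first by [].
by move=> gP; exact/idem_rzP.
Qed.

Lemma incl_faithful n (x y : ntateel k n) : faithful (eval k n) x y ->
  faithful (eval_ntate k n) (ntate_incl k n x) (ntate_incl k n y).
Proof. by case: n x y => [|n] x y //; exact: idem_faithful. Qed.

Lemma incl_conf_ntate n (x y z : ntateel k n) (f : mor x y) (g : mor y z) : conf f g ->
  conf (fmap (ntate_incl k n) f) (fmap (ntate_incl k n) g).
Proof. by case: n x y z f g => [|n] x y z f g //; exact: idem_conf. Qed.
End Inclusion.

Local Notation qfun s s' L L' M M' f := (@mfun _ _ _ _ s s' _ _ L L' M M' f).

Section QuotientMorphisms.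
Variables (k : fieldType) (C : Defs.cat k) (F : functor C (Vect k)).
Variables (tame : C -> Prop) (K k1 : kfield k) (D : cdvf K k1) (s s' : lifting D).
Variables (G G' : functor (Vectf k1) C).
Variables (LG : lifts_forget F tame G) (LG' : lifts_forget F tame G').
Variable E : forall A B : lmodType k1, (A -> B) -> Prop.
Hypothesis lowE : forall (A B : Vectf k1) (psi : sval A -> sval B), klin psi ->
  (exists g, rz (lf_pres LG A) (lf_pres LG' B) g psi) <-> E psi.

(** A morphism covering phi must send the kernel L' to the kernel M' and so induces [mfun], to which
    the criterion [lowE] of the residue field applies, with one lifting on each side. *)
Lemma q_rzP (V W : lmodType K) (L L' : osub D V) (M M' : osub D W)
    (h : findim (oquot s L L')) (h' : findim (oquot s' M M')) (phi : V -> W) : klin phi ->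
  (exists g, rz (qpres LG h) (qpres LG' h') g phi) <->
  [/\ forall x, L x -> M (phi x), forall x, L x -> L' x -> M' (phi x) &
      E (qfun s s' L L' M M' phi)].
Proof.
move=> phiL; split=> [[g gP]|[phiM phiM' /(lowE (A := Q h) (B := Q h'))]].
  have phiM x : L x -> M (phi x) by move/gP => -[].
  have phiM' x : L x -> L' x -> M' (phi x).
    move=> Lx L'x; have [Mx] := gP x Lx.
    have -> : qpres LG h x = 0 by apply/(pr_ker (qpres LG h) Lx).
    rewrite linear0 => /esym e; exact/(pr_ker (qpres LG' h') Mx).
  split=> //; apply/(lowE (A := Q h) (B := Q h')); first exact: mfun_klin.
  exists g => q _; split=> //; have [x Lx <-] := cls_surj (q : oquot s L L').
  have [_ e] := gP x Lx; apply: etrans e _.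
  by rewrite /= /q_pr; congr (lf_pres LG' _ _); apply/esym/mfun_cls.
case; first exact: mfun_klin.
move=> g gP; exists g => x Lx; split; first exact: phiM.
have [_ e] := gP (cls s L L' x) I; apply: etrans e _.
by rewrite /= /q_pr; congr (lf_pres LG' _ _); apply: mfun_cls.
Qed.
End QuotientMorphisms.

Section Induction.
Variable k : fieldType.

(** Homs are described between sharp for s and for s', since two liftings of K involve the pair of
    their tails; tau, which computes E^Yek, is independent of both. Faithfulness and exactness are
    carried along because the next level consumes them. The record is in [Type], the presentations
    being data to which later fields refer. *)
Record sharp_props n (K : kfield k) (T : tower n K) (top : set (set K)) : Type := SharpProps {
  sh_def : forall s : liftings T, liftings_continuous top s -> sharp_defined s;
  sh_pres : forall s : liftings T, liftings_continuous top s ->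
    forall (h : sharp_defined s) (V : Vectf K),
    pres (eval k n) (sharp h V) (V := restr (kmap K) (sval V)) (fun=> True) (fun x => x = 0);
  sh_nat : forall (s : liftings T) (sC : liftings_continuous top s) (h : sharp_defined s)
    (V W : Vectf K) (f : mor V W),
    rz (sh_pres sC h V) (sh_pres sC h W) (fmap (sharp h) f) (f : linhom _ _);
  sh_faithful : forall s s' : liftings T,
    liftings_continuous top s -> liftings_continuous top s' ->
    forall (h : sharp_defined s) (h' : sharp_defined s') (V W : Vectf K),
    faithful (eval k n) (sharp h V) (sharp h' W);
  sh_hom : forall (s s' : liftings T) (sC : liftings_continuous top s)
    (sC' : liftings_continuous top s') (h : sharp_defined s) (h' : sharp_defined s')
    (tau : liftings T), liftings_continuous top tau ->
    forall (V W : Vectf K) (phi : sval V -> sval W), klin phi ->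
    (exists g, rz (sh_pres sC h V) (sh_pres sC' h' W) g phi) <-> EYek tau phi;
  sh_conf : forall (s : liftings T), liftings_continuous top s ->
    forall (h : sharp_defined s) (U V W : Vectf K) (f : mor U V) (g : mor V W),
    conf f g -> conf (fmap (sharp h) f) (fmap (sharp h) g) }.

Section Base.
Variables (K : kfield k) (fin : finite_ext (kmap K)) (top : set (set K)).
Local Notation T := (Tower0 fin).

Definition base_pres (s : liftings T) (h : sharp_defined s) (V : Vectf K) :
  pres (eval k 0) (sharp h V) (V := restr (kmap K) (sval V)) (fun=> True) (fun x => x = 0).
Proof.
apply: (@Pres k _ (eval k 0) (sharp h V) (restr (kmap K) (sval V)) _ _ (fun x => x)) => //.
by move=> v; exists v.
Defined.

Lemma sharp_base : sharp_props T top.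
Proof.
apply: (@SharpProps _ _ _ _ _ (fun s _ h V => base_pres h V)) => //.
- by move=> s s' _ _ h h' V W f g fg; apply: lin_ext.
- move=> s s' _ _ h h' tau _ V W phi phiL; split=> // _.
  have phiL' : linear (phi : restr (kmap K) (sval V) -> restr (kmap K) (sval W)).
    by move=> a x y; exact: phiL.
  by exists (linmk phiL').
Qed.
End Base.

Section Low.
Variables (n : nat) (K : kfield k) (T : tower n K) (top : set (set K)).
Variable H : sharp_props T top.

(** One tame class for the values under all continuous liftings, as morphisms between different ones
    have to be compared. *)
Definition sharp_ob (x : ntate k n) : Prop :=
  exists (s : liftings T) (h : sharp_defined s) (V : Vectf K),
    liftings_continuous top s /\ x = fcomp (ntate_incl k n) (sharp h) V.

Lemma sharp_obF x y : sharp_ob x -> sharp_ob y -> faithful (eval_ntate k n) x y.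
Proof.
move=> [s [h [V [sC ->]]]] [s' [h' [W [sC' ->]]]].
by apply: incl_faithful; exact: (sh_faithful H).
Qed.

Variables (s : liftings T) (sC : liftings_continuous top s) (h : sharp_defined s).

Definition sharp_lifts :
  lifts_forget (eval_ntate k n) sharp_ob (fcomp (ntate_incl k n) (sharp h)).
Proof.
apply: (@LiftsForget k _ (eval_ntate k n) _ K (fcomp (ntate_incl k n) (sharp h))
  (fun A => incl_presP (sh_pres H sC h A))).
- by move=> A; exists s, h, A.
- by move=> A B f; apply: incl_rz; exact: sh_nat.
- by move=> A B D f g fg; apply: incl_conf_ntate; exact: (sh_conf H).
Defined.
End Low.

Section Step.
Variables (n : nat) (K k1 : kfield k) (D : cdvf K k1).
Variable e : forall c, val_ge (dv D) 0 (kmap K c) /\ dres D (kmap K c) = kmap k1 c.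
Variables (T1 : tower n k1) (top : set (set K)).
Hypothesis ST : ST_ring (kmap K) top.
Hypothesis ni : nice (TowerS e T1) top.
Local Notation top1 := (residue_topology D top).
Variable H : sharp_props T1 top1.
Local Notation T := (TowerS e T1).
Local Notation C := (ntate k n).
Local Notation F := (eval_ntate k n).
Local Notation R V := (restr (kmap K) V).

Lemma step_def (s : liftings T) : liftings_continuous top s -> sharp_defined s.
Proof.
move=> [_ sC]; pose h := sh_def H sC; pose LG := sharp_lifts H sC h.
pose epi := @step_epi k n _ (sharp_obF H) K k1 D s.1 _ LG (@step_fin k K k1 D s.1).
pose mono := @step_mono k n _ (sharp_obF H) K k1 D s.1 _ LG _ epi (@step_dir k K k1 D).
apply: (@SharpStep k K k1 D s.1 n (sharp_defined s.2) (fun h => sharp h) h).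
by apply: (@StepDefined k K k1 D s.1 n _ _ epi _ mono);
  [exact: step_bound|exact: (step_tate (sharp_obF H) LG)].
Qed.

Section OneLifting.
Variables (s : liftings T) (sC : liftings_continuous top s) (h : sharp_defined s).
Definition step_sd : step_defined s.1 (fcomp (ntate_incl k n) (sharp (ss_low h))) := ss_step h.
Definition step_LG := sharp_lifts H sC.2 (ss_low h).
Local Notation mono := (@sd_mono _ _ _ _ _ _ _ step_sd).

Definition step_pres (V : Vectf K) :
    pres (eval k n.+1) (sharp h V) (V := R (sval V)) (fun=> True) (fun x => x = 0) :=
  fullsub_pres (Q := @is_tate k C) (F := evind (evpro F)) (x := sharp h V) (sob_pres step_LG mono V).

Lemma step_nat (V W : Vectf K) (f : mor V W) :
  rz (step_pres V) (step_pres W) (fmap (sharp h) f) (f : linhom _ _).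
Proof. exact: (rz_smap step_LG mono (sd_bound step_sd) f). Qed.

Lemma step_conf_sharp (U V W : Vectf K) (f : mor U V) (g : mor V W) :
  conf f g -> conf (fmap (sharp h) f) (fmap (sharp h) g).
Proof. by move=> fg; exact: (step_conf (sharp_obF H) step_LG mono fg). Qed.
End OneLifting.

Section TwoLiftings.
Variables (s s' : liftings T) (sC : liftings_continuous top s).
Variables (sC' : liftings_continuous top s').
Variables (h : sharp_defined s) (h' : sharp_defined s').
Local Notation LG := (step_LG sC h).
Local Notation LG' := (step_LG sC' h').
Local Notation mono := (@sd_mono _ _ _ _ _ _ _ (step_sd h)).
Local Notation mono' := (@sd_mono _ _ _ _ _ _ _ (step_sd h')).

Lemma step_faithful (V W : Vectf K) : faithful (eval k n.+1) (sharp h V) (sharp h' W).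
Proof.
have := itameF (sharp_obF H) (sob_itame LG mono V) (sob_itame LG' mono' W).
by [].
Qed.

(** [sob_rzP] and [EYek_basesP] bring both sides to the same quantifiers. On each quotient
    [EYek_mfun] exchanges tau.1 for s.1 on the source and s'.1 on the target. *)
Lemma step_hom (tau : liftings T) : liftings_continuous top tau ->
  forall (V W : Vectf K) (phi : sval V -> sval W), klin phi ->
  (exists g, rz (step_pres sC h V) (step_pres sC' h' W) g phi) <-> EYek tau phi.
Proof.
move=> tauC V W phi phiL; have [_ ni1] := ni.
have fV := svalP V; have fW := svalP W.
have low (A B : Vectf k1) (psi : sval A -> sval B) : klin psi ->
    (exists g, rz (lf_pres LG A) (lf_pres LG' B) g psi) <-> EYek tau.2 psi.
  move=> psiL; apply: iff_trans (sh_hom H sC.2 sC'.2 (ss_low h) (ss_low h') tauC.2 psiL).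
  exact: incl_rzP.
apply: iff_trans (sob_rzP (sharp_obF H) LG LG' mono mono' phi) _.
apply: iff_sym; apply: iff_trans (EYek_basesP tau fV fW phiL) _.
have mE (t t' u u' : lifting D) (L L' : osub D (sval V)) (M M' : osub D (sval W)) :
    [/\ continuous_lift top t, continuous_lift top t',
        continuous_lift top u & continuous_lift top u'] ->
    [/\ lat L, lat L', lat M & lat M'] ->
    (forall x, L x -> M (phi x)) -> (forall x, L x -> L' x -> M' (phi x)) ->
    EYek tau.2 (qfun t t' L L' M M' phi) -> EYek tau.2 (qfun u u' L L' M M' phi).
  move=> tu lL phiM phiM'.
  exact: (EYek_mfun e ST ni1 tauC.2 tu fV fW lL phiL phiM phiM').
have lb (X : lmodType K) (a : basis X) i : lat (bspan D a i) by exact: bspan_lat.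
have qP (b : basis (sval V)) i (c : basis (sval W)) j :=
  q_rzP low (sd_fin (step_sd h) b i) (sd_fin (step_sd h') c j) phiL.
split=> P b; have [c cP] := P b; exists c.
  move=> j; have [bc {}cP] := cP; have [i [iP Ei]] := cP j; exists i.
  apply/qP; split=> //.
  (* [oquot_fun] is convertible to [mfun] taken with equal liftings. *)
  apply: (mE tau.1 tau.1) Ei => //; split; by [exact: tauC.1|exact: sC.1|exact: sC'.1].
split; first by have [i /qP[bc _ _]] := cP 0%N.
move=> j; have [i /qP[bc iP Ei]] := cP j; exists i; split=> //.
apply: (mE s.1 s'.1) Ei => //; split; by [exact: tauC.1|exact: sC.1|exact: sC'.1].
Qed.
End TwoLiftings.

Definition sharp_step_props : sharp_props T top.
Proof.
exact: (@SharpProps _ _ _ _ step_def step_pres step_nat step_faithful step_hom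
  (fun s sC h U V W f g => @step_conf_sharp s sC h U V W f g)).
Qed.
End Step.

Lemma sharp_propsP n (K : kfield k) (T : tower n K) (top : set (set K)) :
  ST_ring (kmap K) top -> nice T top -> sharp_props T top.
Proof.
elim: T top => {n K} [K fin|n K k1 D e T1 IH] top ST ni; first exact: sharp_base.
by apply: sharp_step_props => //; apply: IH; [exact: residue_ST|exact: ni.2].
Qed.
End Induction.

(** * The evaluation isomorphisms *)

Section LinearFunctors.
Variable k : fieldType.

(** [functor] does not include linearity; that of [eval] makes the bijection with E^Yek linear. *)
Definition klinear_functor (C : Defs.cat k) (F : functor C (Vect k)) : Prop :=
  forall (x y : C) a (f g : mor x y) v,
    fapp F (a *: f + g) v = a *: fapp F f v + fapp F g v.

Section Constructions.
Variables (C : Defs.cat k) (F : functor C (Vect k)) (FL : klinear_functor F).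

Lemma evind_klinear : klinear_functor (evind F).
Proof.
move=> X Y a f g v; have [i [x ->]] := colim_ind (v : colim (evdiag F X)).
rewrite !fapp_evind ivalD.
have [j [u [w [-> ->]]]] := colim_ind2 (ival f i) (ival g i).
by rewrite cinjP !actE FL cinjP.
Qed.

Lemma evpro_klinear : klinear_functor (evpro F).
Proof.
move=> X Y a f g p; apply: plim_ext => j.
have [i [u [w [ef eg]]]] :=
  colim_ind2 (ival (f : indhom Y X) j) (ival (g : indhom Y X) j).
have E (h : mor X Y) : plim_val (fapp (evpro F) h p) j = pact (ival (h : indhom Y X) j) p by [].
have D (q r : plim F Y) : plim_val (a *: q + r) j = a *: plim_val q j + plim_val r j by [].
rewrite D !E (ivalD (C := opc C) a (f : indhom Y X) (g : indhom Y X)) ef eg cinjP !pactE.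
exact: FL.
Qed.

Lemma evidem_klinear : klinear_functor (evidem F).
Proof. by move=> X Y a f g v; apply: val_inj; exact: FL. Qed.

Lemma fullsub_klinear (Q : C -> Prop) : klinear_functor (fcomp F (fullsub_incl Q)).
Proof. by move=> x y; exact: FL. Qed.
End Constructions.

Lemma eval_ntate_klinear n : klinear_functor (eval_ntate k n).
Proof.
elim: n => [|n IH] //=; apply: evidem_klinear; apply: fullsub_klinear.
by apply: evind_klinear; exact: evpro_klinear.
Qed.

Lemma eval_klinear n : klinear_functor (eval k n).
Proof.
case: n => [|n] //=; apply: fullsub_klinear; apply: evind_klinear.
by apply: evpro_klinear; exact: eval_ntate_klinear.
Qed.
End LinearFunctors.

Section Isomorphisms.
Variables (k : fieldType) (C : Defs.cat k) (F : functor C (Vect k)).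

Section Ob.
Variables (x : C) (V : lmodType k).
Variable P : pres F x (V := V) (fun=> True) (fun y => y = 0).

Fact pr_linear : linear (P : V -> F x).
Proof. by move=> a y z; exact: pr_lin. Qed.
Definition pr_mor : mor (V : Vect k) (F x) := linmk pr_linear.
Definition prV (v : F x) : V := s2val (cid2 (pr_surj P v)).
Lemma prVK v : P (prV v) = v.
Proof. exact: (s2valP' (cid2 (pr_surj P v))). Qed.
Lemma prK y : prV (P y) = y.
Proof.
apply/eqP; rewrite -subr_eq0; apply/eqP/(pr_ker P) => //.
rewrite -scaleN1r addrC pr_lin // prVK scaleN1r; exact: addNr.
Qed.
Fact prV_linear : linear prV.
Proof.
by move=> a v w; rewrite -{1}(prVK v) -{1}(prVK w) -(pr_lin P) ?prK.
Qed.
Definition prV_mor : mor (F x) (V : Vect k) := linmk prV_linear.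
End Ob.
End Isomorphisms.

Section Statement.
Variables (k : fieldType) (n : nat) (K : tlf k n).
Let H := sharp_propsP (tlf_ST K) (tlf_nice K).

Definition sharp_wd (s : lifting_system K) : sharp_defined (sval s) := sh_def H (svalP s).
Definition sharp_pres (s : lifting_system K) (V : Vectf K) := sh_pres H (svalP s) (sharp_wd s) V.
Local Notation S s := (sharp (sharp_wd s)).

Section EvalIso.
Variable s : lifting_system K.
Local Notation P := (sharp_pres s).

Definition eval_iso : natiso (fcomp (eval k n) (S s)) (forget (kmap K)).
Proof.
apply: (@NatIso _ _ _ _ (fcomp (eval k n) (S s)) (forget (kmap K))
  (fun V => prV_mor (P V)) (fun V => pr_mor (P V))).
- by move=> V; apply: lin_ext => v; exact: prVK.
- by move=> V; apply: lin_ext => v; exact: prK.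
- move=> V W f; apply: lin_ext => v.
  have [_ e] := sh_nat H (svalP s) (sharp_wd s) f (v := prV (P V) v) I.
  have {}e : fapp (eval k n) (fmap (S s) f) v = P W ((f : linhom _ _) (prV (P V) v)).
    by rewrite -e; congr (fapp _ _ _); exact/esym/prVK.
  by apply: etrans (esym (prK (P W) _)) _; rewrite -e.
Defined.

Lemma eval_homP (V W : Vectf K) (g : mor (S s V) (S s W))
    (f : mor (forget (kmap K) V) (forget (kmap K) W)) :
  eval_hom eval_iso g = f <-> rz (P V) (P W) g (f : linhom _ _).
Proof.
split=> [<- v _|gP].
  by split=> //; exact/esym/prVK.
by apply: lin_ext => v; have [_ e] := gP v I; apply: etrans (congr1 _ e) _; exact: prK.
Qed.
End EvalIso.

Lemma sharp_homP (s s' tau : lifting_system K) (V W : Vectf K)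
    (f : mor (forget (kmap K) V) (forget (kmap K) W)) :
  (exists g, rz (sharp_pres s V) (sharp_pres s' W) g (f : linhom _ _)) <-> EYek_hom tau f.
Proof.
apply: (sh_hom H (svalP s) (svalP s') (sharp_wd s) (sharp_wd s') (svalP tau)).
by move=> a x y; exact: linearP.
Qed.

Lemma sharp_faithful (s s' : lifting_system K) (V W : Vectf K) :
  faithful (eval k n) (S s V) (S s' W).
Proof. exact: (sh_faithful H (svalP s) (svalP s')). Qed.

Lemma eval_range (s tau : lifting_system K) (V W : Vectf K) :
  range (@eval_hom k n K _ (eval_iso s) V W) = [set f | EYek_hom tau f]%classic.
Proof.
apply/seteqP; split=> f.
  by move=> [g _ /eval_homP gP]; apply/(sharp_homP s s); exists g.
by move=> /(sharp_homP s s)[g /eval_homP gP]; exists g.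
Qed.

(** phi f is the morphism covering f, unique by faithfulness. Each property follows by exhibiting a
    morphism that covers the right map; the inverse of phi is [eval_hom]. *)
Lemma EYek_iso (s tau : lifting_system K) (V W : Vectf K) :
  exists phi : EYek_type tau V W -> mor (S s V) (S s W),
  [/\ bijective phi,
      forall (c : k) (f g h : EYek_type tau V W),
        sval h = c *: sval f + sval g -> phi h = c *: phi f + phi g,
      forall f : EYek_type tau V W, eval_hom (eval_iso s) (phi f) = sval f &
      forall f : mor V W,
        exists h : EYek_hom tau (fmap (forget (kmap K)) f),
          phi (exist _ (fmap (forget (kmap K)) f) h) = fmap (S s) f].
Proof.
have ex (f : EYek_type tau V W) : exists g,
    rz (sharp_pres s V) (sharp_pres s W) g (sval f : linhom _ _).
  exact/sharp_homP/(svalP f).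
pose phi f := projT1 (cid (ex f)).
have phiP f : rz (sharp_pres s V) (sharp_pres s W) (phi f) (sval f : linhom _ _).
  exact: (projT2 (cid (ex f))).
have phi_uniq f g : rz (sharp_pres s V) (sharp_pres s W) g (sval f : linhom _ _) -> phi f = g.
  by move=> gP; apply: (rz_inj (@sharp_faithful s s V W) (phiP f) gP).
have phiE f : eval_hom (eval_iso s) (phi f) = sval f by exact/eval_homP.
exists phi; split=> //.
- have psiP (g : mor (S s V) (S s W)) : EYek_hom tau (eval_hom (eval_iso s) g).
    by apply/(sharp_homP s s); exists g; exact/eval_homP.
  exists (fun g => exist _ _ (psiP g)) => [f|g]; last by apply: phi_uniq; exact/eval_homP.
  by apply: eq_sig_hprop; [move=> x p q; exact: Prop_irrelevance|exact: phiE].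
- move=> c f g h hE; apply: phi_uniq => v _; split=> //.
  have [_ ef] := phiP f v I; have [_ eg] := phiP g v I.
  by rewrite eval_klinear ef eg hE -pr_lin.
- move=> f; have fP := sh_nat H (svalP s) (sharp_wd s) f.
  have h : EYek_hom tau (fmap (forget (kmap K)) f).
    by apply/(sharp_homP s s); exists (fmap (S s) f).
  by exists h; exact: phi_uniq.
Qed.

(** The identity of V is K-linear, hence in E^Yek, and [sharp_homP] allows different liftings at
    source and target. *)
Lemma change_ex (s s' : lifting_system K) (V : Vectf K) : exists g, rz (sharp_pres s V) (sharp_pres s' V) g id.
Proof.
apply/(sharp_homP s s' s (V := V) (W := V) (idm _)).
exact: ((EYek_lin_comp (sval s)).1 _ _ (lin1 (sval V)) (svalP V) (svalP V)).
Qed.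
Definition change (s s' : lifting_system K) (V : Vectf K) : mor (S s V) (S s' V) :=
  projT1 (cid (change_ex s s' V)).
Lemma changeP s s' V : rz (sharp_pres s V) (sharp_pres s' V) (change s s' V) id.
Proof. exact: (projT2 (cid (change_ex s s' V))). Qed.

Definition change_iso (s s' : lifting_system K) : natiso (S s) (S s').
Proof.
apply: (@NatIso _ _ _ _ (S s) (S s') (change s s') (change s' s)).
- move=> V; exact: (rz_inj (@sharp_faithful s s V V)
    (rzM (@changeP s s' V) (@changeP s' s V)) (rz1 (sharp_pres s V))).
- move=> V; exact: (rz_inj (@sharp_faithful s' s' V V)
    (rzM (@changeP s' s V) (@changeP s s' V)) (rz1 (sharp_pres s' V))).
- move=> V W f; exact: (rz_inj (@sharp_faithful s s' V W)
    (rzM (@changeP s s' V) (sh_nat H (svalP s') (sharp_wd s') f))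
    (rzM (sh_nat H (svalP s) (sharp_wd s) f) (@changeP s s' W))).
Defined.

Lemma change_eval (s s' : lifting_system K) (V : Vectf K) :
  mcomp (nt (eval_iso s') V) (fmap (eval k n) (nt (change_iso s s') V)) = nt (eval_iso s) V.
Proof.
apply: lin_ext => v; rewrite -(prVK (sharp_pres s V) v).
have [_ e] := changeP s s' (V:=V) (v := prV (sharp_pres s V) v) I.
apply: etrans (congr1 (prV (sharp_pres s' V)) e) _.
by apply: etrans (prK _ _) _; exact/esym/prK.
Qed.
End Statement.

(* E^Yek is computed with an arbitrary system of liftings tau, unrelated to
   the one used for sharp. *)
Theorem theorem3p11 (k : fieldType) (hk : perfect k) (n : nat) (K : tlf k n) :
  exists (wd : forall sigma : lifting_system K, sharp_defined (sval sigma))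
    (al : forall sigma : lifting_system K,
       natiso (fcomp (eval k n) (sharp (wd sigma))) (forget (kmap K))),
  [/\ (* 2 *)
      forall (sigma tau : lifting_system K) (V1 V2 : Vectf K),
      exists phi : EYek_type tau V1 V2 ->
          mor (sharp (wd sigma) V1) (sharp (wd sigma) V2),
        [/\ bijective phi,
            forall (c : k) (f g h : EYek_type tau V1 V2),
              sval h = c *: sval f + sval g ->
              phi h = c *: phi f + phi g,
            forall f : EYek_type tau V1 V2,
              eval_hom (al sigma) (phi f) = sval f &
            forall f : mor V1 V2,
              exists h : EYek_hom tau (fmap (forget (kmap K)) f),
                phi (exist _ (fmap (forget (kmap K)) f) h) =
                fmap (sharp (wd sigma)) f],
      (* 3 *)
      forall sigma sigma' : lifting_system K,
      exists e : natiso (sharp (wd sigma)) (sharp (wd sigma')),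
        forall V : Vectf K,
          mcomp (nt (al sigma') V) (fmap (eval k n) (nt e V)) =
          nt (al sigma) V &
      (* 4 *)
      forall V1 V2 : Vectf K,
        (forall sigma sigma' : lifting_system K,
           range (@eval_hom k n K _ (al sigma) V1 V2) =
           range (@eval_hom k n K _ (al sigma') V1 V2)) /\
        (forall sigma tau : lifting_system K,
           range (@eval_hom k n K _ (al sigma) V1 V2) =
           [set f | EYek_hom tau f])%classic].
Proof.
exists (@sharp_wd k n K), (@eval_iso k n K); split; first exact: EYek_iso.
  by move=> s s'; exists (change_iso s s') => V; exact: change_eval.
move=> V W; split=> [s s'|]; last by move=> s tau; exact: eval_range.
by rewrite !(eval_range _ s).
Qed.
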